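(* Let $\mathbb{D}$ be the unit disc in $\mathbb{C}$. (1) If $U\subset\mathbb{D}$ is a hypercyclic crescent, then the spectrum of $T_U$ (as an operator on $A^2(\mathbb{D})$) is the full interval $[0,1]$. (2) If $U\subset\mathbb{D}$ is a hypercyclic lune determined by two (distinct) coaxial hypercycles, then the spectrum of $T_U$ is an interval of the form $[0,\|T_U\|]$, where $0<\|T_U\|<1$.
   Context: For an open set $W\subset\mathbb{C}$, $A^2(W)$ is the Bergman space: the Hilbert space of holomorphic functions on $W$ square integrable with respect to Lebesgue measure. For a non-empty open $U\subset\mathbb{D}$, $R_U:A^2(\mathbb{D})\to A^2(U)$ is the restriction operator $R_Uf=f|_U$ and $T_U=R_U^*R_U:A^2(\mathbb{D})\to A^2(\mathbb{D})$, where $R_U^*$ is the Hilbert space adjoint. Equivalently, $T_Uf=P(\chi_Uf)$ with $P:L^2(\mathbb{D})\to A^2(\mathbb{D})$ the Bergman (orthogonal) projection and $\chi_U$ the characteristic function of $U$. View $\mathbb{D}$ as the Poincaré disc model of the hyperbolic plane. Given a (complete) hyperbolic geodesic $\Gamma\subset\mathbb{D}$, a hypercycle with axis $\Gamma$ is a curve consisting of all points at a fixed signed hyperbolic distance from $\Gamma$; it is the intersection with $\mathbb{D}$ of a Euclidean circle or straight line passing through the two points of $\overline{\Gamma}\cap\partial\mathbb{D}$. Hypercycles with the same axis are called coaxial. A hypercyclic lune is the open region of $\mathbb{D}$ between two distinct coaxial hypercycles. The two points of $\overline{\Gamma}\cap\partial\mathbb{D}$ divide $\partial\mathbb{D}$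 into two arcs $C_1,C_2$; a hypercyclic crescent is the open region of $\mathbb{D}$ bounded by a hypercycle with axis $\Gamma$ and one of the arcs $C_j$. *)

(* Defs.v *)
From HB Require Import structures.
From mathcomp Require Import all_boot all_order all_algebra.
From mathcomp Require Import complex.
From mathcomp Require Import all_classical all_reals all_analysis measurable_realfun.
From mathcomp Require Import ring.

Set Implicit Arguments.
Unset Strict Implicit.
Unset Printing Implicit Defensive.

Import Order.TTheory GRing.Theory Num.Theory.
Import numFieldNormedType.Exports.

Local Open Scope classical_set_scope.
Local Open Scope ring_scope.
Local Open Scope complex_scope.
HB.instance Definition _ (R : rcfType) := NormedModule.copy R[i] R[i]^o.

Definition disc (R : realType) : set R[i] := [set z | `|z| < 1].
Arguments disc : clear implicits.

Lemma disc_open (R : realType) : open (disc R).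
Proof.
suff -> : disc R = ball (0 : R[i]) 1 by exact: ball_open.
by apply/seteqP; split=> z; rewrite -ball_normE /disc /ball_ /= sub0r normrN.
Qed.

Arguments disc_open : clear implicits.

(* The derivative in the direction [1] of the [R[i]]-normed module [R[i]]: this
   is complex differentiability. *)
Definition holomorphic (R : realType) (W : set R[i]) (f : R[i] -> R[i]) : Prop :=
  forall z, W z -> derivable f z 1.

(* [R[i]] carries no measurable structure: area integrals over [W : set R[i]] are
   taken over the preimage of [W] in R x R. *)
Definition plane (R : realType) (p : R * R) : R[i] := p.1 +i* p.2.

Definition lebesgue2 (R : realType) :
    {measure set (measurableTypeR R * measurableTypeR R) -> \bar R} :=
  ((@lebesgue_measure R) \x (@lebesgue_measure R))%E.
Arguments lebesgue2 : clear implicits.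

Lemma normCE (R : realType) (z : R[i]) : `|z| = (Normc.normc z)%:C.
Proof. by []. Qed.

Lemma normc_ge0 (R : realType) (z : R[i]) : 0 <= Normc.normc z.
Proof. by rewrite -ler0c -normCE normr_ge0. Qed.

Lemma plane_continuous (R : realType) : continuous (@plane R).
Proof.
move=> [a b]; apply/cvgrPdist_lt => e e0.
have [e0' eE] : 0 < complex.Re e /\ e = (complex.Re e)%:C.
  move: e e0 => [x y]; rewrite ltcE /= => /andP[/eqP -> x0]; by split.
exists (ball a (complex.Re e / 2), ball b (complex.Re e / 2)).
  by split; apply: nbhsx_ballx; rewrite divr_gt0.
move=> [x y] [/= ax bY]; rewrite /plane /= normc_def eE ltcR /=.
apply: (@le_lt_trans _ _ (`|a - x| + `|b - y|)); last first.
  by rewrite [ltRHS]splitr ltrD.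
rewrite -(@ler_pXn2r _ 2)// ?nnegrE ?sqrtr_ge0 ?addr_ge0//.
rewrite sqr_sqrtr ?addr_ge0 ?sqr_ge0// [leRHS]sqrrD !real_normK ?num_real//.
by rewrite addrAC lerDl mulrn_wge0 ?mulr_ge0.
Qed.

Lemma measurable_open2 (R : realType) (A : set (R * R)) : open A ->
  measurable (A : set (measurableTypeR R * measurableTypeR R)).
Proof.
move=> oA.
pose B (c : rat * rat) : set R := ball (@ratr R c.1) (ratr c.2).
pose F (q : (rat * rat) * (rat * rat)) : set (R * R) :=
  if pselect (B q.1 `*` B q.2 `<=` A) then B q.1 `*` B q.2 else set0.
have -> : A = \bigcup_q F q.
  apply/seteqP; split=> [[x y] Axy|p [q _]]; last first.
    by rewrite /F; case: pselect => [h /h|].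
  have [[P Q] /= [Px Qy] PQA] : nbhs (x, y) A by exact: open_nbhs_nbhs.
  have Px' : x \in (P° : set R) by rewrite inE.
  have Qy' : y \in (Q° : set R) by rewrite inE.
  have [c [r [xcr crP]]] := open_subball_rat (@open_interior _ P) Px'.
  have [c' [r' [ycr crQ]]] := open_subball_rat (@open_interior _ Q) Qy'.
  exists ((c, r), (c', r')) => //; rewrite /F /=; case: pselect => [h|[]].
    by split; rewrite /B /=; exact: set_mem.
  move=> [u v] [/= /crP /interior_subset Pu /crQ /interior_subset Qv].
  exact: PQA.
apply: countable_bigcupT_measurable => [|q]; first exact: countableP.
rewrite /F; case: pselect => h; last exact: measurable0.
by apply: (@measurableX _ _ (measurableTypeR R) (measurableTypeR R));
  exact: measurable_ball.
Qed.

Lemma measurable_plane (R : realType) (W : set R[i]) (oW : open W) :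
  measurable (@plane R @^-1` W :
    set (measurableTypeR R * measurableTypeR R)).
Proof.
apply: measurable_open2; apply: open_comp => // z _; exact: plane_continuous.
Qed.

Lemma measurable_fun_plane (R : realType) (W : set R[i]) (g : R[i] -> R) :
  open W -> {in W, continuous g} ->
  measurable_fun (@plane R @^-1` W :
    set (measurableTypeR R * measurableTypeR R)) (fun p => g (plane p)).
Proof.
move=> oW cg; apply: (measurability _ (RGenOpens.measurableE R)).
move=> _ [_ [a [b ->] <-]].
rewrite [X in measurable X](_ : _ = @plane R @^-1` (W `&` g @^-1` `]a, b[))//.
apply: measurable_plane; rewrite openE => z [Wz gz]; apply: filterI.
  exact: open_nbhs_nbhs.
by apply: (cg z); [rewrite inE|apply: open_nbhs_nbhs; split => //; exact: interval_open].
Qed.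

Lemma normc_continuous (R : realType) : continuous (@Normc.normc R).
Proof.
move=> z; have FF := nbhs_filter z; apply/cvgrPdist_lt => e e0.
have e0' : 0 < e%:C :> R[i] by rewrite ltcR.
exists e%:C => //= w; rewrite /ball /= => zw.
rewrite -ltcR; apply: le_lt_trans zw.
by rewrite normCE lecR; exact: (@ler_dist_dist R (Rcomplex R)).
Qed.

(* A function on [W] is represented by its extension by 0 to [R[i]], so that
   equality in A^2(W) is equality of functions. The openness proof makes this
   predicate a submodule for every index. *)
Definition bergman_pred (R : realType) (W : set R[i]) (oW : open W) :
    {pred R[i] -> R[i]} :=
  fun f => `[< [/\ forall z, ~ W z -> f z = 0, holomorphic W f &
    (lebesgue2 R).-integrable (@plane R @^-1` W)
      (fun p => (Normc.normc (f (plane p)) ^+ 2)%:E)] >].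

Lemma bergman_submod (R : realType) (W : set R[i]) (oW : open W) :
  submod_closed (bergman_pred oW).
Proof.
split=> [|a f g /asboolP[f0 hf fi] /asboolP[g0 hg gi]]; apply/asboolP.
  split=> [//|z _|]; first exact: derivable_cst.
  apply: eq_integrable (integrable0 _ _) => //=; first exact: measurable_plane.
  move=> p _; rewrite -[RHS]/((Normc.normc (0 : R[i]) ^+ 2)%:E).
  by rewrite /= expr0n addr0 sqrtr0 expr0n.
have hfg : holomorphic W (a *: f + g).
  by move=> z Wz; apply: derivableD (hg z Wz); apply: derivableZ; exact: hf.
split=> //.
  by move=> z nWz; rewrite -[LHS]/(a *: f z + g z) f0// g0// scaler0 addr0.
have mW := measurable_plane oW.
apply: (@le_integrable _ _ _ (lebesgue2 R) _ mW _
    (fun p => (2 * Normc.normc a ^+ 2)%:E * (Normc.normc (f (plane p)) ^+ 2)%:E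
     + 2%:E * (Normc.normc (g (plane p)) ^+ 2)%:E)%E).
- apply/measurable_EFinP.
  apply: (@measurable_fun_plane R W (fun z => Normc.normc ((a *: f + g) z) ^+ 2)) => //.
  move=> z /set_mem Wz.
  have cfg : {for z, continuous (a *: f + g)}.
    by apply: differentiable_continuous; apply/derivable1_diffP; exact: hfg.
  apply: (@continuous_comp _ _ _ (a *: f + g)
    (fun w => Normc.normc w ^+ 2) z cfg).
  apply: (@continuous_comp _ _ _ (@Normc.normc R) (fun x => x ^+ 2)).
    exact: normc_continuous.
  exact: exprn_continuous.
- move=> p _ /=.
  rewrite lee_fin !ger0_norm ?addr_ge0 ?mulr_ge0 ?sqr_ge0 ?exprn_ge0 ?normc_ge0//.
  rewrite -[X in Normc.normc X]/(a * f (plane p) + g (plane p)).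
  set u := f _; set v := g _.
  apply: (@le_trans _ _ ((Normc.normc a * Normc.normc u + Normc.normc v) ^+ 2)).
    rewrite ler_pXn2r ?nnegrE ?addr_ge0 ?mulr_ge0 ?normc_ge0//.
    by rewrite -Normc.normcM le_normcD.
  rewrite -mulrA -exprMn; move: (Normc.normc a * _) (Normc.normc v) => s t.
  rewrite -subr_ge0 (_ : _ - _ = (s - t) ^+ 2) ?sqr_ge0//; ring.
- exact: (integrableD mW (integrableZl mW _ fi) (integrableZl mW _ gi)).
Qed.
HB.instance Definition _ (R : realType) (W : set R[i]) (oW : open W) :=
  GRing.isSubmodClosed.Build _ _ (bergman_pred oW) (bergman_submod oW).

Record bergman (R : realType) (W : set R[i]) (oW : open W) := Bergman {
  bergman_fun :> R[i] -> R[i] ;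
  bergmanP : bergman_fun \in bergman_pred oW }.

HB.instance Definition _ (R : realType) (W : set R[i]) (oW : open W) :=
  [isSub for @bergman_fun R W oW].
HB.instance Definition _ (R : realType) (W : set R[i]) (oW : open W) :=
  [Choice of bergman oW by <:].
HB.instance Definition _ (R : realType) (W : set R[i]) (oW : open W) :=
  [SubChoice_isSubLmodule of bergman oW by <:].

Definition integralC (R : realType) (W : set R[i]) (f : R[i] -> R[i]) : R[i] :=
  (\int[lebesgue2 R]_(p in @plane R @^-1` W) complex.Re (f (plane p))) +i*
  (\int[lebesgue2 R]_(p in @plane R @^-1` W) complex.Im (f (plane p))).

Definition bergman_ip (R : realType) (W : set R[i]) (oW : open W)
    (f g : bergman oW) : R[i] :=
  integralC W (fun z => f z * (g z)^*).

(* In this section [ip] is the inner product of the Hilbert space [V], linear in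
   its first argument. *)
Section inner_product_space.
Context (R : realType).
Implicit Types V W : lmodType R[i].

Definition ip_norm V (ip : V -> V -> R[i]) (v : V) : R :=
  Num.sqrt (complex.Re (ip v v)).

(* [sup] is 0 on unbounded sets, so this is the operator norm of bounded [T]. *)
Definition op_norm V (ip : V -> V -> R[i]) (T : V -> V) : R :=
  sup [set ip_norm ip (T v) | v in [set v | ip_norm ip v <= 1]].

Definition bounded_op V (ip : V -> V -> R[i]) (T : V -> V) : Prop :=
  exists M : R, forall v, ip_norm ip (T v) <= M * ip_norm ip v.

Definition spectrum V (ip : V -> V -> R[i]) (T : V -> V) : set R[i] :=
  [set l | ~ exists S : {linear V -> V}, [/\ bounded_op ip S,
     (forall v, S (T v - l *: v) = v) & (forall v, T (S v) - l *: S v = v)]].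

(* The value at [w] of the Hilbert space adjoint of [T]: the Riesz representative
   of the functional u |-> <T u, w>, and 0 if there is none (which does not
   happen for bounded [T] on a Hilbert space). *)
Definition adjoint V W (ipV : V -> V -> R[i]) (ipW : W -> W -> R[i])
    (T : V -> W) (w : W) : V :=
  xget 0 [set v | forall u, ipW (T u) w = ipV u v].

End inner_product_space.

Lemma bergman_restr_subproof (R : realType) (W U : set R[i]) (oW : open W)
  (oU : open U) (UW : U `<=` W) (f : bergman oW) :
  patch (fun=> 0) U f \in bergman_pred oU.
Proof.
have /asboolP[f0 hf fi] := bergmanP f; apply/asboolP; split.
- by move=> z nUz; rewrite /patch memNset.
- move=> z Uz; apply: near_eq_derivable (hf z (UW z Uz)).
  apply: filterS (open_nbhs_nbhs (conj oU Uz)) => w Uw.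
  by rewrite /patch mem_set.
- have mU := measurable_plane oU; have mW := measurable_plane oW.
  have UW' : @plane R @^-1` U `<=` @plane R @^-1` W by move=> p; exact: UW.
  apply: eq_integrable (integrableS mW mU UW' fi) => // p.
  by rewrite inE /= => Up; rewrite /patch mem_set.
Qed.

Definition bergman_restr (R : realType) (W U : set R[i]) (oW : open W)
    (oU : open U) (UW : U `<=` W) (f : bergman oW) : bergman oU :=
  Bergman (bergman_restr_subproof oU UW f).

Definition bergman_T (R : realType) (U : set R[i]) (oU : open U)
    (UD : U `<=` disc R) (f : bergman (disc_open R)) : bergman (disc_open R) :=
  adjoint (@bergman_ip R _ (disc_open R)) (@bergman_ip R _ oU)
    (bergman_restr oU UD) (bergman_restr oU UD f).

(* Complete geodesics of the Poincare disc: diameters, and arcs of Euclidean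
   circles orthogonal to the unit circle. *)
Definition geodesic (R : realType) (G : set R[i]) : Prop :=
  (exists2 u : R[i], `|u| = 1 &
     G = [set z | disc R z /\ complex.Im (z * u^*) = 0]) \/
  (exists c : R[i], exists r : R, [/\ 0 < r, `|c| ^+ 2 = 1 + r%:C ^+ 2 &
     G = [set z | disc R z /\ `|z - c| = r%:C]]).

(* 2 artanh |(z - w) / (1 - z w^* )|, the distance of curvature -1. *)
Definition hdist (R : realType) (z w : R[i]) : R :=
  let t := Normc.normc ((z - w) / (1 - z * w^*)) in ln ((1 + t) / (1 - t)).

Definition hdist_set (R : realType) (G : set R[i]) (z : R[i]) : R :=
  inf [set hdist z w | w in G].

(* A signed distance to [G]: the continuous choice of a sign on the two sides of
   [G], with opposite signs. If [d] is one then the other one is [- d]. *)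
Definition signed_hdist (R : realType) (G : set R[i]) (d : R[i] -> R) : Prop :=
  [/\ {within disc R, continuous d},
      forall z, disc R z -> `|d z| = hdist_set G z,
      exists2 z, disc R z & d z < 0 &
      exists2 z, disc R z & 0 < d z].

Definition hypercycle (R : realType) (d : R[i] -> R) (a : R) : set R[i] :=
  [set z | disc R z /\ d z = a].

Definition frontier (R : realType) (A : set R[i]) : set R[i] :=
  closure A `\` A°.

(* The arcs into which the end points of [G] divide the unit circle. *)
Definition ideal_arc (R : realType) (G C : set R[i]) : Prop :=
  let B := [set z : R[i] | `|z| = 1] `\` closure G in
  exists2 z, B z & C = connected_component B z.

(* The region between the hypercycles [hypercycle d a] and [hypercycle d b]. *)
Definition hypercyclic_lune (R : realType) (U : set R[i]) : Prop :=
  exists (G : set R[i]) (d : R[i] -> R) (a b : R),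
    [/\ geodesic G, signed_hdist G d, a < b &
        U = [set z | disc R z /\ a < d z < b]].

(* The two end points of the arc [C] belong to the closure of the hypercycle. *)
Definition hypercyclic_crescent (R : realType) (U : set R[i]) : Prop :=
  exists (G : set R[i]) (d : R[i] -> R) (a : R) (C : set R[i]),
    [/\ geodesic G, signed_hdist G d, ideal_arc G C &
     [/\ open U, connected U, U `<=` disc R &
         frontier U = closure (hypercycle d a) `|` C]].

Lemma hypercyclic_lune_open (R : realType) (U : set R[i]) :
  hypercyclic_lune U -> open U /\ U `<=` disc R.
Proof.
move=> [G [d [a [b [_ [cd _ _ _] _ ->]]]]]; split; last by move=> z [].
move: cd; rewrite continuous_open_subspace; last exact: disc_open.
move=> cd; rewrite openE => z [Dz dz].
apply: filterI; first by apply: open_nbhs_nbhs; split=> //; exact: disc_open.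
have nab : nbhs (d z) `]a, b[%classic.
  apply: open_nbhs_nbhs; split; first exact: interval_open.
  by rewrite /= in_itv.
have dab : nbhs z (d @^-1` `]a, b[%classic) := cd z (mem_set Dz) _ nab.
by rewrite set_itvoo in dab.
Qed.

Lemma hypercyclic_crescent_open (R : realType) (U : set R[i]) :
  hypercyclic_crescent U -> open U /\ U `<=` disc R.
Proof. by move=> [G [d [a [C [_ _ _ [oU _ UD _]]]]]]. Qed.

(* Main.v *)
(* The Moebius map zeta sends D to the right half-plane and the axis to the positive
   reals, so Phi = log zeta sends D to the strip |Im w| < pi/2, and hypercycles become
   horizontal lines: every lune or crescent is U = {al < y < be} with y = Im Phi. The
   functions e^{it Phi} Phi' behave as generalized eigenfunctions of T_U, with eigenvalue
   m(t), the mass of (al, be) for the probability density proportional to e^{-2ty} on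
   (-pi/2, pi/2). Damped along the strip they are approximate eigenvectors, which puts
   the closure of the range of m into the spectrum: it contains 0 for a lune, and both 0
   and 1 for a crescent. For a lune m attains its maximum M, at some t0, and M < 1. The
   bound int_U |f|^2 <= M int |f|^2 follows from a nonnegative K with
   K'' = (M - 1_U) e^{-2 t0 y} vanishing to second order at both ends, since
   K(y) Delta |g|^2 >= 0 for g = f e^{-i t0 Phi} / Phi'. *)
From HB Require Import structures.
Require Import Defs.
From mathcomp Require Import all_boot all_order all_algebra.
From mathcomp Require Import complex.
From mathcomp Require Import all_classical all_reals all_analysis.
From mathcomp Require Import measurable_realfun.
From mathcomp Require Import ring lra.

Import Order.TTheory GRing.Theory Num.Theory.
Import numFieldNormedType.Exports.

Local Open Scope classical_set_scope.
Local Open Scope ring_scope.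
Local Open Scope complex_scope.

Set Implicit Arguments.
Unset Strict Implicit.
Unset Printing Implicit Defensive.

Local Notation "z ^J" := (conjc z) (at level 1, format "z ^J").

(** * Wirtinger calculus *)

(** Functions are never transported to the strip: every identity is an area integral over the disc
    against a cutoff [rho]. The derivatives of the cutoff blow up at the circle, and [cos_Phi], cos
    (Im Phi) = (1 - |z|^2) |Phi'| / 2, says what pays for them: a weight in y with a simple zero at
    both ends of the strip absorbs one derivative of [rho], a double zero absorbs two. Integrating
    by parts once needs the former, twice the latter. The double zero at the far end is available
    only at a stationary point of the mean, which is why the bound is proved at a maximizing t0. The
    weights must be continuous, so 1_U is approximated from below by trapezoids in y. For the
    approximate eigenvectors the constants have to be uniform in the ramps; in the energy estimate
    they disappear from the conclusion. Holomorphy means differentiability at each point.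
    Smoothness, Cauchy estimates and completeness of the Bergman space all come from one weak
    equation, the vanishing of the integral of f times the conj(z)-derivative of a test function,
    itself proved by a Goursat bisection with splines in place of triangles. *)

Section complex_norm.
Context (R : realType).
Local Notation C := R[i].
Local Notation nm := (@Normc.normc R).
Implicit Types (z w : C) (x y : R).

Lemma nmD z w : nm (z + w) <= nm z + nm w.
Proof. exact: le_normcD. Qed.

Lemma nmM z w : nm (z * w) = nm z * nm w.
Proof. exact: Normc.normcM. Qed.

Lemma nm_inj : injective (fun x : R => x%:C : C).
Proof. by move=> x y []. Qed.

Lemma natC n : (n%:R : R)%:C = n%:R.
Proof. exact: rmorph_nat. Qed.

Lemma natVC n : (n%:R^-1 : R)%:C = n%:R^-1.
Proof. by rewrite fmorphV rmorph_nat. Qed.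

Lemma nm_nat n : nm n%:R = n%:R.
Proof. by rewrite -natC /= expr0n /= addr0 sqrtr_sqr ger0_norm. Qed.

Lemma nmN z : nm (- z) = nm z.
Proof. exact: normcN. Qed.

Lemma nmB z w : nm (z - w) <= nm z + nm w.
Proof. by rewrite -(nmN w) nmD. Qed.

Lemma nm_distC z w : nm (z - w) = nm (w - z).
Proof. by rewrite -nmN opprB. Qed.

Lemma nm0 : nm 0 = 0.
Proof. exact: Normc.normc0. Qed.

Lemma nm1 : nm 1 = 1.
Proof. exact: Normc.normc1. Qed.

Lemma nm_ge0 z : 0 <= nm z.
Proof. exact: normc_ge0. Qed.
#[local] Hint Resolve nm_ge0 : core.

Lemma nm_eq0 z : (nm z == 0) = (z == 0).
Proof.
apply/eqP/eqP => [/Normc.eq0_normc//|->]; exact: nm0.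
Qed.

Lemma nm_gt0 z : (0 < nm z) = (z != 0).
Proof. by rewrite lt_neqAle nm_ge0 andbT eq_sym nm_eq0. Qed.

Lemma nmV z : nm z^-1 = (nm z)^-1.
Proof. exact: Normc.normcV. Qed.

Lemma nmX z n : nm (z ^+ n) = nm z ^+ n.
Proof. by elim: n => [|n ih]; rewrite ?expr0 ?nm1// !exprS nmM ih. Qed.

Lemma nm_real x : nm x%:C = `|x|.
Proof. by rewrite /= expr0n /= addr0 sqrtr_sqr. Qed.

Lemma nmJ z : nm z^J = nm z.
Proof. by case: z => a b /=; rewrite sqrrN. Qed.

Lemma nm_i : nm 'i = 1.
Proof. by rewrite /= expr0n /= add0r expr1n sqrtr1. Qed.

Lemma nm_sqr z : nm z ^+ 2 = complex.Re z ^+ 2 + complex.Im z ^+ 2.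
Proof. by case: z => a b /=; rewrite sqr_sqrtr// addr_ge0// sqr_ge0. Qed.

Lemma mulJE z : z * z^J = (nm z ^+ 2)%:C.
Proof.
case: z => a b; rewrite nm_sqr /=; apply/eqP; rewrite eq_complex /=.
by apply/andP; split; apply/eqP; ring.
Qed.

Lemma Re_le z : `|complex.Re z| <= nm z.
Proof.
rewrite -(@ler_pXn2r _ 2)// ?nnegrE// nm_sqr real_normK ?num_real//.
by rewrite lerDl sqr_ge0.
Qed.

Lemma Im_le z : `|complex.Im z| <= nm z.
Proof.
rewrite -(@ler_pXn2r _ 2)// ?nnegrE// nm_sqr real_normK ?num_real//.
by rewrite lerDr sqr_ge0.
Qed.

Lemma nm_le_ReIm z : nm z <= `|complex.Re z| + `|complex.Im z|.
Proof.
rewrite -(@ler_pXn2r _ 2)// ?nnegrE ?addr_ge0// nm_sqr sqrrD !real_normK ?num_real//.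
by rewrite addrAC lerDl mulrn_wge0// mulr_ge0.
Qed.

Lemma nm_dist z w : `|nm z - nm w| <= nm (z - w).
Proof.
have H u v : nm u - nm v <= nm (u - v).
  by rewrite lerBlDr; apply: le_trans (nmD _ _); rewrite subrK.
rewrite ler_norml lerNl opprB H andbT.
by rewrite nm_distC H.
Qed.

Lemma cReD z w : complex.Re (z + w) = complex.Re z + complex.Re w.
Proof. by case: z w => a b [c d]. Qed.
Lemma cImD z w : complex.Im (z + w) = complex.Im z + complex.Im w.
Proof. by case: z w => a b [c d]. Qed.
Lemma cReN z : complex.Re (- z) = - complex.Re z.
Proof. by case: z => a b. Qed.
Lemma cImN z : complex.Im (- z) = - complex.Im z.
Proof. by case: z => a b. Qed.
Lemma cReM z w : complex.Re (z * w) =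
  complex.Re z * complex.Re w - complex.Im z * complex.Im w.
Proof. by case: z w => a b [c d]. Qed.
Lemma cImM z w : complex.Im (z * w) =
  complex.Re z * complex.Im w + complex.Im z * complex.Re w.
Proof. by case: z w => a b [c d]. Qed.
Lemma cReJ z : complex.Re z^J = complex.Re z.
Proof. by case: z. Qed.
Lemma cImJ z : complex.Im z^J = - complex.Im z.
Proof. by case: z. Qed.

Lemma conjRM x z : (x%:C * z)^J = x%:C * z^J.
Proof. by case: z => a b; apply/eqP; rewrite eq_complex /=; apply/andP; split; apply/eqP; ring. Qed.

Lemma complexPeq z w : complex.Re z = complex.Re w ->
  complex.Im z = complex.Im w -> z = w.
Proof. by case: z w => a b [c d] /= -> ->. Qed.

Lemma cReE z : (complex.Re z)%:C = (z + z^J) / 2.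
Proof. by rewrite -ReJ_add. Qed.

Lemma cImE z : (complex.Im z)%:C = (z - z^J) / (2 * 'i).
Proof.
case: z => a b; apply: (@mulIf _ (2 * 'i)).
  by rewrite mulf_neq0 ?pnatr_eq0// -nm_eq0 nm_i oner_eq0.
rewrite mulfVK; last by rewrite mulf_neq0 ?pnatr_eq0// -nm_eq0 nm_i oner_eq0.
by rewrite subcJ /= mulrCA mulrA.
Qed.

(* [lo E] and [bO E] say that [E h] is o(|h|), respectively O(|h|), as [h] tends to 0. *)
Definition lo (E : C -> C) := forall e, 0 < e ->
  exists2 d, 0 < d & forall h, nm h < d -> nm (E h) <= e * nm h.

Definition bO (E : C -> C) :=
  exists K d, [/\ 0 < d, 0 <= K & forall h, nm h < d -> nm (E h) <= K * nm h].

Lemma eq_lo E E' : E =1 E' -> lo E -> lo E'.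
Proof.
by move=> eE l e e0; have [d d0 H] := l e e0; exists d => // h; rewrite -eE; exact: H.
Qed.

Lemma eq_bO E E' : E =1 E' -> bO E -> bO E'.
Proof.
move=> eE [K [d [d0 K0 H]]]; exists K, d; split => // h; rewrite -eE; exact: H.
Qed.

Lemma loD E E' : lo E -> lo E' -> lo (fun h => E h + E' h).
Proof.
move=> l l' e e0; have e20 : 0 < e / 2 by rewrite divr_gt0.
have [d d0 H] := l _ e20; have [d' d'0 H'] := l' _ e20.
exists (Num.min d d') => [|h]; first by rewrite lt_min d0.
rewrite lt_min => /andP[hd hd'].
by rewrite (le_trans (nmD _ _))// [in leRHS](splitr e) mulrDl lerD ?H ?H'.
Qed.

Lemma lo0 : lo (fun=> 0).
Proof. by move=> e e0; exists 1 => // h _; rewrite nm0 mulr_ge0// ltW. Qed.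

Lemma loZ c E : lo E -> lo (fun h => c * E h).
Proof.
move=> l e e0; have c1 : 0 < nm c + 1 by rewrite ltr_wpDl.
have [d d0 H] := l (e / (nm c + 1)) (divr_gt0 e0 c1); exists d => // h hd.
rewrite nmM; apply: le_trans (ler_wpM2l (nm_ge0 c) (H h hd)) _.
rewrite mulrA ler_wpM2r// mulrCA -[leRHS]mulr1 ler_wpM2l ?(ltW e0)//.
by rewrite ler_pdivrMr// mul1r lerDl.
Qed.

Lemma loJ E : lo E -> lo (fun h => (E h)^J).
Proof.
by move=> l e e0; have [d d0 H] := l e e0; exists d => // h; rewrite nmJ; exact: H.
Qed.

Lemma lo_bO E : lo E -> bO E.
Proof. by move=> /(_ 1 ltr01)[d d0 H]; exists 1, d. Qed.

Lemma bOD E E' : bO E -> bO E' -> bO (fun h => E h + E' h).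
Proof.
move=> [K [d [d0 K0 H]]] [K' [d' [d'0 K'0 H']]].
exists (K + K'), (Num.min d d'); rewrite lt_min d0 d'0 addr_ge0//; split => // h.
rewrite lt_min => /andP[hd hd'].
by rewrite (le_trans (nmD _ _))// mulrDl lerD ?H ?H'.
Qed.

Lemma bO_lin a b : bO (fun h => a * h + b * h^J).
Proof.
exists (nm a + nm b), 1; split => // [|h _]; first by rewrite addr_ge0.
by rewrite (le_trans (nmD _ _))// !nmM nmJ mulrDl.
Qed.

Lemma lo_bOM E E' : bO E -> bO E' -> lo (fun h => E h * E' h).
Proof.
move=> [K [d [d0 K0 H]]] [K' [d' [d'0 K'0 H']]] e e0.
have k0 : 0 < K * K' + 1 by rewrite ltr_wpDl// mulr_ge0.
exists (Num.min (Num.min d d') (e / (K * K' + 1))) => [|h].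
  by rewrite !lt_min d0 d'0 divr_gt0.
rewrite !lt_min -andbA => /and3P[hd hd' he].
rewrite nmM (le_trans (ler_pM _ _ (H h hd) (H' h hd')))//.
rewrite mulrACA mulrA ler_wpM2r//.
rewrite (@le_trans _ _ ((K * K' + 1) * nm h))// ?ler_wpM2r ?lerDl//.
by move: he; rewrite ltr_pdivlMr// mulrC => /ltW.
Qed.

Lemma lo_comp E k : lo E -> bO k -> lo (fun h => E (k h)).
Proof.
move=> l [K [d [d0 K0 H]]] e e0; have K1 : 0 < K + 1 by rewrite ltr_wpDl.
have [d' d'0 H'] := l (e / (K + 1)) (divr_gt0 e0 K1).
exists (Num.min d (d' / (K + 1))) => [|h].
  by rewrite lt_min d0 divr_gt0.
rewrite lt_min => /andP[hd]; rewrite ltr_pdivlMr// => hd'.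
have kh : nm (k h) <= (K + 1) * nm h.
  by apply: le_trans (H h hd) _; rewrite ler_wpM2r// lerDl.
have kd : nm (k h) < d' by apply: le_lt_trans kh _; rewrite mulrC.
apply: le_trans (H' _ kd) _.
by rewrite mulrAC ler_pdivrMr// -mulrA ler_wpM2l ?(ltW e0)// mulrC.
Qed.

(* Wirtinger derivatives: [a] is the z-derivative and [b] the conj(z)-derivative. *)
Definition wd (f : C -> C) (z a b : C) :=
  lo (fun h => f (z + h) - f z - (a * h + b * h^J)).

Lemma wd_eq f z a b a' b' : wd f z a b -> a = a' -> b = b' -> wd f z a' b'.
Proof. by move=> ? <- <-. Qed.

Lemma wd_bO f z a b : wd f z a b -> bO (fun h => f (z + h) - f z).
Proof.
move=> /lo_bO H; apply: eq_bO (bOD H (bO_lin a b)) => h /=; ring.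
Qed.

Lemma wd_cst c z : wd (fun=> c) z 0 0.
Proof. by apply: eq_lo lo0 => h /=; ring. Qed.

Lemma wd_id z : wd (fun z => z) z 1 0.
Proof. by apply: eq_lo lo0 => h /=; ring. Qed.

Lemma wdJ f z a b : wd f z a b -> wd (fun z => (f z)^J) z b^J a^J.
Proof.
by move=> /loJ; apply: eq_lo => h /=; rewrite !rmorphB !rmorphD !rmorphM/= conjcK; ring.
Qed.

Lemma wdD f g z a b a' b' : wd f z a b -> wd g z a' b' ->
  wd (fun z => f z + g z) z (a + a') (b + b').
Proof. by move=> H H'; apply: eq_lo (loD H H') => h /=; ring. Qed.

Lemma wdN f z a b : wd f z a b -> wd (fun z => - f z) z (- a) (- b).
Proof. by move=> H; apply: eq_lo (loZ (-1) H) => h /=; ring. Qed.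

Lemma wdB f g z a b a' b' : wd f z a b -> wd g z a' b' ->
  wd (fun z => f z - g z) z (a - a') (b - b').
Proof. by move=> H H'; exact: wdD H (wdN H'). Qed.

Lemma wdM f g z a b a' b' : wd f z a b -> wd g z a' b' ->
  wd (fun z => f z * g z) z (a * g z + f z * a') (b * g z + f z * b').
Proof.
move=> H H'; have L := lo_bOM (wd_bO H) (wd_bO H').
apply: eq_lo (loD (loD (loZ (g z) H) (loZ (f z) H')) L) => h /=; ring.
Qed.

Lemma wdZ c f z a b : wd f z a b -> wd (fun z => c * f z) z (c * a) (c * b).
Proof. by move=> H; apply: eq_lo (loZ c H) => h /=; ring. Qed.

Lemma wd_comp f g z a b c d : wd f z a b -> wd g (f z) c d ->
  wd (fun z => g (f z)) z (c * a + d * b^J) (c * b + d * a^J).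
Proof.
move=> H H'; have L := lo_comp H' (wd_bO H).
apply: eq_lo (loD (loD (loZ c H) (loZ d (loJ H))) L) => h /=.
rewrite (addrC (f z)) subrK !rmorphB !rmorphD !rmorphM/= conjcK; ring.
Qed.

Lemma wd_near f g z a b (r : R) : 0 < r ->
  (forall w, nm (w - z) < r -> f w = g w) -> wd f z a b -> wd g z a b.
Proof.
move=> r0 fg H e e0; have [d d0 Hd] := H e e0.
exists (Num.min d r) => [|h]; first by rewrite lt_min d0.
rewrite lt_min => /andP[hd hr]; rewrite -!fg ?Hd//.
  by rewrite subrr nm0.
by rewrite addrAC subrr add0r.
Qed.

Lemma wd_ext f g z a b : f =1 g -> wd f z a b -> wd g z a b.
Proof. by move=> fg; apply: eq_lo => h; rewrite !fg. Qed.

Lemma wd_cont f z a b : wd f z a b -> forall e, 0 < e ->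
  exists2 d, 0 < d & forall w, nm (w - z) < d -> nm (f w - f z) < e.
Proof.
move=> /wd_bO[K [d [d0 K0 H]]] e e0; have K1 : 0 < K + 1 by rewrite ltr_wpDl.
exists (Num.min d (e / (K + 1))) => [|w]; first by rewrite lt_min d0 divr_gt0.
rewrite lt_min => /andP[/H]; rewrite [z + _]addrC subrK => Hw.
rewrite ltr_pdivlMr// => we; apply: le_lt_trans Hw _; apply: le_lt_trans we.
by rewrite mulrC ler_wpM2l// lerDl.
Qed.

Definition rd (k : R -> R) (x k' : R) := forall e, 0 < e ->
  exists2 d, 0 < d & forall h, `|h| < d -> `|k (x + h) - k x - k' * h| <= e * `|h|.

Lemma is_derive_rd (k : R -> R) x k' : is_derive x 1 k k' -> rd k x k'.
Proof.
move=> [dk <-] e e0; have /cvgrPdist_le/(_ e e0) := dk.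
move=> [d d0 H]; exists d => // h hd.
have [->|h0] := eqVneq h 0; first by rewrite addr0 subrr mulr0 subrr normr0 mulr0.
have := H h; rewrite /= sub0r normrN => /(_ hd h0).
rewrite -[lim _]/('D_1 k x) -[h%:A]/(h * 1) -[h^-1 *: _]/(h^-1 * _) => Hh.
have -> : k (x + h) - k x - 'D_1 k x * h =
  - (h * ('D_1 k x - h^-1 * (k (h * 1 + x) - k x))).
  by rewrite mulr1 [h + x]addrC mulrBr mulVKf//; ring.
by rewrite normrN normrM [leRHS]mulrC ler_wpM2l.
Qed.

Lemma wd_real (k : R -> R) (u : C -> R) z a b k' :
  wd (fun z => (u z)%:C) z a b -> rd k (u z) k' ->
  wd (fun z => (k (u z))%:C) z (k'%:C * a) (k'%:C * b).
Proof.
move=> Hu Hk.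
pose E (h : C) : C := (k (u z + complex.Re h) - k (u z) - k' * complex.Re h)%:C.
have lE : lo E.
  move=> e e0; have [d d0 H] := Hk e e0; exists d => // h hd.
  have hd' : `|complex.Re h| < d by apply: le_lt_trans (Re_le h) hd.
  by rewrite /E nm_real (le_trans (H _ hd'))// ler_wpM2l ?(ltW e0)// Re_le.
apply: eq_lo (loD (loZ k'%:C Hu) (lo_comp lE (wd_bO Hu))) => h /=.
rewrite /E cReD cReN /= (addrC (u z)) subrK !(rmorphB, rmorphM, rmorphD)/=; ring.
Qed.

Lemma wd_Re f z a b : wd f z a b ->
  wd (fun z => (complex.Re (f z))%:C) z ((a + b^J) / 2) ((b + a^J) / 2).
Proof.
move=> H; apply: wd_eq (wd_ext _ (wdZ 2^-1 (wdD H (wdJ H)))) _ _.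
- by move=> w; rewrite cReE mulrC.
- by rewrite mulrC.
- by rewrite mulrC.
Qed.

Lemma wd_Im f z a b : wd f z a b ->
  wd (fun z => (complex.Im (f z))%:C) z ((a - b^J) / (2 * 'i)) ((b - a^J) / (2 * 'i)).
Proof.
move=> H; apply: wd_eq (wd_ext _ (wdZ (2 * 'i)^-1 (wdB H (wdJ H)))) _ _.
- by move=> w; rewrite cImE mulrC.
- by rewrite mulrC.
- by rewrite mulrC.
Qed.

Lemma wd_inv z : z != 0 -> wd (fun z => z^-1) z (- z^-2) 0.
Proof.
move=> z0 e e0; have nz : 0 < nm z by rewrite nm_gt0.
exists (Num.min (nm z / 2) (e * nm z ^+ 3 / 2)).
  by rewrite lt_min !divr_gt0// mulr_gt0// exprn_gt0.
move=> h; rewrite lt_min => /andP[h1 h2].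
have zh : nm z / 2 <= nm (z + h).
  have := nmB (z + h) h; rewrite addrK => H; lra.
have zh0 : z + h != 0 by rewrite -nm_gt0; apply: lt_le_trans zh; rewrite divr_gt0.
have -> : (z + h)^-1 - z^-1 - (- z^-2 * h + 0 * h^J) = h * h / (z ^+ 2 * (z + h)).
  by field; rewrite z0 zh0.
rewrite !nmM nmV nmM nmX mulrAC ler_wpM2r//.
rewrite ler_pdivrMr ?mulr_gt0 ?exprn_gt0//; last by rewrite nm_gt0.
apply: (le_trans (ltW h2)).
rewrite exprS -!mulrA ler_wpM2l ?(ltW e0)//.
by rewrite !ler_wpM2l.
Qed.

Lemma wdV f z a b : f z != 0 -> wd f z a b ->
  wd (fun z => (f z)^-1) z (- a / f z ^+ 2) (- b / f z ^+ 2).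
Proof.
move=> fz H; apply: wd_eq (wd_comp H (wd_inv fz)) _ _; rewrite mul0r addr0 mulrC; ring.
Qed.

(** * Powers of the positive part *)

Definition pos (x : R) : R := Num.max x 0.

Lemma pos_ge0 x : 0 <= pos x.
Proof. by rewrite /pos le_max lexx orbT. Qed.

Lemma posE x : 0 <= x -> pos x = x.
Proof. by move=> x0; apply/max_idPl. Qed.

Lemma pos0 x : x <= 0 -> pos x = 0.
Proof. by move=> x0; apply/max_idPr. Qed.

Lemma pos_lip x y : `|pos x - pos y| <= `|x - y|.
Proof.
wlog xy : x y / x <= y => [H|].
  by have [|/ltW] := leP x y => /H //; rewrite distrC (distrC x).
rewrite distrC (distrC x) !ger0_norm ?subr_ge0//; last first.
  by rewrite /pos le_max2// lexx.
have [x0|/ltW x0] := leP 0 x; first by rewrite !posE// (le_trans x0).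
rewrite (pos0 x0) subr0; have [y0|/ltW y0] := leP 0 y; first by rewrite posE// lerBrDr gerDl.
by rewrite pos0// subr_ge0.
Qed.

Lemma mul_pos x : x * pos x = pos x ^+ 2.
Proof.
by rewrite expr2; have [x0|/ltW x0] := leP 0 x; [rewrite posE|rewrite pos0// !mulr0].
Qed.

Lemma posX_mul n x : x * pos x ^+ n.+1 = pos x ^+ n.+2.
Proof. by rewrite exprS mulrA mul_pos -exprD addnC addn2. Qed.

Lemma rd_pos2 x : rd (fun x => pos x ^+ 2) x (2 * pos x).
Proof.
move=> e e0; exists e => // h he.
suff H : `|pos (x + h) ^+ 2 - pos x ^+ 2 - 2 * pos x * h| <= h ^+ 2.
  by apply: le_trans H _; rewrite -real_normK ?num_real// expr2 ler_wpM2r// ltW.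
have [x0|x0] := leP 0 x; have [xh0|xh0] := leP 0 (x + h).
- by rewrite !posE// (_ : _ - _ = h ^+ 2) ?ger0_norm ?sqr_ge0//; ring.
- rewrite (posE x0) (pos0 (ltW xh0)) expr0n /= sub0r.
  rewrite ler_norml; apply/andP; split; nra.
- rewrite (posE xh0) (pos0 (ltW x0)) expr0n /= subr0 mulr0 mul0r subr0.
  rewrite ler_norml; apply/andP; split; nra.
- rewrite (pos0 (ltW xh0)) (pos0 (ltW x0)) (_ : _ - _ = 0) ?normr0 ?sqr_ge0//; ring.
Qed.

(** The square is already differentiable across the kink; higher powers follow by the product rule
    from [posX_mul], without any further case split on the sign. *)
Lemma wd_posX n (u : C -> R) z a b : wd (fun z => (u z)%:C) z a b ->
  wd (fun z => (pos (u z) ^+ n.+2)%:C) z ((n.+2%:R * pos (u z) ^+ n.+1)%:C * a)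
    ((n.+2%:R * pos (u z) ^+ n.+1)%:C * b).
Proof.
move=> H; elim: n => [|n ih]; first exact: (wd_real H (rd_pos2 _)).
have E c : c * (pos (u z) ^+ n.+2)%:C + (u z)%:C * ((n.+2%:R * pos (u z) ^+ n.+1)%:C * c) =
    (n.+3%:R * pos (u z) ^+ n.+2)%:C * c.
  have -> : n.+3%:R = n.+2%:R + 1 :> R by rewrite -natr1.
  by rewrite -(posX_mul n (u z)); move: (pos (u z) ^+ n.+1) (n.+2%:R : R) => p m; ring.
apply: wd_eq (wd_ext _ (wdM H ih)) (E a) (E b).
by move=> w; rewrite -rmorphM/= posX_mul.
Qed.

(** Regularity is recorded as a Lipschitz bound on closed discs: it is stable under products, and it
    is exactly what dominates difference quotients in [cint_wd]. *)
Definition lipr (r : R) (F : C -> C) := exists L : R, forall z w : C, nm z <= r -> nm w <= r ->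
  nm (F z - F w) <= L * nm (z - w).

Lemma lipr_ge0 r F : lipr r F -> exists2 L : R, 0 <= L & forall z w : C, nm z <= r -> nm w <= r ->
  nm (F z - F w) <= L * nm (z - w).
Proof.
move=> [L H]; exists `|L| => // z w zr wr.
by apply: le_trans (H z w zr wr) _; rewrite ler_wpM2r ?ler_norm.
Qed.

Lemma liprW r r' F : r <= r' -> lipr r' F -> lipr r F.
Proof. by move=> rr [L H]; exists L => z w zr wr; rewrite H// (le_trans _ rr). Qed.

Lemma lipr_ext r F G : (forall z, nm z <= r -> F z = G z) -> lipr r F -> lipr r G.
Proof. by move=> FG [L H]; exists L => z w zr wr; rewrite -!FG// H. Qed.

Lemma lipr_cst r c : lipr r (fun=> c).
Proof. by exists 0 => z w _ _; rewrite subrr nm0 mul0r. Qed.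

Lemma lipr_id r : lipr r (fun z => z).
Proof. by exists 1 => z w _ _; rewrite mul1r. Qed.

Lemma lipr_bdd r F : lipr r F -> exists2 M : R, 0 <= M & forall z, nm z <= r -> nm (F z) <= M.
Proof.
move=> /lipr_ge0[L L0 H]; exists (nm (F 0) + L * `|r|); first by rewrite addr_ge0// mulr_ge0.
move=> z zr; have r0 : 0 <= r by apply: le_trans zr.
have := H z 0 zr; rewrite nm0 subr0 => /(_ r0) H0.
rewrite -[F z](subrK (F 0)) (le_trans (nmD _ _))// addrC lerD// (le_trans H0)//.
by rewrite ler_wpM2l// (le_trans zr)// ler_norm.
Qed.

Lemma liprD r F G : lipr r F -> lipr r G -> lipr r (fun z => F z + G z).
Proof.
move=> [L H] [L' H']; exists (L + L') => z w zr wr.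
by rewrite opprD addrACA (le_trans (nmD _ _))// mulrDl lerD ?H ?H'.
Qed.

Lemma liprM r F G : lipr r F -> lipr r G -> lipr r (fun z => F z * G z).
Proof.
move=> lF lG; have [M M0 FM] := lipr_bdd lF; have [N N0 GN] := lipr_bdd lG.
have [L L0 H] := lipr_ge0 lF; have [K K0 H'] := lipr_ge0 lG.
exists (L * N + M * K) => z w zr wr.
rewrite (_ : _ - _ = (F z - F w) * G z + F w * (G z - G w)); last by ring.
rewrite (le_trans (nmD _ _))// !nmM mulrDl lerD//.
  by rewrite mulrAC ler_pM ?H ?GN.
by rewrite -mulrA ler_pM ?H' ?FM.
Qed.

Lemma liprN r F : lipr r F -> lipr r (fun z => - F z).
Proof. by move=> [L H]; exists L => z w zr wr; rewrite -opprD nmN H. Qed.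

Lemma liprJ r F : lipr r F -> lipr r (fun z => (F z)^J).
Proof. by move=> [L H]; exists L => z w zr wr; rewrite -rmorphB nmJ H. Qed.

Lemma lipr_Re r F : lipr r F -> lipr r (fun z => (complex.Re (F z))%:C).
Proof.
move=> [L H]; exists L => z w zr wr; rewrite -rmorphB nm_real -cReN -cReD.
by rewrite (le_trans (Re_le _))// H.
Qed.

Lemma lipr_Im r F : lipr r F -> lipr r (fun z => (complex.Im (F z))%:C).
Proof.
move=> [L H]; exists L => z w zr wr; rewrite -rmorphB nm_real -cImN -cImD.
by rewrite (le_trans (Im_le _))// H.
Qed.

Lemma lipr_comp r (u : C -> R) (k : R -> R) (K : R) : lipr r (fun z => (u z)%:C) ->
  (forall z w, nm z <= r -> nm w <= r -> `|k (u z) - k (u w)| <= K * `|u z - u w|) ->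
  lipr r (fun z => (k (u z))%:C).
Proof.
move=> /lipr_ge0[L L0 H] kK; exists (`|K| * L) => z w zr wr; rewrite -rmorphB nm_real.
apply: le_trans (kK z w zr wr) _; have := H z w zr wr; rewrite -rmorphB nm_real => uzw.
apply: (@le_trans _ _ (`|K| * `|u z - u w|)); first by rewrite ler_wpM2r ?ler_norm.
by rewrite -mulrA ler_wpM2l.
Qed.

Lemma liprX n r F : lipr r F -> lipr r (fun z => F z ^+ n).
Proof.
move=> lF; elim: n => [|n ih]; first exact: lipr_cst.
by apply: lipr_ext (liprM lF ih) => z _; rewrite exprS.
Qed.

Lemma lipr_posX r n (u : C -> R) : lipr r (fun z => (u z)%:C) ->
  lipr r (fun z => (pos (u z) ^+ n)%:C).
Proof.
move=> lu; apply: (lipr_ext (F := fun z => (pos (u z))%:C ^+ n)) => [z _|].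
  by rewrite rmorphXn.
apply/liprX/(lipr_comp (K := 1) lu) => z w _ _; rewrite mul1r; exact: pos_lip.
Qed.

(** In the unit direction v the derivative is a v + b conj(v). Taking v = 1 and v = i bounds |a + b|
    and |a - b| by L, hence both coefficients. *)
Lemma wd_lip_bound F z a b (r L : R) : 0 < r -> 0 <= L ->
  (forall h : C, nm h < r -> nm (F (z + h) - F z) <= L * nm h) ->
  wd F z a b -> nm a <= L /\ nm b <= L.
Proof.
move=> r0 L0 FL H.
have key v : nm v = 1 -> nm (a * v + b * v^J) <= L.
  move=> v1; apply/ler_addgt0Pr => e e0; have [d d0 Hd] := H e e0.
  pose t := Num.min r d / 2.
  have t0 : 0 < t by rewrite divr_gt0// lt_min r0.
  have tlt : t < Num.min r d by rewrite ltr_pdivrMr// mulr_natr mulr2n ltrDl lt_min r0.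
  move: tlt; rewrite lt_min => /andP[tr td].
  have nt : nm (t%:C * v) = t by rewrite nmM v1 mulr1 nm_real gtr0_norm.
  have := Hd (t%:C * v); rewrite nt => /(_ td) H1.
  have := FL (t%:C * v); rewrite nt => /(_ tr) H2.
  have H3 : nm (a * (t%:C * v) + b * (t%:C * v)^J) <= (L + e) * t.
    set X := a * _ + _ in H1 *; set Y := F _ - F z in H1 H2.
    have -> : X = Y - (Y - X) by rewrite opprB addrC subrK.
    by rewrite (le_trans (nmB _ _))// mulrDl lerD.
  rewrite -(@ler_pM2r _ t)//; apply: le_trans H3.
  rewrite conjRM !(mulrCA _ t%:C) -mulrDr nmM nm_real gtr0_norm// mulrC //.
have k1 := key 1 nm1; have ki := key 'i nm_i.
have ii : 'i^J = - 'i :> C by apply/eqP; rewrite eq_complex /= oppr0 !eqxx.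
rewrite conjc1 !mulr1 in k1; rewrite ii mulrN -mulrBl nmM nm_i mulr1 in ki.
have two (x : C) : nm (2 * x) = 2 * nm x.
  by rewrite nmM (_ : 2 = (2 : R)%:C) ?nm_real ?ger0_norm//; rewrite rmorph_nat.
split; rewrite -(@ler_pM2l _ 2)// -two.
- rewrite (_ : 2 * a = (a + b) + (a - b)); last by ring.
  by rewrite (le_trans (nmD _ _))//; lra.
- rewrite (_ : 2 * b = (a + b) - (a - b)); last by ring.
  by rewrite (le_trans (nmB _ _))//; lra.
Qed.

End complex_norm.
#[export] Hint Extern 0 (is_true (@Order.le _ _ _ (@Normc.normc _ _))) =>
  solve [apply: nm_ge0] : core.

(** * Integration over the plane *)

Section complex_sequences.
Context (R : realType).
Local Notation C := R[i].
Local Notation nm := (@Normc.normc R).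

(** Stated with the real modulus, because the norm of [R[i]] takes its values in [R[i]]. *)
Definition ccvg (u : nat -> C) (l : C) := (fun n => nm (u n - l)) @ \oo --> (0 : R).

Lemma ccvgP (u : nat -> C) l : ccvg u l <->
  forall e : R, 0 < e -> \forall n \near \oo, nm (u n - l) <= e.
Proof.
split => [/cvgrPdist_le H e e0|H].
  by apply: filterS (H e e0) => n; rewrite sub0r normrN (ger0_norm (nm_ge0 _)).
apply/cvgrPdist_le => e e0.
by apply: filterS (H e e0) => n; rewrite sub0r normrN (ger0_norm (nm_ge0 _)).
Qed.

Lemma ccvg_cst (l : C) : ccvg (fun=> l) l.
Proof. by rewrite /ccvg subrr nm0; exact: cvg_cst. Qed.

Lemma ccvg_le (u : nat -> C) l (v : nat -> R) : (forall n, nm (u n - l) <= v n) ->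
  v @ \oo --> (0 : R) -> ccvg u l.
Proof.
move=> uv v0; apply: (@squeeze_cvgr _ _ _ _ (fun=> 0) v) => //; last exact: cvg_cst.
by apply: nearW => n; rewrite nm_ge0 uv.
Qed.

Lemma ccvgD (u v : nat -> C) l k : ccvg u l -> ccvg v k ->
  ccvg (fun n => u n + v n) (l + k).
Proof.
move=> ul vk; apply: (@ccvg_le _ _ (fun n => nm (u n - l) + nm (v n - k))).
  by move=> n; rewrite opprD addrACA; exact: nmD.
by rewrite -[X in _ --> X]addr0; exact: cvgD.
Qed.

Lemma ccvgZ c (u : nat -> C) l : ccvg u l -> ccvg (fun n => c * u n) (c * l).
Proof.
move=> ul; apply: (@ccvg_le _ _ (fun n => nm c * nm (u n - l))).
  by move=> n; rewrite -mulrBr nmM.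
by rewrite -[X in _ --> X](mulr0 (nm c)); apply: cvgM => //; exact: cvg_cst.
Qed.

Lemma ccvgN (u : nat -> C) l : ccvg u l -> ccvg (fun n => - u n) (- l).
Proof. by apply: ccvg_le => n; rewrite -opprD nmN. Qed.

Lemma ccvgB (u v : nat -> C) l k : ccvg u l -> ccvg v k ->
  ccvg (fun n => u n - v n) (l - k).
Proof. by move=> ul /ccvgN; exact: ccvgD. Qed.

Lemma ccvg_nm (u : nat -> C) l : ccvg u l -> (fun n => nm (u n)) @ \oo --> nm l.
Proof.
move=> ul; apply/subr_cvg0/norm_cvg0P.
apply: (@squeeze_cvgr _ _ _ _ (fun=> 0) (fun n => nm (u n - l))) => //; last exact: cvg_cst.
by apply: nearW => n; rewrite normr_ge0 nm_dist.
Qed.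

Lemma ccvg_le_lim (u : nat -> C) l (B : R) : ccvg u l -> (\forall n \near \oo, nm (u n) <= B) ->
  nm l <= B.
Proof. by move=> /ccvg_nm ul uB; apply: (cvgr_to_le ul). Qed.

Lemma ccvg_uniq (u : nat -> C) l k : ccvg u l -> ccvg u k -> l = k.
Proof.
move=> ul uk; apply/subr0_eq/eqP; rewrite -nm_eq0 eq_le nm_ge0 andbT.
apply: (ccvg_le_lim (ccvgB ul uk)).
by apply: nearW => n; rewrite subrr nm0.
Qed.

End complex_sequences.

Section plane_integral.
Context (R : realType).
Local Notation C := R[i].
Local Notation nm := (@Normc.normc R).
Local Notation T2 := (measurableTypeR R * measurableTypeR R)%type.
Local Notation mu := (lebesgue2 R).
Implicit Types (g h : C -> R) (F G : C -> C).

Definition meas g := measurable_fun [set: T2] (fun p => g (plane p)).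
Definition rintb g := mu.-integrable [set: T2] (fun p => (g (plane p))%:E).
Definition rint g := (\int[mu]_p g (plane p))%R.

Lemma rintb_meas g : rintb g -> meas g.
Proof. by move=> /measurable_int /measurable_EFinP. Qed.

Lemma meas_cst c : meas (fun=> c).
Proof. exact: measurable_cst. Qed.

Lemma measD g h : meas g -> meas h -> meas (fun z => g z + h z).
Proof. exact: measurable_funD. Qed.

Lemma measM g h : meas g -> meas h -> meas (fun z => g z * h z).
Proof. exact: measurable_funM. Qed.

Lemma measN g : meas g -> meas (fun z => - g z).
Proof. by move=> mg; apply: measurable_funN. Qed.

Lemma measX g n : meas g -> meas (fun z => g z ^+ n).
Proof. exact: measurable_funX. Qed.

Lemma meas_comp g (k : R -> R) : measurable_fun [set: R] k -> meas g ->
  meas (fun z => k (g z)).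
Proof. by move=> mk mg; apply: measurableT_comp mg. Qed.

Lemma meas_ext g h : g =1 h -> meas g -> meas h.
Proof. by move=> /funext ->. Qed.

Lemma rintb_ext g h : g =1 h -> rintb g -> rintb h.
Proof. by move=> /funext ->. Qed.

Lemma rint_ext g h : g =1 h -> rint g = rint h.
Proof. by move=> /funext ->. Qed.

Lemma rintb_le g h : meas g -> (forall z, `|g z| <= h z) -> rintb h -> rintb g.
Proof.
move=> mg gh; apply: le_integrable => //; first exact/measurable_EFinP.
by move=> p _ /=; rewrite lee_fin (le_trans (gh _))// ler_norm.
Qed.

Lemma rintb0 : rintb (fun=> 0).
Proof. exact: integrable0. Qed.

Lemma rintbD g h : rintb g -> rintb h -> rintb (fun z => g z + h z).
Proof. by move=> ig ih; exact: (integrableD measurableT ig ih). Qed.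

Lemma rintbZ c g : rintb g -> rintb (fun z => c * g z).
Proof. by move=> ig; exact: (integrableZl measurableT c ig). Qed.

Lemma rintbN g : rintb g -> rintb (fun z => - g z).
Proof. by move=> /(rintbZ (-1)); apply: rintb_ext => z; rewrite mulN1r. Qed.

Lemma rintb_abs g : rintb g -> rintb (fun z => `|g z|).
Proof.
move=> ig; have mg := rintb_meas ig; move: (ig) => /integrable_abse.
by apply: eq_integrable => //.
Qed.

Lemma rintD g h : rintb g -> rintb h -> rint (fun z => g z + h z) = rint g + rint h.
Proof. by move=> ig ih; exact: RintegralD. Qed.

Lemma rintZ c g : rintb g -> rint (fun z => c * g z) = c * rint g.
Proof. by move=> ig; exact: RintegralZl. Qed.

Lemma rintN g : rintb g -> rint (fun z => - g z) = - rint g.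
Proof.
by move=> ig; rewrite -mulN1r -rintZ//; apply: rint_ext => z; rewrite mulN1r.
Qed.

Lemma rint0 : rint (fun=> 0) = 0.
Proof. by rewrite -[RHS](mul0r (rint (fun=> 0))) -rintZ ?mul0r//; exact: rintb0. Qed.

Lemma rint_ge0 g : (forall z, 0 <= g z) -> 0 <= rint g.
Proof. by move=> g0; apply: Rintegral_ge0. Qed.

Lemma rint_le g h : rintb g -> rintb h -> (forall z, g z <= h z) -> rint g <= rint h.
Proof. by move=> ig ih gh; exact: le_Rintegral. Qed.

Lemma rint_dct (g_ : nat -> C -> R) g h : (forall n, meas (g_ n)) ->
  (forall z, (fun n => g_ n z) @ \oo --> g z) ->
  (forall n z, `|g_ n z| <= h z) -> rintb h ->
  rintb g /\ (fun n => rint (g_ n)) @ \oo --> rint g.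
Proof.
move=> mg gg gh ih.
have mg' : measurable_fun [set: T2] (fun p => (g (plane p))%:E).
  apply/measurable_EFinP.
  by apply: (@measurable_fun_cvg _ _ _ _ (fun n p => g_ n (plane p))) => // p _.
have := @dominated_convergence _ _ _ mu setT measurableT
  (fun n p => (g_ n (plane p))%:E) (fun p => (g (plane p))%:E)
  (fun p => (h (plane p))%:E).
have mg_ n : measurable_fun [set: T2] (fun p => (g_ n (plane p))%:E).
  by apply/measurable_EFinP; exact: mg.
move=> /(_ mg_ mg') []//.
- by apply: aeW => p _; apply: cvg_EFin; [exact: nearW|exact: gg].
- by apply: aeW => p n _; rewrite /= lee_fin.
move=> ig _ H; split => //.
move: H; rewrite -[X in _ --> X]fineK; last exact: integrable_fin_num.
by move=> /fine_cvg.
Qed.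

Definition cmeas F := meas (fun z => complex.Re (F z)) /\ meas (fun z => complex.Im (F z)).
Definition cintb F := rintb (fun z => complex.Re (F z)) /\ rintb (fun z => complex.Im (F z)).
Definition cint F : C := rint (fun z => complex.Re (F z)) +i* rint (fun z => complex.Im (F z)).

Lemma cmeas_ext F G : F =1 G -> cmeas F -> cmeas G.
Proof. by move=> /funext ->. Qed.
Lemma cintb_ext F G : F =1 G -> cintb F -> cintb G.
Proof. by move=> /funext ->. Qed.
Lemma cint_ext F G : F =1 G -> cint F = cint G.
Proof. by move=> /funext ->. Qed.

Lemma cintb_meas F : cintb F -> cmeas F.
Proof. by move=> [/rintb_meas ? /rintb_meas ?]. Qed.

Lemma cmeas_cst c : cmeas (fun=> c).
Proof. by split; exact: meas_cst. Qed.

Lemma cmeasD F G : cmeas F -> cmeas G -> cmeas (fun z => F z + G z).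
Proof.
move=> [F1 F2] [G1 G2]; split.
  by apply: meas_ext (measD F1 G1) => z; rewrite cReD.
by apply: meas_ext (measD F2 G2) => z; rewrite cImD.
Qed.

Lemma cmeasM F G : cmeas F -> cmeas G -> cmeas (fun z => F z * G z).
Proof.
move=> [F1 F2] [G1 G2]; split.
  by apply: meas_ext (measD (measM F1 G1) (measN (measM F2 G2))) => z; rewrite cReM.
by apply: meas_ext (measD (measM F1 G2) (measM F2 G1)) => z; rewrite cImM.
Qed.

Lemma cmeasJ F : cmeas F -> cmeas (fun z => (F z)^J).
Proof.
move=> [F1 F2]; split; first by apply: meas_ext F1 => z; rewrite cReJ.
by apply: meas_ext (measN F2) => z; rewrite cImJ.
Qed.

Lemma cmeas_real g : meas g -> cmeas (fun z => (g z)%:C).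
Proof. by move=> mg; split => //; exact: meas_cst. Qed.

Lemma meas_nm F : cmeas F -> meas (fun z => nm (F z)).
Proof.
move=> [F1 F2]; have H := measD (measX 2 F1) (measX 2 F2).
have mk : measurable_fun [set: R] (@Num.sqrt R).
  by apply: continuous_measurable_fun; exact: sqrt_continuous.
by apply: meas_ext (meas_comp mk H) => z /=; case: (F z).
Qed.

Lemma cintb_le F h : cmeas F -> (forall z, nm (F z) <= h z) -> rintb h -> cintb F.
Proof.
move=> [F1 F2] Fh ih; split.
  by apply: rintb_le ih => // z; exact: le_trans (Re_le _) (Fh z).
by apply: rintb_le ih => // z; exact: le_trans (Im_le _) (Fh z).
Qed.

Lemma cintb_nm F : cintb F -> rintb (fun z => nm (F z)).
Proof.
move=> iF; have mF := cintb_meas iF; have [F1 F2] := iF.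
apply: rintb_le (rintbD (rintb_abs F1) (rintb_abs F2)); first exact: meas_nm.
by move=> z; rewrite (ger0_norm (nm_ge0 _)) nm_le_ReIm.
Qed.

Lemma cintbD F G : cintb F -> cintb G -> cintb (fun z => F z + G z).
Proof.
move=> [F1 F2] [G1 G2]; split.
  by apply: rintb_ext (rintbD F1 G1) => z; rewrite cReD.
by apply: rintb_ext (rintbD F2 G2) => z; rewrite cImD.
Qed.

Lemma cintD F G : cintb F -> cintb G -> cint (fun z => F z + G z) = cint F + cint G.
Proof.
move=> [F1 F2] [G1 G2]; apply: complexPeq; rewrite /= -rintD//.
  by apply: rint_ext => z; rewrite cReD.
by apply: rint_ext => z; rewrite cImD.
Qed.

Lemma cintbZ c F : cintb F -> cintb (fun z => c * F z).
Proof.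
move=> [F1 F2]; split.
  apply: rintb_ext (rintbD (rintbZ (complex.Re c) F1) (rintbZ (- complex.Im c) F2)).
  by move=> z; rewrite cReM mulNr.
apply: rintb_ext (rintbD (rintbZ (complex.Re c) F2) (rintbZ (complex.Im c) F1)).
by move=> z; rewrite cImM.
Qed.

Lemma cintZ c F : cintb F -> cint (fun z => c * F z) = c * cint F.
Proof.
move=> [F1 F2]; apply: complexPeq; rewrite ?cReM ?cImM /=.
  rewrite -mulNr -!rintZ// -rintD; [|exact: rintbZ..].
  by apply: rint_ext => z; rewrite cReM mulNr.
rewrite -!rintZ// -rintD; [|exact: rintbZ..].
by apply: rint_ext => z; rewrite cImM.
Qed.

Lemma cintbN F : cintb F -> cintb (fun z => - F z).
Proof. by move=> /(cintbZ (-1)); apply: cintb_ext => z; rewrite mulN1r. Qed.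

Lemma cintN F : cintb F -> cint (fun z => - F z) = - cint F.
Proof.
by move=> iF; rewrite -mulN1r -cintZ//; apply: cint_ext => z; rewrite mulN1r.
Qed.

Lemma cintbB F G : cintb F -> cintb G -> cintb (fun z => F z - G z).
Proof. by move=> iF /cintbN; exact: cintbD. Qed.

Lemma cintB F G : cintb F -> cintb G -> cint (fun z => F z - G z) = cint F - cint G.
Proof. by move=> iF iG; rewrite cintD ?cintN//; exact: cintbN. Qed.

Lemma cint0 : cint (fun=> 0) = 0.
Proof. by rewrite /cint rint0. Qed.

Lemma cintJ F : cintb F -> cint (fun z => (F z)^J) = (cint F)^J.
Proof.
move=> [F1 F2]; apply: complexPeq; rewrite ?cReJ ?cImJ /=.
  by apply: rint_ext => z; rewrite cReJ.
by rewrite -rintN//; apply: rint_ext => z; rewrite cImJ.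
Qed.

Lemma cint_real g : rintb g -> cint (fun z => (g z)%:C) = (rint g)%:C.
Proof. by move=> ig; apply: complexPeq => //=; exact: rint0. Qed.

(** Multiplying by the unimodular [c] that turns the integral into its modulus reduces the bound to
    Re (c F) <= |F|. *)
Lemma le_nm_cint F : cintb F -> nm (cint F) <= rint (fun z => nm (F z)).
Proof.
move=> iF; have [I0|I0] := eqVneq (cint F) 0.
  by rewrite I0 nm0; apply: rint_ge0 => z; exact: nm_ge0.
have nI : nm (cint F) != 0 by rewrite nm_eq0.
pose c := (cint F)^J / (nm (cint F))%:C.
have nc : nm c = 1.
  by rewrite nmM nmV nmJ nm_real (ger0_norm (nm_ge0 _)) divff.
have : c * cint F = (nm (cint F))%:C.
  rewrite /c mulrAC [_^J * _]mulrC mulJE expr2 rmorphM/= mulfK//.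
  by rewrite -nm_eq0 nm_real normr_eq0.
rewrite -cintZ// => /(congr1 (@complex.Re _)) /= <-.
have [G1 G2] := cintbZ c iF.
apply: rint_le => //; first exact: cintb_nm.
by move=> z; rewrite (le_trans (ler_norm _))// (le_trans (Re_le _))// nmM nc mul1r.
Qed.

Lemma cint_dct (F_ : nat -> C -> C) F h : (forall n, cmeas (F_ n)) ->
  (forall z, ccvg (fun n => F_ n z) (F z)) ->
  (forall n z, nm (F_ n z) <= h z) -> rintb h ->
  cintb F /\ ccvg (fun n => cint (F_ n)) (cint F).
Proof.
move=> mF FF Fh ih.
have sub (u : nat -> R) l (v : nat -> R) : (forall n, `|u n - l| <= v n) ->
    v @ \oo --> (0 : R) -> u @ \oo --> l.
  move=> uv v0; apply/cvgrPdist_le => e e0; have /cvgrPdist_le/(_ e e0) := v0.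
  apply: filterS => n; rewrite sub0r normrN => H; rewrite distrC.
  by apply: le_trans (uv n) _; apply: le_trans (ler_norm _) H.
have [] := @rint_dct (fun n z => complex.Re (F_ n z)) (fun z => complex.Re (F z)) h.
- by move=> n; case: (mF n).
- by move=> z; apply: sub (FF z) => n; rewrite -cReN -cReD Re_le.
- by move=> n z; exact: le_trans (Re_le _) (Fh n z).
- by [].
move=> I1 L1.
have [] := @rint_dct (fun n z => complex.Im (F_ n z)) (fun z => complex.Im (F z)) h.
- by move=> n; case: (mF n).
- by move=> z; apply: sub (FF z) => n; rewrite -cImN -cImD Im_le.
- by move=> n z; exact: le_trans (Im_le _) (Fh n z).
- by [].
move=> I2 L2; split; first by split.
apply: (@squeeze_cvgr _ _ _ _ (fun=> 0) (fun n =>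
  `|rint (fun z => complex.Re (F_ n z)) - rint (fun z => complex.Re (F z))| +
  `|rint (fun z => complex.Im (F_ n z)) - rint (fun z => complex.Im (F z))|)).
- apply: nearW => n; rewrite nm_ge0 /=.
  exact: (nm_le_ReIm ((rint (fun z => complex.Re (F_ n z)) - rint (fun z => complex.Re (F z)))
    +i* (rint (fun z => complex.Im (F_ n z)) - rint (fun z => complex.Im (F z))))).
- exact: cvg_cst.
- rewrite -[X in _ --> X]addr0; apply: cvgD.
    by apply/norm_cvg0P/subr_cvg0.
  by apply/norm_cvg0P/subr_cvg0.
Qed.

(** * Translation invariance of area integrals *)

Lemma measurable_addr (a : R) :
  measurable_fun [set: measurableTypeR R]
    (fun x : measurableTypeR R => (x + a : measurableTypeR R)).
Proof.
by apply: (@measurable_funD _ _ R setT (fun x : measurableTypeR R => x) (cst a)).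
Qed.

Lemma lebesgue_measure_translate (a : R) (A : set (measurableTypeR R)) :
  measurable A -> lebesgue_measure ((fun x : measurableTypeR R =>
     (x + a : measurableTypeR R)) @^-1` A) = lebesgue_measure A.
Proof.
move=> mA; apply/esym.
apply: (@lebesgue_measure_unique R (pushforward lebesgue_measure
  (fun x : measurableTypeR R => (x + a : measurableTypeR R)))) => //.
- exact: measurable_addr.
- move=> mf _ [[u v]] _ <-; rewrite /pushforward /=.
  transitivity (lebesgue_measure (`]u - a, v - a]%classic : set R)); last first.
    congr lebesgue_measure.
    by apply/seteqP; split=> x /=; rewrite !in_itv /= ltrBlDr lerBrDr.
  by rewrite !lebesgue_measure_itv/= !lte_fin ltrD2r -!EFinB; case: ifPn => // _; congr (_%:E); ring.
Qed.

Definition shift2 (c : C) (p : T2) : T2 := (p.1 + complex.Re c, p.2 + complex.Im c).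

Lemma plane_shift2 c p : plane (shift2 c p) = plane p + c.
Proof. by case: c => a b; case: p => x y. Qed.

Lemma measurable_shift2 c : measurable_fun setT (shift2 c).
Proof.
apply/measurable_fun_pairP; split => /=.
  rewrite (_ : _ \o _ = (fun x : measurableTypeR R => (x + complex.Re c : measurableTypeR R)) \o fst)//.
  by apply: measurableT_comp; [exact: measurable_addr|exact: measurable_fst].
rewrite (_ : _ \o _ = (fun x : measurableTypeR R => (x + complex.Im c : measurableTypeR R)) \o snd)//.
by apply: measurableT_comp; [exact: measurable_addr|exact: measurable_snd].
Qed.

(** By uniqueness of the product measure it suffices to translate rectangles. *)
Lemma lebesgue2_shift c (A : set T2) : measurable A -> mu (shift2 c @^-1` A) = mu A.
Proof.
move=> mA; apply/esym.
apply: (@product_measure_unique _ _ _ _ R (@lebesgue_measure R) (@lebesgue_measure R)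
   (pushforward mu (shift2 c))) => //; first exact: measurable_shift2.
move=> mf A1 A2 mA1 mA2.
transitivity (mu (
  ((fun x : measurableTypeR R => (x + complex.Re c : measurableTypeR R)) @^-1` A1) `*`
  ((fun x : measurableTypeR R => (x + complex.Im c : measurableTypeR R)) @^-1` A2))) => //.
rewrite [LHS]product_measure1E//; last 2 first.
- by rewrite -[X in measurable X]setTI; exact: measurable_addr.
- by rewrite -[X in measurable X]setTI; exact: measurable_addr.
by congr (_ * _)%E; exact: lebesgue_measure_translate.
Qed.

Lemma meas_shift c g : meas g -> meas (fun z => g (z + c)).
Proof.
move=> mg; rewrite /meas.
rewrite (_ : (fun p => _) = (fun p => g (plane p)) \o shift2 c); last first.
  by apply/funext => p /=; rewrite plane_shift2.
by apply: measurableT_comp => //; exact: measurable_shift2.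
Qed.

Lemma ge0_integral_shift c (k : T2 -> \bar R) : measurable_fun setT k ->
  (forall p, (0 <= k p)%E) ->
  (\int[mu]_p k (shift2 c p) = \int[mu]_p k p)%E.
Proof.
move=> mk k0.
have := @ge0_integral_pushforward _ _ _ _ R (shift2 c) (measurable_shift2 c) mu setT k
  measurableT mk (fun p _ => k0 p).
rewrite preimage_setT => <-.
apply: eq_measure_integral => [|? A mA _]; first exact: measurable_shift2.
exact: lebesgue2_shift.
Qed.

Lemma rintb_shift c g : rintb g -> rintb (fun z => g (z + c)).
Proof.
move=> ig; have mg := rintb_meas ig; apply/integrableP; split.
  by apply/measurable_EFinP; exact: meas_shift.
rewrite (_ : (fun p => _) = (fun p => `|(g (plane p))%:E|%E) \o shift2 c); last first.
  by apply/funext => p /=; rewrite plane_shift2.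
rewrite ge0_integral_shift//; first by case/integrableP : ig.
by apply: measurableT_comp => //; exact/measurable_EFinP.
Qed.

Lemma rint_shift c g : rintb g -> rint (fun z => g (z + c)) = rint g.
Proof.
move=> ig; have mg := rintb_meas ig; rewrite /rint /Rintegral; congr fine.
rewrite (_ : (fun p => _) = (fun p => (g (plane p))%:E) \o shift2 c); last first.
  by apply/funext => p /=; rewrite plane_shift2.
have mk : measurable_fun setT (fun p : T2 => (g (plane p))%:E) by exact/measurable_EFinP.
have ik : mu.-integrable (shift2 c @^-1` setT) ((fun p => (g (plane p))%:E) \o shift2 c).
  rewrite preimage_setT (_ : _ \o _ = fun p => (g (plane p + c))%:E).
    exact: rintb_shift.
  by apply/funext => p /=; rewrite plane_shift2.
have H := @integral_pushforward _ _ _ _ R (shift2 c) (measurable_shift2 c) mu setT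
   (fun p => (g (plane p))%:E) mk ik measurableT.
rewrite preimage_setT in H; rewrite -H.
apply: eq_measure_integral => [|? A mA _]; first exact: measurable_shift2.
exact: lebesgue2_shift.
Qed.

Lemma cintb_shift c F : cintb F -> cintb (fun z => F (z + c)).
Proof. by move=> [F1 F2]; split; [exact: rintb_shift F1|exact: rintb_shift F2]. Qed.

Lemma cint_shift c F : cintb F -> cint (fun z => F (z + c)) = cint F.
Proof.
move=> [F1 F2]; apply: complexPeq => /=; first exact: rint_shift F1.
exact: rint_shift F2.
Qed.

(** Squares replace discs as dominating sets: being products of intervals they have an explicit
    area. *)
Definition box (c : C) (r : R) (z : C) : bool :=
  (`|complex.Re z - complex.Re c| <= r) && (`|complex.Im z - complex.Im c| <= r).

Lemma box_set c r : [set p : T2 | box c r (plane p)] =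
  ([set` `[complex.Re c - r, complex.Re c + r]] `*`
   [set` `[complex.Im c - r, complex.Im c + r]] : set T2).
Proof.
by apply/seteqP; split=> -[x y]; rewrite /box /= !in_itv /= !ler_distl => /andP.
Qed.

Lemma measurable_box c r : measurable [set p : T2 | box c r (plane p)].
Proof. by rewrite box_set; apply: measurableX. Qed.

Lemma lebesgue2_box c r : 0 <= r -> mu [set p : T2 | box c r (plane p)] = (4 * r ^+ 2)%:E.
Proof.
move=> r0; rewrite box_set [LHS]product_measure1E//.
have H (a : R) : lebesgue_measure [set` `[a - r, a + r]] = (2 * r)%:E.
  rewrite lebesgue_measure_itv/= lte_fin ltrBlDr -addrA ltrDl.
  case: ifPn => [_|]; first by rewrite -EFinB; congr EFin; ring.
  rewrite -leNgt => rr; have -> : r = 0 by lra.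
  by rewrite mulr0.
by transitivity ((2 * r)%:E * (2 * r)%:E)%E; [congr (_ * _)%E; exact: H|rewrite -EFinM; congr EFin; ring].
Qed.

Definition boxi c r (z : C) : R := (box c r z)%:R.

Lemma boxiE c r : (fun p : T2 => boxi c r (plane p)) = \1_[set p : T2 | box c r (plane p)].
Proof. by apply/funext => p; rewrite indicE /boxi; congr ((_ : bool)%:R); apply/idP/idP; rewrite inE. Qed.

Lemma meas_boxi c r : meas (boxi c r).
Proof. by rewrite /meas boxiE; apply: measurable_indic; exact: measurable_box. Qed.

Lemma rintb_boxi c r : rintb (boxi c r).
Proof.
have [r0|r0] := leP 0 r; last first.
  apply: rintb_ext rintb0 => z; rewrite /boxi /box.
  by rewrite leNgt (lt_le_trans r0).
apply/integrableP; split; first by apply/measurable_EFinP; exact: meas_boxi.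
rewrite (eq_integral (fun p => (\1_[set p : T2 | box c r (plane p)] p)%:E)).
  rewrite integral_indic//; last exact: measurable_box.
  by rewrite setIT lebesgue2_box// ltry.
by move=> p _; rewrite -boxiE gee0_abs// lee_fin ler0n.
Qed.

Lemma rint_boxi c r : 0 <= r -> rint (boxi c r) = 4 * r ^+ 2.
Proof.
move=> r0; rewrite /rint boxiE /Rintegral integral_indic//; last exact: measurable_box.
by rewrite setIT lebesgue2_box.
Qed.

Lemma boxi_nm c r z : nm (z - c) <= r -> boxi c r z = 1.
Proof.
move=> zr; rewrite /boxi /box -!cReN -!cImN -cReD -cImD.
by rewrite (le_trans (Re_le _) zr) (le_trans (Im_le _) zr).
Qed.

Lemma boxi_ge0 c r z : 0 <= boxi c r z.
Proof. exact: ler0n. Qed.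

Lemma cintb_bdd F r M : cmeas F -> (forall z, nm (F z) <= M) ->
  (forall z, r < nm z -> F z = 0) -> cintb F.
Proof.
move=> mF FM F0; apply: cintb_le mF _ (rintbZ M (rintb_boxi 0 r)) => z.
have [zr|/F0 ->] := leP (nm z) r; first by rewrite boxi_nm ?subr0// mulr1.
by rewrite nm0 mulr_ge0// ?boxi_ge0// (le_trans _ (FM 0)).
Qed.

Lemma cmeas_open (W : set C) F : open W -> (forall z, ~ W z -> F z = 0) ->
  (forall z, W z -> forall e, 0 < e -> exists2 d, 0 < d &
     forall w, nm (w - z) < d -> nm (F w - F z) < e) -> cmeas F.
Proof.
move=> oW F0 cF.
have H (k : C -> R) : (forall z w, `|k z - k w| <= nm (z - w)) -> k 0 = 0 ->
    meas (fun z => k (F z)).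
  move=> kl k0.
  have mW := measurable_plane oW.
  have := @measurable_fun_plane R W (fun z => k (F z)) oW.
  have cW : {in W, continuous (fun z => k (F z))}.
    move=> z /set_mem Wz; have FF := nbhs_filter z; apply/cvgrPdist_lt => e e0.
    have [d d0 Hd] := cF z Wz e e0.
    have d0' : 0 < d%:C :> C by rewrite ltcR.
    exists d%:C => //= w; rewrite /ball /= normCE ltcR => zw.
    by rewrite (le_lt_trans (kl _ _))// nm_distC Hd// nm_distC.
  move=> /(_ cW) mk; rewrite /meas -(setvU (@plane R @^-1` W)).
  apply/measurable_funU => //; first exact: measurableC.
  split; last exact: mk.
  have E : {in ~` (@plane R @^-1` W), cst (0 : R) =1 fun p : T2 => k (F (plane p))}.
    by move=> p; rewrite inE /= => nW; rewrite F0.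
  by apply: (@eq_measurable_fun _ _ _ _ _ (cst (0 : R)) _ E); exact: measurable_cst.
split.
  apply: H => // z w; rewrite -cReN -cReD; exact: Re_le.
apply: H => // z w; rewrite -cImN -cImD; exact: Im_le.
Qed.

Lemma cmeas_lip F (r L : R) : 0 < r -> (forall z w, nm (z - w) < r -> nm (F z - F w) <= L * nm (z - w)) ->
  cmeas F.
Proof.
move=> r0 FL; apply: (@cmeas_open setT) => [|z /(_ I)//|z _ e e0]; first exact: openT.
exists (Num.min r (e / (`|L| + 1))) => [|w].
  by rewrite lt_min r0 divr_gt0// ltr_wpDl.
rewrite lt_min => /andP[/FL H].
rewrite ltr_pdivlMr ?ltr_wpDl// => we; apply: le_lt_trans H _; apply: le_lt_trans we.
rewrite [leRHS]mulrC; apply: ler_wpM2r => //.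
by apply: le_trans (ler_norm L) _; rewrite lerDl.
Qed.

(* The difference quotients of [F] integrate to 0 by translation invariance. *)
Lemma cint_wd F a b (r L : R) : 0 < r ->
  (forall z w, nm (z - w) < r -> nm (F z - F w) <= L * nm (z - w)) ->
  (exists B M, forall z, nm (F z) <= B /\ (M < nm z -> F z = 0)) ->
  (forall z, wd F z (a z) (b z)) ->
  [/\ cintb a, cintb b, cint a = 0 & cint b = 0].
Proof.
move=> r0 FL [B [M FM]] Fab.
have mF := cmeas_lip r0 FL.
have iF : cintb F.
  by apply: (@cintb_bdd F M B) => // z; case: (FM z).
have [N Nr] : exists N : nat, N.+1%:R^-1 < r by have [N _ H] := near_infty_natSinv_lt (PosNum r0); exists N; exact: (H N (leqnn N)).
(* The shift by N keeps every increment below r, the range in which the Lipschitz bound holds. *)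
pose t n : R := (n + N).+1%:R^-1.
have t0 n : 0 < t n by rewrite invr_gt0 ltr0n.
have tr n : t n < r.
  by apply: le_lt_trans Nr; rewrite lef_pV2 ?posrE ?ltr0n// ler_nat ltnS leq_addl.
have t1 n : t n <= 1 by rewrite invf_le1 ?ltr0n// ler1n.
have tcvg : t @ \oo --> (0 : R).
  have H := @cvg_harmonic R; rewrite -(cvg_shiftn N) in H; exact: H.
have L0 : 0 <= `|L| by [].
have key (v : C) : nm v = 1 ->
    cintb (fun z => a z * v + b z * v^J) /\ cint (fun z => a z * v + b z * v^J) = 0.
  move=> v1.
  pose Q n z := (t n)^-1%:C * (F (z + (t n)%:C * v) - F z).
  have ntv n : nm ((t n)%:C * v) = t n.
    by rewrite nmM v1 mulr1 nm_real gtr0_norm.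
  have iQ n : cintb (Q n) by apply/cintbZ/cintbB => //; exact: cintb_shift.
  have I0 n : cint (Q n) = 0.
    rewrite cintZ ?cintB ?cint_shift ?subrr ?mulr0//; first exact: cintb_shift.
    by apply: cintbB => //; exact: cintb_shift.
  (* Domination: the quotient is at most |L|, and increments of length at most 1 keep its support
     within radius M + 1. *)
  have [] := @cint_dct Q (fun z => a z * v + b z * v^J) (fun z => `|L| * boxi 0 (M + 1) z).
  - by move=> n; exact: cintb_meas (iQ n).
  - move=> z; apply/cvgrPdist_le => e e0.
    have [d d0 Hd] := Fab z e e0.
    have /cvgrPdist_lt/(_ d d0) := tcvg.
    apply: filterS => n; rewrite sub0r normrN (gtr0_norm (t0 n)) => tnd.
    rewrite sub0r normrN (ger0_norm (nm_ge0 _)).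
    have := Hd ((t n)%:C * v); rewrite ntv => /(_ tnd).
    rewrite -ler_pdivrMr//; apply: le_trans.
    rewrite [X in nm X](_ : _ = (t n)^-1%:C * (F (z + (t n)%:C * v) - F z -
      (a z * ((t n)%:C * v) + b z * ((t n)%:C * v)^J))); last first.
      have tn0 : (t n)%:C != 0 :> C by rewrite -nm_eq0 nm_real normr_eq0 gt_eqF.

      rewrite /Q conjRM.
      rewrite (_ : (t n)^-1%:C = (t n)%:C^-1); last by rewrite fmorphV.
      move: (F (z + _)) => Fv; move: (t n)%:C tn0 => w w0; field; exact: w0.
    rewrite nmM nm_real ger0_norm ?invr_ge0 ?(ltW (t0 n))//.
    by rewrite mulrC.
  - move=> n z.
    have [zM|zM] := leP (nm z) (M + 1); last first.
      rewrite /Q !(FM _).2.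
      + by rewrite subrr mulr0 nm0 mulr_ge0// boxi_ge0.
      + by apply: lt_trans zM; rewrite ltrDl.
      + have := nmB (z + (t n)%:C * v) ((t n)%:C * v); rewrite addrK ntv => H.
        by have := t1 n; move: H zM; lra.
    rewrite boxi_nm ?subr0// mulr1 /Q nmM nm_real ger0_norm ?invr_ge0 ?(ltW (t0 n))//.
    rewrite ler_pdivrMl// (mulrC (t n) `|L|).
    have zt : nm (z + (t n)%:C * v - z) = t n by rewrite addrAC subrr add0r ntv.
    apply: le_trans (FL _ _ _) _; rewrite zt//.
    by rewrite ler_wpM2r ?(ltW (t0 n))// ler_norm.
  - exact/rintbZ/rintb_boxi.
  move=> iab Iab; split => //.
  apply: (ccvg_uniq Iab); rewrite /ccvg; under eq_fun do rewrite I0 subrr nm0.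
  exact: cvg_cst.
have [i1 I1] := key 1 (@nm1 R); have [ii Ii] := key 'i (@nm_i R).
(* The directions 1 and i give a + b and i (a - b), from which a and then b are recovered. *)
have aE z : 2^-1 * ((a z * 1 + b z * 1^J) + (- 'i) * (a z * 'i + b z * 'i^J)) = a z.
  have h2 : (2 : C) != 0 by rewrite pnatr_eq0.
  apply: (mulfI h2); rewrite mulVKf// conjc1.
  rewrite (_ : 'i^J = - 'i); last by apply/eqP; rewrite eq_complex /= oppr0 !eqxx.
  have ii1 := sqr_i R; transitivity (2 * a z + (b z - a z) * ('i ^+ 2 + 1)); first ring.
  by rewrite ii1 addNr mulr0 addr0.
have ia : cintb a.
  exact: cintb_ext aE (cintbZ 2^-1 (cintbD i1 (cintbZ (- 'i) ii))).
have ib : cintb b.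
  apply: cintb_ext (cintbB i1 ia) => z; rewrite conjc1; ring.
have aa : cint a = 0.
  have iii := cintbZ (- 'i) ii.
  rewrite -(cint_ext aE) (cintZ _ (cintbD i1 iii)) (cintD i1 iii) I1 (cintZ _ ii) Ii.
  by rewrite mulr0 addr0 mulr0.
split => //.
rewrite -(addKr (cint a) (cint b)) -cintD// aa oppr0 add0r -I1.
by apply: cint_ext => z; rewrite conjc1 !mulr1.
Qed.
End plane_integral.

(** * Goursat: the weak Cauchy-Riemann equation *)

Section goursat.
Context (R : realType).
Local Notation C := R[i].
Local Notation nm := (@Normc.normc R).

Definition hol (f : C -> C) := forall z, nm z < 1 -> exists a, wd f z a 0.

Lemma disc_compact r : compact [set p : R * R | nm (plane p) <= r].
Proof.
apply: (@subclosed_compact _ _ (`[- r, r] `*` `[- r, r])).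
- have -> : [set p : R * R | nm (plane p) <= r] = (fun p => nm (plane p)) @^-1` [set x : R | x <= r] by [].
  apply: closed_comp; last exact: closed_le.
  move=> p _; apply: (@continuous_comp _ _ _ (@plane R) nm).
    exact: plane_continuous.
  exact: normc_continuous.
- by apply: compact_setX; exact: segment_compact.
- move=> [x y] /= xyr; have := Re_le (x +i* y); have := Im_le (x +i* y) => /= hy hx.
  by split; rewrite /= in_itv /= -ler_norml; [apply: le_trans hx _|apply: le_trans hy _].
Qed.

Lemma cont_bdd (f : C -> C) r : (forall z, nm z <= r -> forall e, 0 < e ->
    exists2 d, 0 < d & forall w, nm (w - z) < d -> nm (f w - f z) < e) ->
  exists2 M : R, 0 <= M & forall z, nm z <= r -> nm (f z) <= M.
Proof.
move=> cf; pose A := [set p : R * R | nm (plane p) <= r].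
have cA : {within A, continuous (fun p => nm (f (plane p)))}.
  apply: continuous_in_subspaceT => p /set_mem Ap.
  apply: (@continuous_comp _ _ _ (@plane R) (fun z => nm (f z))).
    exact: plane_continuous.
  have FF := nbhs_filter (plane p); apply/cvgrPdist_lt => e e0.
  have [d d0 Hd] := cf _ Ap e e0.
  have d0' : 0 < d%:C :> C by rewrite ltcR.
  exists d%:C => //= w; rewrite /ball /= normCE ltcR => zw.
  by rewrite (le_lt_trans (nm_dist _ _))// nm_distC Hd// nm_distC.
have /compact_bounded[M [_ HM]] := continuous_compact cA (@disc_compact r).
exists (`|M| + 1) => [|z zr]; first by rewrite addr_ge0.
have := HM (`|M| + 1); rewrite (le_lt_trans (ler_norm M)) ?ltrDl// => /(_ isT (nm (f z))).
move=> H; apply: le_trans (ler_norm _) (H _); exists (complex.Re z, complex.Im z).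
  by case: z zr {H}.
by case: z zr {H}.
Qed.

Lemma hol_bdd (f : C -> C) r : hol f -> r < 1 ->
  exists2 M : R, 0 <= M & forall z, nm z <= r -> nm (f z) <= M.
Proof.
move=> hf r1; apply: cont_bdd => z zr.
have [a Ha] := hf z (le_lt_trans zr r1); exact: wd_cont Ha.
Qed.

Lemma discE (z : C) : disc R z = (nm z < 1) :> Prop.
Proof. by rewrite /disc /= normCE (ltcR (nm z) 1). Qed.

Lemma disc_open_nm : open [set z : C | nm z < 1].
Proof.
rewrite (_ : [set z : C | nm z < 1] = disc R); first exact: disc_open.
by apply/seteqP; split=> z /=; rewrite discE.
Qed.

Lemma hol_meas (f : C -> C) : hol f -> (forall z, 1 <= nm z -> f z = 0) -> cmeas f.
Proof.
move=> hf f0; apply: (cmeas_open disc_open_nm) => z /= h.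
  by apply: f0; rewrite leNgt; apply/negP.
by have [a Ha] := hf z h; exact: wd_cont Ha.
Qed.

(* [F] is a test function with Wirtinger derivatives [a], [b], supported in the
   closed disc of radius [r]. *)
Definition test (r r' : R) (F a b : C -> C) :=
  [/\ r < r', lipr r' F, forall z, nm z < r' -> wd F z (a z) (b z) &
      forall z, r <= nm z -> [/\ F z = 0, a z = 0 & b z = 0]].

Lemma test_wd r r' F a b : test r r' F a b -> forall z, wd F z (a z) (b z).
Proof.
move=> [rr _ H F0] z; have [/H//|zr] := ltP (nm z) r'.
have [_ -> ->] := F0 z (le_trans (ltW rr) zr).
apply: (@wd_near _ (fun=> 0) _ _ _ _ (r' - r)); last exact: wd_cst.
  by rewrite subr_gt0.
move=> w wz; have [] // : [/\ F w = 0, a w = 0 & b w = 0]; apply: F0.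
by have := nm_dist w z => /ler_normlP[H1 _]; lra.
Qed.

(** Two points closer than r' - r lie either both in the disc of radius r' or both in the region
    where F vanishes. *)
Lemma test_lip r r' F a b : test r r' F a b -> exists2 L : R, 0 <= L &
  forall z w, nm (z - w) < r' - r -> nm (F z - F w) <= L * nm (z - w).
Proof.
move=> [rr /lipr_ge0[L L0 H] _ F0]; exists L => // z w zw.
have Z u : r <= nm u -> F u = 0 by move=> /F0[].
have := nm_dist z w => /ler_normlP[H1 H2].
have [zr|zr] := leP (nm z) r'; have [wr|wr] := leP (nm w) r'; first exact: H.
- by rewrite (Z z) ?(Z w) ?subrr ?nm0 ?mulr_ge0//; lra.
- by rewrite (Z z) ?(Z w) ?subrr ?nm0 ?mulr_ge0//; lra.
- by rewrite (Z z) ?(Z w) ?subrr ?nm0 ?mulr_ge0//; lra.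
Qed.

Lemma test_bdd r r' F a b : test r r' F a b -> exists2 M : R, 0 <= M &
  forall z, [/\ nm (F z) <= M, nm (a z) <= M & nm (b z) <= M].
Proof.
move=> tF; have [rr lF _ F0] := tF; have [L L0 FL] := test_lip tF.
have [M M0 FM] := lipr_bdd lF; exists (M + L) => [|z]; first exact: addr_ge0.
have [aL bL] : nm (a z) <= L /\ nm (b z) <= L.
  apply: (@wd_lip_bound _ F z _ _ (r' - r) L) => //; last exact: test_wd tF z.
    by rewrite subr_gt0.
  move=> h hr; have E : z + h - z = h by rewrite addrAC subrr add0r.
  by rewrite -[in leRHS]E FL ?E.
split; [|exact: ler_wpDl|exact: ler_wpDl].
have [zr|zr] := leP (nm z) r'; first by rewrite ler_wpDr// FM.
by have [|-> _ _] := F0 z; [lra|rewrite nm0 addr_ge0].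
Qed.

Lemma cint_test r r' F a b : test r r' F a b ->
  [/\ cintb a, cintb b, cint a = 0 & cint b = 0].
Proof.
move=> tF; have [L L0 FL] := test_lip tF; have [M M0 FM] := test_bdd tF.
have [rr _ _ F0] := tF.
apply: (@cint_wd R F a b (r' - r) L); rewrite ?subr_gt0//; last exact: test_wd tF.
exists M, r => z; split; first by case: (FM z).
by move=> /ltW /F0[].
Qed.

Lemma testM r r' r'' F a b G c d : test r r' F a b -> r'' <= r' -> r < r'' -> lipr r'' G ->
  (forall z, nm z < r'' -> wd G z (c z) (d z)) ->
  test r r'' (fun z => F z * G z) (fun z => a z * G z + F z * c z)
    (fun z => b z * G z + F z * d z).
Proof.
move=> [rr lF H F0] r2 r3 lG HG; split => //.
- by apply: liprM lG; exact: liprW lF.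
- by move=> z zr; apply: wdM; [apply: H; exact: lt_le_trans r2|exact: HG].
- by move=> z /F0[-> -> ->]; rewrite !mul0r !addr0.
Qed.

(* The quadratic B-spline on [0, 3], up to a factor 2. It is C^1, and it is a
   combination of its dilates at half the scale, which makes the bisection in
   Goursat's argument compatible with a C^1 partition of the test function. *)
Definition spl (x : R) := pos x ^+ 2 - 3 * pos (x - 1) ^+ 2 + 3 * pos (x - 2) ^+ 2 - pos (x - 3) ^+ 2.
Definition dspl (x : R) := 2 * (pos x - 3 * pos (x - 1) + 3 * pos (x - 2) - pos (x - 3)).

Lemma pos2 (x : R) : pos (2 * x) = 2 * pos x.
Proof.
have [x0|/ltW x0] := leP 0 x; first by rewrite !posE// mulr_ge0.
by rewrite !pos0// ?mulr0// pmulr_rle0.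
Qed.

(** The two-scale relation, with the binomial weights 1, 3, 3, 1. Once the knots are written in
    terms of 2 x it is a linear identity between values of [pos]. *)
Lemma spl_refine x : spl x = 4^-1 * (spl (2 * x) + 3 * spl (2 * x - 1) +
  3 * spl (2 * x - 2) + spl (2 * x - 3)).
Proof.
rewrite /spl.
have -> : pos x = 2^-1 * pos (2 * x) by rewrite pos2 mulKf.
have -> : pos (x - 1) = 2^-1 * pos (2 * x - 2) by rewrite (_ : _ - 2 = 2 * (x - 1)) ?pos2 ?mulKf//; ring.
have -> : pos (x - 2) = 2^-1 * pos (2 * x - 4) by rewrite (_ : _ - 4 = 2 * (x - 2)) ?pos2 ?mulKf//; ring.
have -> : pos (x - 3) = 2^-1 * pos (2 * x - 6) by rewrite (_ : _ - 6 = 2 * (x - 3)) ?pos2 ?mulKf//; ring.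
rewrite (_ : 2 * x - 1 - 1 = 2 * x - 2); last ring.
rewrite (_ : 2 * x - 1 - 2 = 2 * x - 3); last ring.
rewrite (_ : 2 * x - 1 - 3 = 2 * x - 4); last ring.
rewrite (_ : 2 * x - 2 - 1 = 2 * x - 3); last ring.
rewrite (_ : 2 * x - 2 - 2 = 2 * x - 4); last ring.
rewrite (_ : 2 * x - 2 - 3 = 2 * x - 5); last ring.
rewrite (_ : 2 * x - 3 - 1 = 2 * x - 4); last ring.
rewrite (_ : 2 * x - 3 - 2 = 2 * x - 5); last ring.
rewrite (_ : 2 * x - 3 - 3 = 2 * x - 6); last ring.
by field.
Qed.

Lemma dspl_refine x : dspl x = 2^-1 * (dspl (2 * x) + 3 * dspl (2 * x - 1) +
  3 * dspl (2 * x - 2) + dspl (2 * x - 3)).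
Proof.
rewrite /dspl.
have -> : pos x = 2^-1 * pos (2 * x) by rewrite pos2 mulKf.
have -> : pos (x - 1) = 2^-1 * pos (2 * x - 2) by rewrite (_ : _ - 2 = 2 * (x - 1)) ?pos2 ?mulKf//; ring.
have -> : pos (x - 2) = 2^-1 * pos (2 * x - 4) by rewrite (_ : _ - 4 = 2 * (x - 2)) ?pos2 ?mulKf//; ring.
have -> : pos (x - 3) = 2^-1 * pos (2 * x - 6) by rewrite (_ : _ - 6 = 2 * (x - 3)) ?pos2 ?mulKf//; ring.
rewrite (_ : 2 * x - 1 - 1 = 2 * x - 2); last ring.
rewrite (_ : 2 * x - 1 - 2 = 2 * x - 3); last ring.
rewrite (_ : 2 * x - 1 - 3 = 2 * x - 4); last ring.
rewrite (_ : 2 * x - 2 - 1 = 2 * x - 3); last ring.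
rewrite (_ : 2 * x - 2 - 2 = 2 * x - 4); last ring.
rewrite (_ : 2 * x - 2 - 3 = 2 * x - 5); last ring.
rewrite (_ : 2 * x - 3 - 1 = 2 * x - 4); last ring.
rewrite (_ : 2 * x - 3 - 2 = 2 * x - 5); last ring.
rewrite (_ : 2 * x - 3 - 3 = 2 * x - 6); last ring.
by field.
Qed.

Lemma spl_out x : (x <= 0) || (3 <= x) -> spl x = 0 /\ dspl x = 0.
Proof.
move=> /orP[x0|x3]; rewrite /spl /dspl.
  by rewrite !pos0 ?expr0n /=; [split; ring|lra..].
by rewrite !posE; [split; ring|lra..].
Qed.

Lemma spl_bdd x : `|spl x| <= 24 /\ `|dspl x| <= 24.
Proof.
have [x0|x0] := leP x 0; first by have [|-> ->] := @spl_out x; rewrite ?x0 ?normr0.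
have [x3|x3] := leP 3 x; first by have [|-> ->] := @spl_out x; rewrite ?x3 ?orbT ?normr0.
rewrite /spl /dspl (posE (ltW x0)) (pos0 (x := x - 3)) ?subr_le0 ?(ltW x3)// expr0n /= !subr0.
have := pos_ge0 (x - 1); have := pos_ge0 (x - 2).
have q2 : pos (x - 2) <= 1 by have [h|/ltW h] := leP 0 (x - 2); [rewrite posE//; lra|rewrite pos0].
have q1 : pos (x - 1) <= 2 by have [h|/ltW h] := leP 0 (x - 1); [rewrite posE//; lra|rewrite pos0].
move: (pos (x - 1)) (pos (x - 2)) q1 q2 => u v u1 v1 v0 u0.
split; rewrite ler_norml; apply/andP; split; nra.
Qed.

(** Integer translates sum to a constant; this starts the bisection from finitely many atoms
    covering the disc. *)
Lemma spl_sum x : 0 <= x -> x <= 1 -> spl x + spl (x + 1) + spl (x + 2) = 2 /\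
  dspl x + dspl (x + 1) + dspl (x + 2) = 0.
Proof.
move=> x0 x1; rewrite /spl /dspl.
rewrite (posE x0) (pos0 (x := x - 1)) ?(pos0 (x := x - 2)) ?(pos0 (x := x - 3)); [|lra..].
rewrite (posE (x := x + 1)) ?(posE (x := x + 1 - 1)) ?(pos0 (x := x + 1 - 2)) ?(pos0 (x := x + 1 - 3)); [|lra..].
rewrite (posE (x := x + 2)) ?(posE (x := x + 2 - 1)) ?(posE (x := x + 2 - 2)) ?(pos0 (x := x + 2 - 3)); [|lra..].
rewrite !expr0n /=; split; ring.
Qed.

Lemma wd_spl (u : C -> R) z a b : wd (fun z => (u z)%:C) z a b ->
  wd (fun z => (spl (u z))%:C) z ((dspl (u z))%:C * a) ((dspl (u z))%:C * b).
Proof.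
move=> H.
have T (c : R) : wd (fun z => (u z - c)%:C) z a b.
  apply: wd_eq (wd_ext _ (wdB H (wd_cst c%:C z))) _ _; rewrite ?subr0// => w.
  by rewrite rmorphB.
have P (c : R) := wd_posX 0 (T c).
apply: wd_eq (wd_ext _ (wdB (wdD (wdB (wd_posX 0 H) (wdZ 3 (P 1))) (wdZ 3 (P 2))) (P 3))) _ _.
- by move=> w; rewrite /spl; ring.
- by rewrite /dspl; ring.
- by rewrite /dspl; ring.
Qed.

Lemma lipr_spl r (u : C -> R) : lipr r (fun z => (u z)%:C) -> lipr r (fun z => (spl (u z))%:C).
Proof.
move=> H.
have T (c : R) : lipr r (fun z => (u z - c)%:C).
  by apply: lipr_ext (liprD H (lipr_cst r (- c)%:C)) => w _; rewrite rmorphB rmorphN.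
have P (c : R) := lipr_posX 2 (T c).
apply: lipr_ext (liprD (liprD (liprD (lipr_posX 2 H) (liprM (lipr_cst r (- 3)) (P 1)))
  (liprM (lipr_cst r 3) (P 2))) (liprN (P 3))) => w _.
by rewrite /spl; ring.
Qed.

Lemma nested_itv (x : nat -> R) (s : R) : 0 < s ->
  (forall n, x n <= x n.+1 /\ x n.+1 + 3 * (s / 2 ^+ n.+1) <= x n + 3 * (s / 2 ^+ n)) ->
  exists X, forall n, x n <= X <= x n + 3 * (s / 2 ^+ n).
Proof.
move=> s0 H.
have sn n : 0 < s / 2 ^+ n by rewrite divr_gt0// exprn_gt0.
have xnd : {homo x : n m / (n <= m)%N >-> n <= m}.
  by apply: homo_leq => [//|? ? ?|n]; [exact: le_trans|case: (H n)].
have yni : {homo (fun n => x n + 3 * (s / 2 ^+ n)) : n m / (n <= m)%N >-> m <= n}.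
  apply: (@homo_leq _ _ (fun a b => b <= a)) => [//|? ? ? ab bc|n]; first exact: le_trans bc ab.
  by case: (H n).
have xy n m : x n <= x m + 3 * (s / 2 ^+ m).
  apply: (@le_trans _ _ (x (maxn n m) + 3 * (s / 2 ^+ (maxn n m)))).
    apply: (le_trans (xnd _ _ (leq_maxl n m))).
    by rewrite lerDl mulr_ge0// ltW.
  exact: yni (leq_maxr n m).
exists (sup (range x)) => n; apply/andP; split.
  apply: ub_le_sup; last by exists n.
  by exists (x 0 + 3 * (s / 2 ^+ 0)) => _ [m _ <-].
by apply: ge_sup; [exists (x 0), 0|move=> _ [m _ <-]].
Qed.

(** The atom at scale s, supported in [x0, x0 + 3 s]; [dspl1] is its derivative in u. *)
Definition spl1 (x0 s u : R) := spl ((u - x0) / s).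
Definition dspl1 (x0 s u : R) := dspl ((u - x0) / s) / s.

Lemma spl1_refine x0 s u : 0 < s -> spl1 x0 s u = 4^-1 * (spl1 x0 (s / 2) u +
  3 * spl1 (x0 + s / 2) (s / 2) u + 3 * spl1 (x0 + s) (s / 2) u + spl1 (x0 + 3 * s / 2) (s / 2) u).
Proof.
move=> s0; have sn : s != 0 by rewrite gt_eqF.
rewrite /spl1 spl_refine; congr (_ * (spl _ + _ * spl _ + _ * spl _ + spl _)); by field.
Qed.

Lemma dspl1_refine x0 s u : 0 < s -> dspl1 x0 s u = 4^-1 * (dspl1 x0 (s / 2) u +
  3 * dspl1 (x0 + s / 2) (s / 2) u + 3 * dspl1 (x0 + s) (s / 2) u + dspl1 (x0 + 3 * s / 2) (s / 2) u).
Proof.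
move=> s0; have sn : s != 0 by rewrite gt_eqF.
rewrite /dspl1 dspl_refine.
have -> : (u - x0) / (s / 2) = 2 * ((u - x0) / s) by field.
have -> : (u - (x0 + s / 2)) / (s / 2) = 2 * ((u - x0) / s) - 1 by field.
have -> : (u - (x0 + s)) / (s / 2) = 2 * ((u - x0) / s) - 2 by field.
have -> : (u - (x0 + 3 * s / 2)) / (s / 2) = 2 * ((u - x0) / s) - 3 by field.
by field.
Qed.

Lemma wd_spl1 x0 s (u : C -> R) z a b : wd (fun z => (u z)%:C) z a b ->
  wd (fun z => (spl1 x0 s (u z))%:C) z ((dspl1 x0 s (u z))%:C * a) ((dspl1 x0 s (u z))%:C * b).
Proof.
move=> H.
have T : wd (fun z => ((u z - x0) / s)%:C) z (s^-1%:C * a) (s^-1%:C * b).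
  apply: wd_eq (wd_ext _ (wdZ s^-1%:C (wdB H (wd_cst x0%:C z)))) _ _; rewrite ?subr0// => w.
  by rewrite -rmorphB -rmorphM/= mulrC.
by apply: wd_eq (wd_spl T) _ _; rewrite mulrA -rmorphM.
Qed.

Lemma lipr_spl1 r x0 s (u : C -> R) : lipr r (fun z => (u z)%:C) ->
  lipr r (fun z => (spl1 x0 s (u z))%:C).
Proof.
move=> H; apply: lipr_spl.
apply: lipr_ext (liprM (lipr_cst r s^-1%:C) (liprD H (lipr_cst r (- x0)%:C))) => w _.
by rewrite -rmorphD -rmorphM/= mulrC.
Qed.

Lemma wd_Re_id (z : C) : wd (fun z => (complex.Re z)%:C) z 2^-1 2^-1.
Proof. by apply: wd_eq (wd_Re (wd_id z)) _ _; rewrite ?conjc0 ?conjc1 ?addr0 ?add0r mul1r. Qed.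

Lemma invi2 : (2 * 'i)^-1 = - ('i / 2) :> C.
Proof.
have i0 : 'i != 0 :> C by rewrite -nm_eq0 nm_i oner_eq0.
apply: (mulfI (x := 2 * 'i)); first by rewrite mulf_neq0// pnatr_eq0.
rewrite divff ?mulf_neq0 ?pnatr_eq0//.
have -> : 2 * 'i * - ('i / 2) = - ('i ^+ 2) :> C by field.
by rewrite sqr_i opprK.
Qed.

Lemma wd_Im_id (z : C) : wd (fun z => (complex.Im z)%:C) z (- ('i / 2)) ('i / 2).
Proof.
by apply: wd_eq (wd_Im (wd_id z)) _ _; rewrite ?conjc0 ?conjc1 ?subr0 ?sub0r invi2 ?mul1r ?mulN1r ?opprK.
Qed.

(** The weights 1, 3, 3, 1 sum to 8, so after the factor 1/4 one of the pieces carries half of |a|.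
    Refining both coordinates thus loses a factor 4, the factor by which the area shrinks. *)
Lemma Goursat_pick (a a1 a2 a3 a4 : C) : a = 4^-1 * (a1 + 3 * a2 + 3 * a3 + a4) ->
  [\/ nm a <= 2 * nm a1, nm a <= 2 * nm a2, nm a <= 2 * nm a3 | nm a <= 2 * nm a4].
Proof.
move=> aE; have [|h1] := leP (nm a) (2 * nm a1); first by constructor 1.
have [|h2] := leP (nm a) (2 * nm a2); first by constructor 2.
have [|h3] := leP (nm a) (2 * nm a3); first by constructor 3.
have [|h4] := leP (nm a) (2 * nm a4); first by constructor 4.
exfalso.
have nr (k : R) (x : C) : nm (k%:C * x) = `|k| * nm x by rewrite nmM nm_real.
have e1 := nmD (a1 + 3 * a2 + 3 * a3) a4.
have e2 := nmD (a1 + 3 * a2) (3 * a3).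
have e3 := nmD a1 (3 * a2).
have e4 (x : C) : nm (3 * x) = 3 * nm x.
  by rewrite -(rmorph_nat (real_complex R) 3) nr ger0_norm.
have : nm a = 4^-1 * nm (a1 + 3 * a2 + 3 * a3 + a4).
  by rewrite aE -(rmorph_nat (real_complex R) 4) -fmorphV nr ger0_norm// invr_ge0.
rewrite !e4 in e2 e3; lra.
Qed.

Section weak.
Variables (f : C -> C) (r r' : R) (phi a b : C -> C).
Hypotheses (hf : hol f) (f0 : forall z, 1 <= nm z -> f z = 0) (r1 : r' < 1)
  (tphi : test r r' phi a b).

Lemma weak_bdd : exists M : R, [/\ 0 <= M, forall z, nm z < r' -> nm (f z) <= M,
   forall z, nm (phi z) <= M & forall z, nm (b z) <= M].
Proof.
have [M M0 HM] := hol_bdd hf r1; have [N N0 HN] := test_bdd tphi.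
exists (M + N); split => [|z /ltW /HM zM|z|z]; rewrite ?addr_ge0//.
- by rewrite ler_wpDr.
- by rewrite ler_wpDl//; case: (HN z).
- by rewrite ler_wpDl//; case: (HN z).
Qed.

Lemma cintb_fM G : cmeas G -> (exists M : R, forall z, nm (G z) <= M) ->
  (forall z, r <= nm z -> G z = 0) -> cintb (fun z => f z * G z).
Proof.
move=> mG [N GN] G0; have [M [M0 fM _ _]] := weak_bdd; have [rr _ _ _] := tphi.
have N0 : 0 <= N by apply: le_trans (GN 0).
apply: (@cintb_bdd R _ r (M * N)).
- by apply: cmeasM => //; exact: hol_meas.
- move=> z; have [zr|zr] := leP r (nm z); first by rewrite G0// mulr0 nm0 mulr_ge0.
  by rewrite nmM ler_pM// fM// (lt_trans zr).
- by move=> z /ltW zr; rewrite G0// mulr0.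
Qed.

(** The conj(z)-derivative of [pat], the test function times an atom in each coordinate; [aat] is
    the z-derivative. *)
Definition gat x s y t z : C := b z * (spl1 x s (complex.Re z) * spl1 y t (complex.Im z))%:C +
  phi z * (2^-1 * (dspl1 x s (complex.Re z) * spl1 y t (complex.Im z))%:C
          + 'i / 2 * (spl1 x s (complex.Re z) * dspl1 y t (complex.Im z))%:C).

Definition aat x s y t z : C := a z * (spl1 x s (complex.Re z) * spl1 y t (complex.Im z))%:C +
  phi z * (2^-1 * (dspl1 x s (complex.Re z) * spl1 y t (complex.Im z))%:C
          - 'i / 2 * (spl1 x s (complex.Re z) * dspl1 y t (complex.Im z))%:C).

Definition pat x s y t z : C := phi z * (spl1 x s (complex.Re z) * spl1 y t (complex.Im z))%:C.

Lemma test_at x s y t : test r r' (pat x s y t) (aat x s y t) (gat x s y t).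
Proof.
have [rr lphi _ _] := tphi.
apply: (testM tphi) => //.
- apply: lipr_ext (liprM (lipr_spl1 x s (lipr_Re (lipr_id r'))) (lipr_spl1 y t (lipr_Im (lipr_id r')))) => z _.
  by rewrite -rmorphM.
- move=> z _; apply: wd_eq (wd_ext _ (wdM (wd_spl1 x s (wd_Re_id z)) (wd_spl1 y t (wd_Im_id z)))) _ _.
  + by move=> w; rewrite -rmorphM.
  + by rewrite !rmorphM/=; ring.
  + by rewrite !rmorphM/=; ring.
Qed.

Lemma cintb_fgat x s y t : cintb (fun z => f z * gat x s y t z).
Proof.
have tat := test_at x s y t; have [_ ig _ _] := cint_test tat.
apply: cintb_fM.
- exact: cintb_meas.
- by have [M _ HM] := test_bdd tat; exists M => z; case: (HM z).
- by have [_ _ _ H] := tat; move=> z /H[].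
Qed.

(** The counterpart of the integral of f along the boundary of a small triangle in the classical
    argument. *)
Definition J x s y t := cint (fun z => f z * gat x s y t z).

Lemma cint4 (F F1 F2 F3 F4 : C -> C) : cintb F1 -> cintb F2 -> cintb F3 -> cintb F4 ->
  (forall z, F z = 4^-1 * (F1 z + 3 * F2 z + 3 * F3 z + F4 z)) ->
  cint F = 4^-1 * (cint F1 + 3 * cint F2 + 3 * cint F3 + cint F4).
Proof.
move=> i1 i2 i3 i4 FE; have j2 := cintbZ 3 i2; have j3 := cintbZ 3 i3.
have k2 := cintbD i1 j2; have k3 := cintbD k2 j3.
rewrite (cint_ext FE) (cintZ _ (cintbD k3 i4)) (cintD k3 i4) (cintD k2 j3) (cintD i1 j2).
by rewrite (cintZ _ i2) (cintZ _ i3).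
Qed.

Lemma conv4l (p q t u v : R) : (4^-1 * (p + 3 * q + 3 * t + u) * v)%:C =
  4^-1 * ((p * v)%:C + 3 * (q * v)%:C + 3 * (t * v)%:C + (u * v)%:C) :> C.
Proof.
rewrite -(natC R 3) -(natVC R 4); ring.
Qed.

Lemma conv4r (p q t u v : R) : (v * (4^-1 * (p + 3 * q + 3 * t + u)))%:C =
  4^-1 * ((v * p)%:C + 3 * (v * q)%:C + 3 * (v * t)%:C + (v * u)%:C) :> C.
Proof. by rewrite mulrC conv4l !(mulrC v). Qed.

Lemma step_itv (x s : R) : 0 < s -> [/\ x <= x <= x + 3 * s / 2, x <= x + s / 2 <= x + 3 * s / 2,
  x <= x + s <= x + 3 * s / 2 & x <= x + 3 * s / 2 <= x + 3 * s / 2].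
Proof. by move=> s0; split; lra. Qed.

Lemma J_refine1 x s y t : 0 < s -> J x s y t = 4^-1 * (J x (s / 2) y t +
  3 * J (x + s / 2) (s / 2) y t + 3 * J (x + s) (s / 2) y t + J (x + 3 * s / 2) (s / 2) y t).
Proof.
move=> s0; apply: cint4; try exact: cintb_fgat.
by move=> z; rewrite /gat (spl1_refine _ _ s0) (dspl1_refine _ _ s0) !conv4l; ring.
Qed.

Lemma J_refine2 x s y t : 0 < t -> J x s y t = 4^-1 * (J x s y (t / 2) +
  3 * J x s (y + t / 2) (t / 2) + 3 * J x s (y + t) (t / 2) + J x s (y + 3 * t / 2) (t / 2)).
Proof.
move=> s0; apply: cint4; try exact: cintb_fgat.
by move=> z; rewrite /gat (spl1_refine _ _ s0) (dspl1_refine _ _ s0) !conv4r; ring.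
Qed.

Lemma J_step x s y : 0 < s -> exists x' y', [/\ x <= x' <= x + 3 * s / 2,
  y <= y' <= y + 3 * s / 2 & nm (J x s y s) <= 4 * nm (J x' (s / 2) y' (s / 2))].
Proof.
move=> s0.
have [x1 x2 x3 x4] := step_itv x s0; have [y1 y2 y3 y4] := step_itv y s0.
have [x' xx' H1] : exists2 x', x <= x' <= x + 3 * s / 2 & nm (J x s y s) <= 2 * nm (J x' (s / 2) y s).
  by case: (Goursat_pick (J_refine1 x y s s0)) => H;
    [exists x|exists (x + s / 2)|exists (x + s)|exists (x + 3 * s / 2)].
have [y' yy' H2] : exists2 y', y <= y' <= y + 3 * s / 2 & nm (J x' (s / 2) y s) <= 2 * nm (J x' (s / 2) y' (s / 2)).
  by case: (Goursat_pick (J_refine2 x' (s / 2) y s0)) => H;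
    [exists y|exists (y + s / 2)|exists (y + s)|exists (y + 3 * s / 2)].
exists x', y'; split; [exact: xx'|exact: yy'|apply: (le_trans H1)].
have -> : 4 = 2 * 2 :> R by rewrite -natrM.
by rewrite -mulrA; apply: ler_wpM2l H2.
Qed.

(* Goursat: the atom at the limit point of a sequence of nested boxes is as
   small as the error of the affine approximation of [f]. *)
Lemma J0 x s y : 0 < s -> J x s y s = 0.
Proof.
move=> s0; have [M [M0 fM phiM bM]] := weak_bdd; have [rr _ _ phi0] := tphi.
pose q (k : nat) := s / 2 ^+ k.
have q0 k : 0 < q k by rewrite divr_gt0// exprn_gt0.
have qS k : q k.+1 = q k / 2 by rewrite /q exprSr invfM mulrA.
(* Choosing the next corner for all scales and corners at once makes the bisection a plain
   recursion, [st]. *)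
have [F HF] : exists F : nat * (R * R) -> R * R, forall p, [/\ p.2.1 <= (F p).1 <= p.2.1 + 3 * q p.1 / 2,
   p.2.2 <= (F p).2 <= p.2.2 + 3 * q p.1 / 2 & nm (J p.2.1 (q p.1) p.2.2 (q p.1)) <=
     4 * nm (J (F p).1 (q p.1.+1) (F p).2 (q p.1.+1))].
  suff /choice[F HF] : forall p : nat * (R * R), exists p' : R * R, [/\ p.2.1 <= p'.1 <= p.2.1 + 3 * q p.1 / 2,
     p.2.2 <= p'.2 <= p.2.2 + 3 * q p.1 / 2 & nm (J p.2.1 (q p.1) p.2.2 (q p.1)) <=
     4 * nm (J p'.1 (q p.1.+1) p'.2 (q p.1.+1))] by exists F.
  move=> [k [u v]] /=; have [x' [y' [? ? ?]]] := J_step u v (q0 k).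
  by exists (x', y'); rewrite qS.
pose st := fix st (n : nat) : R * R := if n is n'.+1 then F (n', st n') else (x, y).
have stH k : nm (J x s y s) <= 4 ^+ k * nm (J (st k).1 (q k) (st k).2 (q k)).
  elim: k => [|k ih]; first by rewrite /q expr0 !divr1 mul1r.
  apply: le_trans ih _; rewrite exprSr -mulrA ler_wpM2l ?exprn_ge0//.
  by case: (HF (k, st k)).
have [X HX] : exists X, forall n, (st n).1 <= X <= (st n).1 + 3 * (s / 2 ^+ n).
  apply: nested_itv => // n; rewrite -/(q n) -/(q n.+1) qS.
  case: (HF (n, st n)) => /= h1 _ _; have := q0 n; move: h1 => /=.
  by move: (q n) (F _).1 (st n).1 => qn u v /andP[h1 h2] h3; split; lra.
have [Y HY] : exists Y, forall n, (st n).2 <= Y <= (st n).2 + 3 * (s / 2 ^+ n).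
  apply: nested_itv => // n; rewrite -/(q n) -/(q n.+1) qS.
  case: (HF (n, st n)) => /= _ h1 _; have := q0 n; move: h1 => /=.
  by move: (q n) (F _).2 (st n).2 => qn u v /andP[h1 h2] h3; split; lra.
pose z0 : C := X +i* Y.
have qsmall e : 0 < e -> exists n, q n < e.
  move=> e0; have [n _ Hn] := near_infty_natSinv_expn_lt (PosNum (divr_gt0 e0 s0)).
  exists n; rewrite /q -ltr_pdivlMl// mulrC; have := Hn n (leqnn n) => /=.
  by rewrite mul1r.
(* The support is a square of side 3 q whose closure contains z0, whence the radius 6 q. *)
have supp n z : gat (st n).1 (q n) (st n).2 (q n) z != 0 ->
    nm (z - z0) <= 6 * q n /\ boxi ((st n).1 +i* (st n).2) (3 * q n) z = 1.
  move=> g0; rewrite -/(q n) in HX HY.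
  have in3 (u v : R) : (spl1 v (q n) u != 0) || (dspl1 v (q n) u != 0) -> v < u < v + 3 * q n.
    move=> H; apply: contraLR H; rewrite negb_and -!leNgt => H.
    have [|H1 H2] := @spl_out ((u - v) / q n).
      by rewrite ler_pdivlMr// pmulr_lle0 ?invr_gt0// subr_le0 lerBrDl.
    by rewrite /spl1 /dspl1 H1 H2 mul0r eqxx.
  have Rin : (st n).1 < complex.Re z < (st n).1 + 3 * q n.
    apply: in3; apply: contraNT g0; rewrite negb_or !negbK => /andP[/eqP H1 /eqP H2].
    by rewrite /gat H1 H2 !mul0r !mulr0 addr0 mulr0 addr0.
  have Iin : (st n).2 < complex.Im z < (st n).2 + 3 * q n.
    apply: in3; apply: contraNT g0; rewrite negb_or !negbK => /andP[/eqP H1 /eqP H2].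
    by rewrite /gat H1 H2 !mulr0 addr0 !mulr0 addr0.
  have := HX n; have := HY n; rewrite -!/(q n).
  move: (q0 n) Rin Iin; rewrite /z0; clear; case: z => zx zy /=.
  move: (q n) (st n) => p [u v] /= p0 /andP[a1 a2] /andP[b1 b2] /andP[c1 c2] /andP[d1 d2].
  split.
    apply: (le_trans (nm_le_ReIm ((zx - X) +i* (zy - Y)))) => /=.
    have : `|zx - X| <= 3 * p by rewrite ler_norml; apply/andP; split; lra.
    have : `|zy - Y| <= 3 * p by rewrite ler_norml; apply/andP; split; lra.
    lra.
  rewrite /boxi /box /=.
  have -> : `|zx - u| <= 3 * p by rewrite ler_norml; apply/andP; split; lra.
  by have -> : `|zy - v| <= 3 * p by rewrite ler_norml; apply/andP; split; lra.
(* 24 bounds both [spl] and [dspl], and 576 = 24^2; the term 1 / q comes from differentiating the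
   dilated atom. *)
have gbd n z : nm (gat (st n).1 (q n) (st n).2 (q n) z) <= M * 576 * (1 + 1 / q n).
  rewrite /gat; move: (st n) (q0 n) => [u v] /= p0.
  have [[a1 a2] [b1 b2]] := (spl_bdd ((complex.Re z - u) / q n), spl_bdd ((complex.Im z - v) / q n)).
  have hx : `|spl1 u (q n) (complex.Re z)| <= 24 by [].
  have hy : `|spl1 v (q n) (complex.Im z)| <= 24 by [].
  have hdx : `|dspl1 u (q n) (complex.Re z)| <= 24 / q n.
    by rewrite /dspl1 normrM normfV (gtr0_norm p0) ler_wpM2r// invr_ge0 ltW.
  have hdy : `|dspl1 v (q n) (complex.Im z)| <= 24 / q n.
    by rewrite /dspl1 normrM normfV (gtr0_norm p0) ler_wpM2r// invr_ge0 ltW.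
  have i2 : nm ('i / 2) = 2^-1 by rewrite nmM nmV nm_nat nm_i mul1r.
  rewrite [leRHS]mulrDr mulr1 mul1r; apply: (le_trans (nmD _ _)); apply: lerD.
    rewrite nmM nm_real normrM; apply: ler_pM => //.
    by rewrite (_ : 576 = 24 * 24) ?ler_pM// -natrM.
  rewrite nmM -(mulrA M); apply: ler_pM; [exact: nm_ge0|exact: nm_ge0|exact: phiM|].
  apply: (le_trans (nmD _ _)).
  rewrite !nmM !nm_real nmV nm_nat nm_i mul1r (normrM (dspl1 _ _ _)) (normrM (spl1 _ _ _)).
  have h1 : `|dspl1 u (q n) (complex.Re z)| * `|spl1 v (q n) (complex.Im z)| <= 24 / q n * 24 by apply: ler_pM.
  have h2 : `|spl1 u (q n) (complex.Re z)| * `|dspl1 v (q n) (complex.Im z)| <= 24 * (24 / q n) by apply: ler_pM.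
  move: h1 h2; rewrite mulrAC mulrA.
  have -> : 24 * 24 = 576 :> R by rewrite -natrM.
  by move: (_ * `|spl1 _ _ _|) (_ * `|dspl1 _ _ _|) (576 / _) => ? ? ?; lra.
have [N N0 gN] : exists2 N : R, 0 <= N & forall n z, nm (gat (st n).1 (q n) (st n).2 (q n) z) <= N * (1 + 1 / q n).
  by exists (M * 576); [exact: (mulr_ge0 M0 (ler0n _ _))|exact: gbd].
have tat n := test_at (st n).1 (q n) (st n).2 (q n).
have qs n : q n <= s.
  by rewrite /q ler_pdivrMr ?exprn_gt0// ler_peMr ?(ltW s0)// exprn_ege1// ler1n.
(* If z0 is off the open disc, f has no derivative to use there, but small atoms then miss the
   support of phi and [gat] is identically 0. *)
have [z01|z01] := ltP (nm z0) 1; last first.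
  have [n qn] := qsmall ((1 - r') / 6) (divr_gt0 (etrans (subr_gt0 _ _) r1) (ltr0n _ 6)).
  have g0 z : gat (st n).1 (q n) (st n).2 (q n) z = 0.
    apply/eqP; apply: contraT => /[dup] g0 /supp[zz0 _].
    have zr : r <= nm z.
      have := nm_dist z z0 => /ler_normlP[H1 _]; move: H1 z01 zz0 qn rr.
      move: (nm z) (nm z0) (nm (z - z0)) (q n) r1; clear; move=> *; lra.
    have [p0 _ b0] := phi0 z zr; by rewrite /gat p0 b0 !mul0r addr0 eqxx in g0.
  have := stH n; rewrite (_ : J (st n).1 _ _ _ = 0).
    by rewrite nm0 mulr0 => H; apply/eqP; rewrite -nm_eq0 eq_le H nm_ge0.
  by rewrite /J -[RHS](@cint0 R); apply: cint_ext => z; rewrite g0 mulr0.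
have [c Hc] := hf z01.
(* 216 = 6 * 36: the radius 6 q in the error of f, and the area 36 q^2 of the square. The loss 4^n
   cancels against q^2, since 4^n q^2 = s^2. *)
pose K := 216 * (N * (s + 1) * s ^+ 2).
have K0 : 0 <= K.
  apply: mulr_ge0; first exact: ler0n.
  by apply: mulr_ge0; [apply: mulr_ge0 => //; rewrite addr_ge0// ltW|exact: sqr_ge0].
suff JK e : 0 < e -> nm (J x s y s) <= e * K.
  apply/eqP; rewrite -nm_eq0 eq_le nm_ge0 andbT.
  apply/ler_addgt0Pr => e e0; rewrite add0r.
  have K1 : 0 < K + 1 by rewrite ltr_wpDl.
  apply: le_trans (JK _ (divr_gt0 e0 K1)) _.
  by rewrite -mulrA ler_piMr ?(ltW e0)// mulrC ler_pdivrMr// mul1r lerDl.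
move=> e0; have [d d0 Hd] := Hc e e0.
have [n qn] := qsmall (d / 6) (divr_gt0 d0 (ltr0n _ 6)).
pose G := gat (st n).1 (q n) (st n).2 (q n).
(* A conj(z)-derivative of a test function integrates to 0 against 1 and against z, so the affine
   part of f at z0 drops out and only [E] is left. *)
have [_ iG _ IG] := cint_test (tat n).
have [_ izG _ IzG] := cint_test (testM (tat n) (lexx r') rr (lipr_id r') (fun z _ => wd_id z)).
have izG' : cintb (fun z => z * G z) by apply: cintb_ext izG => z; rewrite mulr0 addr0 mulrC.
have IzG' : cint (fun z => z * G z) = 0 by rewrite -IzG; apply: cint_ext => z; rewrite mulr0 addr0 mulrC.
have ifG : cintb (fun z => f z * G z) := cintb_fgat _ _ _ _.
pose E z := f z - f z0 - c * (z - z0).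
have EE z : E z * G z = f z * G z - ((f z0 - c * z0) * G z + c * (z * G z)) by rewrite /E; ring.
have iL : cintb (fun z => (f z0 - c * z0) * G z + c * (z * G z)) by apply: cintbD; exact: cintbZ.
have iE : cintb (fun z => E z * G z) by apply: cintb_ext (cintbB ifG iL) => z; rewrite EE.
have JE : J (st n).1 (q n) (st n).2 (q n) = cint (fun z => E z * G z).
  rewrite (cint_ext EE) (cintB ifG iL) (cintD (cintbZ _ iG) (cintbZ _ izG')) (cintZ _ iG) (cintZ _ izG') IG IzG'.
  by rewrite !mulr0 addr0 subr0.
pose B := e * (6 * q n) * (N * (1 + 1 / q n)).
have EB z : nm (E z * G z) <= B * boxi ((st n).1 +i* (st n).2) (3 * q n) z.
  have qn0 : 0 <= 1 / q n by rewrite divr_ge0// ltW.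
  have B0 : 0 <= B.
    apply: mulr_ge0; apply: mulr_ge0; rewrite ?(ltW e0)//; last by rewrite addr_ge0.
    by apply: mulr_ge0 => //; exact: ltW.
  have [G0|G0] := eqVneq (G z) 0; first by rewrite G0 mulr0 nm0 mulr_ge0// boxi_ge0.
  have [zz0 ->] := supp n z G0; rewrite mulr1 nmM; apply: ler_pM => //.
  have := Hd (z - z0); rewrite (addrC z0) subrK mul0r addr0 => H.
    apply: le_trans (H _) _; first by apply: le_lt_trans zz0 _; rewrite mulrC -ltr_pdivlMr.
    by rewrite ler_wpM2l// ltW.
  exact: gN.
have JB : nm (J (st n).1 (q n) (st n).2 (q n)) <= B * (4 * (3 * q n) ^+ 2).
  rewrite JE; apply: le_trans (le_nm_cint iE) _.
  have q3 : 0 <= 3 * q n by apply: mulr_ge0; [exact: ler0n|exact: ltW].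
  have ib := rintb_boxi ((st n).1 +i* (st n).2) (3 * q n).
  rewrite -(rint_boxi ((st n).1 +i* (st n).2) q3) -(rintZ B ib).
  by apply: rint_le; [exact: cintb_nm|exact: rintbZ|exact: EB].
apply: le_trans (stH n) _; apply: le_trans (ler_wpM2l _ JB) _; first by rewrite exprn_ge0.
rewrite /K /B {JB EB B}; have -> : s ^+ 2 = 4 ^+ n * q n ^+ 2.
  have qE : s = q n * 2 ^+ n by rewrite /q divfK// expf_neq0// pnatr_eq0.
  have E4 : 4 ^+ n = (2 ^+ n) ^+ 2 :> R by rewrite exprAC; congr (_ ^+ n); ring.
  by rewrite E4 [in LHS]qE exprMn mulrC.
have qn0 : q n != 0 by rewrite gt_eqF.
rewrite [leLHS](_ : _ = e * (216 * (N * (q n + 1) * (4 ^+ n * q n ^+ 2)))); last by field.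
apply: ler_wpM2l; first exact: ltW.
apply: ler_wpM2l => //; apply: ler_wpM2r.
  by apply: mulr_ge0; [exact: exprn_ge0|exact: sqr_ge0].
by apply: ler_wpM2l => //; rewrite lerD2r.
Qed.

(** On [-1, 1] the three atoms of scale 2 at -1, -3, -5 sum to 2, so on the disc the nine products
    sum to 4; each of the nine integrals vanishes by [J0]. *)
Lemma weak_dbar : cintb (fun z => f z * b z) /\ cint (fun z => f z * b z) = 0.
Proof.
have [rr _ _ phi0] := tphi.
have Jsum z : f z * b z = 4^-1 *
  ((f z * gat (-1) 2 (-1) 2 z + f z * gat (-3) 2 (-1) 2 z + f z * gat (-5) 2 (-1) 2 z) +
   (f z * gat (-1) 2 (-3) 2 z + f z * gat (-3) 2 (-3) 2 z + f z * gat (-5) 2 (-3) 2 z) +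
   (f z * gat (-1) 2 (-5) 2 z + f z * gat (-3) 2 (-5) 2 z + f z * gat (-5) 2 (-5) 2 z)).
  have [zr|zr] := leP r (nm z).
    have [p0 _ b0] := phi0 z zr; rewrite /gat p0 b0; ring.
  have z1 : nm z < 1 by apply: lt_trans zr _; apply: lt_trans rr r1.
  have key (u : R) : `|u| <= nm z ->
     [/\ spl1 (-5) 2 u = 2 - spl1 (-1) 2 u - spl1 (-3) 2 u &
      dspl1 (-5) 2 u = - dspl1 (-1) 2 u - dspl1 (-3) 2 u].
    move=> uz; have [u1 u2] : -1 <= u /\ u <= 1.
      by have := le_lt_trans uz z1; rewrite ltr_norml => /andP[/ltW ? /ltW ?].
    have [||H1 H2] := @spl_sum ((u - -1) / 2); [lra|lra|].
    rewrite /spl1 /dspl1.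
    rewrite (_ : (u - -5) / 2 = (u - -1) / 2 + 2); last by field.
    rewrite (_ : (u - -3) / 2 = (u - -1) / 2 + 1); last by field.
    by split; lra.
  rewrite /gat; have [-> ->] := key _ (Re_le z); have [-> ->] := key _ (Im_le z).
  move: (spl1 _ _ (complex.Re z)) (spl1 _ _ (complex.Re z)) (dspl1 _ _ (complex.Re z)) (dspl1 _ _ (complex.Re z)).
  move: (spl1 _ _ (complex.Im z)) (spl1 _ _ (complex.Im z)) (dspl1 _ _ (complex.Im z)) (dspl1 _ _ (complex.Im z)).
  move: (f z) (b z) (phi z) => ? ? ? ? ? ? ? ? ? ? ?; clear.
  by field.
have i3 y : cintb (fun z => f z * gat (-1) 2 y 2 z + f z * gat (-3) 2 y 2 z + f z * gat (-5) 2 y 2 z).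
  by do 2?[apply: cintbD]; exact: cintb_fgat.
have I3 y : y \in [:: -1; -3; -5] -> cint (fun z => f z * gat (-1) 2 y 2 z + f z * gat (-3) 2 y 2 z + f z * gat (-5) 2 y 2 z) = 0.
  have i2 := cintbD (cintb_fgat (-1) 2 y 2) (cintb_fgat (-3) 2 y 2).
  move=> _; rewrite (cintD i2 (cintb_fgat (-5) 2 y 2)) (cintD (cintb_fgat (-1) 2 y 2) (cintb_fgat (-3) 2 y 2)).
  rewrite -!/(J _ _ _ _) !J0// !addr0 //.
split.
  apply: cintb_ext (cintbZ 4^-1 (cintbD (cintbD (i3 (-1)) (i3 (-3))) (i3 (-5)))) => z.
  by rewrite Jsum.
rewrite (cint_ext Jsum) (cintZ _ (cintbD (cintbD (i3 (-1)) (i3 (-3))) (i3 (-5)))).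
rewrite (cintD (cintbD (i3 (-1)) (i3 (-3))) (i3 (-5))) (cintD (i3 (-1)) (i3 (-3))).
by rewrite !I3 ?addr0 ?mulr0// !inE eqxx ?orbT.
Qed.

End weak.
End goursat.

(** * Mean value property and Cauchy estimates *)

Section mean_value.
Context (R : realType).
Local Notation C := R[i].
Local Notation nm := (@Normc.normc R).

Lemma wd_nm2 (z w : C) : wd (fun w => (nm (w - z) ^+ 2)%:C) w (w - z)^J (w - z).
Proof.
have H := wdB (wd_id w) (wd_cst z w).
apply: wd_eq (wd_ext _ (wdM H (wdJ H))) _ _.
- by move=> v; rewrite mulJE.
- by rewrite !subr0 conjc0 mulr0 addr0 mul1r.
- by rewrite !subr0 mul0r add0r conjc1 mulr1.
Qed.

Lemma lipr_nm2 r (z : C) : lipr r (fun w => (nm (w - z) ^+ 2)%:C).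
Proof.
have H := liprD (lipr_id r) (lipr_cst r (- z)).
by apply: lipr_ext (liprM H (liprJ H)) => w _; rewrite mulJE.
Qed.

Lemma continuous_meas (k : R -> R) (g : C -> R) : continuous k -> meas g -> meas (fun w => k (g w)).
Proof. by move=> ck; apply: meas_comp; exact: continuous_measurable_fun. Qed.

Lemma meas_pos (g : C -> R) : meas g -> meas (fun w => pos (g w)).
Proof.
apply: continuous_meas => x; apply/cvgrPdist_le => e e0; exists e => // y /= xy.
by apply: le_trans (pos_lip _ _) _; exact: ltW.
Qed.

(** The constant 1 in the convention that functions vanish off the disc; testing with it normalizes
    the kernels below. *)
Definition disc_ind (z : C) : C := if nm z < 1 then 1 else 0.

Lemma hol_one : hol disc_ind.
Proof.
move=> z z1; exists 0; apply: (@wd_near _ (fun=> 1) _ _ _ _ (1 - nm z)); last exact: wd_cst.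
  by rewrite subr_gt0.
move=> w wz; rewrite /disc_ind ifT//; have := nm_dist w z => /ler_normlP[_ H]; lra.
Qed.

Lemma one_out z : 1 <= nm z -> disc_ind z = 0.
Proof. by move=> z1; rewrite /disc_ind ltNge z1. Qed.

(** * A smooth mean value kernel and the estimates it gives *)

Section kernel.
Variables (r0 : R).
Hypotheses (r00 : 0 <= r0) (r01 : r0 < 1).
(** Discs of radius rho around points of modulus at most r0 stay inside the unit disc, even with the
    margin rho / 2 that [test] requires ([rr1]). *)
Let rho := (1 - r0) / 2.
Let T := rho ^+ 2.
Let rho0 : 0 < rho. Proof. by rewrite divr_gt0// subr_gt0. Qed.
Let rho1 : rho <= 1. Proof. by rewrite /rho; move: r00; lra. Qed.
Let T0 : 0 < T. Proof. exact: exprn_gt0. Qed.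
Let T1 : T <= 1. Proof. by rewrite exprn_ile1// ltW. Qed.

(** The cube makes the kernel C^2 in z, so that the first-order Taylor expansion of f has a
    quadratic remainder. *)
Definition ker (z w : C) : R := pos (T - nm (w - z) ^+ 2) ^+ 3.

Lemma ker_ge0 z w : 0 <= ker z w.
Proof. by rewrite exprn_ge0// pos_ge0. Qed.

Lemma posT_le z w : pos (T - nm (w - z) ^+ 2) <= 1.
Proof.
have H := sqr_ge0 (nm (w - z)); have [h|/ltW h] := leP 0 (T - nm (w - z) ^+ 2); last by rewrite pos0.
by rewrite posE//; move: T1 H; lra.
Qed.

Lemma ker_le1 z w : ker z w <= 1.
Proof. by rewrite exprn_ile1 ?pos_ge0// posT_le. Qed.

Lemma posT0 z w : rho <= nm (w - z) -> pos (T - nm (w - z) ^+ 2) = 0.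
Proof. by move=> H; rewrite pos0// subr_le0 ler_pXn2r// nnegrE// ltW. Qed.

Lemma ker_out z w : rho <= nm (w - z) -> ker z w = 0.
Proof. by move=> H; rewrite /ker posT0// expr0n. Qed.

Lemma meas_nm2 z : meas (fun w => nm (w - z) ^+ 2).
Proof.
apply: measX; apply: meas_nm; apply: (@cmeas_lip _ _ 1 1) => // u v _.
by rewrite mul1r opprB addrA subrK.
Qed.

Lemma meas_posT z : meas (fun w => pos (T - nm (w - z) ^+ 2)).
Proof. by apply: meas_pos; apply: measD (meas_cst _) (measN (meas_nm2 z)). Qed.

Lemma meas_ker z : meas (ker z).
Proof. exact: (measX 3 (meas_posT z)). Qed.

Lemma rintb_bd (g : C -> R) (z : C) (M s : R) : meas g -> (forall w, `|g w| <= M) ->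
  (forall w, s < nm (w - z) -> g w = 0) -> rintb g.
Proof.
move=> mg gM g0; apply: rintb_le mg _ (rintbZ M (rintb_boxi z s)) => w.
have [ws|/g0 ->] := leP (nm (w - z)) s; first by rewrite boxi_nm// mulr1.
by rewrite normr0 mulr_ge0 ?boxi_ge0// (le_trans _ (gM 0)).
Qed.

Lemma rintb_ker z : rintb (ker z).
Proof.
apply: (@rintb_bd _ z 1 rho); first exact: meas_ker.
  by move=> w; rewrite ger0_norm ?ker_ge0// ker_le1.
by move=> w /ltW; exact: ker_out.
Qed.

Definition kc := rint (ker 0).

Lemma kcE z : rint (ker z) = kc.
Proof.
rewrite -(rint_shift z (rintb_ker z)); apply: rint_ext => w.
by rewrite /ker addrK subr0.
Qed.

Lemma kc_gt0 : 0 < kc.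
Proof.
have b0 : 0 < (T / 2) ^+ 3 by rewrite exprn_gt0// divr_gt0.
have r20 : 0 <= rho / 2 by rewrite divr_ge0// ltW.
apply: (@lt_le_trans _ _ (rint (fun z => (T / 2) ^+ 3 * boxi 0 (rho / 2) z))).
  by rewrite (rintZ _ (rintb_boxi _ _)) rint_boxi// mulr_gt0// mulr_gt0// exprn_gt0// divr_gt0.
apply: rint_le; [exact/rintbZ/rintb_boxi|exact: rintb_ker|move=> z].
rewrite /boxi; case: (boolP (box _ _ _)) => [|_]; last by rewrite mulr0 ker_ge0.
rewrite /box !subr0 mulr1 => /andP[hx hy].
rewrite ler_pXn2r ?nnegrE ?pos_ge0 ?divr_ge0 ?(ltW T0)// subr0.
have := real_normK (num_real (complex.Re z)); have := real_normK (num_real (complex.Im z)).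
have := nm_sqr z; move: hx hy.
have := normr_ge0 (complex.Re z); have := normr_ge0 (complex.Im z).
rewrite /T; move: (`|complex.Re z|) (`|complex.Im z|) (nm z) => a b n b0' a0' ha hb hn e1 e2.
have a2 : a ^+ 2 <= (rho / 2) ^+ 2 by rewrite ler_pXn2r// nnegrE.
have b2 : b ^+ 2 <= (rho / 2) ^+ 2 by rewrite ler_pXn2r// nnegrE.
have e3 : (rho / 2) ^+ 2 = rho ^+ 2 / 4 by field.
have h : rho ^+ 2 / 2 <= rho ^+ 2 - n ^+ 2 by lra.
by rewrite posE//; apply: le_trans h; rewrite divr_ge0// sqr_ge0.
Qed.

(* test function [conj (w - z) (T - |w - z|^2)_+^4 / (|w - z|^2 + d)] *)
Definition cauchy_d (d : R) (z w : C) : R :=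
  d * pos (T - nm (w - z) ^+ 2) ^+ 4 / (nm (w - z) ^+ 2 + d) ^+ 2.
Definition cauchy_k (d : R) (z w : C) : R :=
  nm (w - z) ^+ 2 * ker z w / (nm (w - z) ^+ 2 + d).

Lemma meas_inv (d : R) z : 0 < d -> meas (fun w => (nm (w - z) ^+ 2 + d)^-1).
Proof.
move=> d0; apply: (meas_ext (g := fun w => (`|nm (w - z) ^+ 2| + d)^-1)) => [w|].
  by rewrite ger0_norm ?sqr_ge0.
apply: (@continuous_meas (fun x => (`|x| + d)^-1)) (meas_nm2 z) => x.
apply: cvgV; first by rewrite gt_eqF// ltr_wpDl.
by apply: cvgD; [exact: norm_continuous|exact: cvg_cst].
Qed.

Lemma meas_cauchy_d d z : 0 < d -> meas (cauchy_d d z).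
Proof.
move=> d0; apply: measM; first by apply: measM (meas_cst d) (measX 4 (meas_posT z)).
by apply: meas_ext (measX 2 (meas_inv z d0)) => w; rewrite exprVn.
Qed.

Lemma meas_cauchy_k d z : 0 < d -> meas (cauchy_k d z).
Proof.
move=> d0; apply: measM; last exact: meas_inv.
by apply: measM (meas_nm2 z) (meas_ker z).
Qed.

Lemma cauchy_k_bd d z w : 0 < d -> 0 <= cauchy_k d z w <= ker z w.
Proof.
move=> d0; have u0 := sqr_ge0 (nm (w - z)); have k0 := ker_ge0 z w; rewrite /cauchy_k.
have ud : 0 < nm (w - z) ^+ 2 + d by rewrite ltr_wpDl.
apply/andP; split; first by apply: divr_ge0; [exact: mulr_ge0|exact: ltW].
rewrite ler_pdivrMr// mulrC.
by apply: ler_wpM2l => //; rewrite lerDl ltW.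
Qed.

Lemma cauchy_d_bd d z w : 0 < d -> 0 <= cauchy_d d z w <= d^-1.
Proof.
move=> d0; have u0 := sqr_ge0 (nm (w - z)); rewrite /cauchy_d.
have ud : 0 < nm (w - z) ^+ 2 + d by rewrite ltr_wpDl.
have p0 := pos_ge0 (T - nm (w - z) ^+ 2); have p1 := posT_le z w.
have p4 : 0 <= pos (T - nm (w - z) ^+ 2) ^+ 4 <= 1 by rewrite exprn_ge0//= exprn_ile1.
move: (pos _ ^+ 4) p4 => p /andP[q0 q1]; move: (nm _ ^+ 2) u0 ud => u u0 ud.
apply/andP; split; first by apply: divr_ge0; [apply: mulr_ge0 => //; exact: ltW|exact: sqr_ge0].
rewrite ler_pdivrMr ?exprn_gt0//.
rewrite ler_pdivlMl//; apply: (@le_trans _ _ (d ^+ 2)).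
  by rewrite mulrA -expr2 ler_piMr// sqr_ge0.
by rewrite ler_pXn2r// ?nnegrE ?(ltW d0) ?(ltW ud)// lerDr.
Qed.

Lemma cauchy_out d z w : rho <= nm (w - z) -> cauchy_d d z w = 0 /\ cauchy_k d z w = 0.
Proof.
move=> H; rewrite /cauchy_d /cauchy_k (posT0 H) ker_out// expr0n /=.
by rewrite !mulr0 !mul0r.
Qed.

Lemma cauchy_alg (p U d : R) (v : C) : U%:C = v * v^J -> (U + d)%:C != 0 :> C ->
  (1 * (p ^+ 4)%:C + v^J * ((4 * p ^+ 3)%:C * - v)) / (U + d)%:C +
    v^J * (p ^+ 4)%:C * (- v / (U + d)%:C ^+ 2) =
  (d * p ^+ 4 / (U + d) ^+ 2 - 4 * (U * p ^+ 3 / (U + d)))%:C.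
Proof.
move=> e h; have hR : U + d != 0 by apply: contraNneq h => ->.
have -> : 1 * (p ^+ 4)%:C + v^J * ((4 * p ^+ 3)%:C * - v) = (p ^+ 4 - 4 * p ^+ 3 * U)%:C.
  by transitivity ((p ^+ 4)%:C - (4 * p ^+ 3)%:C * U%:C); [rewrite e|]; ring.
have -> : v^J * (p ^+ 4)%:C * (- v / (U + d)%:C ^+ 2) = - (p ^+ 4 * U / (U + d) ^+ 2)%:C.
  by rewrite !rmorphM fmorphV rmorphXn /= e; ring.
rewrite -fmorphV -rmorphM -rmorphB; congr (_%:C); field; exact: hR.
Qed.

(** A regularized Cauchy kernel cut off by a bump. As d tends to 0, [cauchy_d] concentrates at z
    with bounded mass and [cauchy_k] tends to [ker], so the weak equation becomes a mean value
    property. *)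
Lemma cauchy_test d z : 0 < d -> nm z <= r0 -> exists F a,
  test (r0 + rho) (r0 + rho + rho / 2) F a (fun w => (cauchy_d d z w - 4 * cauchy_k d z w)%:C).
Proof.
move=> d0 zr.
pose u w := nm (w - z) ^+ 2.
pose P w : C := (pos (T - u w) ^+ 4)%:C.
pose I w : C := (u w + d)%:C^-1.
have u0 w : 0 <= u w by exact: sqr_ge0.
have ud w : (u w + d)%:C != 0 :> C by rewrite -nm_eq0 nm_real normr_eq0 gt_eqF// ltr_wpDl.
exists (fun w => (w - z)^J * P w * I w).
pose P' w : C := (4 * pos (T - u w) ^+ 3)%:C.
have wP w : wd P w (P' w * (- (w - z)^J)) (P' w * (- (w - z))).
  apply: (@wd_posX R 2 (fun w => T - u w)).
  apply: wd_eq (wd_ext _ (wdB (wd_cst T%:C w) (wd_nm2 z w))) _ _; rewrite ?sub0r// => v.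
  by rewrite rmorphB.
have wI w : wd I w (- (w - z)^J / (u w + d)%:C ^+ 2) (- (w - z) / (u w + d)%:C ^+ 2).
  apply: wdV => //.
  apply: wd_eq (wd_ext _ (wdD (wd_nm2 z w) (wd_cst d%:C w))) _ _; rewrite ?addr0// => v.
  by rewrite rmorphD.
have wJ w : wd (fun w => (w - z)^J) w 0 1.
  apply: wd_eq (wdJ (wdB (wd_id w) (wd_cst z w))) _ _; first by rewrite subr0 conjc0.
  by rewrite subr0 conjc1.
have wT w := wdM (wdM (wJ w) (wP w)) (wI w).
exists (fun w => (0 * P w + (w - z)^J * (P' w * - (w - z)^J)) * I w +
    (w - z)^J * P w * (- (w - z)^J / (u w + d)%:C ^+ 2)).
split.
- by rewrite ltrDl divr_gt0.
- apply: liprM; first apply: liprM.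
  + exact: liprJ (liprD (lipr_id _) (lipr_cst _ (- z))).
  + apply: lipr_posX; apply: lipr_ext (liprD (lipr_cst _ T%:C) (liprN (lipr_nm2 _ z))) => w _.
    by rewrite -rmorphN -rmorphD.
  + apply: (lipr_ext (F := fun w => ((u w + d)^-1)%:C)) => [w _|]; first by rewrite /I fmorphV.
    apply: (@lipr_comp _ _ u (fun x => (x + d)^-1) (d ^- 2)) (lipr_nm2 _ z) _ => v w _ _.
    have ud' x : 0 < u x + d by rewrite ltr_wpDl.
    have -> : (u v + d)^-1 - (u w + d)^-1 = (u w - u v) * ((u v + d)^-1 * (u w + d)^-1).
      by field; rewrite !gt_eqF.
    rewrite normrM mulrC distrC; apply: ler_wpM2r => //.
    rewrite ger0_norm ?mulr_ge0 ?invr_ge0 ?(ltW (ud' _))// expr2 invfM.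
    by rewrite ler_pM ?invr_ge0 ?(ltW (ud' _))// lef_pV2 ?posrE// lerDr.
- move=> w _; apply: wd_eq (wT w) _ _ => //.
  rewrite /cauchy_d /cauchy_k /ker -/(u w) /I /P /P'.
  have := ud w; have : (u w)%:C = (w - z) * (w - z)^J :> C by rewrite mulJE.
  move: (pos (T - u w)) (u w) (w - z) => p U v e h; exact: cauchy_alg e h.
- move=> w wr.
  have vr : rho <= nm (w - z).
    by have := nm_dist w z => /ler_normlP[_]; move: zr wr; lra.
  have [-> ->] := cauchy_out d vr; rewrite /P /P' (posT0 vr) !expr0n /= !mulr0 subr0 rmorph0.
  by rewrite !(mul0r, mulr0, addr0).
Qed.

Lemma rr1 : r0 + rho + rho / 2 < 1.
Proof. by rewrite /rho; move: r01; lra. Qed.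

Lemma cauchy_int d z F : 0 < d -> nm z <= r0 -> hol F -> (forall w, 1 <= nm w -> F w = 0) ->
  [/\ cintb (fun w => F w * (cauchy_d d z w)%:C), cintb (fun w => F w * (cauchy_k d z w)%:C) &
   cint (fun w => F w * (cauchy_d d z w)%:C) = 4 * cint (fun w => F w * (cauchy_k d z w)%:C)].
Proof.
move=> d0 zr hF F0; have [Psi [a tPsi]] := cauchy_test d0 zr.
have [W1 W2] := weak_dbar hF F0 rr1 tPsi.
have out w : r0 + rho <= nm w -> rho <= nm (w - z).
  by move=> wr; have := nm_dist w z => /ler_normlP[_]; move: zr wr; lra.
have i1 : cintb (fun w => F w * (cauchy_d d z w)%:C).
  apply: (cintb_fM hF F0 rr1 tPsi); first exact: (cmeas_real (meas_cauchy_d z d0)).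
    exists d^-1 => w; have /andP[h1 h2] := cauchy_d_bd z w d0.
    by rewrite nm_real ger0_norm.
  by move=> w /out /(cauchy_out d)[-> _].
have i2 : cintb (fun w => F w * (cauchy_k d z w)%:C).
  apply: (cintb_fM hF F0 rr1 tPsi); first exact: (cmeas_real (meas_cauchy_k z d0)).
    exists 1 => w; have /andP[h1 h2] := cauchy_k_bd z w d0.
    by rewrite nm_real ger0_norm// (le_trans h2)// ker_le1.
  by move=> w /out /(cauchy_out d)[_ ->].
split => //; apply/eqP; rewrite -subr_eq0 -(cintZ _ i2) -(cintB i1 (cintbZ 4 i2)) -W2.
by apply/eqP/cint_ext => w; ring.
Qed.

(** The weak equation for the constant 1 bounds the mass uniformly in d, so its exact value is never
    computed. *)
Lemma cauchy_mass d z : 0 < d -> nm z <= r0 -> rintb (cauchy_d d z) /\ rint (cauchy_d d z) <= 4 * kc.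
Proof.
move=> d0 zr; have [i1 i2 E] := cauchy_int d0 zr hol_one one_out.
have oneM (g : C -> R) : (forall w, rho <= nm (w - z) -> g w = 0) ->
    (fun w => disc_ind w * (g w)%:C) =1 (fun w => (g w)%:C).
  move=> g0 w; rewrite /disc_ind; case: ifPn => [_|]; first by rewrite mul1r.
  rewrite -leNgt => w1; rewrite g0 ?mulr0//.
  by have := nm_dist w z => /ler_normlP[_]; move: zr w1 rr1 rho0; lra.
have o1 := oneM _ (fun w h => (cauchy_out d h).1).
have o2 := oneM _ (fun w h => (cauchy_out d h).2).
have [j1 _] := cintb_ext o1 i1; have [j2 _] := cintb_ext o2 i2.
have k1 : rintb (cauchy_d d z) by [].
have k2 : rintb (cauchy_k d z) by [].
split => //; move: E; rewrite (cint_ext o1) (cint_ext o2) (cint_real k1) (cint_real k2).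
rewrite -(natC R 4) -rmorphM => /(@nm_inj R) ->.
rewrite ler_pM2l// -(kcE z); apply: rint_le => //; first exact: rintb_ker.
by move=> w; have /andP[] := cauchy_k_bd z w d0.
Qed.

(** As F vanishes at z, only the boundedness of the mass of [cauchy_d] matters: F is small near z,
    and away from z [cauchy_d] is O(d). *)
Lemma mean_value0 z F : nm z <= r0 -> hol F -> (forall w, 1 <= nm w -> F w = 0) -> F z = 0 ->
  cint (fun w => F w * (ker z w)%:C) = 0.
Proof.
move=> zr hF F0 Fz.
have rho2 : r0 + rho < 1 by have := rr1; move: rho0; lra.
have [B B0 FB] := hol_bdd hF rho2.
have inn w : nm (w - z) < rho -> nm (F w) <= B.
  by move=> wr; apply: FB; have := nm_dist w z => /ler_normlP[_]; move: zr wr; lra.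
have kB (g : C -> R) w : 0 <= g w -> (rho <= nm (w - z) -> g w = 0) -> nm (F w * (g w)%:C) <= B * g w.
  move=> g0 gout; rewrite nmM nm_real ger0_norm//.
  have [/gout ->|wr] := leP rho (nm (w - z)); first by rewrite !mulr0.
  by rewrite ler_wpM2r// inn.
pose d n : R := n.+1%:R^-1.
have d0 n : 0 < d n by rewrite invr_gt0 ltr0n.
have dcvg : d @ \oo --> (0 : R) := @cvg_harmonic R.
have [iK cvgK] : cintb (fun w => F w * (ker z w)%:C) /\
    ccvg (fun n => cint (fun w => F w * (cauchy_k (d n) z w)%:C)) (cint (fun w => F w * (ker z w)%:C)).
  apply: (@cint_dct _ (fun n w => F w * (cauchy_k (d n) z w)%:C) _ (fun w => B * ker z w)).
  - by move=> n; have [_ /cintb_meas] := cauchy_int (d0 n) zr hF F0.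
  - move=> w; have [->|wz] := eqVneq w z.
      rewrite Fz mul0r; under eq_fun do rewrite mul0r; exact: ccvg_cst.
    have u0 : 0 < nm (w - z) ^+ 2 by rewrite exprn_gt0// nm_gt0 subr_eq0.
    apply: (@ccvg_le _ _ _ (fun n => nm (F w) * (nm (w - z) ^+ 2)^-1 * d n)) => [n|]; last first.
      by rewrite -[X in _ --> X](mulr0 (nm (F w) * (nm (w - z) ^+ 2)^-1)); apply: cvgM => //; exact: cvg_cst.
    rewrite -mulrBr -rmorphB nmM nm_real -mulrA; apply: ler_wpM2l => //.
    rewrite /cauchy_k distrC; have k0 := ker_ge0 z w; have k1 := ker_le1 z w; have dn := d0 n.
    move: (nm _ ^+ 2) (ker z w) (d n) u0 k0 k1 dn => u k e u0 k0 k1 e0.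
    rewrite (_ : k - _ = k * e / (u + e)); last by field; rewrite gt_eqF// addr_gt0.
    have ue := addr_gt0 u0 e0.
    rewrite ger0_norm; last by apply: divr_ge0; [apply: mulr_ge0 => //; exact: ltW|exact: ltW].
    rewrite ler_pdivrMr// -mulrA mulrCA [k * e]mulrC; apply: ler_wpM2l; first exact: ltW.
    rewrite mulrDr mulVf ?gt_eqF//; apply: (le_trans k1); rewrite lerDl.
    by apply: mulr_ge0; rewrite ?invr_ge0; exact: ltW.
  - move=> n w; have /andP[h1 h2] := cauchy_k_bd z w (d0 n).
    apply: (le_trans (kB _ _ h1 _)); first by move=> /(cauchy_out (d n))[].
    exact: ler_wpM2l.
  - exact/rintbZ/rintb_ker.
apply/eqP; rewrite -nm_eq0 eq_le nm_ge0 andbT; apply/ler_addgt0Pr => e e0; rewrite add0r.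
have k4 : 0 < kc + 1 by rewrite ltr_wpDl// ltW// kc_gt0.
(* The part within eta of z contributes at most e1 * (4 * kc), that is e / 2 after division by the 4
   of [cauchy_int]. *)
pose e1 := e / (kc + 1) / 2; have e10 : 0 < e1 by rewrite !divr_gt0.
have [a Ha] := hF z (le_lt_trans zr r01).
have [eta eta0 Heta] := wd_cont Ha e10.
have Hc n : nm (cint (fun w => F w * (cauchy_d (d n) z w)%:C)) <= e1 * (4 * kc) + B / eta ^+ 4 * (4 * rho ^+ 2) * d n.
  have [i1 _ _] := cauchy_int (d0 n) zr hF F0; have [m1 m2] := cauchy_mass (d0 n) zr.
  apply: le_trans (le_nm_cint i1) _.
  have ib := rintb_boxi z rho; have j1 := rintbZ e1 m1; have j2 := rintbZ (d n * (B / eta ^+ 4)) ib.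
  apply: (@le_trans _ _ (rint (fun w => e1 * cauchy_d (d n) z w + d n * (B / eta ^+ 4) * boxi z rho w))).
    apply: rint_le; [exact: cintb_nm|exact: rintbD|move=> w].
    have /andP[h1 h2] := cauchy_d_bd z w (d0 n).
    have b0 := boxi_ge0 z rho w.
    have Be : 0 <= B / eta ^+ 4 by rewrite divr_ge0// exprn_ge0// ltW.
    have [weta|weta] := ltP (nm (w - z)) eta.
      have /ltW := Heta w weta; rewrite Fz subr0 => Fw.
      rewrite nmM nm_real ger0_norm// ler_wpDr ?ler_wpM2r//.
      by rewrite mulr_ge0// mulr_ge0// ltW.
    have [wr|wr] := leP rho (nm (w - z)).
      have [-> _] := cauchy_out (d n) wr; rewrite mulr0 nm0 mulr0 add0r.
      by rewrite mulr_ge0// mulr_ge0// ltW.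
    have e1c : 0 <= e1 * cauchy_d (d n) z w by apply: mulr_ge0 => //; exact: ltW.
    rewrite boxi_nm ?(ltW wr)// mulr1 ler_wpDl//.
    apply: (le_trans (kB _ _ h1 _)); first by move=> /(cauchy_out (d n))[].
    rewrite (mulrCA (d n) B); apply: ler_wpM2l => //; rewrite /cauchy_d.
    have p0 := pos_ge0 (T - nm (w - z) ^+ 2); have p1 := posT_le z w.
    have p4 : 0 <= pos (T - nm (w - z) ^+ 2) ^+ 4 <= 1 by rewrite exprn_ge0//= exprn_ile1.
    move: (pos _ ^+ 4) p4 => p /andP[q0 q1].
    apply: ler_pM; rewrite ?mulr_ge0 ?invr_ge0 ?sqr_ge0 ?(ltW (d0 n))//.
      by rewrite ler_piMr// ltW.
    have w2 : 0 < nm (w - z) ^+ 2 by rewrite exprn_gt0// (lt_le_trans eta0).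
    rewrite lef_pV2 ?posrE ?exprn_gt0// ?addr_gt0//.
    rewrite (_ : eta ^+ 4 = (eta ^+ 2) ^+ 2); last by rewrite -exprM.
    rewrite ler_pXn2r// ?nnegrE ?sqr_ge0 ?addr_ge0 ?(ltW w2) ?(ltW (d0 n))//.
    rewrite ler_wpDr ?(ltW (d0 n))// ler_pXn2r// nnegrE ltW//; exact: lt_le_trans weta.
  rewrite (rintD j1 j2) (rintZ _ m1) (rintZ _ ib) rint_boxi ?(ltW rho0)//.
  apply: lerD; first by apply: ler_wpM2l => //; exact: ltW.
  by rewrite -mulrA [leRHS]mulrC.
pose K := B / eta ^+ 4 * (4 * rho ^+ 2).
apply: (ccvg_le_lim cvgK).
have Kd : (fun n => K * d n) @ \oo --> (0 : R).
  by rewrite -[X in _ --> X](mulr0 K); apply: cvgM => //; exact: cvg_cst.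
have e2 : 0 < e / 2 by rewrite divr_gt0.
have /cvgrPdist_le/(_ _ e2) := Kd.
apply: filterS => n; rewrite sub0r normrN => Kn.
have [_ _ E] := cauchy_int (d0 n) zr hF F0.
have := Hc n; rewrite E nmM nm_nat -/K.
have := ler_norm (K * d n); have ke : e1 * kc <= e / 2.
  rewrite /e1 mulrAC ler_pM2r ?invr_gt0// mulrAC ler_pdivrMr//.
  by rewrite ler_pM2l// lerDl.
rewrite (mulrCA e1 4 kc); move: Kn ke; move: `|K * d n| (K * d n) (nm _) (e1 * kc) => ? ? ? ?; lra.
Qed.

(** Subtracting f(z) times the constant 1 reduces to a function vanishing at z; the constant
    contributes the mass [kc]. *)
Lemma mean_value z f : nm z <= r0 -> hol f -> (forall w, 1 <= nm w -> f w = 0) ->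
  cintb (fun w => f w * (ker z w)%:C) /\ cint (fun w => f w * (ker z w)%:C) = f z * kc%:C.
Proof.
move=> zr hf f0.
have out w : rho <= nm (w - z) -> ker z w = 0 by exact: ker_out.
have ib (g : C -> C) : hol g -> (forall w, 1 <= nm w -> g w = 0) -> cintb (fun w => g w * (ker z w)%:C).
  move=> hg g0; have [Psi [a tPsi]] := cauchy_test ltr01 zr.
  apply: (cintb_fM hg g0 rr1 tPsi); first exact: (cmeas_real (meas_ker z)).
    by exists 1 => w; rewrite nm_real ger0_norm ?ker_ge0// ker_le1.
  move=> w wr; rewrite out//.
  by have := nm_dist w z => /ler_normlP[_]; move: zr wr; lra.
split; first exact: ib.
have i1 := ib _ hf f0; have i2 := ib _ hol_one one_out.
have oneE : (fun w => disc_ind w * (ker z w)%:C) =1 (fun w => (ker z w)%:C).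
  move=> w; rewrite /disc_ind; case: ifPn => [_|]; first by rewrite mul1r.
  rewrite -leNgt => w1; rewrite out ?mulr0//.
  by have := nm_dist w z => /ler_normlP[_]; move: zr w1 rr1 rho0; lra.
pose F w := f w - f z * disc_ind w.
have hF : hol F.
  move=> w w1; have [a Ha] := hf w w1; have [b Hb] := hol_one w1.
  by exists (a - f z * b); apply: wd_eq (wdB Ha (wdZ (f z) Hb)) _ _; rewrite // mulr0 subr0.
have z1 : nm z < 1 by exact: le_lt_trans zr r01.
have := @mean_value0 z F zr hF.
rewrite (_ : F z = 0); last by rewrite /F /disc_ind z1 mulr1 subrr.
move=> H; have {}H := H _ erefl.
apply/eqP; rewrite -subr_eq0 -(kcE z) -(cint_real (rintb_ker z)) -(cint_ext oneE) -(cintZ _ i2).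
rewrite -(cintB i1 (cintbZ _ i2)) -[X in _ == X]H; first by apply/eqP/cint_ext => w; rewrite /F; ring.
by move=> w w1; rewrite /F f0// one_out// mulr0 subr0.
Qed.

(** The four cases are the signs of x and x + y. The bound keeps the form of the smooth remainder 3
    x y^2 + y^3, so the kink costs nothing. *)
Lemma pos_taylor (x y : R) :
  `|pos (x + y) ^+ 3 - pos x ^+ 3 - 3 * pos x ^+ 2 * y| <= 3 * pos x * y ^+ 2 + `|y| ^+ 3.
Proof.
have [x0|x0] := leP 0 x; have [xy|xy] := leP 0 (x + y).
- rewrite !posE// (_ : _ - _ = 3 * x * y ^+ 2 + y ^+ 3); last by ring.
  by rewrite (le_trans (ler_normD _ _))// lerD// ?normrX// ger0_norm// mulr_ge0 ?sqr_ge0// mulr_ge0.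
- rewrite (posE x0) (pos0 (ltW xy)) expr0n /= sub0r.
  have y0 : y < 0 by lra.
  rewrite (ltr0_norm y0) [X in `|X|](_ : _ = - (x ^+ 2 * (x + 3 * y))); last by ring.
  rewrite normrN normrM ger0_norm ?sqr_ge0// ler0_norm; last by lra.
  have y3 : 0 <= (- y) ^+ 3 by rewrite exprn_ge0// oppr_ge0 ltW.
  suff : x ^+ 2 * - (x + 3 * y) <= 3 * x * y ^+ 2 by lra.
  rewrite -subr_ge0 (_ : _ - _ = x ^+ 3 + 3 * (x * - y * - (y + x))); last by ring.
  by rewrite addr_ge0 ?exprn_ge0// mulr_ge0// mulr_ge0 ?mulr_ge0//; lra.
- rewrite (pos0 (ltW x0)) (posE xy) [X in `|X|](_ : _ = (x + y) ^+ 3); last by ring.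
  rewrite [leRHS](_ : _ = `|y| ^+ 3); last by ring.
  by rewrite ger0_norm ?exprn_ge0// ger0_norm ?ler_pXn2r ?nnegrE//; lra.
- rewrite (pos0 (ltW x0)) (pos0 (ltW xy)) [X in `|X|](_ : _ = 0); last by ring.
  by rewrite [leRHS](_ : _ = `|y| ^+ 3); [rewrite normr0 exprn_ge0|ring].
Qed.

Lemma cint_mul_le (f G : C -> C) (M : R) : cintb f -> (forall w, 1 <= nm w -> f w = 0) -> cmeas G ->
  (forall w, nm w < 1 -> nm (G w) <= M) ->
  cintb (fun w => f w * G w) /\ nm (cint (fun w => f w * G w)) <= M * rint (fun w => nm (f w)).
Proof.
move=> fi f0 mG GM; have fG w : nm (f w * G w) <= M * nm (f w).
  have [w1|/f0 ->] := ltP (nm w) 1; last by rewrite mul0r nm0 mulr0.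
  by rewrite nmM mulrC ler_wpM2r// GM.
have iN := cintb_nm fi.
have iG : cintb (fun w => f w * G w).
  by apply: cintb_le (rintbZ M iN) => //; apply: cmeasM => //; exact: cintb_meas.
split => //; apply: le_trans (le_nm_cint iG) _; rewrite -(rintZ M iN).
by apply: rint_le => //; [exact: cintb_nm|exact: rintbZ].
Qed.

Lemma nm2_diff (v w : C) : `|nm v ^+ 2 - nm w ^+ 2| <= nm (v - w) * (nm v + nm w).
Proof.
rewrite (_ : _ - _ = (nm v - nm w) * (nm v + nm w)); last by ring.
by rewrite normrM (ger0_norm (addr_ge0 (nm_ge0 _) (nm_ge0 _))) ler_wpM2r ?nm_dist// addr_ge0.
Qed.

Lemma est_sum (a b c d e : R) : a <= b + c -> b <= 48 * e -> c <= 128 * e -> d <= 3 * e -> 0 <= e ->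
  a + d <= 200 * e.
Proof. lra. Qed.

(** By [mean_value], z enters f(z) only through [ker z]. Bounds, Lipschitz bounds and Taylor
    remainders of the kernel therefore pass to f, with the L^1 norm of f as factor. *)
Lemma hol_estimates : exists2 K : R, 0 <= K & forall f, hol f -> (forall w, 1 <= nm w -> f w = 0) ->
  cintb f -> let N := rint (fun w => nm (f w)) in
  [/\ forall z, nm z <= r0 -> nm (f z) <= K * N,
      forall z w, nm z <= r0 -> nm w <= r0 -> nm (f z - f w) <= K * N * nm (z - w) &
      forall z a, nm z < r0 -> wd f z a 0 -> nm a <= K * N /\
        forall h, nm (z + h) <= r0 -> nm (f (z + h) - f z - a * h) <= K * N * nm h ^+ 2].
Proof.
have k0 := kc_gt0.
have kC : kc%:C != 0 :> C by rewrite -nm_eq0 nm_real normr_eq0 gt_eqF.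
(* 200 covers the Lipschitz constant 12 of the kernel and the sum 48 + 128 + 3 of the three Taylor
   remainders. *)
exists (200 / kc) => [|f hf f0 fi N]; first exact: divr_ge0 (ler0n _ 200) (ltW k0).
have N0 : 0 <= N by apply: rint_ge0.
have mv z : nm z <= r0 -> f z = kc^-1%:C * cint (fun w => f w * (ker z w)%:C).
  by move=> zr; have [_ ->] := mean_value zr hf f0; rewrite fmorphV mulrCA mulVf// mulr1.
have dist2 z w : nm z <= r0 -> nm w < 1 -> nm (w - z) <= 2.
  by move=> zr w1; apply: (le_trans (nmB _ _)); move: r01; lra.
have nk x : nm (kc^-1%:C * x) = kc^-1 * nm x by rewrite nmM nm_real ger0_norm// invr_ge0 ltW.
have ik z := cint_mul_le fi f0 (cmeas_real (meas_ker z)) (M := 1).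
have {}ik z : cintb (fun w => f w * (ker z w)%:C) /\ nm (cint (fun w => f w * (ker z w)%:C)) <= 1 * N.
  by apply: ik => w _; rewrite nm_real ger0_norm ?ker_ge0// ker_le1.
have est1 z : nm z <= r0 -> nm (f z) <= 200 / kc * N.
  move=> zr; rewrite (mv z zr) nk mulrAC [leRHS]mulrC; apply: ler_wpM2l; first by rewrite invr_ge0 ltW.
  by apply: (le_trans (ik z).2); apply: ler_wpM2r => //; lra.
have est2 z w : nm z <= r0 -> nm w <= r0 -> nm (f z - f w) <= 200 / kc * N * nm (z - w).
  move=> zr wr; rewrite (mv z zr) (mv w wr) -mulrBr nk.
  rewrite [leRHS](_ : _ = kc^-1 * (200 * nm (z - w) * N)); last by ring.
  apply: ler_wpM2l; first by rewrite invr_ge0 ltW.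
  have [iz _] := ik z; have [iw _] := ik w; rewrite -(cintB iz iw).
  rewrite (@cint_ext _ _ (fun v => f v * (ker z v - ker w v)%:C)); last by move=> v; ring.
  have := cint_mul_le fi f0 (cmeas_real (measD (meas_ker z) (measN (meas_ker w)))) (M := 12 * nm (z - w)).
  case=> [v v1|_ H]; last first.
    apply: (le_trans H); apply: ler_wpM2r => //; apply: ler_wpM2r => //.
    by rewrite ler_nat.
  rewrite nm_real /ker.
  have := nm2_diff (v - w) (v - z); have := dist2 z v zr v1; have := dist2 w v wr v1.
  rewrite (_ : v - w - (v - z) = z - w); last by ring.
  have := posT_le z v; have := posT_le w v.
  have := pos_ge0 (T - nm (v - z) ^+ 2); have := pos_ge0 (T - nm (v - w) ^+ 2).
  have := pos_lip (T - nm (v - z) ^+ 2) (T - nm (v - w) ^+ 2).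
  rewrite (_ : T - nm (v - z) ^+ 2 - _ = nm (v - w) ^+ 2 - nm (v - z) ^+ 2); last by ring.
  move: (pos _) (pos _) => p q pq q0 p0 q1 p1 d1 d2 d3.
  rewrite distrC (_ : p ^+ 3 - q ^+ 3 = (p - q) * (p ^+ 2 + p * q + q ^+ 2)); last by ring.
  rewrite normrM.
  have s3 : `|p ^+ 2 + p * q + q ^+ 2| <= 3.
    rewrite ger0_norm ?addr_ge0 ?mulr_ge0 ?sqr_ge0//.
    have : p ^+ 2 <= 1 by rewrite exprn_ile1.
    have : q ^+ 2 <= 1 by rewrite exprn_ile1.
    have : p * q <= 1 by rewrite mulr_ile1.
    by lra.
  have pq4 : `|p - q| <= nm (z - w) * 4.
    by rewrite distrC; apply: (le_trans pq); apply: (le_trans d3); apply: ler_wpM2l => //; lra.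
  apply: (le_trans (ler_pM _ _ pq4 s3)) => //; have := nm_ge0 (z - w); move: (nm _) => ?; lra.
split => // z a zr Ha.
have zr' := ltW zr.
have KN0 : 0 <= 200 / kc * N by apply: (mulr_ge0 _ N0); apply: (divr_ge0 _ (ltW k0)); exact: ler0n.
have na : nm a <= 200 / kc * N.
  have rz : 0 < r0 - nm z by rewrite subr_gt0.
  have [] // := @wd_lip_bound _ f z a 0 (r0 - nm z) (200 / kc * N) rz.
  move=> h hr; have E : z + h - z = h by rewrite addrAC subrr add0r.
  rewrite -[in leRHS]E; apply: est2 => //.
  by apply: (le_trans (nmD _ _)); move: hr; lra.
split => // h0 zh0.
(* The differential of [ker] in z along h; [L h] is the resulting linear term of f. *)
pose g (h : C) (w : C) : R := pos (T - nm (w - z) ^+ 2) ^+ 2 * (6 * complex.Re ((w - z) * h^J)).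
pose L h := kc^-1%:C * cint (fun w => f w * (g h w)%:C).
have mg h : meas (g h).
  apply: measM; first exact: (measX 2 (meas_posT z)).
  apply: measM; first exact: meas_cst.
  have [//] : cmeas (fun w => (w - z) * h^J).
  apply: cmeasM; last exact: cmeas_cst.
  apply: (@cmeas_lip _ _ 1 1) => // u v _.
  by rewrite mul1r opprB addrA subrK.
have gb h w : nm w < 1 -> nm (g h w)%:C <= 12 * nm h.
  move=> w1; rewrite nm_real /g normrM.
  have p2 : `|pos (T - nm (w - z) ^+ 2) ^+ 2| <= 1.
    by rewrite ger0_norm ?sqr_ge0// exprn_ile1// ?pos_ge0// posT_le.
  have q2 : `|6 * complex.Re ((w - z) * h^J)| <= 12 * nm h.
    rewrite normrM ger0_norm//; have := Re_le ((w - z) * h^J); rewrite nmM nmJ.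
    have := ler_wpM2r (nm_ge0 h) (dist2 z w zr' w1); move: (nm _ * nm h) `|complex.Re _| => ? ?; lra.
  by rewrite -[leRHS]mul1r; apply: ler_pM.
have ig h : cintb (fun w => f w * (g h w)%:C).
  by have [] := cint_mul_le fi f0 (cmeas_real (mg h)) (gb h).
have Lh t h : L (t%:C * h) = t%:C * L h.
  rewrite /L mulrCA -(cintZ _ (ig h)); congr (_ * _); apply: cint_ext => w.
  have E : complex.Re ((w - z) * (t%:C * h)^J) = t * complex.Re ((w - z) * h^J).
    rewrite (_ : (w - z) * _ = t%:C * ((w - z) * h^J)); last by rewrite conjRM mulrCA.
    move: (_ * h^J) => u; rewrite cReM.
    by rewrite -[complex.Im t%:C]/(0 : R) mul0r subr0.
  by rewrite /g E; ring.
have TL h : nm (z + h) <= r0 -> nm (f (z + h) - f z - L h) <= 200 / kc * N * nm h ^+ 2.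
  move=> zh; rewrite (mv _ zh) (mv z zr') /L -!mulrBr nk.
  rewrite [leRHS](_ : _ = kc^-1 * (200 * nm h ^+ 2 * N)); last by ring.
  apply: ler_wpM2l; first by rewrite invr_ge0 ltW.
  have [iz _] := ik z; have [iw _] := ik (z + h).
  rewrite -(cintB iw iz) -(cintB (cintbB iw iz) (ig h)).
  rewrite (@cint_ext _ _ (fun v => f v * (ker (z + h) v - ker z v - g h v)%:C)); last by move=> v; ring.
  have := cint_mul_le fi f0 (cmeas_real (measD (measD (meas_ker (z + h)) (measN (meas_ker z))) (measN (mg h)))) (M := 200 * nm h ^+ 2).
  case=> [v v1|_ H]; last first.
    exact: H.
  rewrite nm_real /ker /g.
  have h2 : nm h <= 2.
    rewrite (_ : h = z + h - z); last by ring.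
    by apply: (le_trans (nmB _ _)); move: r01; lra.
  pose x := T - nm (v - z) ^+ 2.
  pose y := nm (v - z) ^+ 2 - nm (v - (z + h)) ^+ 2.
  have xyE : T - nm (v - (z + h)) ^+ 2 = x + y by rewrite /x /y; ring.
  have yE : y = 2 * complex.Re ((v - z) * h^J) - nm h ^+ 2.
    rewrite /y (_ : v - (z + h) = v - z - h); last by ring.
    move: (v - z) => u; rewrite !nm_sqr cReM cReJ cImJ !cReD !cReN !cImD !cImN; ring.
  have y4 : `|y| <= 4 * nm h.
    have := nm2_diff (v - z) (v - (z + h)); rewrite -/y (_ : v - z - _ = h); last by ring.
    move/le_trans; apply; rewrite mulrC; apply: ler_wpM2r => //.
    by have := dist2 z v zr' v1; have := dist2 (z + h) v zh v1; lra.
  have := pos_taylor x y; rewrite xyE -/x.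
  rewrite (_ : _ - _ - pos x ^+ 2 * _ =
    (pos (x + y) ^+ 3 - pos x ^+ 3 - 3 * pos x ^+ 2 * y) - 3 * pos x ^+ 2 * nm h ^+ 2); last first.
    by rewrite yE; ring.
  have := posT_le z v; rewrite -/x; have := pos_ge0 x.
  move: (_ - _ - 3 * pos x ^+ 2 * y) => X.
  move: (pos x) (nm h) (nm_ge0 h) h2 y4 => p b b0 b2 y4 p0 p1 XT.
  apply: (le_trans (ler_normB _ _)).
  have y2 : y ^+ 2 <= 16 * b ^+ 2.
    rewrite -real_normK ?num_real// (_ : 16 * b ^+ 2 = (4 * b) ^+ 2); last by ring.
    by rewrite ler_pXn2r// nnegrE mulr_ge0.
  have y3 : `|y| ^+ 3 <= 128 * b ^+ 2.
    apply: (@le_trans _ _ ((4 * b) ^+ 3)); first by rewrite ler_pXn2r// nnegrE mulr_ge0.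
    rewrite (_ : (4 * b) ^+ 3 = 64 * b ^+ 2 * b); last by ring.
    rewrite (_ : 128 * b ^+ 2 = 64 * b ^+ 2 * 2); last by ring.
    by apply: ler_wpM2l => //; rewrite mulr_ge0// sqr_ge0.
  have t1 : 3 * p * y ^+ 2 <= 48 * b ^+ 2.
    have : p * y ^+ 2 <= 1 * y ^+ 2 by rewrite ler_wpM2r ?sqr_ge0.
    by rewrite -mulrA mul1r; move: (p * y ^+ 2) (y ^+ 2) y2 => ? ? ? ?; lra.
  have t2 : `|3 * p ^+ 2 * b ^+ 2| <= 3 * b ^+ 2.
    rewrite ger0_norm ?mulr_ge0 ?sqr_ge0//; apply: ler_wpM2r; first exact: sqr_ge0.
    have : p ^+ 2 <= 1 by rewrite exprn_ile1.
    by lra.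
  exact: (est_sum XT t1 y3 t2 (sqr_ge0 b)).
(* Both are first-order terms of f at z and both are homogeneous under real factors, so comparing
   them along t h as t tends to 0 identifies them. *)
suff aL h : a * h = L h by rewrite aL; exact: TL.
apply/subr0_eq/eqP; rewrite -nm_eq0 eq_le nm_ge0 andbT; apply/ler_addgt0Pr => e e0; rewrite add0r.
pose H := nm h + 1; have H0 : 0 < H by rewrite ltr_wpDl.
have e1 : 0 < e / 2 / H by rewrite !divr_gt0.
have [d d0 Hd] := Ha _ e1.
pose M := 200 / kc * N * H ^+ 2 + 1.
have M0 : 0 < M.
  exact: ltr_wpDl (mulr_ge0 KN0 (sqr_ge0 H)) ltr01.
pose t := Num.min (Num.min (d / H) ((r0 - nm z) / H)) (e / 2 / M) / 2.
have t0 : 0 < t by rewrite divr_gt0// !lt_min !divr_gt0// subr_gt0.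
have tlt : t < Num.min (Num.min (d / H) ((r0 - nm z) / H)) (e / 2 / M).
  by rewrite /t ltr_pdivrMr// mulr_natr mulr2n ltrDl !lt_min !divr_gt0// subr_gt0.
move: tlt; rewrite !lt_min -andbA => /and3P[t1 t2 t3].
have nth : nm (t%:C * h) = t * nm h by rewrite nmM nm_real gtr0_norm.
have tH : t * nm h <= t * H by rewrite ler_pM2l// lerDl.
have thd : nm (t%:C * h) < d.
  by rewrite nth; apply: (le_lt_trans tH); rewrite -ltr_pdivlMr.
have thr : nm (z + t%:C * h) <= r0.
  apply: (le_trans (nmD _ _)); rewrite nth.
  by move: t2; rewrite ltr_pdivlMr// => t2; lra.
have := Hd _ thd; have := TL _ thr; rewrite mul0r addr0 Lh nth.
set X := f _ - f z => h1 h2.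
have : nm (t%:C * (a * h - L h)) <= e / 2 / H * (t * nm h) + 200 / kc * N * (t * nm h) ^+ 2.
  rewrite (_ : t%:C * _ = (X - t%:C * L h) - (X - a * (t%:C * h))); last by ring.
  by apply: (le_trans (nmB _ _)); rewrite addrC lerD.
rewrite nmM nm_real gtr0_norm// => h3.
have : nm (a * h - L h) <= e / 2 / H * nm h + 200 / kc * N * nm h ^+ 2 * t.
  rewrite -(ler_pM2l t0); apply: (le_trans h3).
  by rewrite le_eqVlt; apply/orP; left; apply/eqP; ring.
move/le_trans; apply; rewrite [leRHS]splitr; apply: lerD.
  by rewrite -mulrA ler_piMr ?(ltW (divr_gt0 e0 _))// mulrC ler_pdivrMr// mul1r lerDl.
apply: (@le_trans _ _ (M * t)).
  apply: ler_wpM2r; first exact: ltW.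
  rewrite ler_wpDr//; apply: ler_wpM2l; first exact: KN0.
  by rewrite ler_pXn2r ?nnegrE ?(ltW H0)// lerDl.
by rewrite mulrC -ler_pdivlMr// ltW.
Qed.

End kernel.
End mean_value.

(** * Limits and derivatives of holomorphic functions *)

Section hol_theory.
Context (R : realType).
Local Notation C := R[i].
Local Notation nm := (@Normc.normc R).

Lemma ccauchy (u : nat -> C) : (forall e, 0 < e -> exists N, forall n m, (N <= n)%N -> (N <= m)%N ->
  nm (u n - u m) <= e) -> exists l, ccvg u l.
Proof.
move=> H.
have rc (v : nat -> R) : (forall n m, `|v n - v m| <= nm (u n - u m)) -> exists l : R, v @ \oo --> l.
  move=> vu; suff /cvg_ex[l Hl] : cvgn v by exists l.
  apply/cauchy_cvgP/cauchy_ballP => e e0.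
  have e2 : 0 < e / 2 by rewrite divr_gt0.
  have [N HN] := H _ e2.
  pose A := [set v n | n in [set n | (N <= n)%N]].
  have AF : (v @ \oo) A by exists N => // n /= Nn; exists n.
  exists (A, A) => // -[x y] [/= [n Nn <-] [m Nm <-]]; rewrite /ball /=.
  by apply: le_lt_trans (vu n m) _; apply: le_lt_trans (HN _ _ Nn Nm) _; rewrite ltr_pdivrMr// mulr_natr mulr2n ltrDl.
have [x Hx] := rc (fun n => complex.Re (u n)) (fun n m => le_trans (eq_ind _ (fun x => `|x| <= _) (lexx _) _ (etrans (cReD _ _) (congr1 _ (cReN _)))) (Re_le (u n - u m))).
have [y Hy] := rc (fun n => complex.Im (u n)) (fun n m => le_trans (eq_ind _ (fun x => `|x| <= _) (lexx _) _ (etrans (cImD _ _) (congr1 _ (cImN _)))) (Im_le (u n - u m))).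
exists (x +i* y); apply: (@ccvg_le _ _ _ (fun n => `|complex.Re (u n) - x| + `|complex.Im (u n) - y|)).
  by move=> n; apply: le_trans (nm_le_ReIm _) _; rewrite cReD cReN cImD cImN.
rewrite -[0]addr0; apply: cvgD.
  by rewrite -(normr0 R) -(subrr x); apply: cvg_norm; apply: cvgB Hx (cvg_cst _).
by rewrite -(normr0 R) -(subrr y); apply: cvg_norm; apply: cvgB Hy (cvg_cst _).
Qed.

(** Extension by 0, which is how elements of [bergman] are represented and what integrals over the
    whole plane expect. *)
Definition zext (f : C -> C) (z : C) : C := if nm z < 1 then f z else 0.

Lemma zextE f z : nm z < 1 -> zext f z = f z.
Proof. by rewrite /zext => ->. Qed.

Lemma zext0 f z : 1 <= nm z -> zext f z = 0.
Proof. by rewrite /zext ltNge => ->. Qed.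

Lemma wd_disc f g z a b : nm z < 1 -> (forall w, nm w < 1 -> f w = g w) -> wd f z a b -> wd g z a b.
Proof.
move=> z1 fg; apply: (@wd_near _ _ _ _ _ _ (1 - nm z)); first by rewrite subr_gt0.
move=> w hr; apply: fg; rewrite (_ : w = (w - z) + z); last by ring.
apply: (le_lt_trans (nmD _ _)); lra.
Qed.

Lemma hol_disc f g : (forall w, nm w < 1 -> f w = g w) -> hol f -> hol g.
Proof. by move=> fg hf z z1; have [a Ha] := hf z z1; exists a; apply: wd_disc Ha. Qed.

Lemma hol_zext f : hol f -> hol (zext f).
Proof. by apply: hol_disc => w w1; rewrite zextE. Qed.

Lemma hol_cst c : hol (fun=> c : C).
Proof. by move=> z _; exists 0; exact: wd_cst. Qed.

Lemma hol_id : hol (fun z : C => z).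
Proof. by move=> z _; exists 1; exact: wd_id. Qed.

Lemma holD f g : hol f -> hol g -> hol (fun z : C => f z + g z).
Proof.
move=> hf hg z z1; have [a Ha] := hf z z1; have [b Hb] := hg z z1.
by exists (a + b); apply: wd_eq (wdD Ha Hb) _ _ => //; rewrite addr0.
Qed.

Lemma holM f g : hol f -> hol g -> hol (fun z : C => f z * g z).
Proof.
move=> hf hg z z1; have [a Ha] := hf z z1; have [b Hb] := hg z z1.
eexists; apply: wd_eq (wdM Ha Hb) _ _; first reflexivity.
by rewrite !(mul0r, mulr0) addr0.
Qed.

Lemma holN f : hol f -> hol (fun z : C => - f z).
Proof. by move=> /(holM (hol_cst (-1))); apply: hol_disc => w _; rewrite mulN1r. Qed.

Lemma holV f : hol f -> (forall z, nm z < 1 -> f z != 0) -> hol (fun z : C => (f z)^-1).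
Proof.
move=> hf f0 z z1; have [a Ha] := hf z z1; eexists.
apply: wd_eq (wdV (f0 z z1) Ha) _ _; first reflexivity.
by rewrite oppr0 mul0r.
Qed.

Lemma hol_comp f g : hol f -> (forall z, nm z < 1 -> exists a, wd g (f z) a 0) -> hol (fun z : C => g (f z)).
Proof.
move=> hf hg z z1; have [a Ha] := hf z z1; have [b Hb] := hg z z1.
eexists; apply: wd_eq (wd_comp Ha Hb) _ _; first reflexivity.
by rewrite !(mul0r, mulr0) addr0.
Qed.

Lemma hol_dilate f (s : R) c : hol f -> 0 < s -> nm c + s <= 1 -> hol (fun z => f (s%:C * z + c)).
Proof.
move=> hf s0 sc z z1.
have w1 : nm (s%:C * z + c) < 1.
  apply: (le_lt_trans (nmD _ _)); rewrite nmM nm_real gtr0_norm//.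
  apply: lt_le_trans sc; rewrite addrC ltrD2l.
  by rewrite -[ltRHS]mulr1 ltr_pM2l.
have [a Ha] := hf _ w1.
have := wd_comp (wdD (wdZ s%:C (wd_id z)) (wd_cst c z)) Ha.
by move=> H; eexists; apply: wd_eq H _ _; first reflexivity; rewrite mulr0 addr0 mulr0 mul0r addr0.
Qed.

(** Dilating by s turns a bound M on the disc of radius s into an L^1 bound 4 M on the unit disc,
    where [hol_estimates] applies; 4 is the area of the dominating square. *)
Lemma hol_est (r s : R) : 0 <= r -> r < s -> s < 1 -> exists2 K, 0 <= K & forall f M, hol f ->
  (forall z, nm z <= s -> nm (f z) <= M) ->
  (forall z w, nm z <= r -> nm w <= r -> nm (f z - f w) <= K * M * nm (z - w)) /\
  forall z a, nm z < r -> wd f z a 0 -> nm a <= K * M /\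
    forall h, nm (z + h) <= r -> nm (f (z + h) - f z - a * h) <= K * M * nm h ^+ 2.
Proof.
move=> r0 rs s1; have s0 : 0 < s := le_lt_trans r0 rs.
have t0 : 0 <= r / s by rewrite divr_ge0// ltW.
have t1 : r / s < 1 by rewrite ltr_pdivrMr// mul1r.
have [K K0 HK] := hol_estimates t0 t1.
exists (4 * K / s ^+ 2) => [|f M hf fM].
  by rewrite divr_ge0 ?mulr_ge0// ltW// exprn_gt0.
have sC : s%:C != 0 :> C by rewrite -nm_eq0 nm_real normr_eq0 gt_eqF.
pose F := zext (fun z => f (s%:C * z)).
have hF : hol F.
  apply: hol_zext; apply: (@hol_disc (fun z => f (s%:C * z + 0))); first by move=> w _; rewrite addr0.
  by apply: hol_dilate => //; rewrite nm0 add0r ltW.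
have ns x : nm (s%:C * x) = s * nm x by rewrite nmM nm_real gtr0_norm.
have FM z : nm (F z) <= M * boxi 0 1 z.
  have [z1|z1] := ltP (nm z) 1; last first.
    rewrite /F zext0// nm0 mulr_ge0 ?boxi_ge0//; apply: le_trans (nm_ge0 (f 0)) (fM _ _).
    by rewrite nm0 ltW.
  have -> : boxi 0 1 z = 1 :> R by rewrite boxi_nm// subr0 ltW.
  rewrite mulr1 /F zextE//; apply: fM.
  by rewrite ns -[leRHS]mulr1 ler_pM2l// ltW.
have F0 w : 1 <= nm w -> F w = 0 by exact: zext0.
have iF : cintb F by apply: cintb_le FM (rintbZ M (rintb_boxi 0 1)); exact: hol_meas.
have N4 : rint (fun w => nm (F w)) <= 4 * M.
  apply: le_trans (rint_le (cintb_nm iF) (rintbZ M (rintb_boxi 0 1)) FM) _.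
  by rewrite (rintZ _ (rintb_boxi 0 1)) rint_boxi// expr1n mulr1 mulrC.
have [_ e2 e3] := HK F hF F0 iF.
move: (rint _) N4 e2 e3 => N N4 e2 e3.
have dr z : nm z <= r -> nm (s^-1%:C * z) <= r / s.
  by move=> zr; rewrite nmM nm_real gtr0_norm ?invr_gt0// mulrC ler_pM2r// invr_gt0.
have fF z : nm z <= r -> f z = F (s^-1%:C * z).
  move=> zr; rewrite /F zextE; last exact: le_lt_trans (dr z zr) t1.
  by rewrite mulrA -rmorphM/= mulfV ?gt_eqF// mul1r.
have KN : K * N / s <= 4 * K / s ^+ 2 * M.
  have M0 : 0 <= M by apply: le_trans (nm_ge0 (f 0)) (fM _ _); rewrite nm0 ltW.
  rewrite ler_pdivrMr// (_ : _ * s = K * (4 * M) / s); last by field; rewrite gt_eqF.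
  rewrite ler_pdivlMr//; apply: (@le_trans _ _ (K * (4 * M) * s)).
    by apply: ler_wpM2r; [exact: ltW|exact: ler_wpM2l].
  by rewrite -[leRHS]mulr1; apply: ler_wpM2l; [apply: mulr_ge0 => //; exact: mulr_ge0|exact: ltW].
have KN2 : K * N / s ^+ 2 <= 4 * K / s ^+ 2 * M.
  rewrite [leRHS](_ : _ = K * (4 * M) / s ^+ 2); last by ring.
  by rewrite ler_pM2r ?invr_gt0 ?exprn_gt0//; exact: ler_wpM2l.
split=> [z w zr wr|z a zr Ha].
  rewrite (fF z zr) (fF w wr); apply: le_trans (e2 _ _ (dr _ zr) (dr _ wr)) _.
  rewrite -mulrBr nmM nm_real gtr0_norm ?invr_gt0// mulrA; exact: ler_wpM2r.
have zd : nm (s^-1%:C * z) < r / s.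
  by rewrite nmM nm_real gtr0_norm ?invr_gt0// mulrC ltr_pM2r// invr_gt0.
have HF : wd F (s^-1%:C * z) (s%:C * a) 0.
  apply: (@wd_disc (fun z => f (s%:C * z))); first exact: lt_trans zd t1.
    by move=> w w1; rewrite /F zextE.
  have E : s%:C * (s^-1%:C * z) = z by rewrite mulrA -rmorphM/= mulfV ?gt_eqF// mul1r.
  have Ha' : wd f (s%:C * (s^-1%:C * z)) a 0 by rewrite E.
  have H := wd_comp (wdZ s%:C (wd_id (s^-1%:C * z))) Ha'.
  by apply: wd_eq H _ _; rewrite ?mulr1 ?mulr0 ?mul0r ?addr0 ?conjc0 ?mulr0// mulrC.
have [na e4] := e3 _ _ zd HF; split.
  apply: le_trans KN; rewrite ler_pdivlMr// mulrC -[leLHS](ns a); exact: na.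
move=> h zh.
have := e4 (s^-1%:C * h); rewrite -mulrDr -(fF _ zh) -(fF _ (ltW zr)) => /(_ (dr _ zh)).
rewrite (_ : s%:C * a * _ = a * h); last by rewrite [s%:C * a]mulrC -mulrA (mulrA s%:C) -rmorphM/= mulfV ?gt_eqF// mul1r.
move=> H; apply: (le_trans H).
rewrite nmM nm_real gtr0_norm ?invr_gt0// exprMn exprVn mulrA; apply: ler_wpM2r => //; exact: exprn_ge0.
Qed.

Lemma hol_lipr (f : C -> C) (r : R) : hol f -> r < 1 -> lipr r f.
Proof.
move=> hf r1; pose t := Num.max r 0.
have t0 : 0 <= t by rewrite le_max lexx orbT.
have t1 : t < 1 by rewrite gt_max r1 ltr01.
have ts : t < (1 + t) / 2 by lra.
have s1 : (1 + t) / 2 < 1 by lra.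
have [K K0 HK] := hol_est t0 ts s1.
have [M _ HM] := hol_bdd hf s1.
apply: (@liprW _ _ t); first by rewrite le_max lexx.
by exists (K * M) => z w zr wr; have [H _] := HK f M hf HM; exact: H.
Qed.

Lemma wd_quad (f : C -> C) z a (d B : R) : 0 < d ->
  (forall h, nm h < d -> nm (f (z + h) - f z - a * h) <= B * nm h ^+ 2) -> wd f z a 0.
Proof.
move=> d0 H e e0; exists (Num.min d (e / (`|B| + 1))).
  by rewrite lt_min d0 divr_gt0// ltr_wpDl.
move=> h; rewrite lt_min => /andP[hd he]; rewrite mul0r addr0.
apply: (le_trans (H h hd)); rewrite expr2 mulrA; apply: ler_wpM2r => //.
move: he; rewrite ltr_pdivlMr; last by rewrite ltr_wpDl.
move=> he; apply: le_trans (ltW he); rewrite mulrC; apply: ler_wpM2l => //.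
by apply: (le_trans (ler_norm B)); rewrite lerDl.
Qed.

(** The quadratic bound on the Taylor remainder is uniform in n, so it survives the limit once the
    derivatives at z are known to be Cauchy. *)
Lemma hol_limit (f_ : nat -> C -> C) f : (forall n, hol (f_ n)) ->
  (forall r, 0 <= r -> r < 1 -> forall e, 0 < e -> exists N, forall n z, (N <= n)%N -> nm z <= r ->
     nm (f_ n z - f z) <= e) -> hol f.
Proof.
move=> hf lf z z1; pose r := (1 + nm z) / 2; pose s := (1 + r) / 2.
have z0 := nm_ge0 z.
have r0 : 0 <= r by rewrite /r; lra.
have zr : nm z < r by rewrite /r; lra.
have rs : r < s by rewrite /s /r; lra.
have s1 : s < 1 by rewrite /s /r; lra.
have [K K0 HK] := hol_est r0 rs s1.
have s0 := ltW (le_lt_trans r0 rs).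
have ls := lf s s0 s1.
have /choice[a_ Ha] : forall n, exists a, wd (f_ n) z a 0 by move=> n; exact: hf.
have cv w : nm w <= s -> ccvg (fun n => f_ n w) (f w).
  move=> ws; apply/ccvgP => e e0; have [N HN] := ls e e0.
  by exists N => // n /= Nn; exact: HN.
have [a ca] : exists a, ccvg a_ a.
  apply: ccauchy => e e0.
  have e1 : 0 < e / (K + 1) / 2 by rewrite !divr_gt0// ltr_wpDl.
  have [N HN] := ls _ e1; exists N => n m Nn Nm.
  have := HK (fun w => f_ n w - f_ m w) (e / (K + 1)) (holD (hf n) (holN (hf m))).
  case=> [w ws|_ /(_ z (a_ n - a_ m) zr) []].
  - rewrite (_ : _ - _ = (f_ n w - f w) - (f_ m w - f w)); last by ring.
    apply: (le_trans (nmB _ _)); rewrite [leRHS]splitr.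
    by apply: lerD; exact: HN.
  - by apply: wd_eq (wdB (Ha n) (Ha m)) _ _ => //; rewrite subrr.
  - move=> H _; apply: (le_trans H); have K1 : 0 < K + 1 by rewrite ltr_wpDl.
    by rewrite mulrA ler_pdivrMr// mulrC ler_pM2l// lerDl.
(* A uniform bound M1 + 2 on the tail: M1 bounds [f_ N1], and 2 is two errors of size 1. *)
have [N1 HN1] := ls 1 ltr01.
have [M1 _ HM1] := hol_bdd (hf N1) s1.
exists a; apply: (@wd_quad _ _ _ (r - nm z) (K * (M1 + 2))); first by rewrite subr_gt0.
move=> h hr.
have zh : nm (z + h) <= r by apply: (le_trans (nmD _ _)); lra.
have c1 := cv (z + h) (le_trans zh (ltW rs)).
have c2 := cv z (ltW (lt_trans zr rs)).
have := ccvgB (ccvgB c1 c2) (ccvgZ h ca).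
move/ccvg_le_lim => H; rewrite [a * h]mulrC; apply: H; exists N1 => // n /= Nn.
have [w ws|_ /(_ z (a_ n) zr (Ha n))[_]] := HK (f_ n) (M1 + 2) (hf n).
  rewrite (_ : f_ n w = (f_ n w - f w) - (f_ N1 w - f w) + f_ N1 w); last by ring.
  have := HM1 w ws; have := HN1 _ _ Nn ws; have := HN1 _ _ (leqnn _) ws.
  have := nmD (f_ n w - f w - (f_ N1 w - f w)) (f_ N1 w); have := nmB (f_ n w - f w) (f_ N1 w - f w); lra.
by move=> /(_ h zh); rewrite [a_ n * h]mulrC.
Qed.

(** After a dilation by s, the derivative is the uniform limit of difference quotients, which are
    holomorphic, so [hol_limit] applies to it. *)
Lemma hol_deriv f : hol f -> exists2 f', hol f' & forall z, nm z < 1 -> wd f z (f' z) 0.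
Proof.
move=> hf.
have /choice[f' Hf'] : forall z, exists a, nm z < 1 -> wd f z a 0.
  move=> z; have [z1|z1] := ltP (nm z) 1; last by exists 0.
  by have [a Ha] := hf z z1; exists a.
exists f' => // z0 z01.
(* s lies between |z0| and 1, and d leaves room for the increments: s z + h stays within radius s1 <
   1 for |z| < 1 and 0 < h <= d. *)
pose s := (1 + nm z0) / 2; pose d := (1 - s) / 2; pose s1 := s + d; pose s2 := (1 + s1) / 2.
have n0 := nm_ge0 z0.
have s0 : 0 < s by rewrite /s; lra.
have zs : nm z0 < s by rewrite /s; lra.
have s1' : s < 1 by rewrite /s; lra.
have d0 : 0 < d by rewrite /d /s; lra.
have s10 : 0 <= s1 by rewrite addr_ge0// ltW.
have s11 : s1 < 1 by rewrite /s1 /d /s; lra.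
have s12 : s1 < s2 by rewrite /s2; lra.
have s21 : s2 < 1 by rewrite /s2; lra.
have [K K0 HK] := hol_est s10 s12 s21.
have [M _ HM] := hol_bdd hf s21.
have [_ {HK}HK] := HK f M hf HM.
have M0 : 0 <= M by apply: le_trans (nm_ge0 (f 0)) (HM _ _); rewrite nm0; lra.
pose h n : R := d / n.+1%:R.
have h0 n : 0 < h n by rewrite divr_gt0.
have hd n : h n <= d by rewrite ler_pdivrMr// (ler_peMr (ltW d0))// ler1n.
pose q n z := (h n)^-1%:C * (f (s%:C * z + (h n)%:C) - f (s%:C * z)).
have sC : s%:C != 0 :> C by rewrite -nm_eq0 nm_real normr_eq0 gt_eqF.
have nh n : nm (h n)%:C = h n by rewrite nm_real gtr0_norm.
have hG : hol (fun z => f' (s%:C * z)).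
  apply: (@hol_limit q) => [n|r r0 r1 e e0].
    apply: holM; first exact: hol_cst.
    apply: holD; first by apply: hol_dilate => //; rewrite nh; apply: (le_trans (lerD (hd n) (lexx s))); rewrite /d; lra.
    apply: holN; apply: (@hol_disc (fun z => f (s%:C * z + 0))); first by move=> w _; rewrite addr0.
    by apply: hol_dilate => //; rewrite ?nm0; rewrite /s; lra.
  pose B := K * M * d / e.
  exists (Num.bound B) => n z Nn zr.
  have sz : nm (s%:C * z) < s1.
    rewrite nmM nm_real gtr0_norm//; apply: (@le_lt_trans _ _ (s * 1)); last by rewrite mulr1 ltrDl.
    by apply: ler_wpM2l; [exact: ltW|exact: (le_trans zr (ltW r1))].
  have szh : nm (s%:C * z + (h n)%:C) <= s1.
    apply: (le_trans (nmD _ _)); rewrite nh; apply: lerD (hd n).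
    rewrite nmM nm_real gtr0_norm// -[leRHS]mulr1.
    by apply: ler_wpM2l; [exact: ltW|exact: (le_trans zr (ltW r1))].
  have [_ /(_ _ szh) H] := HK _ _ sz (Hf' _ (lt_trans sz s11)).
  have hC : (h n)%:C != 0 :> C by rewrite -nm_eq0 nh gt_eqF.
  rewrite (_ : _ - _ = (h n)^-1%:C * (f (s%:C * z + (h n)%:C) - f (s%:C * z) - f' (s%:C * z) * (h n)%:C)); last first.
    by rewrite /q fmorphV; field.
  rewrite nmM nm_real gtr0_norm ?invr_gt0// ler_pdivrMl//; apply: (le_trans H).
  rewrite nh expr2 mulrA [leRHS]mulrC; apply: ler_wpM2r; first exact: ltW.
  rewrite /h mulrA ler_pdivrMr// -ler_pdivrMl// mulrC -/B.
  have B0 : 0 <= B by apply: divr_ge0; [apply: mulr_ge0; [exact: mulr_ge0|exact: ltW]|exact: ltW].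
  have := archi_boundP B0; rewrite -/B => /ltW/le_trans; apply.
  by rewrite ler_nat; exact: leq_trans Nn (leqnSn _).
have dz : nm (s^-1%:C * z0) < 1.
  by rewrite nmM nm_real gtr0_norm ?invr_gt0// mulrC ltr_pdivrMr// mul1r.
have [a Ha] := hG _ dz; exists (s^-1%:C * a).
have := wd_comp (wdZ s^-1%:C (wd_id z0)) Ha => /wd_ext H.
apply: (wd_eq (H _ _)) => [w||].
- by rewrite mulrA -rmorphM/= mulfV ?gt_eqF// mul1r.
- by rewrite mulr1 mul0r addr0 mulrC.
- by rewrite !mulr0 mul0r addr0.
Qed.

End hol_theory.

(** * Forms, spectra and approximate eigenvalues *)

Section hilbert.
Context (R : realType) (V : lmodType R[i]).
Local Notation C := R[i].
Local Notation nm := (@Normc.normc R).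

(** Positive semidefinite Hermitian forms: this covers the inner product and the degenerate forms
    obtained by integrating over part of the disc. *)
Record form (a : V -> V -> C) : Prop := Form {
  formDl : forall u v w, a (u + v) w = a u w + a v w;
  formZl : forall c u v, a (c *: u) v = c * a u v;
  formJ : forall u v, a v u = (a u v)^J;
  form_ge0 : forall u, 0 <= complex.Re (a u u) }.

Definition qf (a : V -> V -> C) (u : V) : R := complex.Re (a u u).

Section form_theory.
Variables (a : V -> V -> C) (fa : form a).
Local Notation q := (qf a).

Lemma formDr u v w : a u (v + w) = a u v + a u w.
Proof. by rewrite formJ// formDl// (formJ fa u v) (formJ fa u w) -rmorphD conjcK. Qed.

Lemma formZr c u v : a u (c *: v) = c^J * a u v.
Proof. by rewrite formJ// formZl// rmorphM/= -(formJ fa v u). Qed.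

Lemma formNl u v : a (- u) v = - a u v.
Proof. by rewrite -scaleN1r formZl// mulN1r. Qed.

Lemma formNr u v : a u (- v) = - a u v.
Proof. by rewrite -scaleN1r formZr rmorphN rmorph1 mulN1r. Qed.

Lemma formBl u v w : a (u - v) w = a u w - a v w.
Proof. by rewrite formDl// formNl. Qed.

Lemma formBr u v w : a u (v - w) = a u v - a u w.
Proof. by rewrite formDr formNr. Qed.

Lemma form0l v : a 0 v = 0.
Proof. by rewrite -(scale0r (0 : V)) formZl// mul0r. Qed.

Lemma formE u : a u u = (q u)%:C.
Proof.
apply: complexPeq => //=; have := congr1 (@complex.Im R) (formJ fa u u).
by rewrite cImJ => H; apply/eqP; move/eqP: H; rewrite -addr_eq0 -mulr2n mulrn_eq0.
Qed.

Lemma qD u v : q (u + v) = q u + q v + 2 * complex.Re (a u v).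
Proof.
rewrite /qf formDl// !formDr !cReD (formJ fa u v) cReJ; ring.
Qed.

Lemma qZ c u : q (c *: u) = nm c ^+ 2 * q u.
Proof. by rewrite /qf formZl// formZr mulrA mulJE formE -rmorphM. Qed.

Lemma qN u : q (- u) = q u.
Proof. by rewrite -scaleN1r qZ nmN nm1 expr1n mul1r. Qed.

Lemma qB u v : q (u - v) = q u + q v - 2 * complex.Re (a u v).
Proof. by rewrite qD qN formNr cReN mulrN. Qed.

Lemma q_ge0 u : 0 <= q u. Proof. exact: form_ge0. Qed.

(** Nonnegativity along u + t a(u, v) v. When q(v) = 0 the optimal t does not exist, and a
    sufficiently negative t gives the contradiction instead. *)
Lemma form_CS u v : nm (a u v) ^+ 2 <= q u * q v.
Proof.
set c := a u v; pose Q := nm c ^+ 2.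
have Q0 : 0 <= Q by exact: exprn_ge0.
have H t : 0 <= q u + 2 * t * Q + t ^+ 2 * Q * q v.
  have := q_ge0 (u + (t%:C * c) *: v); rewrite qD qZ formZr -/c.
  rewrite nmM nm_real exprMn real_normK ?num_real// -/Q.
  have -> : (t%:C * c)^J * c = (t * Q)%:C.
    by rewrite conjRM -mulrA [c^J * c]mulrC mulJE -rmorphM.
  by rewrite (_ : q u + _ + 2 * complex.Re (t * Q)%:C = q u + 2 * t * Q + t ^+ 2 * Q * q v)//=; ring.
have [v0|v0] := eqVneq (q v) 0.
  rewrite v0 mulr0 -/Q; have [//|Qp] := leP Q 0.
  have := H (- (q u + 1) / (2 * Q)); rewrite v0 mulr0 addr0.
  rewrite (_ : q u + _ = -1); last by field; rewrite gt_eqF.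
  by rewrite oppr_ge0 leNgt ltr01.
have vp : 0 < q v by rewrite lt_def v0 q_ge0.
have := H (- (q v)^-1); rewrite (_ : q u + _ + _ = q u - Q / q v); last by field.
by rewrite subr_ge0 ler_pdivrMr.
Qed.

Lemma form_CS_Re u v : complex.Re (a u v) ^+ 2 <= q u * q v.
Proof.
apply: le_trans (form_CS u v); rewrite -(real_normK (num_real (complex.Re _))).
by rewrite ler_pXn2r ?nnegrE ?nm_ge0// Re_le.
Qed.

Lemma qB_le u v : q (u - v) <= 2 * q u + 2 * q v.
Proof. by have := q_ge0 (u + v); rewrite qD qB; lra. Qed.

End form_theory.

(** Completeness is phrased with squared norms, the only quantity that the forms provide. *)
Record hilbert (ip : V -> V -> C) : Prop := Hilbert {
  hilbert_form :> form ip;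
  hilbert_def : forall u, qf ip u = 0 -> u = 0;
  hilbert_complete : forall u : nat -> V,
    (forall e, 0 < e -> exists N, forall n m, (N <= n)%N -> (N <= m)%N -> qf ip (u n - u m) <= e) ->
    exists l, forall e, 0 < e -> exists N, forall n, (N <= n)%N -> qf ip (u n - l) <= e }.

Section hilbert_theory.
Variables (ip : V -> V -> C) (H : hilbert ip).
Let fip : form ip := hilbert_form H.

Lemma hilbert_eq u v : (forall w, ip w u = ip w v) -> u = v.
Proof.
move=> uv; apply/subr0_eq/(hilbert_def H).
by rewrite /qf formBr// uv subrr.
Qed.

(* Minimize [a v v - 2 Re (l v)]. *)
Lemma Lax_Milgram (a : V -> V -> C) (l : V -> C) (d M L : R) : form a -> 0 < d ->
  (forall v, d * qf ip v <= qf a v) -> (forall v, qf a v <= M * qf ip v) ->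
  (forall u v, l (u + v) = l u + l v) -> (forall c v, l (c *: v) = c * l v) ->
  (forall v, nm (l v) ^+ 2 <= L * qf ip v) -> exists w, forall v, l v = a v w.
Proof.
move=> fa d0 da aM lD lZ lL.
pose J v := qf a v - 2 * complex.Re (l v).
pose L1 := `|L| + 1; have L10 : 0 < L1 by rewrite ltr_wpDl.
have Jb v : - (L1 / d) <= J v.
  have h1 : nm (l v) ^+ 2 <= L1 * qf ip v.
    apply: (le_trans (lL v)); apply: ler_wpM2r; first exact: q_ge0.
    by apply: (le_trans (ler_norm L)); rewrite lerDl.
  have h2 : 2 * nm (l v) <= d / L1 * nm (l v) ^+ 2 + L1 / d.
    have := sqr_ge0 (d / L1 * nm (l v) - 1).
    move=> h; have := mulr_ge0 (ltW (divr_gt0 L10 d0)) h.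
    rewrite (_ : L1 / d * _ = d / L1 * nm (l v) ^+ 2 + L1 / d - 2 * nm (l v)) ?subr_ge0//.
    by field; rewrite !gt_eqF.
  have h3 : d / L1 * nm (l v) ^+ 2 <= d * qf ip v.
    rewrite mulrAC ler_pdivrMr// -mulrA; apply: ler_wpM2l; first exact: ltW.
    by rewrite mulrC.
  have := Re_le (l v); have := ler_norm (complex.Re (l v)); have := da v; rewrite /J; lra.
pose A := [set J v | v in [set: V]].
have iA : has_inf A.
  by split; [exists (J 0), 0|exists (- (L1 / d)) => _ [v _ <-]].
pose j := inf A.
have jJ v : j <= J v by apply: ge_inf; [exact: iA.2|exists v].
(* Squares, so that a variation of size s = 1 / (n + 1) has an error s^2 matching the distance from
   the infimum. *)
pose e n : R := (n.+1%:R ^+ 2)^-1.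
have e0 n : 0 < e n by rewrite invr_gt0 exprn_gt0.
have /choice[v_ Hv] : forall n, exists v, J v < j + e n.
  by move=> n; have [_ [v _ <-] Hv] := inf_adherent (e0 n) iA; exists v.
have re (t : R) x : complex.Re (t%:C * x) = t * complex.Re x.
  by rewrite cReM -[complex.Im t%:C]/(0 : R) mul0r subr0.
have JE u v (t : R) : J (u + t%:C *: v) = J u + 2 * t * (complex.Re (a u v) - complex.Re (l v)) + t ^+ 2 * qf a v.
  rewrite /J qD// qZ// formZr// lD lZ nm_real real_normK ?num_real// cReD.
  rewrite -[(t%:C)^J]/((t -i* 0)) oppr0 !re; ring.
(* The parallelogram law at the midpoint: two almost minimizers are close in the norm of a, hence in
   that of [ip]. *)
have cau n m : qf a (v_ n - v_ m) <= 2 * (e n + e m).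
  have := jJ ((2^-1)%:C *: (v_ n + v_ m)); have := Hv n; have := Hv m.
  rewrite /J qZ// nm_real lZ re.
  rewrite ger0_norm ?invr_ge0// lD cReD qD// qB//; lra.
have eN x : 0 < x -> exists N, forall n, (N <= n)%N -> e n <= x.
  move=> x0; exists (Num.bound x^-1) => n Nn.
  have := archi_boundP (ltW (eqbRL (invr_gt0 x) x0)) => /ltW h.
  rewrite /e -[leRHS]invrK lef_pV2 ?posrE ?invr_gt0 ?exprn_gt0//.
  apply: (le_trans h); apply: (@le_trans _ _ n.+1%:R); first by rewrite ler_nat; apply: leq_trans Nn _.
  by rewrite expr2 ler_peMr// ler1n.
have [w Hw] : exists w, forall x, 0 < x -> exists N, forall n, (N <= n)%N -> qf ip (v_ n - w) <= x.
  apply: (hilbert_complete H) => x x0.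
  have [N HN] := eN (d * x / 4) ltac:(by rewrite divr_gt0 ?mulr_gt0).
  exists N => n m Nn Nm; rewrite -(ler_pM2l d0); apply: (le_trans (da _)); apply: (le_trans (cau n m)).
  by have := HN _ Nn; have := HN _ Nm; lra.
(* Stationarity of the limit: the variations v and -v bound the derivative at [v_ n], and
   Cauchy-Schwarz carries the bound to w. *)
have D0 v : complex.Re (a w v) = complex.Re (l v).
  apply/eqP; rewrite -subr_eq0 -normr_le0; apply/ler_addgt0Pr => x x0; rewrite add0r.
  pose B := qf a v + 1; have B0 : 0 < B by rewrite ltr_wpDl ?q_ge0.
  pose M1 := `|M| + 1; have M10 : 0 < M1 by rewrite ltr_wpDl.
  have y0 : 0 < x / 2 / B by rewrite !divr_gt0.
  have [N1 HN1] := eN _ (exprn_gt0 2 y0).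
  have [N2 HN2] := Hw ((x / 2) ^+ 2 / B / M1) ltac:(by rewrite !divr_gt0// exprn_gt0// divr_gt0).
  pose n := maxn N1 N2; pose D := complex.Re (a (v_ n) v) - complex.Re (l v).
  have h1 : `|D| <= x / 2.
    pose s : R := n.+1%:R^-1; have s0 : 0 < s by rewrite invr_gt0.
    have se : e n = s ^+ 2 by rewrite /s exprVn.
    have sx : s <= x / 2 / B.
      by rewrite -(@ler_pXn2r _ 2)// ?nnegrE ?(ltW s0) ?(ltW y0)// -se HN1// leq_maxl.
    have := jJ (v_ n + s%:C *: v); have := jJ (v_ n + (- s)%:C *: v); rewrite !JE -/D sqrrN.
    have := Hv n; rewrite se => k1 k2 k3.
    have : s * (2 * `|D|) <= s * (s * B).
      have q0 := q_ge0 fa v.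
      rewrite (_ : s * (s * B) = s ^+ 2 + s ^+ 2 * qf a v); last by rewrite /B; ring.
      by have [D0|D0] := leP 0 D; [rewrite ger0_norm|rewrite ltr0_norm]; move: k1 k2 k3; rewrite // -/j; lra.
    rewrite ler_pM2l// => k4; have : s * B <= x / 2 by rewrite -ler_pdivlMr.
    have := normr_ge0 D; lra.
  have h2 : `|complex.Re (a (v_ n - w) v)| <= x / 2.
    rewrite -(@ler_pXn2r _ 2)// ?nnegrE ?divr_ge0 ?(ltW x0)// real_normK ?num_real//.
    apply: (le_trans (form_CS_Re fa _ _)).
    apply: (@le_trans _ _ ((M1 * ((x / 2) ^+ 2 / B / M1)) * B)).
      apply: ler_pM; rewrite ?q_ge0//; last by rewrite lerDl.
      apply: (le_trans (aM _)); apply: (@le_trans _ _ (M1 * qf ip (v_ n - w))).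
        apply: ler_wpM2r; first exact: q_ge0.
        by apply: (le_trans (ler_norm M)); rewrite lerDl.
      by rewrite ler_pM2l// HN2// leq_maxr.
    by rewrite (_ : M1 * _ * B = (x / 2) ^+ 2)//; field; rewrite !gt_eqF.
  have -> : complex.Re (a w v) - complex.Re (l v) = D - complex.Re (a (v_ n - w) v).
    by rewrite formBl// cReD cReN /D; ring.
  by apply: (le_trans (ler_normB _ _)); lra.
exists w => v; rewrite formJ//; apply: complexPeq; first by rewrite cReJ D0.
(* The real parts at i v are the imaginary parts at v. *)
have := D0 ('i *: v); rewrite formZr// lZ !cReM cReJ cImJ /= !(mul0r, mul1r, mulN1r, add0r, sub0r, opprK, mulNr) cImJ.
by move=> ->; rewrite opprK.
Qed.

(** * Operators represented by bounded forms *)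

Section operator.
Variables (b : V -> V -> C) (T : V -> V) (M : R).
Hypotheses (fb : form b) (bM : forall v, qf b v <= M * qf ip v) (TE : forall u v, ip u (T v) = b u v).
Hypothesis (M0 : 0 <= M).

Lemma opD u v : T (u + v) = T u + T v.
Proof. by apply: hilbert_eq => w; rewrite TE (formDr fip) (formDr fb) !TE. Qed.

Lemma opZ c v : T (c *: v) = c *: T v.
Proof. by apply: hilbert_eq => w; rewrite TE (formZr fip) (formZr fb) !TE. Qed.

Lemma opB u v : T (u - v) = T u - T v.
Proof. by rewrite opD -scaleN1r opZ scaleN1r. Qed.

Lemma q_op v : qf ip (T v) <= M ^+ 2 * qf ip v.
Proof.
have := form_CS_Re fb (T v) v; rewrite -TE -/(qf ip (T v)) => h.
have [->|nz] := eqVneq (qf ip (T v)) 0; first by rewrite mulr_ge0 ?sqr_ge0 ?q_ge0.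
have p : 0 < qf ip (T v) by rewrite lt_def nz q_ge0.
rewrite -(ler_pM2l p) -expr2; apply: (le_trans h).
apply: (le_trans (ler_pM (q_ge0 fb _) (q_ge0 fb _) (bM _) (bM _))).
by rewrite le_eqVlt; apply/orP; left; apply/eqP; ring.
Qed.

Lemma op_sym (c : C) u v : ip (T u - c^J *: u) v = ip u (T v - c *: v).
Proof.
rewrite formBl// formBr// TE formZl// (formZr fip); congr (_ - _).
by rewrite (formJ fip) TE -(formJ fb).
Qed.

(** Cauchy-Schwarz: if the numerical range keeps distance d from c, then T - c is bounded below by
    d; so is its adjoint T - conj(c), whose quadratic form is conjugate. *)
Lemma op_coercive (c : C) (d : R) : 0 <= d ->
  (forall v, d * qf ip v <= nm (b v v - c * ip v v)) ->
  forall v, d ^+ 2 * qf ip v <= qf ip (T v - c^J *: v) /\ d ^+ 2 * qf ip v <= qf ip (T v - c *: v).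
Proof.
move=> d0 Hd v.
have [v0|v0] := eqVneq (qf ip v) 0; first by rewrite v0 mulr0 !q_ge0.
have vp : 0 < qf ip v by rewrite lt_def v0 q_ge0.
have key w : nm (ip v w) = nm (b v v - c * ip v v) -> d ^+ 2 * qf ip v <= qf ip w.
  move=> E; have := form_CS fip v w; rewrite E => h.
  rewrite -(ler_pM2l vp); apply: le_trans h.
  rewrite (_ : qf ip v * _ = (d * qf ip v) ^+ 2); last by ring.
  by rewrite ler_pXn2r ?nnegrE ?nm_ge0 ?mulr_ge0 ?q_ge0.
have E1 : ip v (T v - c^J *: v) = b v v - c * ip v v.
  by rewrite (formBr fip) (formZr fip) conjcK TE.
split; apply: key; first by rewrite E1.
have E2 : (qf b v)%:C - c^J * (qf ip v)%:C = ((qf b v)%:C - c * (qf ip v)%:C)^J.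
  by apply: complexPeq; rewrite !(cReJ, cImJ, cReD, cImD, cReN, cImN, cReM, cImM)/=; ring.
by rewrite (formBr fip) (formZr fip) TE (formE fb) (formE fip) E2 nmJ.
Qed.

(** To solve (T - c) u = w, put u = (T - conj(c)) z, where z represents <v, w> in the coercive form
    <(T - conj(c)) v, (T - conj(c)) z>. *)
Lemma resolvent (c : C) (d : R) : 0 < d ->
  (forall v, d * qf ip v <= nm (b v v - c * ip v v)) -> ~ spectrum ip T c.
Proof.
move=> d0 Hd; apply; have cv := op_coercive (ltW d0) Hd.
have d20 : 0 < d ^+ 2 by rewrite exprn_gt0.
pose a u v := ip (T u - c^J *: u) (T v - c^J *: v).
have fa : form a.
  split=> [u v w|k u v|u v|u]; rewrite /a.
  - rewrite opD scalerDr opprD addrACA.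
    exact: (formDl fip).
  - by rewrite opZ scalerA (mulrC c^J) -scalerA -scalerBr (formZl fip).
  - exact: formJ.
  - exact: q_ge0.
have aM v : qf a v <= (2 * M ^+ 2 + 2 * nm c ^+ 2) * qf ip v.
  apply: (le_trans (qB_le fip _ _)); rewrite (qZ fip) nmJ.
  by have := q_op v; move: (qf ip (T v)) (qf ip v) (nm c) => x y z; lra.
have /choice[S HS] : forall w, exists u, T u - c *: u = w.
  move=> w; have CS v : nm (ip v w) ^+ 2 <= qf ip w * qf ip v by rewrite mulrC; exact: form_CS.
  have [z Hz] := Lax_Milgram fa d20 (fun v => (cv v).1) aM
    (fun u v => formDl fip u v w) (fun k v => formZl fip k v w)  CS.
  exists (T z - c^J *: z); apply: hilbert_eq => v.
  by rewrite -op_sym (Hz v).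
have inj v : T v - c *: v = 0 -> v = 0.
  move=> E; apply: (hilbert_def H); apply/eqP; rewrite eq_le q_ge0// andbT.
  rewrite -(ler_pM2l d20) mulr0; apply: (le_trans (cv v).2).
  by rewrite E /qf (form0l fip).
have HS' v : S (T v - c *: v) = v.
  apply/subr0_eq/inj; have E := HS (T v - c *: v); move: (S _) E => s E.
  by rewrite opB scalerBr opprD addrACA -opprD E subrr.
have lS : linear S.
  move=> k u v; rewrite -[in LHS](HS u) -[in LHS](HS v) -[RHS]HS'; congr (S _).
  rewrite opD opZ scalerBr [in RHS]scalerDr opprD [RHS]addrACA.
  by rewrite !scalerA (mulrC c).
pose S' : {linear V -> V} := HB.pack S (GRing.isLinear.Build _ _ _ _ S lS).
exists S'; split=> //.
exists (Num.sqrt (d ^+ 2)^-1) => v /=; rewrite /ip_norm -sqrtrM ?invr_ge0 ?(ltW d20)//.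
by rewrite ler_wsqrtr// ler_pdivlMl// -[in leRHS](HS v) (cv _).2.
Qed.

(** The numerical range lies in [0, M], and a point off this interval is separated from it by |Im
    c|, by -Re c or by Re c - M. *)
Lemma spectrum_sub (c : C) : spectrum ip T c -> exists2 x : R, 0 <= x <= M & c = x%:C.
Proof.
move=> Hc; case: (pselect (exists2 x : R, 0 <= x <= M & c = x%:C)) => // n; exfalso.
case: c n Hc => x y n; pose c := (x +i* y)%C.
have E v : b v v - c * ip v v = (qf b v - x * qf ip v) +i* (- (y * qf ip v)).
  by rewrite (formE fb) (formE fip); apply: complexPeq; rewrite ?cReD ?cImD ?cReN ?cImN ?cReM ?cImM /=; ring.
have ge_re v : `|qf b v - x * qf ip v| <= nm (b v v - c * ip v v) by rewrite E; exact: (Re_le (_ +i* _)).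
have ge_im v : `|y| * qf ip v <= nm (b v v - c * ip v v).
  by rewrite E; apply: le_trans (Im_le (_ +i* _)) => /=; rewrite normrN normrM (ger0_norm (q_ge0 fip _)).
have [y0|y0] := eqVneq y 0; last by apply: (@resolvent c `|y|); rewrite ?normr_gt0.
have [x0|x0] := ltP x 0.
  apply: (@resolvent c (- x)); rewrite ?oppr_gt0// => v; apply: le_trans (ge_re v).
  by apply: le_trans (ler_norm _); rewrite mulNr lerDr q_ge0.
have [xM|xM] := ltP M x.
  apply: (@resolvent c (x - M)); rewrite ?subr_gt0// => v; apply: le_trans (ge_re v).
  by rewrite distrC; apply: le_trans (ler_norm _); rewrite mulrBl lerB.
by case: n; exists x; rewrite ?x0 ?xM// y0.
Qed.

(* [F] is an approximate eigenvector of the operator of the form [b], tested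
   against all [g]. *)
Definition approx (x : R) := forall e, 0 < e -> exists2 F, 0 < qf ip F &
  forall g, nm (b g F - x%:C * ip g F) ^+ 2 <= e * qf ip F * qf ip g.

(** Tested against g = T F - x F, the inequality gives |g|^2 <= e |F|^2. An inverse with bound B
    would give |F|^2 <= B^2 |g|^2, impossible for e = 1 / (B^2 + 1). *)
Lemma approx_spectrum x : approx x -> spectrum ip T x%:C.
Proof.
move=> ax [S [[B HB] HS _]].
have e0 : 0 < (B ^+ 2 + 1)^-1 by rewrite invr_gt0 ltr_wpDl ?sqr_ge0.
have [F F0 HF] := ax _ e0; pose g := T F - x%:C *: F.
have g1 : qf ip g <= (B ^+ 2 + 1)^-1 * qf ip F.
  have := HF g; rewrite -TE -[x%:C]conjc_real -(formZr fip) -(formBr fip) -/g.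
  rewrite (formE fip) nm_real real_normK ?num_real// expr2 => h.
  have [->|nz] := eqVneq (qf ip g) 0; first by rewrite mulr_ge0 ?ltW.
  by move: h; rewrite ler_pM2r// lt_def nz q_ge0.
have := HB g; rewrite /g HS -/g /ip_norm -!/(qf ip _) => h.
have : qf ip F <= B ^+ 2 * qf ip g.
  have hh : 0 <= B * Num.sqrt (qf ip g) by apply: le_trans h; exact: sqrtr_ge0.
  rewrite -[leLHS]sqr_sqrtr ?q_ge0// -[qf ip g]sqr_sqrtr ?q_ge0// -exprMn.
  by rewrite ler_pXn2r ?nnegrE ?sqrtr_ge0.
have B2 : 0 < B ^+ 2 + 1 by rewrite ltr_wpDl ?sqr_ge0.
move: g1; rewrite ler_pdivlMl// mulrDl mul1r => g1 g2.
have g0 : qf ip g = 0 by apply/eqP; rewrite eq_le q_ge0// andbT; lra.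
by move: g2; rewrite g0 mulr0 leNgt F0.
Qed.

(** The upper bound is [q_op]. For the lower one, a normalized approximate eigenvector v has b(v, v)
    >= M - e, and b(v, v) = <v, T v> is at most |T v|. *)
Lemma op_norm_approx : approx M -> op_norm ip T = M.
Proof.
move=> aM; apply/eqP; rewrite eq_le; apply/andP; split.
  apply: ge_sup; first by exists (ip_norm ip (T 0)), 0 => //=; rewrite /ip_norm (form0l fip) sqrtr0.
  move=> _ [v /= v1 <-]; apply: (@le_trans _ _ (M * ip_norm ip v)).
    rewrite /ip_norm -!/(qf ip _) -[M in leRHS]ger0_norm// -sqrtr_sqr -sqrtrM ?sqr_ge0//.
    by rewrite ler_wsqrtr// q_op.
  by rewrite -[leRHS]mulr1 ler_wpM2l.
apply/ler_addgt0Pr => e e0; have [F F0 HF] := aM _ (exprn_gt0 2 e0).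
have := HF F; rewrite -mulrA -expr2 -exprMn (formE fb) (formE fip) -rmorphM -rmorphB nm_real.
rewrite ler_pXn2r ?nnegrE ?mulr_ge0 ?(ltW e0) ?(ltW F0)// => h.
pose v := ((Num.sqrt (qf ip F))^-1)%:C *: F.
have qv : qf ip v = 1.
  rewrite /v qZ// nm_real real_normK ?num_real// exprVn sqr_sqrtr ?(ltW F0)// mulVf//.
  by rewrite gt_eqF.
have bv : M - e <= qf b v.
  rewrite /v qZ// nm_real real_normK ?num_real// exprVn sqr_sqrtr ?(ltW F0)//.
  rewrite ler_pdivlMl//; move: h; rewrite distrC => /(le_trans (ler_norm _)); lra.
have nv : ip_norm ip v = 1 by rewrite /ip_norm -/(qf ip v) qv sqrtr1.
have : ip_norm ip (T v) <= op_norm ip T.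
  apply: ub_le_sup; last by exists v => //=; rewrite nv.
  exists M => _ [u /= u1 <-]; apply: (@le_trans _ _ (M * ip_norm ip u)).
    rewrite /ip_norm -!/(qf ip _) -[M in leRHS]ger0_norm// -sqrtr_sqr -sqrtrM ?sqr_ge0//.
    by rewrite ler_wsqrtr// q_op.
  by rewrite -[leRHS]mulr1 ler_wpM2l.
have := form_CS_Re fip v (T v); rewrite qv mul1r TE -/(qf b v) => k.
have : qf b v <= ip_norm ip (T v).
  rewrite /ip_norm -/(qf ip _) -[leLHS]ger0_norm ?q_ge0// -sqrtr_sqr.
  by rewrite ler_wsqrtr.
lra.
Qed.

End operator.
End hilbert_theory.
End hilbert.

(** * The Bergman space of the disc *)

Section bergman_space.
Context (R : realType).
Local Notation C := R[i].
Local Notation nm := (@Normc.normc R).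

Lemma rint_fatou (g_ : nat -> C -> R) g (B : R) : (forall n, rintb (g_ n)) -> (forall n z, 0 <= g_ n z) ->
  (forall z, (fun n => g_ n z) @ \oo --> g z) -> (forall n, rint (g_ n) <= B) -> rintb g /\ rint g <= B.
Proof.
move=> ig g0 gg gB.
have mg : meas g.
  by apply: (@measurable_fun_cvg _ _ _ _ (fun n p => g_ n (plane p))) => [m|p _]; [exact: rintb_meas|exact: gg].
have gp z : 0 <= g z.
  have := gg z; move/cvg_lim => <-//; apply: limr_ge; first by apply/cvg_ex; exists (g z); exact: gg.
  exact: nearW.
have fE : (\int[lebesgue2 R]_p (g (plane p))%:E <= B%:E)%E.
  have := @fatou _ _ _ (lebesgue2 R) setT measurableT (fun n p => (g_ n (plane p))%:E).
  have -> : (fun p => limn_einf (fun n => (g_ n (plane p))%:E)) = (fun p => (g (plane p))%:E).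
    apply/funext => p; have /cvg_limn_einf_sup[->//] : (fun n => (g_ n (plane p))%:E) @ \oo --> (g (plane p))%:E.
    by apply: cvg_EFin; [exact: nearW|exact: gg].
  move=> H; apply: le_trans (H _ _) _ => [n|n p _|].
  - by apply/measurable_EFinP; exact: rintb_meas.
  - by rewrite lee_fin.
  rewrite limn_einf_lim; apply: lime_le; first exact: is_cvg_einfs.
  apply: nearW => n; apply: (@le_trans _ _ (\int[lebesgue2 R]_p (g_ n (plane p))%:E)%E).
    by apply: ereal_inf_lbound; exists n => /=.
  have fn : (\int[lebesgue2 R]_p (g_ n (plane p))%:E)%E \is a fin_num.
    by apply: integrable_fin_num => //; exact: ig.
  by rewrite -[leLHS]fineK// lee_fin; exact: gB.
have ig' : rintb g.
  apply/integrableP; split; first exact/measurable_EFinP.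
  apply: le_lt_trans (ltry B); apply: le_trans fE; rewrite le_eqVlt; apply/orP; left; apply/eqP.
  by apply: eq_integral => p _; rewrite /= ger0_norm.
split=> //; rewrite -lee_fin /rint /Rintegral fineK//; exact: integrable_fin_num.
Qed.

Lemma gt0_realC (e : C) : 0 < e -> 0 < complex.Re e /\ e = (complex.Re e)%:C.
Proof. by case: e => x y; rewrite ltcE /= => /andP[/eqP -> x0]; split. Qed.

Lemma derivable_wd (f : C -> C) z : derivable f z 1 <-> exists a, wd f z a 0.
Proof.
have FF := @nbhs_filter C 0.
have E a h : h != 0 -> nm (a - h^-1 *: ((f \o shift z) (h *: 1) - f z)) * nm h = nm (f (z + h) - f z - a * h).
  move=> h0; rewrite -nmM -[h^-1 *: _]/(h^-1 * _) -[(f \o _) _]/(f (h * 1 + z)) mulr1 mulrBl mulrAC mulVf// mul1r.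
  by rewrite nm_distC (addrC h).
split=> [/cvg_ex[a Ha]|[a Ha]].
  exists a => e e0; move/cvgrPdist_le : Ha => /(_ e%:C); rewrite ltcR => /(_ e0).
  move=> [d /gt0_realC[d0 dE] H]; exists (complex.Re d) => // h hd.
  have [->|h0] := eqVneq h 0; first by rewrite mul0r !addr0 mulr0 subrr nm0 subr0 nm0 mulr0.
  rewrite mul0r addr0 -E//; apply: ler_wpM2r => //.
  by have := H h; rewrite /= sub0r normrN dE normCE ltcR => /(_ hd h0); rewrite normCE lecR.
apply/cvg_ex; exists a; apply/cvgrPdist_le => e /gt0_realC[e0 ->].
have [d d0 H] := Ha _ e0; exists d%:C; first by rewrite /= ltcR.
move=> h /=; rewrite sub0r normrN normCE ltcR => hd h0; rewrite normCE lecR.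
have hp : 0 < nm h by rewrite nm_gt0.
by rewrite -(ler_pM2r hp) E//; have := H h hd; rewrite mul0r addr0.
Qed.

Lemma holomorphic_disc (f : C -> C) : holomorphic (disc R) f <-> hol f.
Proof.
split=> H z z1; first by apply/derivable_wd; apply: H; rewrite discE.
by apply/derivable_wd; apply: H; rewrite discE in z1.
Qed.

Local Notation H := (bergman (disc_open R)).

Lemma disc_restrict (g : C -> R) : (forall z, 1 <= nm z -> g z = 0) ->
  ((fun p => (g (plane p))%:E) \_ (@plane R @^-1` disc R)) = (fun p => (g (plane p))%:E).
Proof.
move=> g0; apply/funext => p; rewrite /patch; case: ifPn => // /negP; rewrite inE /= discE => h.
by rewrite g0// leNgt; apply/negP.
Qed.

Lemma bergman_out (f : H) z : 1 <= nm z -> f z = 0.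
Proof.
have /asboolP[f0 _ _] := bergmanP f => z1; apply: f0; rewrite discE.
by apply/negP; rewrite -leNgt.
Qed.

Lemma bergman_hol (f : H) : hol f.
Proof. by have /asboolP[_ hf _] := bergmanP f; exact/holomorphic_disc. Qed.

Lemma bergman_l2 (f : H) : rintb (fun z => nm (f z) ^+ 2).
Proof.
have /asboolP[_ _] := bergmanP f; move/(integrable_mkcond _ (measurable_plane (disc_open R))).
rewrite (disc_restrict (g := fun z => nm (f z) ^+ 2))// => z /bergman_out ->.
by rewrite nm0 expr0n.
Qed.

Lemma bergman_mk (f : C -> C) : hol f -> (forall z, 1 <= nm z -> f z = 0) ->
  rintb (fun z => nm (f z) ^+ 2) -> {F : H | bergman_fun F = f}.
Proof.
move=> hf f0 fi; have fP : f \in bergman_pred (disc_open R).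
  apply/asboolP; split; first by move=> z; rewrite discE => /negP; rewrite -leNgt; exact: f0.
    exact/holomorphic_disc.
  apply/(integrable_mkcond _ (measurable_plane (disc_open R))).
  rewrite (disc_restrict (g := fun z => nm (f z) ^+ 2))// => z /f0 ->.
  by rewrite nm0 expr0n.
by exists (Bergman fP).
Qed.

Lemma bergman_meas (f : H) : cmeas f.
Proof. by apply: hol_meas; [exact: bergman_hol|move=> z; exact: bergman_out]. Qed.

Lemma bergman_eqP (f g : H) : (forall z, f z = g z) -> f = g.
Proof. by move=> fg; apply: val_inj; apply/funext. Qed.

Definition chi (U : set C) (z : C) : R := if `[< U z >] then 1 else 0.

Lemma chi_ge0 U z : 0 <= chi U z.
Proof. by rewrite /chi; case: ifP. Qed.

Lemma chi_le1 U z : chi U z <= 1.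
Proof. by rewrite /chi; case: ifP. Qed.

Lemma meas_chi U : open U -> meas (chi U).
Proof.
move=> oU; have mU := measurable_plane oU.
have -> : chi U = (fun z => \1_(@plane R @^-1` U) (complex.Re z, complex.Im z)).
  apply/funext => z; rewrite indicE /chi; case: asboolP => h; first by rewrite mem_set//; case: z h.
  by rewrite memNset//; case: z h.
have := measurable_indic (D := setT) (R := R) mU; apply: eq_measurable_fun => p _.
by rewrite /plane/=; case: p.
Qed.

Lemma integralCE (U : set C) (F : C -> C) : open U -> integralC U F = cint (fun z => (chi U z)%:C * F z).
Proof.
move=> oU; rewrite /integralC /cint /rint; congr (_ +i* _).
  rewrite Rintegral_mkcond; apply: eq_Rintegral => p _; rewrite /patch cReM -[complex.Im _%:C]/(0 : R) mul0r subr0 /= /chi.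
  case: asboolP => h; first by rewrite mem_set// mul1r.
  by rewrite memNset// mul0r.
rewrite Rintegral_mkcond; apply: eq_Rintegral => p _; rewrite /patch cImM -[complex.Im _%:C]/(0 : R) mul0r addr0 /= /chi.
case: asboolP => h; first by rewrite mem_set// mul1r.
by rewrite memNset// mul0r.
Qed.

Lemma cintb_l2 (k : C -> R) (F G : C -> C) : meas k -> (forall z, 0 <= k z <= 1) -> cmeas F -> cmeas G ->
  rintb (fun z => nm (F z) ^+ 2) -> rintb (fun z => nm (G z) ^+ 2) -> cintb (fun z => (k z)%:C * (F z * (G z)^J)).
Proof.
move=> mk k01 mF mG iF iG; apply: cintb_le (rintbD iF iG).
  by apply: cmeasM; [exact: cmeas_real|apply: cmeasM => //; exact: cmeasJ].
move=> z; rewrite !nmM nmJ nm_real; have /andP[k0 k1] := k01 z; rewrite ger0_norm//.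
have h : nm (F z) * nm (G z) <= nm (F z) ^+ 2 + nm (G z) ^+ 2.
  have := sqr_ge0 (nm (F z) - nm (G z)); have := sqr_ge0 (nm (F z)); have := sqr_ge0 (nm (G z)).
  rewrite sqrrB; move: (nm (F z)) (nm (G z)) => x y; lra.
apply: le_trans h; rewrite -[leRHS]mul1r; apply: ler_wpM2r => //; exact: mulr_ge0.
Qed.

(** The Toeplitz form with symbol k: k = 1 gives the inner product, [chi U] the form of T_U, and
    trapezoids of y its approximations. *)
Definition bform (k : C -> R) (u v : H) : C := cint (fun z => (k z)%:C * (u z * (v z)^J)).

Section symbol.
Variable k : C -> R.
Hypotheses (mk : meas k) (k01 : forall z, 0 <= k z <= 1).

Lemma cintb_bform (u v : H) : cintb (fun z => (k z)%:C * (u z * (v z)^J)).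
Proof. by apply: cintb_l2 => //; [exact: bergman_meas|exact: bergman_meas|exact: bergman_l2|exact: bergman_l2]. Qed.

Lemma qf_bform (u : H) : qf (bform k) u = rint (fun z => k z * nm (u z) ^+ 2).
Proof.
by rewrite /qf /bform /cint /=; apply: rint_ext => z; rewrite mulJE -rmorphM.
Qed.

Lemma rintb_bform (u : H) : rintb (fun z => k z * nm (u z) ^+ 2).
Proof.
have [h _] := cintb_bform u u; apply: rintb_ext h => z.
by rewrite mulJE -rmorphM.
Qed.

Lemma bform_form : form (bform k).
Proof.
split=> [u v w|c u v|u v|u].
- rewrite /bform -(cintD (cintb_bform _ _) (cintb_bform _ _)); apply: cint_ext => z.
  by rewrite -[(u + v : H) z]/(u z + v z); ring.
- rewrite /bform -(cintZ _ (cintb_bform _ _)); apply: cint_ext => z.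
  by rewrite -[(c *: u : H) z]/(c * u z); ring.
- rewrite /bform -(cintJ (cintb_bform _ _)); apply: cint_ext => z.
  by rewrite conjRM rmorphM/= conjcK (mulrC (v z)).
- rewrite -/(qf _ _) qf_bform; apply: rint_ge0 => z; have /andP[k0 _] := k01 z.
  by apply: mulr_ge0 => //; exact: sqr_ge0.
Qed.

End symbol.

Lemma one01 (z : C) : 0 <= (fun=> 1 : R) z <= 1. Proof. by rewrite ler01 lexx. Qed.

Lemma bergman_ipE (u v : H) : bergman_ip u v = bform (fun=> 1) u v.
Proof.
rewrite /bergman_ip integralCE; last exact: disc_open.
apply: cint_ext => z; rewrite /chi; case: asboolP; rewrite discE // => /negP; rewrite -leNgt => z1.
by rewrite (bergman_out u z1) !mul0r !mulr0.
Qed.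

Lemma ip_form : form (@bergman_ip R _ (disc_open R)).
Proof.
have -> : @bergman_ip R _ (disc_open R) = bform (fun=> 1).
  by apply/funext => u; apply/funext => v; exact: bergman_ipE.
by apply: bform_form; [exact: meas_cst|exact: one01].
Qed.

Lemma qf_ip (u : H) : qf (@bergman_ip R _ (disc_open R)) u = rint (fun z => nm (u z) ^+ 2).
Proof.
rewrite /qf bergman_ipE -/(qf (bform _) u) qf_bform; first by apply: rint_ext => z; rewrite mul1r.
Qed.

(** 2 |u| <= e + |u|^2 / e on a square of area 4 replaces Cauchy-Schwarz; it yields (4 e + e) / 2 <=
    3 e. *)
Lemma l1_l2 (u : C -> C) (e : R) : cmeas u -> (forall z, 1 <= nm z -> u z = 0) -> 0 < e ->
  rintb (fun z => nm (u z) ^+ 2) ->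
  rint (fun z => nm (u z) ^+ 2) <= e ^+ 2 -> cintb u /\ rint (fun z => nm (u z)) <= 3 * e.
Proof.
move=> mu u0 e0 iu ue.
pose h z := e * boxi 0 1 z + e^-1 * nm (u z) ^+ 2.
have ih : rintb h by apply: rintbD; apply: rintbZ => //; exact: rintb_boxi.
have uh z : nm (u z) <= h z / 2.
  rewrite ler_pdivlMr// /h; have [z1|z1] := leP 1 (nm z).
    rewrite u0// nm0 mul0r expr0n mulr0 addr0; apply: mulr_ge0; [exact: ltW|exact: boxi_ge0].
  rewrite boxi_nm ?subr0 ?(ltW z1)// mulr1.
  have := mulr_ge0 (ltW (eqbRL (invr_gt0 e) e0)) (sqr_ge0 (nm (u z) - e)).
  have -> : e^-1 * (nm (u z) - e) ^+ 2 = e + e^-1 * nm (u z) ^+ 2 - nm (u z) * 2.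
    by field; rewrite gt_eqF.
  by rewrite subr_ge0.
have ih2 : rintb (fun z => h z / 2).
  by apply: rintb_ext (rintbZ 2^-1 ih) => z; rewrite mulrC.
have iu1 : cintb u by exact: cintb_le uh ih2.
split=> //; apply: (le_trans (rint_le (cintb_nm iu1) ih2 uh)).
rewrite (@rint_ext _ _ (fun z => 2^-1 * h z)); last by move=> z; rewrite mulrC.
rewrite (rintZ _ ih) /h (rintD (rintbZ _ (rintb_boxi 0 1)) (rintbZ _ iu)).
rewrite (rintZ _ (rintb_boxi 0 1)) (rintZ _ iu) rint_boxi// expr1n mulr1.
have : e^-1 * rint (fun z => nm (u z) ^+ 2) <= e by rewrite ler_pdivrMl// -expr2.
by move: (_^-1 * rint _) => y; lra.
Qed.

Lemma bergman_sup (r : R) : 0 <= r -> r < 1 -> exists2 K, 0 <= K & forall (u : H) e, 0 < e ->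
  qf (@bergman_ip R _ (disc_open R)) u <= e ^+ 2 -> forall z, nm z <= r -> nm (u z) <= K * e.
Proof.
move=> r0 r1; have [K K0 HK] := hol_estimates r0 r1.
exists (K * 3) => [|u e e0 ue z zr]; first exact: mulr_ge0.
rewrite qf_ip in ue.
have u0 z' : 1 <= nm z' -> u z' = 0 by exact: bergman_out.
have [iu lu] := l1_l2 (bergman_meas u) u0 e0 (bergman_l2 u) ue.
have [h _ _] := HK u (bergman_hol u) u0 iu.
by apply: (le_trans (h z zr)); rewrite -mulrA; exact: ler_wpM2l.
Qed.

Lemma bergman_def (u : H) : qf (@bergman_ip R _ (disc_open R)) u = 0 -> u = 0.
Proof.
move=> u0; apply: bergman_eqP => z; rewrite -[(0 : H) z]/(0 : C).
have [z1|z1] := leP 1 (nm z); first exact: bergman_out.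
apply/eqP; rewrite -nm_eq0 eq_le nm_ge0 andbT.
have [K K0 HK] := bergman_sup (nm_ge0 z) z1.
apply/ler_addgt0Pr => e e0; rewrite add0r.
have d0 : 0 < e / (K + 1) by rewrite divr_gt0// ltr_wpDl.
apply: (le_trans (HK u _ d0 _ z (lexx _))); first by rewrite u0 sqr_ge0.
by rewrite mulrA ler_pdivrMr ?ltr_wpDl// mulrC ler_pM2l// lerDl.
Qed.

(** By [bergman_sup] a Cauchy sequence converges uniformly on smaller discs, the limit is
    holomorphic by [hol_limit], and Fatou turns pointwise convergence into convergence in norm. *)
Lemma bergman_complete (u : nat -> H) :
  (forall e, 0 < e -> exists N, forall n m, (N <= n)%N -> (N <= m)%N ->
     qf (@bergman_ip R _ (disc_open R)) (u n - u m) <= e) ->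
  exists l, forall e, 0 < e -> exists N, forall n, (N <= n)%N ->
     qf (@bergman_ip R _ (disc_open R)) (u n - l) <= e.
Proof.
move=> cu.
have uc r e : 0 <= r -> r < 1 -> 0 < e -> exists N, forall n m z, (N <= n)%N -> (N <= m)%N -> nm z <= r ->
    nm (u n z - u m z) <= e.
  move=> r0 r1 e0; have [K K0 HK] := bergman_sup r0 r1.
  have d0 : 0 < e / (K + 1) by rewrite divr_gt0// ltr_wpDl.
  have [N HN] := cu _ (exprn_gt0 2 d0); exists N => n m z Nn Nm zr.
  have := HK (u n - u m) _ d0 (HN _ _ Nn Nm) z zr; rewrite -[(u n - u m : H) z]/(u n z - u m z) => /le_trans; apply.
  by rewrite mulrA ler_pdivrMr ?ltr_wpDl// mulrC ler_pM2l// lerDl.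
have /choice[f Hf] : forall z, exists l, ccvg (fun n => u n z) l.
  move=> z; have [z1|z1] := leP 1 (nm z).
    by exists 0; rewrite (_ : (fun _ => _) = fun=> 0); [exact: ccvg_cst|apply/funext => n; exact: bergman_out].
  apply: ccauchy => e e0; have [N HN] := uc _ _ (nm_ge0 z) z1 e0.
  by exists N => n m Nn Nm; exact: HN.
have f0 z : 1 <= nm z -> f z = 0.
  move=> z1; apply: ccvg_uniq (Hf z) _.
  by rewrite (_ : (fun _ => _) = fun=> 0); [exact: ccvg_cst|apply/funext => n; exact: bergman_out].
have hf : hol f.
  apply: (@hol_limit _ (fun n => u n)) => [n|r r0 r1 e e0]; first exact: bergman_hol.
  have [N HN] := uc _ _ r0 r1 e0; exists N => n z Nn zr.
  have := ccvgB (ccvg_cst (u n z)) (Hf z) => /ccvg_le_lim; apply.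
  by exists N => // m /= Nm; exact: HN.
have fat e : 0 < e -> exists N, forall n, (N <= n)%N ->
    rintb (fun z => nm (u n z - f z) ^+ 2) /\ rint (fun z => nm (u n z - f z) ^+ 2) <= e.
  move=> e0; have [N HN] := cu e e0; exists N => n Nn.
  apply: (@rint_fatou (fun m z => nm (u n z - u (m + N)%N z) ^+ 2)) => [m|m z|z|m].
  - exact: (bergman_l2 (u n - u (m + N)%N)).
  - exact: sqr_ge0.
  - have cz := ccvg_nm (ccvgB (ccvg_cst (u n z)) (Hf z)).
    have h : (fun m => nm (u n z - u m z) ^+ 2) @ \oo --> nm (u n z - f z) ^+ 2 := cvgM cz cz.
    exact: (@cvg_comp _ _ _ (addn^~ N) (fun m => nm (u n z - u m z) ^+ 2) _ _ _ (cvg_addnr N) (h _)).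
  - by have := HN n (m + N)%N Nn (leq_addl _ _); rewrite qf_ip.
have if2 : rintb (fun z => nm (f z) ^+ 2).
  have [N HN] := fat 1 ltr01; have [iN _] := HN N (leqnn _).
  have h := rintbD (rintbZ 2 iN) (rintbZ 2 (bergman_l2 (u N))).
  apply: rintb_le h; first by apply: measX; apply: meas_nm; exact: hol_meas.
  move=> z; rewrite ger0_norm ?sqr_ge0// -[X in nm X ^+ 2 <= _](_ : u N z - (u N z - f z) = f z); last by ring.
  have := nmB (u N z) (u N z - f z); move: (nm _) (nm_ge0 (u N z - (u N z - f z))) => x x0.
  move: (nm (u N z)) (nm (u N z - f z)) => a b xab.
  have : x ^+ 2 <= (a + b) ^+ 2 by rewrite ler_pXn2r ?nnegrE//; apply: le_trans x0 xab.
  by have := sqr_ge0 (a - b); rewrite sqrrB sqrrD; lra.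
have [F FE] := bergman_mk hf f0 if2.
exists F => e e0; have [N HN] := fat e e0; exists N => n Nn; rewrite qf_ip.
have [_] := HN n Nn; apply: le_trans; rewrite le_eqVlt; apply/orP; left; apply/eqP.
by apply: rint_ext => z; rewrite -[(u n - F : H) z]/(u n z - F z) FE.
Qed.

Lemma bergman_hilbert : hilbert (@bergman_ip R _ (disc_open R)).
Proof. by split; [exact: ip_form|exact: bergman_def|exact: bergman_complete]. Qed.

(** * T_U as the operator of a form *)

Section toeplitz.
Variables (U : set C) (oU : open U) (UD : U `<=` disc R).

Lemma chi01 z : 0 <= chi U z <= 1.
Proof. by rewrite chi_ge0 chi_le1. Qed.

Lemma restr_ip (u v : H) : bergman_ip (bergman_restr oU UD u) (bergman_restr oU UD v) = bform (chi U) u v.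
Proof.
rewrite /bergman_ip integralCE//; apply: cint_ext => z; rewrite /chi.
by case: asboolP => h; rewrite ?mul0r//= /patch mem_set.
Qed.

Lemma bform_le (k : C -> R) (u : H) : meas k -> (forall z, 0 <= k z <= 1) ->
  qf (bform k) u <= qf (@bergman_ip R _ (disc_open R)) u.
Proof.
move=> mk k01; rewrite qf_bform qf_ip; apply: rint_le; [exact: rintb_bform|exact: bergman_l2|].
by move=> z; have /andP[_ k1] := k01 z; rewrite -[leRHS]mul1r; apply: ler_wpM2r => //; exact: sqr_ge0.
Qed.

(** [adjoint] picks a Riesz representative if there is one; [Lax_Milgram] for the inner product
    itself is the Riesz theorem that supplies it. *)
Lemma bergman_TE (u v : H) : bergman_ip u (bergman_T oU UD v) = bform (chi U) u v.
Proof.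
have fc := bform_form (meas_chi oU) chi01.
have fi := ip_form.
have [w Hw] : exists w, forall x, bform (chi U) x v = bergman_ip x w.
  apply: (@Lax_Milgram _ _ _ bergman_hilbert _ _ 1 1 (qf (@bergman_ip R _ (disc_open R)) v) fi) => //.
  - by move=> x; rewrite mul1r.
  - by move=> x; rewrite mul1r.
  - by move=> x y; exact: formDl.
  - by move=> c x; exact: formZl.
  - move=> x; apply: (le_trans (form_CS fc x v)); rewrite mulrC.
    by apply: ler_pM; rewrite ?q_ge0// bform_le//; [exact: meas_chi|exact: chi01|exact: meas_chi|exact: chi01].
have E x : bergman_ip (bergman_restr oU UD x) (bergman_restr oU UD v) = bergman_ip x w.
  by rewrite restr_ip.
have := @xgetPex H 0 [set w | forall x, bergman_ip (bergman_restr oU UD x) (bergman_restr oU UD v) = bergman_ip x w] (ex_intro _ w E).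
by move=> /(_ u); rewrite restr_ip => ->.
Qed.

End toeplitz.
End bergman_space.

(** * Exponential weights on the interval *)

Section one_dim.
Context (R : realType).
Implicit Types (f g h : R -> R).
Local Notation hp := (@pi R / 2).

Lemma hp_bounds : 1 <= hp /\ hp < 2.
Proof. by split; [exact: pihalf_ge1|exact: pihalf_lt2]. Qed.

(* (-3, 3) contains the interval [-pi/2, pi/2] on which everything lives. *)
Definition der f f' := forall x : R, - 3 < x < 3 -> is_derive x 1 f (f' x).

Lemma der_cont f f' (x : R) : der f f' -> - 3 < x < 3 -> {for x, continuous f}.
Proof.
move=> H x3; have [df _] := H x x3.
by apply: differentiable_continuous; apply/derivable1_diffP.
Qed.

Lemma diff_le f f' g g' a b : - 3 < a -> a <= b -> b < 3 -> der f f' -> der g g' ->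
  (forall x, a <= x <= b -> f' x <= g' x) -> f b - f a <= g b - g a.
Proof.
move=> a3 ab b3 hf hg fg; pose k x := g x - f x.
have hk : der k (fun x => g' x - f' x).
  by move=> x x3; have := hf x x3; have := hg x x3 => ? ?; exact: is_deriveB.
have in3 x : a <= x <= b -> - 3 < x < 3.
  by move=> /andP[ax xb]; rewrite (lt_le_trans a3 ax) (le_lt_trans xb b3).
have [||c] := @MVT_segment R k (fun x => g' x - f' x) a b ab.
- move=> x; rewrite in_itv/= => /andP[ax xb]; apply: hk; apply: in3; by rewrite !ltW.
- apply: continuous_in_subspaceT => x; rewrite inE/= in_itv/= => h.
  by apply: (der_cont hk); exact: in3.
rewrite in_itv/= => cab E.
have : 0 <= k b - k a by rewrite E; apply: mulr_ge0; rewrite subr_ge0 ?fg.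
by rewrite /k; lra.
Qed.

Lemma diff_eq f f' g g' a b : - 3 < a -> a <= b -> b < 3 -> der f f' -> der g g' ->
  (forall x, a <= x <= b -> f' x = g' x) -> f b - f a = g b - g a.
Proof.
move=> a3 ab b3 hf hg fg; apply/eqP; rewrite eq_le; apply/andP; split.
  by apply: (diff_le a3 ab b3 hf hg) => x h; rewrite fg.
by apply: (diff_le a3 ab b3 hg hf) => x h; rewrite fg.
Qed.

(** Starting at -3 makes this an antiderivative on the whole interval of [der], so no one-sided
    derivative arises at -pi/2. *)
Definition prim h (x : R) : R := (\int[@lebesgue_measure R]_(t in [set` Interval (BLeft (- 3)) (BRight x)]) h t)%R.

Lemma der_prim h : continuous h -> der (prim h) h.
Proof.
move=> ch x /andP[x1 x2].
have ci : (@lebesgue_measure R).-integrable [set` Interval (BLeft (- 3)) (BRight 3)] (EFin \o h).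
  apply: continuous_compact_integrable; first exact: segment_compact.
  exact: continuous_subspaceT.
have [||df dE] := @continuous_FTC1 R h (BLeft (- 3)) x 3 x2 ci.
- by rewrite lte_fin.
- exact: ch.
by apply: DeriveDef; [exact: df|rewrite -derive1E; exact: dE].
Qed.

(** As an increment of an antiderivative, so that comparisons of integrals are instances of the mean
    value theorem through [diff_le]. *)
Definition pint h a b : R := prim h b - prim h a.

Lemma pint_cat h a b c : pint h a b + pint h b c = pint h a c.
Proof. by rewrite /pint; ring. Qed.

Section between.
Variables (a b : R).
Hypotheses (a3 : - 3 < a) (ab : a <= b) (b3 : b < 3).

Lemma pint_le g h : continuous g -> continuous h -> (forall x, a <= x <= b -> g x <= h x) -> pint g a b <= pint h a b.
Proof. by move=> cg ch gh; apply: (diff_le a3 ab b3 (der_prim cg) (der_prim ch)). Qed.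

Lemma pint_eq F h : continuous h -> der F h -> pint h a b = F b - F a.
Proof. by move=> ch hF; apply: (diff_eq a3 ab b3 (der_prim ch) hF). Qed.

Lemma pint_ext g h : continuous g -> continuous h -> (forall x, a <= x <= b -> g x = h x) -> pint g a b = pint h a b.
Proof. by move=> cg ch gh; apply: (diff_eq a3 ab b3 (der_prim cg) (der_prim ch)). Qed.

Lemma pint_cst c : pint (fun=> c) a b = c * (b - a).
Proof.
rewrite (@pint_eq (fun x => c * x) (fun=> c)); [by rewrite mulrBr|exact: cst_continuous|].
move=> x _; have := @is_deriveZ _ _ _ (@id R) c x 1 1 (is_derive_id _ _).
by rewrite -[c *: 1]/(c * 1) mulr1.
Qed.

Lemma pint_lin c d g h k : continuous g -> continuous h -> continuous k ->
  (forall x, a <= x <= b -> k x = c * g x + d * h x) -> pint k a b = c * pint g a b + d * pint h a b.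
Proof.
move=> cg ch ck kE.
have der2 : der (fun x => c * prim g x + d * prim h x) (fun x => c * g x + d * h x).
  move=> x x3; have h1 := der_prim cg x3; have h2 := der_prim ch x3.
  by apply: is_deriveD.
by rewrite /pint (diff_eq a3 ab b3 (der_prim ck) der2 kE); ring.
Qed.

Lemma pint_ge0 h : continuous h -> (forall x, a <= x <= b -> 0 <= h x) -> 0 <= pint h a b.
Proof.
move=> ch h0; have -> : 0 = pint (fun=> 0) a b by rewrite pint_cst mul0r.
by apply: pint_le => //; exact: cst_continuous.
Qed.

End between.

Lemma contZ c h : continuous h -> continuous (fun y => c * h y).
Proof. by move=> ch y; apply: continuousM; [exact: cst_continuous|exact: ch]. Qed.

Definition wexp (t y : R) : R := expR (- (2 * t * y)).

Lemma wexp_gt0 t y : 0 < wexp t y. Proof. exact: expR_gt0. Qed.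

Lemma wexp_cont t : continuous (wexp t).
Proof.
move=> y; apply: continuous_comp; last exact: continuous_expR.
apply: continuousN; apply: continuousM; [exact: cst_continuous|exact: id].
Qed.

Lemma wexp_le t t' y : `|y| <= hp -> wexp t' y <= expR (4 * `|t - t'|) * wexp t y.
Proof.
move=> y2; rewrite /wexp -expRD ler_expR; have [_ h2] := hp_bounds.
have : `|(t - t') * y| <= `|t - t'| * 2 by rewrite normrM ler_wpM2l// (le_trans y2)// ltW.
by move=> /(le_trans (ler_norm _)); lra.
Qed.

Lemma wexp_bd t y : `|y| <= hp -> wexp t y <= expR (4 * `|t|).
Proof. by move=> /(@wexp_le 0 t); rewrite sub0r normrN /wexp mulr0 mul0r oppr0 expR0 mulr1. Qed.

Definition wmass t := pint (wexp t) (- hp) hp.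

Lemma hp3 : - 3 < - hp /\ hp < 3. Proof. by have [_ h] := hp_bounds; lra. Qed.
Lemma hp0 : - hp <= hp. Proof. by have [h _] := hp_bounds; lra. Qed.

Lemma wmass_gt0 t : 0 < wmass t.
Proof.
have [h1 h2] := hp3; have [g1 g2] := hp_bounds.
have E y : - hp <= y <= hp -> expR (- (4 * `|t|)) <= wexp t y.
  rewrite -ler_norml => /(@wexp_le t 0); rewrite subr0 /wexp mulr0 mul0r oppr0 expR0 => h.
  have -> : expR (- (4 * `|t|)) = (expR (4 * `|t|))^-1 by exact: expRN.
  by rewrite -(ler_pM2l (expR_gt0 (4 * `|t|))) mulfV ?gt_eqF ?expR_gt0.
apply: (@lt_le_trans _ _ (pint (fun=> expR (- (4 * `|t|))) (- hp) hp)).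
  by rewrite pint_cst// ?hp0// mulr_gt0 ?expR_gt0//; lra.
by apply: pint_le => //; [exact: hp0|exact: cst_continuous|exact: wexp_cont].
Qed.

(* On the line Im w = y of the strip, e^{it w} has squared modulus e^{-2ty}; so this
   is the mean of [g] over [a, b] against the density of that mode in the strip. *)
Definition wmean g a b t := pint (fun y => g y * wexp t y) a b / wmass t.

Lemma gw_cont g t : continuous g -> continuous (fun y => g y * wexp t y).
Proof. by move=> cg y; apply: continuousM; [exact: cg|exact: wexp_cont]. Qed.

Lemma ratio_close (E e x y : R) : 1 <= E -> E - 1 <= e -> y <= E * x -> x <= E * y ->
  x <= 1 -> y <= 1 -> 0 <= x -> 0 <= y -> `|x - y| <= e.
Proof.
move=> E1 h2 k1 k2 m1 m2 m3 m4; rewrite ler_norml; apply/andP; split.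
  have : (E - 1) * x <= E - 1 by rewrite ler_piMr ?subr_ge0.
  by lra.
have : (E - 1) * y <= E - 1 by rewrite ler_piMr ?subr_ge0.
by lra.
Qed.

Section ratio.
Variables (g : R -> R) (a b : R).
Hypotheses (cg : continuous g) (g01 : forall y, 0 <= g y <= 1) (ah : - hp <= a) (ab : a <= b) (bh : b <= hp).

Let a3 : - 3 < a. Proof. by apply: lt_le_trans ah; have [] := hp3. Qed.
Let b3 : b < 3. Proof. by apply: le_lt_trans bh _; have [] := hp3. Qed.
Let gw0 t y : 0 <= g y * wexp t y.
Proof. by have /andP[g0 _] := g01 y; apply: mulr_ge0 => //; exact: ltW (wexp_gt0 _ _). Qed.

Lemma in_hp y : a <= y <= b -> `|y| <= hp.
Proof. by move=> /andP[y1 y2]; rewrite ler_norml (le_trans ah y1) (le_trans y2 bh). Qed.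

Lemma wmean_ge0 t : 0 <= wmean g a b t.
Proof.
rewrite /wmean divr_ge0 ?(ltW (wmass_gt0 t))//; apply: pint_ge0 => //; first exact: gw_cont.
Qed.

Lemma wmean_le1 t : wmean g a b t <= 1.
Proof.
rewrite /wmean ler_pdivrMr ?wmass_gt0// mul1r /wmass -(pint_cat _ (- hp) a hp) -(pint_cat _ a b hp).
have h1 : pint (fun y => g y * wexp t y) a b <= pint (wexp t) a b.
  apply: pint_le => //; [exact: gw_cont|exact: wexp_cont|].
  move=> y _; have /andP[_ g1] := g01 y; rewrite -[leRHS]mul1r.
  by apply: ler_wpM2r => //; exact: ltW (wexp_gt0 _ _).
have [h3 h4] := hp3.
have h5 : 0 <= pint (wexp t) (- hp) a.
  by apply: pint_ge0 => //; [exact: le_lt_trans ab b3|exact: wexp_cont|move=> x _; exact: ltW (wexp_gt0 _ _)].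
have h6 : 0 <= pint (wexp t) b hp.
  by apply: pint_ge0 => //; [exact: lt_le_trans a3 ab|exact: wexp_cont|move=> x _; exact: ltW (wexp_gt0 _ _)].
lra.
Qed.

(** Changing t to t' multiplies the weight by a factor of at most e^(4 |t - t'|), since |y| < 2;
    numerator and denominator together give 8. Continuity and positivity of the mean follow from
    this. *)
Lemma wmean_mul t t' : wmean g a b t' <= expR (8 * `|t - t'|) * wmean g a b t.
Proof.
set e := expR (4 * `|t - t'|).
have e0 : 0 < e by exact: expR_gt0.
have -> : expR (8 * `|t - t'|) = e * e by rewrite /e -expRD; congr expR; ring.
have n1 : pint (fun y => g y * wexp t' y) a b <= e * pint (fun y => g y * wexp t y) a b.
  rewrite -[leRHS]addr0 -[X in _ + X](mul0r (pint (fun=> 0) a b)).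
  have E y : a <= y <= b -> e * (g y * wexp t y) = e * (g y * wexp t y) + 0 * 0 by move=> _; ring.
  have cE : continuous (fun y => e * (g y * wexp t y)).
    by apply: contZ; exact: gw_cont.
  rewrite -(pint_lin a3 ab b3 (gw_cont (t := t) cg) (@cst_continuous _ _ 0) cE E).
  apply: pint_le => //; first exact: gw_cont.
  move=> y yab; rewrite mulrCA; have /andP[g0 _] := g01 y.
  by apply: ler_wpM2l => //; apply: wexp_le; exact: in_hp.
have d1 : wmass t <= e * wmass t'.
  have [h3 h4] := hp3.
  rewrite /wmass -[leRHS]addr0 -[X in _ + X](mul0r (pint (fun=> 0) (- hp) hp)).
  have E y : - hp <= y <= hp -> e * wexp t' y = e * wexp t' y + 0 * 0 by move=> _; ring.
  have cE : continuous (fun y => e * wexp t' y).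
    by apply: contZ; exact: wexp_cont.
  rewrite -(pint_lin h3 hp0 h4 (@wexp_cont t') (@cst_continuous _ _ 0) cE E).
  apply: pint_le => //; [exact: hp0|exact: wexp_cont|].
  by move=> y; rewrite -ler_norml /e distrC; exact: wexp_le.
have D0 := wmass_gt0 t; have D0' := wmass_gt0 t'.
have nn : 0 <= pint (fun y => g y * wexp t y) a b by apply: pint_ge0 => //; exact: gw_cont.
rewrite /wmean ler_pdivrMr//; apply: (le_trans n1).
rewrite -!mulrA; apply: ler_wpM2l; first exact: ltW.
rewrite mulrCA; apply: (le_trans (y := pint (fun y => g y * wexp t y) a b * 1)); first by rewrite mulr1.
apply: ler_wpM2l => //; by rewrite mulrCA ler_pdivlMl// mulr1.
Qed.

Lemma wmean_cont : continuous (wmean g a b).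
Proof.
move=> t; apply/cvgrPdist_le => e e0.
have H : (fun t' => expR (8 * `|t - t'|) - 1) @ t --> (0 : R).
  have -> : 0 = expR (8 * `|t - t|) - 1 by rewrite subrr normr0 mulr0 expR0 subrr.
  have c1 : continuous (fun t' : R => expR (8 * `|t - t'|) - 1).
    move=> x; apply: cvgB; last exact: cvg_cst.
    apply: (@continuous_comp _ _ _ (fun t' : R => 8 * `|t - t'|) expR); last exact: continuous_expR.
    apply: (@contZ 8 (fun t' => `|t - t'|)) => y; apply: cvg_norm.
    by apply: cvgB; [exact: cvg_cst|exact: cvg_id].
  exact: (c1 t).
have := H; move/cvgrPdist_le => /(_ e e0); apply: filterS => t'.
rewrite sub0r normrN => h; have h2 := le_trans (ler_norm _) h.
have k1 := wmean_mul t t'; have k2 := wmean_mul t' t; rewrite distrC in k2.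
have m1 := wmean_le1 t; have m2 := wmean_le1 t'; have m3 := wmean_ge0 t; have m4 := wmean_ge0 t'.
have E1 : 1 <= expR (8 * `|t - t'|) by rewrite -expR0 ler_expR; apply: mulr_ge0.
move: (expR _) E1 h2 k1 k2 => E E1 h2 k1 k2.
exact: (ratio_close E1 h2 k1 k2 m1 m2 m3 m4).
Qed.

(** For large t the weight concentrates at -pi/2: the mass on [a, b] is at most 4 e^(-2ta), that to
    the left of a point c < a is larger by a factor exponential in t. *)
Lemma wmean_small : - hp < a -> forall e, 0 < e -> exists T, forall t, T <= t -> wmean g a b t <= e.
Proof.
move=> ah' e e0; pose d := a + hp; have d0 : 0 < d by rewrite /d; lra.
exists (Num.max 1 (8 / (d ^+ 2 * e))) => t; rewrite ge_max => /andP[t1 t2].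
have t0 : 0 < t by exact: lt_le_trans ltr01 t1.
(* The midpoint of -pi/2 and a, at distance d / 2 from both, so that the weight at c is e^(t d)
   times the weight at a. *)
pose c := (a - hp) / 2.
have [h1 h2] := hp_bounds; have [h3 h4] := hp3.
have n1 : pint (fun y => g y * wexp t y) a b <= wexp t a * 4.
  apply: (@le_trans _ _ (pint (fun=> wexp t a) a b)).
    apply: pint_le => //; [exact: gw_cont|exact: cst_continuous|].
    move=> y /andP[ay _]; have /andP[g0 g1] := g01 y.
    apply: (@le_trans _ _ (1 * wexp t y)); first by apply: ler_wpM2r => //; exact: ltW (wexp_gt0 _ _).
    rewrite mul1r ler_expR lerN2 -!mulrA ler_pM2l// ler_pM2l//.
  by rewrite pint_cst//; apply: ler_wpM2l; [exact: ltW (wexp_gt0 _ _)|move: ah bh h2; lra].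
have c1 : - hp <= c by rewrite /c; lra.
have c2 : c <= a by rewrite /c; lra.
have c3 : c < 3 by exact: le_lt_trans c2 (le_lt_trans ab b3).
have n2 : wexp t c * (d / 2) <= wmass t.
  rewrite /wmass -(pint_cat _ _ c); apply: (@le_trans _ _ (pint (wexp t) (- hp) c)).
    rewrite (_ : d / 2 = c - (- hp)); last by rewrite /d /c; lra.
    rewrite -pint_cst//.
    apply: pint_le => //; [exact: cst_continuous|exact: wexp_cont|].
    by move=> y /andP[_ yc]; rewrite ler_expR lerN2 -!mulrA ler_pM2l// ler_pM2l.
  rewrite lerDl; apply: pint_ge0 => //; [exact: lt_le_trans h3 c1|exact: le_trans c2 (le_trans ab bh)|exact: wexp_cont|move=> x _; exact: ltW (wexp_gt0 _ _)].
rewrite /wmean ler_pdivrMr ?wmass_gt0//; apply: (le_trans n1).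
apply: (@le_trans _ _ (e * (wexp t c * (d / 2)))); last by apply: ler_wpM2l => //; exact: ltW.
have acE : wexp t c = wexp t a * expR (t * d).
  by rewrite /wexp -expRD; congr expR; rewrite /c /d; field.
have big : 8 / (d * e) <= expR (t * d).
  apply: le_trans (expR_ge1Dx _); apply: (@le_trans _ _ (t * d)); last by rewrite lerDr.
  rewrite -ler_pdivrMr//; apply: le_trans t2.
  by rewrite le_eqVlt; apply/orP; left; apply/eqP; field; rewrite !gt_eqF.
rewrite acE mulrCA -!mulrA; apply: ler_wpM2l; first exact: ltW (wexp_gt0 _ _).
move: big; rewrite ler_pdivrMr ?mulr_gt0// => big.
rewrite mulrCA !mulrA; lra.
Qed.

End ratio.

(** The reflection y -> -y exchanges t and -t, which transfers the behaviour at plus infinity to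
    minus infinity. *)
Lemma wmean_reflect g a b t : continuous g -> - hp <= a -> a <= b -> b <= hp ->
  wmean g a b t = wmean (fun y => g (- y)) (- b) (- a) (- t).
Proof.
move=> cg ah ab bh; have [h3 h4] := hp3.
have F h c d : continuous h -> - 3 < c -> c <= d -> d < 3 -> pint h c d = pint (fun y => h (- y)) (- d) (- c).
  move=> ch c3 cd d3.
  have ch' : continuous (fun y => h (- y)).
    by move=> y; apply: continuous_comp; [exact: opp_continuous|exact: ch].
  have c3' : - 3 < - d by lra.
  have cd' : - d <= - c by lra.
  have d3' : - c < 3 by lra.
  have dF : der (fun x => - prim h (- x)) (fun y => h (- y)).
    move=> x x3; have x3' : - 3 < - x < 3 by lra.
    have d1 := der_prim ch x3'.
    have d2 : is_derive x 1 (fun x : R => - x) (- 1) by apply: is_deriveN.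
    have := @is_derive1_comp R (prim h) (fun x => - x) x (h (- x)) (- 1) d1 d2 => d12.
    by have := @is_deriveN _ _ _ (prim h \o (fun x => - x)) x 1 _ d12; rewrite mulrN1 opprK.
  by rewrite (pint_eq c3' cd' d3' ch' dF) /pint !opprK; ring.
rewrite /wmean /wmass (F _ _ _ (@wexp_cont t) h3 hp0 h4).
rewrite (F _ _ _ (@gw_cont g t cg) (lt_le_trans h3 ah) ab (le_lt_trans bh h4)).
have wE y : wexp t (- y) = wexp (- t) y by rewrite /wexp !mulrN mulNr.
rewrite opprK (_ : (fun y => wexp t (- y)) = wexp (- t)); last by apply/funext => y; rewrite wE.
by rewrite (_ : (fun y => g (- y) * wexp t (- y)) = (fun y => g (- y) * wexp (- t) y))//; apply/funext => y; rewrite wE.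
Qed.

End one_dim.

Section one_dim_data.
Context (R : realType).
Implicit Types (f g h : R -> R).
Local Notation hp := (@pi R / 2).

Lemma derD f f' g g' : der f f' -> der g g' -> der (fun x => f x + g x) (fun x => f' x + g' x).
Proof. by move=> hf hg x x3; have := hf x x3; have := hg x x3 => ? ?; exact: is_deriveD. Qed.

Lemma derZ c f f' : der f f' -> der (fun x => c * f x) (fun x => c * f' x).
Proof. by move=> hf x x3; have := hf x x3 => ?; exact: is_deriveZ. Qed.

Lemma derM f f' g g' : der f f' -> der g g' -> der (fun x => f x * g x) (fun x => f x * g' x + g x * f' x).
Proof. by move=> hf hg x x3; have := hf x x3; have := hg x x3 => ? ?; exact: is_deriveM. Qed.

Lemma der_id : der (fun x : R => x) (fun=> 1).
Proof. by move=> x _; exact: is_derive_id. Qed.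

Lemma der_cst c : der (fun=> c : R) (fun=> 0).
Proof. by move=> x _; exact: is_derive_cst. Qed.

Lemma der_eq f f' g' : der f f' -> (forall x, f' x = g' x) -> der f g'.
Proof. by move=> hf e x x3; rewrite -e; exact: hf. Qed.

Lemma sin_xcos x : 0 <= x -> x <= hp -> x * cos x <= sin x.
Proof.
move=> x0 xh; have [h3 h4] := hp3 R.
have dl : der (fun x : R => x * cos x) (fun x => x * - sin x + cos x * 1).
  by apply: (derM der_id) => y _; exact: is_derive_cos.
have dr : der (@sin R) (@cos R) by move=> y _; exact: is_derive_sin.
have N3 : -3 < 0 :> R by rewrite oppr_lt0.
have := diff_le N3 x0 (le_lt_trans xh h4) dl dr.
rewrite mul0r sin0 !subr0; apply => y /andP[y0 yx].
rewrite mulr1 mulrN gerDr oppr_le0; apply: mulr_ge0 => //.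
have [->|yn] := eqVneq y 0; first by rewrite sin0.
have yh : y <= hp := le_trans yx xh.
by apply: sin_ge0_pi; rewrite y0/=; have := pi_ge0 R; lra.
Qed.

(** Write x = x cos^2 x + x sin^2 x and use x cos x <= sin x in the first term, x < 2 in the
    second. *)
Lemma le_3sin x : 0 <= x -> x <= hp -> x <= 3 * sin x.
Proof.
move=> x0 xh; have s0 : 0 <= sin x by apply: sin_ge0_pi; rewrite x0/=; have := pi_ge0 R; lra.
have c0 : 0 <= cos x by apply: cos_ge0_pihalf; rewrite xh andbT; lra.
have h1 := sin_xcos x0 xh; have := cos2Dsin2 x; have [_ h2] := hp_bounds R.
have c1 := cos_le1 x; have s1 := sin_le1 x.
move: (cos x) (sin x) s0 c0 h1 c1 s1 => c s s0 c0 h1 c1 s1 cs.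
have e1 : x = x * c * c + x * s * s.
  by rewrite -{1}(mulr1 x) -cs !expr2; ring.
have e2 : x * c * c <= s.
  apply: (@le_trans _ _ (s * c)); first exact: ler_wpM2r.
  by rewrite -[leRHS]mulr1; exact: ler_wpM2l.
have e3 : x * s * s <= 2 * s.
  apply: ler_wpM2r => //; rewrite -[leRHS]mulr1; apply: ler_pM => //; lra.
by lra.
Qed.

(** Converts the distance to the ends of the strip into cos y, the quantity that [cos_Phi] compares
    with 1 - |z|^2. *)
Lemma hp_cos y : `|y| <= hp -> hp - `|y| <= 3 * cos y.
Proof.
move=> yh; have n0 := normr_ge0 y.
have -> : cos y = sin (hp - `|y|).
  rewrite -cosBpihalf addrAC subrr add0r cosN.
  by case: (ger0P y) => _ //; rewrite cosN.
by apply: le_3sin; lra.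
Qed.

Lemma in3 y : `|y| <= hp -> - 3 < y < 3.
Proof. by rewrite ler_norml => /andP[h1 h2]; have [h3 h4] := hp3 R; rewrite (lt_le_trans h3 h1) (le_lt_trans h2 h4). Qed.

(** Integrate f' from the endpoint nearer to y. *)
Lemma double_zero f f' (W : R) : der f f' -> f (- hp) = 0 -> f hp = 0 -> 
  (forall y, `|y| <= hp -> `|f' y| <= W) -> forall y, `|y| <= hp -> `|f y| <= W * (hp - `|y|).
Proof.
move=> df f1 f2 fW y yh; have /andP[y1 y2] := in3 yh.
have [h3 h4] := hp3 R; have := yh; rewrite ler_norml => /andP[y3 y4].
have dW : der (fun x => W * x) (fun=> W) by apply: der_eq (derZ W der_id) _ => x; rewrite mulr1.
have dWN : der (fun x => (- W) * x) (fun=> - W) by apply: der_eq (derZ (- W) der_id) _ => x; rewrite mulr1.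
have B x a b : - hp <= a -> b <= hp -> a <= x <= b -> - W <= f' x <= W.
  move=> ah bh /andP[ax xb]; rewrite -ler_norml; apply: fW.
  by rewrite ler_norml (le_trans ah ax) (le_trans xb bh).
have l1 := diff_le h3 y3 y2 df dW (fun x hx => (andP (B x _ _ (lexx _) y4 hx)).2).
have l2 := diff_le h3 y3 y2 dWN df (fun x hx => (andP (B x _ _ (lexx _) y4 hx)).1).
have r1 := diff_le y1 y4 h4 df dW (fun x hx => (andP (B x _ _ y3 (lexx _) hx)).2).
have r2 := diff_le y1 y4 h4 dWN df (fun x hx => (andP (B x _ _ y3 (lexx _) hx)).1).
rewrite f1 in l1 l2; rewrite f2 in r1 r2.
by rewrite ler_norml; apply/andP; split; case: (ger0P y) => _; lra.
Qed.

Lemma double_zero2 f f' (W : R) : der f f' -> f (- hp) = 0 -> f hp = 0 -> 0 <= W ->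
  (forall y, `|y| <= hp -> `|f' y| <= W * (hp - `|y|)) -> forall y, `|y| <= hp -> `|f y| <= W * (hp - `|y|) ^+ 2.
Proof.
move=> df f1 f2 W0 fW y yh; have /andP[y1 y2] := in3 yh.
have [h3 h4] := hp3 R; have := yh; rewrite ler_norml => /andP[y3 y4].
have dq (c : R) V : der (fun x => V * (x - c) ^+ 2) (fun x => 2 * V * (x - c)).
  have dc := derD der_id (der_cst (- c)).
  by apply: der_eq (derZ V (derM dc dc)) _ => x; ring.
have [yp|yn] := leP 0 y.
  have B x : y <= x <= hp -> `|f' x| <= W * (hp - x).
    move=> /andP[yx xh]; have x0 := le_trans yp yx; have := fW x; rewrite (ger0_norm x0) => /(_ xh); exact.
  have r1 := diff_le y1 y4 h4 df (dq hp (- W)).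
  have r2 := diff_le y1 y4 h4 (dq hp W) df.
  have {r1} : f hp - f y <= - W * (hp - hp) ^+ 2 - - W * (y - hp) ^+ 2.
    by apply: r1 => x xi; have hx := B x xi; have := le_trans (ler_norm _) hx; have /andP[_ xh] := xi;
      have : 0 <= W * (hp - x) by [apply: mulr_ge0; rewrite ?subr_ge0]; lra.
  have {r2} : W * (hp - hp) ^+ 2 - W * (y - hp) ^+ 2 <= f hp - f y.
    by apply: r2 => x xi; have := B x xi; rewrite ler_norml => /andP[hx _]; have /andP[_ xh] := xi;
      have : 0 <= W * (hp - x) by [apply: mulr_ge0; rewrite ?subr_ge0]; lra.
  rewrite f2 subrr expr0n /= !mulr0 sub0r mulNr opprK sub0r.
  by rewrite ler_norml -sqrrN opprB (ger0_norm yp) => h1 h2; apply/andP; split; lra.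
have B x : - hp <= x <= y -> `|f' x| <= W * (hp + x).
  move=> /andP[hx xy]; have x0 := le_lt_trans xy yn; have := fW x; rewrite (ltr0_norm x0) opprK; apply.
  by rewrite lerNl.
have r1 := diff_le h3 y3 y2 df (dq (- hp) W).
have r2 := diff_le h3 y3 y2 (dq (- hp) (- W)) df.
have {r1} : f y - f (- hp) <= W * (y - - hp) ^+ 2 - W * (- hp - - hp) ^+ 2.
  by apply: r1 => x xi; have hx := B x xi; have := le_trans (ler_norm _) hx; have /andP[xh _] := xi;
    have : 0 <= W * (hp + x) by [apply: mulr_ge0 => //; lra]; lra.
have {r2} : - W * (y - - hp) ^+ 2 - - W * (- hp - - hp) ^+ 2 <= f y - f (- hp).
  by apply: r2 => x xi; have := B x xi; rewrite ler_norml => /andP[hx _]; have /andP[xh _] := xi;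
    have : 0 <= W * (hp + x) by [apply: mulr_ge0 => //; lra]; lra.
rewrite f1 subrr expr0n /= !mulr0 !subr0 opprK (ltr0_norm yn) opprK (addrC hp).
by rewrite ler_norml => h1 h2; apply/andP; split; lra.
Qed.

(** A continuous minorant of the indicator of (al, be). Its ramps are linear, so {trap >= M} is the
    explicit interval [al + d M, be - d M], as [pot_ge0] requires. *)
Definition trap (al be d y : R) : R := Num.min 1 (pos (Num.min ((y - al) / d) ((be - y) / d))).

Section trap.
Variables (al be d : R).
Hypothesis (d0 : 0 < d).
Local Notation h := (trap al be d).

Lemma trap_cont : continuous h.
Proof.
move=> y.
have c1 : {for y, continuous (fun y : R => (y - al) / d)}.
  by apply: cvgM; [apply: cvgB; [exact: cvg_id|exact: cvg_cst]|exact: cvg_cst].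
have c2 : {for y, continuous (fun y : R => (be - y) / d)}.
  by apply: cvgM; [apply: cvgB; [exact: cvg_cst|exact: cvg_id]|exact: cvg_cst].
have cc (c : R) : {for y, continuous (fun=> c : R)} by exact: cst_continuous.
exact: (continuous_min (cc 1) (continuous_max (continuous_min c1 c2) (cc 0))).
Qed.

Lemma trap01 y : 0 <= h y <= 1.
Proof. by rewrite /trap ge_min lexx le_min ler01 pos_ge0. Qed.

Lemma trap_le M y : 0 <= M -> (y <= al + d * M) || (be - d * M <= y) -> h y <= M.
Proof.
move=> M0 H; rewrite /trap ge_min; apply/orP; right; rewrite /pos ge_max M0 andbT ge_min.
by rewrite !ler_pdivrMr// ![M * d]mulrC; case/orP: H => H; apply/orP; [left|right]; lra.
Qed.

Lemma trap_ge M y : M <= 1 -> al + d * M <= y -> y <= be - d * M -> M <= h y.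
Proof.
move=> M1 h1 h2; rewrite /trap le_min M1 /= /pos le_max le_min !ler_pdivlMr// ![M * d]mulrC.
by apply/orP; left; apply/andP; split; lra.
Qed.

Lemma trap_out y : (y <= al) || (be <= y) -> h y = 0.
Proof.
move=> H; apply/eqP; rewrite eq_le; have /andP[-> _] := trap01 y; rewrite andbT.
by apply: trap_le => //; rewrite mulr0 addr0 subr0.
Qed.

Lemma trap_one y : al + d <= y -> y <= be - d -> h y = 1.
Proof.
move=> h1 h2; apply/eqP; rewrite eq_le; have /andP[_ ->] := trap01 y => /=.
by apply: trap_ge; rewrite ?mulr1.
Qed.

End trap.

Definition wslab (al be t : R) := wmean (fun=> 1) al be t.

Lemma pint_w1 (a b t : R) : pint (fun y => 1 * wexp t y) a b = pint (wexp t) a b.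
Proof. by congr (pint _ a b); apply/funext => y; rewrite mul1r. Qed.

Lemma sum_error (x y z u v e f : R) : x <= e -> y <= f -> 0 <= u -> 0 <= v ->
  x + (z + y) <= u + (z + v) + (e + f).
Proof. by lra. Qed.

(** The two functions differ only on the ramps, of total length 2 d, where the weight is at most
    e^(4 |t|). *)
Lemma wmean_trap al be d t : - hp <= al -> al + d <= be - d -> be <= hp -> 0 < d ->
  wmean (trap al be d) (- hp) hp t <= wslab al be t /\
  wslab al be t <= wmean (trap al be d) (- hp) hp t + 2 * d * expR (4 * `|t|) / wmass t.
Proof.
move=> ah dd bh d0; have [h3 h4] := hp3 R; have D0 := wmass_gt0 t.
have ct : continuous (trap al be d) by exact: trap_cont.
have gc : continuous (fun y : R => trap al be d y * wexp t y) by exact: gw_cont.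
rewrite /wslab /wmean -mulrDl !ler_pM2r ?invr_gt0// pint_w1.
have k1 : - hp <= al + d by lra.
have k2 : be - d <= hp by lra.
have z1 : pint (fun y => trap al be d y * wexp t y) (- hp) al = 0.
  rewrite -(mul0r (al - - hp)) -pint_cst//; last by lra.
  apply: pint_ext => //; [by lra|exact: cst_continuous|].
  by move=> x /andP[_ xa]; rewrite trap_out ?xa// mul0r.
have z2 : pint (fun y => trap al be d y * wexp t y) be hp = 0.
  rewrite -(mul0r (hp - be)) -pint_cst//; last by lra.
  apply: pint_ext => //; [by lra|exact: cst_continuous|].
  by move=> x /andP[xb _]; rewrite trap_out ?xb ?orbT// mul0r.
rewrite -(pint_cat _ (- hp) al hp) -(pint_cat _ al be hp) z1 z2 add0r addr0.
have a3 : -3 < al by lra.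
have b3 : be < 3 by lra.
have ab : al <= be by lra.
have ad : al <= al + d by rewrite lerDl ltW.
have bd : be - d <= be by rewrite lerBlDr lerDl ltW.
have ad3 : al + d < 3 by lra.
have bd3 : - 3 < be - d by lra.
have adb : al + d <= be := le_trans dd bd.
have abd : al <= be - d := le_trans ad dd.
have a3' : - 3 < al + d := lt_le_trans a3 ad.
have b3' : be - d < 3 := le_lt_trans bd b3.
have ah' : al <= hp := le_trans ab bh.
have bh' : - hp <= be := le_trans ah ab.
have tw y : trap al be d y * wexp t y <= wexp t y.
  by have /andP[_ t1] := trap01 al be d y; rewrite ler_piMl// ltW// wexp_gt0.
have tw0 y : 0 <= trap al be d y * wexp t y.
  by have /andP[t1 _] := trap01 al be d y; apply: mulr_ge0 => //; exact: ltW (wexp_gt0 _ _).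
split; first by apply: pint_le => //; exact: wexp_cont.
have wW y : al <= y <= be -> wexp t y <= expR (4 * `|t|).
  by move=> /andP[y1 y2]; apply: wexp_bd; rewrite ler_norml (le_trans ah y1) (le_trans y2 bh).
rewrite -(pint_cat (wexp t) al (al + d) be) -(pint_cat (wexp t) (al + d) (be - d) be).
rewrite -(pint_cat (fun y => _ * _) al (al + d) be) -(pint_cat (fun y => _ * _) (al + d) (be - d) be).
have i1 : pint (wexp t) al (al + d) <= expR (4 * `|t|) * (al + d - al).
  rewrite -(pint_cst a3 ad ad3); apply: (pint_le a3 ad ad3); [exact: wexp_cont|exact: cst_continuous|].
  by move=> x /andP[x1 x2]; apply: wW; rewrite x1 (le_trans x2 adb).
have i2 : pint (wexp t) (be - d) be <= expR (4 * `|t|) * (be - (be - d)).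
  rewrite -(pint_cst bd3 bd b3); apply: (pint_le bd3 bd b3); [exact: wexp_cont|exact: cst_continuous|].
  by move=> x /andP[x1 x2]; apply: wW; rewrite (le_trans abd x1).
have i3 : pint (fun y => trap al be d y * wexp t y) (al + d) (be - d) = pint (wexp t) (al + d) (be - d).
  apply: (pint_ext a3' dd b3'); [exact: gc|exact: wexp_cont|].
  by move=> x /andP[x1 x2]; rewrite trap_one// mul1r.
have i4 : 0 <= pint (fun y => trap al be d y * wexp t y) al (al + d) by exact: (pint_ge0 a3 ad ad3 gc).
have i5 : 0 <= pint (fun y => trap al be d y * wexp t y) (be - d) be by exact: (pint_ge0 bd3 bd b3 gc).
rewrite i3 (_ : 2 * d * _ = expR (4 * `|t|) * (al + d - al) + expR (4 * `|t|) * (be - (be - d))); last by ring.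
exact: sum_error i1 i2 i4 i5.
Qed.

(** * The potential attached to an extremal mode *)

Section potential.
Variables (h : R -> R) (M t : R).
Hypotheses (ch : continuous h) (h01 : forall y, 0 <= h y <= 1) (M01 : 0 <= M <= 1).
Hypothesis ME : M = wmean h (- hp) hp t.

Definition pot' (y : R) := (M - h y) * wexp t y.

Lemma pot'_cont : continuous pot'.
Proof.
move=> y; apply: cvgM; last exact: wexp_cont.
by apply: cvgB; [exact: cvg_cst|exact: ch].
Qed.

(* [pot] is the solution of K'' = (M - h) e^{-2ty} with K = K' = 0 at -pi/2; both also
   vanish at pi/2, K' because M is the mean of h and K because t maximizes the mean. *)
Definition pot1 y := prim pot' y - prim pot' (- hp).

Lemma der_pot1 : der pot1 pot'.
Proof.
by apply: der_eq (derD (der_prim pot'_cont) (der_cst _)) _ => x; rewrite addr0.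
Qed.

Lemma pot'_int s : pint (fun y => (M - h y) * wexp s y) (- hp) hp = M * wmass s - pint (fun y => h y * wexp s y) (- hp) hp.
Proof.
have [h3 h4] := hp3 R; have h0 := hp0 R.
have c1 : continuous (fun y : R => (M - h y) * wexp s y).
  by move=> y; apply: cvgM; [apply: cvgB; [exact: cvg_cst|exact: ch]|exact: wexp_cont].
have E y : - hp <= y <= hp -> (M - h y) * wexp s y = M * wexp s y + (-1) * (h y * wexp s y) by move=> _; ring.
by rewrite (pint_lin h3 h0 h4 (@wexp_cont _ s) (gw_cont (t := s) ch) c1 E) mulN1r.
Qed.

Lemma pot1_0 : pot1 (- hp) = 0 /\ pot1 hp = 0.
Proof.
split; first by rewrite /pot1 subrr.
rewrite -[pot1 hp]/(pint pot' (- hp) hp) pot'_int ME /wmean mulfVK ?subrr// gt_eqF//; exact: wmass_gt0.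
Qed.

Lemma pot'_bd y : `|y| <= hp -> `|pot' y| <= expR (4 * `|t|).
Proof.
move=> yh; rewrite normrM (gtr0_norm (wexp_gt0 t y)) -[leRHS]mul1r.
apply: ler_pM => //; [exact: ltW (wexp_gt0 _ _)| |exact: wexp_bd].
by have /andP[? ?] := h01 y; have /andP[? ?] := M01; rewrite ler_norml; apply/andP; split; lra.
Qed.

Lemma pot1_bd y : `|y| <= hp -> `|pot1 y| <= expR (4 * `|t|) * (hp - `|y|).
Proof. by have [z1 z2] := pot1_0; apply: double_zero der_pot1 z1 z2 pot'_bd y. Qed.

Lemma exp_taylor (x : R) : `|x| <= 2^-1 -> `|expR x - 1 - x| <= 2 * x ^+ 2.
Proof.
move=> x2; have h1 := expR_ge1Dx x; have h2 := expR_ge1Dx (- x).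
have x3 : x <= 2^-1 := le_trans (ler_norm x) x2.
have : 0 < expR x by exact: expR_gt0.
have : expR x * expR (- x) = 1 by rewrite -expRD subrr expR0.
move: (expR x) (expR (- x)) h1 h2 => a b h1 h2 ab a0.
have : a * (1 - x) <= 1 by rewrite -[leRHS]ab; apply: ler_wpM2l => //; exact: ltW.
move=> h3; rewrite ger0_norm; last by lra.
have q : (1 + x + 2 * x ^+ 2) * (1 - x) = 1 + x ^+ 2 * (1 - 2 * x) by ring.
have : a * (1 - x) <= (1 + x + 2 * x ^+ 2) * (1 - x).
  by apply: (le_trans h3); rewrite q lerDl; apply: mulr_ge0; [exact: sqr_ge0|lra].
rewrite ler_pM2r; last by lra.
by lra.
Qed.

Hypothesis tmax : forall s, wmean h (- hp) hp s <= M.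

(** Stationarity of the mean at its maximum t, obtained without differentiating in t: the integral
    of (M - h) e^(-2(t+s)y) is nonnegative for every s, and its expansion in s begins with -2 s
    times this moment. *)
Lemma first_moment : pint (fun y => y * pot' y) (- hp) hp = 0.
Proof.
have [h3 h4] := hp3 R; have h0 := hp0 R; have [g1 g2] := hp_bounds R.
have cy : continuous (fun y : R => y * pot' y).
  by move=> y; apply: cvgM; [exact: cvg_id|exact: pot'_cont].
set P := pint _ _ _; pose W := expR (4 * `|t|).
have W0 : 0 < W by exact: expR_gt0.
(* 1/8 keeps the exponent 2 s y within 1/2, where [exp_taylor] holds; 128 = 32 * 4 is the quadratic
   error 32 W s^2 times a length of at most 4. *)
have key s : `|s| <= 8^-1 -> 2 * s * P <= 128 * W * s ^+ 2.
  move=> s8.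
  have p0 : 0 <= pint (fun y => (M - h y) * wexp (t + s) y) (- hp) hp.
    by rewrite pot'_int subr_ge0 -ler_pdivrMr ?wmass_gt0//; exact: tmax.
  have c1 : continuous (fun y : R => (M - h y) * wexp (t + s) y).
    by move=> y; apply: cvgM; [apply: cvgB; [exact: cvg_cst|exact: ch]|exact: wexp_cont].
  have c2 : continuous (fun y : R => pot' y + (- (2 * s)) * (y * pot' y)).
    by move=> y; apply: cvgD; [exact: pot'_cont|apply: cvgM; [exact: cvg_cst|exact: cy]].
  have c3 : continuous (fun y : R => 1 * (pot' y + (- (2 * s)) * (y * pot' y)) + (32 * W * s ^+ 2) * 1).
    by move=> y; apply: cvgD; [apply: cvgM; [exact: cvg_cst|exact: c2]|exact: cvg_cst].
  have : pint (fun y => (M - h y) * wexp (t + s) y) (- hp) hp <=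
      pint (fun y => 1 * (pot' y + (- (2 * s)) * (y * pot' y)) + (32 * W * s ^+ 2) * 1) (- hp) hp.
    apply: pint_le => // y; rewrite -ler_norml => yh.
    have wE : (M - h y) * wexp (t + s) y = pot' y * expR (- (2 * s * y)).
      by rewrite /pot' /wexp -[RHS]mulrA -expRD; congr (_ * expR _); ring.
    have y2 : `|y| <= 2 by apply: (le_trans yh); exact: ltW.
    have xs : `|- (2 * s * y)| <= 4 * `|s|.
      rewrite normrN !normrM ger0_norm// mulrAC; have := ler_wpM2l (normr_ge0 s) y2.
      by rewrite -mulrA (mulrC `|y|); lra.
    have x2 : `|- (2 * s * y)| <= 2^-1 by apply: (le_trans xs); lra.
    have := exp_taylor x2; set x := - (2 * s * y); move=> h1.
    have xq : x ^+ 2 <= 16 * s ^+ 2.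
      rewrite -(real_normK (num_real x)) -(real_normK (num_real s)).
      rewrite (_ : 16 * `|s| ^+ 2 = (4 * `|s|) ^+ 2); last by ring.
      by rewrite ler_pXn2r ?nnegrE// mulr_ge0.
    have h2 : `|pot' y * (expR x - 1 - x)| <= W * (32 * s ^+ 2).
      rewrite normrM; apply: ler_pM => //; first exact: pot'_bd.
      by apply: (le_trans h1); lra.
    rewrite wE -/x; have := le_trans (ler_norm _) h2.
    rewrite (_ : pot' y * (expR x - 1 - x) = pot' y * expR x - pot' y - x * pot' y); last by ring.
    rewrite /x; lra.
  have cc : continuous (fun _ : R => 1 : R) by exact: cst_continuous.
  rewrite (@pint_lin _ _ _ h3 h0 h4 1 (32 * W * s ^+ 2) _ _ _ c2 cc c3 (fun y _ => erefl)).
  have c4 : forall y, - hp <= y <= hp -> pot' y + (- (2 * s)) * (y * pot' y) = 1 * pot' y + (- (2 * s)) * (y * pot' y) by move=> y _; rewrite mul1r.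
  rewrite (pint_lin h3 h0 h4 pot'_cont cy c2 c4) -/P pint_cst// !mul1r.
  have -> : pint pot' (- hp) hp = 0 := pot1_0.2.
  have : 32 * W * s ^+ 2 * (hp - - hp) <= 32 * W * s ^+ 2 * 4.
    apply: ler_wpM2l; last by lra.
    by apply: mulr_ge0; [apply: mulr_ge0 => //; exact: ltW|exact: sqr_ge0].
  lra.
apply/eqP; rewrite -normr_le0; apply/ler_addgt0Pr => e e0; rewrite add0r.
pose s := Num.min 8^-1 (e / (64 * W)).
have s0 : 0 < s by rewrite lt_min invr_gt0 ltr0n /= divr_gt0// mulr_gt0.
have s1 : s <= 8^-1 by rewrite ge_min lexx.
have s2 : 64 * W * s <= e by rewrite mulrC -ler_pdivlMr ?mulr_gt0// ge_min lexx orbT.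
have k1 := key s; have k2 := key (- s); rewrite normrN gtr0_norm// in k1 k2.
have {}k1 := k1 s1; have {}k2 := k2 s1; rewrite sqrrN in k2.
have k3 : s * P <= s * e.
  by apply: (@le_trans _ _ (s * (64 * W * s))); [move: k1; rewrite expr2; lra|rewrite ler_pM2l].
have k4 : s * - P <= s * e.
  by apply: (@le_trans _ _ (s * (64 * W * s))); [move: k2; rewrite expr2; lra|rewrite ler_pM2l].
rewrite !ler_pM2l// in k3 k4.
by rewrite ler_norml; apply/andP; split; lra.
Qed.

(** The twofold integral in the form of an integral of (y - u) [pot'] u: since [pot1] vanishes at
    pi/2, the value there is minus the first moment. *)
Definition pot y := y * pot1 y - (prim (fun y => y * pot' y) y - prim (fun y => y * pot' y) (- hp)).

Lemma der_pot : der pot pot1.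
Proof.
have cy : continuous (fun y : R => y * pot' y).
  by move=> y; apply: cvgM; [exact: cvg_id|exact: pot'_cont].
have d1 := derD (derM der_id der_pot1) (derZ (-1) (derD (der_prim cy) (der_cst (- prim (fun y => y * pot' y) (- hp))))).
have d2 := der_eq d1 _; move: d2 => /(_ pot1) d2.
have E x : x * pot' x + pot1 x * 1 + -1 * (x * pot' x + 0) = pot1 x by ring.
move=> x x3; have := d2 E x x3; congr (is_derive _ _ _ _).
by apply/funext => y; rewrite mulN1r.
Qed.

Lemma pot_0 : pot (- hp) = 0 /\ pot hp = 0.
Proof.
have [z1 z2] := pot1_0; rewrite /pot z1 z2 !mulr0 subrr subr0; split=> //.
by rewrite sub0r -[X in - X]/(pint (fun y => y * pot' y) (- hp) hp) first_moment oppr0.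
Qed.

Lemma pot_bd y : `|y| <= hp -> `|pot y| <= expR (4 * `|t|) * (hp - `|y|) ^+ 2.
Proof.
by have [z1 z2] := pot_0; apply: double_zero2 der_pot z1 z2 _ pot1_bd y; exact: expR_ge0.
Qed.

(** K'' >= 0 outside [a, b], so K moves up from its double zeros at both ends and K(a), K(b) >= 0.
    On [a, b] K is concave, hence at least one of K(a), K(b). *)
Lemma pot_ge0 a b : - hp <= a -> a <= b -> b <= hp -> (forall y, y <= a -> h y <= M) ->
  (forall y, b <= y -> h y <= M) -> (forall y, a <= y <= b -> M <= h y) ->
  forall y, `|y| <= hp -> 0 <= pot y.
Proof.
move=> ah ab bh hl hr hm.
have [h3 h4] := hp3 R; have [z1 z2] := pot1_0; have [k1 k2] := pot_0.
have d0 := der_cst 0.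
have a3 : -3 < a by lra.
have b3 : b < 3 by lra.
have w0 y : 0 <= wexp t y by exact: ltW (wexp_gt0 _ _).
have pl y : - hp <= y -> y <= a -> 0 <= pot1 y.
  move=> y1 y2; have y3 : y < 3 by lra.
  have := diff_le h3 y1 y3 d0 der_pot1; rewrite subrr z1 subr0; apply => x /andP[_ xy].
  by apply: mulr_ge0 => //; rewrite subr_ge0 hl// (le_trans xy).
have pr y : b <= y -> y <= hp -> pot1 y <= 0.
  move=> y1 y2; have y3 : -3 < y by lra.
  have := diff_le y3 y2 h4 d0 der_pot1; rewrite subrr z2 sub0r oppr_ge0; apply => x /andP[xy _].
  by apply: mulr_ge0 => //; rewrite subr_ge0 hr// (le_trans y1).
have Pl y : - hp <= y -> y <= a -> 0 <= pot y.
  move=> y1 y2; have y3 : y < 3 by lra.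
  have := diff_le h3 y1 y3 d0 der_pot; rewrite subrr k1 subr0; apply => x /andP[x1 xy].
  by apply: pl => //; exact: le_trans xy y2.
have Pr y : b <= y -> y <= hp -> 0 <= pot y.
  move=> y1 y2; have y3 : -3 < y by lra.
  have := diff_le y3 y2 h4 der_pot d0; rewrite subrr k2 sub0r oppr_le0; apply => x /andP[xy x2].
  by apply: pr => //; exact: le_trans y1 xy.
have mono x y : a <= x -> x <= y -> y <= b -> pot1 y <= pot1 x.
  move=> x1 xy y1; have x3 : -3 < x by lra.
  have y3 : y < 3 by lra.
  have := diff_le x3 xy y3 der_pot1 d0; rewrite subrr subr_le0; apply => u /andP[u1 u2].
  by apply: mulr_le0_ge0 => //; rewrite subr_le0 hm// (le_trans x1 u1) (le_trans u2 y1).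
move=> y; rewrite ler_norml => /andP[y1 y2].
have [ya|ay] := leP y a; first exact: Pl.
have [by_|yb] := leP b y; first exact: Pr.
have y3 : -3 < y by lra.
have y4 : y < 3 by lra.
have [s|s] := leP 0 (pot1 y).
  apply: (@le_trans _ _ (pot a)); first exact: Pl.
  have := diff_le a3 (ltW ay) y4 d0 der_pot; rewrite subrr subr_ge0; apply => x /andP[x1 x2].
  by apply: (le_trans s); apply: mono => //; exact: ltW.
apply: (@le_trans _ _ (pot b)); first exact: Pr.
have := diff_le y3 (ltW yb) b3 der_pot d0; rewrite subrr subr_le0; apply => x /andP[x1 x2].
by apply: le_trans (ltW s); apply: mono => //; exact: ltW.
Qed.

End potential.
End one_dim_data.

(** * The disc as a strip *)

Section strip_map.
Context (R : realType).
Local Notation C := R[i].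
Local Notation nm := (@Normc.normc R).

Lemma cplxE (x y : R) : x +i* y = x%:C + 'i * y%:C.
Proof. by apply: complexPeq => /=; ring. Qed.

Lemma i2 : 'i * 'i = -1 :> C.
Proof. by rewrite -expr2 sqr_i. Qed.

Lemma wd_ReIm (u v : C -> R) z a b a' b' : wd (fun z => (u z)%:C) z a b -> wd (fun z => (v z)%:C) z a' b' ->
  wd (fun z => u z +i* v z) z (a + 'i * a') (b + 'i * b').
Proof.
move=> hu hv; apply: wd_ext (wd_eq (wdD hu (wdZ 'i hv)) erefl erefl) => w.
by rewrite cplxE.
Qed.

Definition cexp (w : C) : C := (expR (complex.Re w))%:C * (cos (complex.Im w) +i* sin (complex.Im w)).

Lemma nm_cexp w : nm (cexp w) = expR (complex.Re w).
Proof.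
rewrite nmM nm_real ger0_norm ?expR_ge0//.
by rewrite /Normc.normc cos2Dsin2 sqrtr1 mulr1.
Qed.

Lemma cexpD w w' : cexp (w + w') = cexp w * cexp w'.
Proof.
rewrite /cexp cReD cImD expRD cosD sinD; apply: complexPeq; rewrite !(cReM, cImM) /=; ring.
Qed.

Lemma cexp0 : cexp 0 = 1.
Proof. by rewrite /cexp /= expR0 cos0 sin0 mul1r. Qed.

Lemma cexp_neq0 w : cexp w != 0.
Proof. by rewrite -nm_eq0 nm_cexp gt_eqF// expR_gt0. Qed.

Lemma cexpN w : cexp (- w) = (cexp w)^-1.
Proof. by apply: (mulfI (cexp_neq0 w)); rewrite -cexpD subrr cexp0 mulfV ?cexp_neq0. Qed.

Lemma wd_cexp w : wd cexp w (cexp w) 0.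
Proof.
have hR := wd_real (wd_Re_id w) (is_derive_rd (is_derive_expR (complex.Re w))).
have hc := wd_real (wd_Im_id w) (is_derive_rd (is_derive_cos (complex.Im w))).
have hs := wd_real (wd_Im_id w) (is_derive_rd (is_derive_sin (complex.Im w))).
have A (e c s : C) : e / 2 * (c + 'i * s) + e * (- s * - ('i / 2) + 'i * (c * - ('i / 2))) = e * (c + 'i * s).
  by field: i2.
have B (e c s : C) : e / 2 * (c + 'i * s) + e * (- s * ('i / 2) + 'i * (c * ('i / 2))) = 0.
  by field: i2.
by apply: wd_eq (wdM hR (wd_ReIm hc hs)) _ _; rewrite /cexp (cplxE (cos _)) rmorphN; [exact: A|exact: B].
Qed.

Lemma atan_factor (x y : R) : 0 < x -> (1 + (y / x) ^+ 2)^-1 = x ^+ 2 / (x ^+ 2 + y ^+ 2).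
Proof.
move=> x0; have h : x ^+ 2 + y ^+ 2 != 0 by rewrite gt_eqF// ltr_wpDr ?sqr_ge0// exprn_gt0.
by field; rewrite h gt_eqF.
Qed.

(** The principal logarithm on the right half-plane, where [atan] gives the argument; ln |w|^2
    avoids differentiating a square root. *)
Definition clog (w : C) : C := (2^-1 * ln (nm w ^+ 2)) +i* atan (complex.Im w / complex.Re w).

Lemma wd_clog w : 0 < complex.Re w -> wd clog w w^-1 0.
Proof.
move=> x0.
have n0 : 0 < nm w ^+ 2 by rewrite nm_sqr ltr_wpDr ?sqr_ge0// exprn_gt0.
have hn : wd (fun w : C => (nm w ^+ 2)%:C) w w^J w.
  apply: wd_ext (wd_eq (wdM (wd_id w) (wdJ (wd_id w))) _ _) => [z||]; first by rewrite mulJE.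
    by rewrite rmorph0; ring.
  by rewrite rmorph1; ring.
have hl := wd_real hn (is_derive_rd (is_derive1_ln n0)).
have xC : (complex.Re w)%:C != 0 :> C by rewrite -nm_eq0 nm_real normr_eq0 gt_eqF.
have hq0 := wdM (wd_Im_id w) (wdV xC (wd_Re_id w)).
have qE (z : C) : (complex.Im z)%:C / (complex.Re z)%:C = (complex.Im z / complex.Re z)%:C by rewrite rmorphM/= fmorphV.
have hq := wd_ext qE hq0.
have ha := wd_real hq (is_derive_rd (is_derive1_atan _)).
have hl2 := wdZ (2^-1 : R)%:C hl.
have lE (z : C) : (2^-1 : R)%:C * (ln (nm z ^+ 2))%:C = (2^-1 * ln (nm z ^+ 2))%:C by rewrite rmorphM.
have hl3 := wd_ext lE hl2.
have w0 : w != 0 by rewrite -nm_eq0; apply: contraTneq n0 => ->; rewrite expr0n ltxx.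
have n2 : (nm w ^+ 2)%:C = w * w^J by rewrite mulJE.
have wJ0 : w^J != 0 by rewrite -nm_eq0 nmJ nm_eq0.
have aE : ((1 + (complex.Im w / complex.Re w) ^+ 2)^-1)%:C = (complex.Re w)%:C ^+ 2 / (w * w^J).
  rewrite -n2 -rmorphXn -fmorphV -rmorphM/= nm_sqr; congr (_%:C); exact: atan_factor.
have nE : (nm w ^- 2)%:C = (w * w^J)^-1 :> C by rewrite -n2 -fmorphV.
have wE : w = (complex.Re w)%:C + 'i * (complex.Im w)%:C by rewrite -cplxE; case: (w).
have vE : w^J = (complex.Re w)%:C - 'i * (complex.Im w)%:C.
  by move: (w) => [x y]; apply: complexPeq => /=; ring.
have A (X Y v u : C) : v = X + 'i * Y -> u = X - 'i * Y -> X != 0 -> v != 0 -> u != 0 ->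
  2^-1 * ((v * u)^-1 * u) + 'i * (X ^+ 2 / (v * u) * (- ('i / 2) / X + Y * (- 2^-1 / X ^+ 2))) = v^-1 /\
  2^-1 * ((v * u)^-1 * v) + 'i * (X ^+ 2 / (v * u) * ('i / 2 / X + Y * (- 2^-1 / X ^+ 2))) = 0.
  by move=> -> -> X0 v0 u0; split; field: i2; rewrite X0 v0 u0.
have [A1 A2] := A _ _ _ _ wE vE xC w0 wJ0.
by apply: wd_eq (wd_ReIm hl3 ha) _ _; rewrite aE nE natVC.
Qed.


Lemma cexp_RI w : complex.Re (cexp w) = expR (complex.Re w) * cos (complex.Im w) /\
  complex.Im (cexp w) = expR (complex.Re w) * sin (complex.Im w).
Proof. by rewrite cReM cImM /= !mul0r subr0 addr0. Qed.

Lemma nm_cosh2 w :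
  nm (cexp w + cexp (- w)) ^+ 2 = expR (2 * complex.Re w) + expR (- (2 * complex.Re w)) + 2 * cos (2 * complex.Im w) /\
  nm (cexp w - cexp (- w)) ^+ 2 = expR (2 * complex.Re w) + expR (- (2 * complex.Re w)) - 2 * cos (2 * complex.Im w).
Proof.
rewrite !nm_sqr !cReD !cImD !cReN !cImN.
have [-> ->] := cexp_RI w; have [-> ->] := cexp_RI (- w); rewrite !cReN !cImN cosN sinN.
move: (complex.Re w) (complex.Im w) => x y.
have e2 (t : R) : expR (2 * t) = expR t ^+ 2 by exact: expRM_natl.
have -> : expR (- (2 * x)) = expR (- x) ^+ 2 by rewrite -mulrN e2.
have ab : expR x * expR (- x) = 1 by rewrite -expRD subrr expR0.
have cs := cos2Dsin2 y.
have -> : cos (2 * y) = cos y ^+ 2 - sin y ^+ 2 by rewrite mulrC mulr_natr cosD -!expr2.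
rewrite e2; move: (expR x) (expR (- x)) (cos y) (sin y) ab cs => a b c s ab cs.
have cs' : c ^+ 2 = 1 - s ^+ 2 by rewrite -cs addrK.
split; ring: ab cs'.
Qed.

(* 1 / (2 cosh (e w)): decays along the strip, with logarithmic derivative at most e. *)
Definition eta (e : R) (w : C) : C := (cexp (e%:C * w) + cexp (- (e%:C * w)))^-1.

(** e <= 1/2 keeps 2 e Im w within [-pi/2, pi/2], where the cosine in [nm_cosh2] is nonnegative.
    Then |2 cosh (e w)| is at least e^(e |Re w|), and it dominates |2 sinh (e w)|. *)
Lemma eta_spec (e : R) (w : C) : 0 < e -> e <= 2^-1 -> `|complex.Im w| < pi / 2 ->
  [/\ nm (eta e w) <= expR (- (e * `|complex.Re w|)), eta e w != 0 &
      exists2 d, wd (eta e) w d 0 & nm d <= e * nm (eta e w)].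
Proof.
move=> e0 e2 y2; pose v := e%:C * w.
have xE : complex.Re v = e * complex.Re w by rewrite cReM -[complex.Im _%:C]/(0 : R) mul0r subr0.
have yE : complex.Im v = e * complex.Im w by rewrite cImM -[complex.Im _%:C]/(0 : R) mul0r addr0.
have [h1 h2] := nm_cosh2 v.
have c0 : 0 <= cos (2 * complex.Im v).
  apply: cos_ge0_pihalf; rewrite -ler_norml yE normrM ger0_norm//.
  rewrite normrM (gtr0_norm e0); have n0 := normr_ge0 (complex.Im w).
  by apply: le_trans (ltW y2); rewrite mulrA ler_piMl//; lra.
set D := cexp v + cexp (- v) in h1.
have g0 t : 0 <= expR t :> R by exact: expR_ge0.
have D1 : expR (e * `|complex.Re w|) <= nm D.
  rewrite -(@ler_pXn2r _ 2)// ?nnegrE ?expR_ge0// h1 expr2 -expRD xE.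
  have -> : e * `|complex.Re w| + e * `|complex.Re w| = `|2 * (e * complex.Re w)|.
    by rewrite !normrM (gtr0_norm e0) ger0_norm//; ring.
  have := g0 (2 * (e * complex.Re w)); have := g0 (- (2 * (e * complex.Re w))).
  by case: (ger0P (2 * (e * complex.Re w))) => _; lra.
have D0 : 0 < nm D by apply: lt_le_trans D1; exact: expR_gt0.
have Dn : D != 0 by rewrite -nm_gt0.
have nE : nm (eta e w) = (nm D)^-1 by rewrite nmV.
split; first by rewrite nE expRN lef_pV2 ?posrE ?expR_gt0.
  by rewrite /eta -/v -/D invr_eq0.
have hv := wdZ e%:C (wd_id w).
have hD := wdD (wd_comp hv (wd_cexp v)) (wd_comp (wdN hv) (wd_cexp (- v))).
have H := @wdV _ (fun z => cexp (e%:C * z) + cexp (- (e%:C * z))) _ _ _ Dn hD; eexists; first by apply: wd_eq H _ _; [reflexivity|rewrite -/v !(mulr0, mul0r, addr0, oppr0)].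
rewrite !(mul0r, addr0) mulr1 mulrN -mulrBl -/v.
rewrite nmM nmN nmM nm_real (gtr0_norm e0) nmV nmX nE.
have DD : nm (cexp v - cexp (- v)) <= nm D.
  rewrite -(@ler_pXn2r _ 2)// ?nnegrE ?nm_ge0// h1 h2; lra.
rewrite -/D; move: (nm (_ - _)) (nm D) D0 DD => x y y0 xy.
rewrite (_ : x * e / y ^+ 2 = e / y * (x / y)); last by field; rewrite gt_eqF.
by apply: ler_piMr; [exact: ltW (divr_gt0 e0 y0)|rewrite ler_pdivrMr// mul1r].
Qed.

Lemma Re_zeta_alg (p q z : C) : nm p = 1 -> nm q = 1 ->
  complex.Re ((q - p) * p^J * (z - p) * (z - q)^J) = nm (p - q) ^+ 2 / 2 * (1 - nm z ^+ 2).
Proof.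
move=> p1 q1; have hp := nm_sqr p; have hq := nm_sqr q; rewrite p1 expr1n in hp; rewrite q1 expr1n in hq.
rewrite !nm_sqr; move: hp hq; move: p q z {p1 q1} => [a b] [c d] [x y] /= hp hq.
have hp' : a ^+ 2 = 1 - b ^+ 2 by rewrite hp addrK.
have hq' : c ^+ 2 = 1 - d ^+ 2 by rewrite hq addrK.
by field: hp' hq'.
Qed.

Section poles.
Variables (p q : C).
Hypotheses (p1 : nm p = 1) (q1 : nm q = 1) (pq : p != q).

(* A Moebius map of the disc onto the right half-plane taking the geodesic from [p]
   to [q] to the positive axis; its logarithm [Phi] maps the disc onto the strip
   |Im w| < pi/2. *)
Definition zeta (z : C) : C := (q - p) * p^J * (z - p) / (z - q).
Definition Phi (z : C) : C := clog (zeta z).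
Definition dPhi (z : C) : C := (p - q) / ((z - q) * (z - p)).

Lemma disc_neq z c : nm z < 1 -> nm c = 1 -> z - c != 0.
Proof. by move=> z1 c1; rewrite subr_eq0; apply: contraTneq z1 => ->; rewrite c1 ltxx. Qed.

Lemma pq0 : 0 < nm (p - q). Proof. by rewrite nm_gt0 subr_eq0. Qed.

Lemma zp0 z : nm z < 1 -> 0 < nm (z - p). Proof. by move=> z1; rewrite nm_gt0 disc_neq. Qed.
Lemma zq0 z : nm z < 1 -> 0 < nm (z - q). Proof. by move=> z1; rewrite nm_gt0 disc_neq. Qed.

Lemma nm_zeta z : nm (zeta z) = nm (p - q) * nm (z - p) / nm (z - q).
Proof. by rewrite /zeta !nmM nmV nmJ p1 mulr1 nm_distC. Qed.

Lemma Re_zeta z : nm z < 1 -> complex.Re (zeta z) = nm (p - q) ^+ 2 / 2 * (1 - nm z ^+ 2) / nm (z - q) ^+ 2.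
Proof.
move=> z1; have zq := zq0 z1.
have zqC : (nm (z - q) ^+ 2)%:C != 0 :> C by rewrite -nm_eq0 nm_real normr_eq0 gt_eqF// exprn_gt0.
have -> : zeta z = (nm (z - q) ^- 2)%:C * ((q - p) * p^J * (z - p) * (z - q)^J).
  have -> : (nm (z - q) ^- 2)%:C = ((z - q) * (z - q)^J)^-1 :> C by rewrite mulJE -fmorphV.
  have zq' := disc_neq z1 q1; have : (z - q)^J != 0 by rewrite -nm_eq0 nmJ nm_eq0.
  rewrite /zeta; move: ((z - q)^J) => v v0; field; by rewrite v0 zq'.
rewrite cReM -[complex.Im _%:C]/(0 : R) mul0r subr0 -[complex.Re _%:C]/(_ ^- 2) mulrC; congr (_ / _).
exact: Re_zeta_alg.
Qed.

Lemma Re_zeta_gt0 z : nm z < 1 -> 0 < complex.Re (zeta z).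
Proof.
move=> z1; rewrite Re_zeta// divr_gt0 ?exprn_gt0 ?zq0// mulr_gt0 ?divr_gt0 ?exprn_gt0 ?pq0//.
by rewrite subr_gt0 exprn_ilt1 ?nm_ge0.
Qed.

Lemma wd_Phi z : nm z < 1 -> wd Phi z (dPhi z) 0.
Proof.
move=> z1; have zq := disc_neq z1 q1; have zp := disc_neq z1 p1.
have hq : wd (fun z => z - q) z (1 - 0) (0 - 0) by apply: wdB; [exact: wd_id|exact: wd_cst].
have hp : wd (fun z => z - p) z (1 - 0) (0 - 0) by apply: wdB; [exact: wd_id|exact: wd_cst].
have hz := wdM (wdZ ((q - p) * p^J) hp) (@wdV _ (fun z => z - q) _ _ _ zq hq).
have h := wd_comp hz (wd_clog (Re_zeta_gt0 z1)).
apply: wd_eq h _ _; last by rewrite !(subr0, mulr0, mul0r, addr0, oppr0).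
have pJ : p^J != 0 by rewrite -nm_eq0 nmJ p1 oner_eq0.
have qp : q - p != 0 by rewrite subr_eq0 eq_sym.
rewrite /zeta /dPhi !mul0r !subr0 addr0 mulr1; field.
by rewrite zq zp pJ qp.
Qed.

Lemma hol_Phi : hol Phi.
Proof. by move=> z z1; exists (dPhi z); exact: wd_Phi. Qed.

Lemma hol_dPhi : hol dPhi.
Proof.
apply: (holM (hol_cst _)); apply: holV.
  by apply: holM; exact: (holD (@hol_id R) (hol_cst _)).
by move=> z z1; rewrite mulf_neq0// disc_neq.
Qed.

Lemma dPhi_neq0 z : nm z < 1 -> dPhi z != 0.
Proof.
move=> z1; rewrite /dPhi mulf_neq0 ?subr_eq0// invr_eq0 mulf_neq0//; exact: disc_neq.
Qed.

Lemma cos_atan_div (w : C) : 0 < complex.Re w -> cos (atan (complex.Im w / complex.Re w)) = complex.Re w / nm w.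
Proof.
move=> x0; rewrite cos_atan -[RHS]invrK invf_div; congr (_^-1).
have n0 : 0 <= nm w / complex.Re w by rewrite divr_ge0// ltW.
rewrite -[RHS]ger0_norm// -sqrtr_sqr; congr Num.sqrt.
by rewrite !expr_div_n nm_sqr mulrDl mulfV// gt_eqF// exprn_gt0.
Qed.

(** The hyperbolic metrics |dw| / cos (Im w) of the strip and 2 |dz| / (1 - |z|^2) of the disc
    correspond under [Phi]. *)
Lemma cos_Phi z : nm z < 1 -> cos (complex.Im (Phi z)) = (1 - nm z ^+ 2) / 2 * nm (dPhi z).
Proof.
move=> z1; rewrite -[complex.Im (Phi z)]/(atan _) cos_atan_div ?Re_zeta_gt0// Re_zeta// nm_zeta /dPhi.
rewrite !nmM nmV nmM; field.
by rewrite (gt_eqF (zp0 z1)) (gt_eqF (zq0 z1)) (gt_eqF pq0).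
Qed.

Lemma Phi_strip z : `|complex.Im (Phi z)| < pi / 2.
Proof. by rewrite ltr_norml atan_gtNpi2 atan_ltpi2. Qed.

Lemma exp_Re_Phi z : nm z < 1 -> expR (complex.Re (Phi z)) = nm (p - q) * nm (z - p) / nm (z - q).
Proof.
move=> z1; have n0 : 0 < nm (zeta z).
  by rewrite nm_zeta divr_gt0 ?mulr_gt0 ?pq0 ?zp0 ?zq0.
rewrite -nm_zeta -[complex.Re (Phi z)]/(2^-1 * ln (nm (zeta z) ^+ 2)) lnXn// -[ln _ *+ 2]mulr_natl mulKf//.
by rewrite lnK.
Qed.

End poles.
End strip_map.

(** * Cutoffs and modes *)

Section cutoff.
Context (R : realType).
Local Notation C := R[i].
Local Notation nm := (@Normc.normc R).

Definition sd (z : C) : R := 1 - nm z ^+ 2.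

Lemma sd_gt0 z : nm z < 1 -> 0 < sd z.
Proof. by move=> z1; rewrite subr_gt0 exprn_ilt1 ?nm_ge0. Qed.

Lemma sd_le1 z : sd z <= 1.
Proof. by rewrite lerBlDr lerDl sqr_ge0. Qed.

Lemma sd_neq0 z : nm z < 1 -> (sd z)%:C != 0 :> C.
Proof. by move=> z1; rewrite -nm_eq0 nm_real normr_eq0 gt_eqF// sd_gt0. Qed.

Lemma wd_sdV z : nm z < 1 -> wd (fun z => ((sd z)^-1)%:C) z (z^J / (sd z)%:C ^+ 2) (z / (sd z)%:C ^+ 2).
Proof.
move=> z1.
have h : wd (fun z => (sd z)%:C) z (- z^J) (- z).
  have h0 := wdB (wd_cst 1 z) (wd_nm2 0 z).
  apply: wd_eq (wd_ext _ h0) _ _ => [w||]; rewrite ?subr0 ?sub0r//.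
  by rewrite rmorphB rmorph1.
have := @wdV _ (fun z => (sd z)%:C) _ _ _ (sd_neq0 z1) h.
rewrite !opprK => H; apply: wd_ext H => w; by rewrite fmorphV.
Qed.

Lemma lipr_sdV r : r < 1 -> lipr r (fun z : C => ((sd z)^-1)%:C).
Proof.
move=> r1; have [r0|r0] := leP 0 r; last first.
  by exists 0 => z w zr; have := le_trans (nm_ge0 z) zr; rewrite leNgt r0.
have c0 : 0 < 1 - r ^+ 2 by rewrite subr_gt0 exprn_ilt1.
apply: (@lipr_comp _ r sd (fun x => x^-1) ((1 - r ^+ 2) ^- 2)).
  have h := liprD (lipr_cst r 1) (liprN (lipr_nm2 r 0)).
  by apply: lipr_ext h => z _; rewrite subr0 -rmorphB.
move=> z w zr wr.
have sr x : nm x <= r -> 1 - r ^+ 2 <= sd x.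
  by move=> xr; rewrite lerD2l lerN2 ler_pXn2r ?nnegrE ?nm_ge0.
have := sr z zr; have := sr w wr; move: (sd z) (sd w) => x y yc xc.
have x0 := lt_le_trans c0 xc; have y0 := lt_le_trans c0 yc.
rewrite (_ : x^-1 - y^-1 = (x * y)^-1 * (y - x)); last by field; rewrite !gt_eqF.
rewrite normrM distrC; apply: ler_wpM2r => //.
rewrite gtr0_norm ?invr_gt0 ?mulr_gt0// lef_pV2 ?posrE ?mulr_gt0 ?exprn_gt0// expr2.
by apply: ler_pM => //; exact: ltW.
Qed.

Lemma conjMl (x y : C) : (x * y)^J = x^J * y^J.
Proof. exact: rmorphM. Qed.

Section level.
Variable n : nat.
Let k : R := n.+1%:R.
Let k0 : 0 < k. Proof. by rewrite ltr0n. Qed.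
Let k1 : 1 <= k. Proof. by rewrite ler1n. Qed.

Definition cu (z : C) : R := 1 - k^-1 * (sd z)^-1.
(* A C^2 cutoff vanishing near the unit circle; |drho| (1 - |z|^2) and
   |ddrho| (1 - |z|^2)^2 stay bounded, and tend to 0 pointwise, as [n] grows. *)
Definition rho (z : C) : R := pos (cu z) ^+ 3.
Definition drho (z : C) : C := (pos (cu z) ^+ 2)%:C * ((- (3 / k))%:C * (z^J * ((sd z)^-1)%:C ^+ 2)).
Definition ddrho (z : C) : C :=
  (2 * pos (cu z))%:C * (- k^-1%:C * (z / (sd z)%:C ^+ 2)) * ((- (3 / k))%:C * (z^J * ((sd z)^-1)%:C ^+ 2)) +
  (pos (cu z) ^+ 2)%:C * ((- (3 / k))%:C * (((sd z)^-1)%:C ^+ 2 + z^J * (2 * ((sd z)^-1)%:C * (z / (sd z)%:C ^+ 2)))).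

Lemma wd_cu z : nm z < 1 -> wd (fun z => (cu z)%:C) z (- k^-1%:C * (z^J / (sd z)%:C ^+ 2)) (- k^-1%:C * (z / (sd z)%:C ^+ 2)).
Proof.
move=> z1; have h := wdB (wd_cst 1 z) (wdZ k^-1%:C (wd_sdV z1)).
apply: wd_eq (wd_ext _ h) _ _ => [w||]; rewrite ?sub0r ?mulNr//.
by rewrite /cu rmorphB rmorphM rmorph1.
Qed.

Lemma wd_rho z : nm z < 1 -> wd (fun z => (rho z)%:C) z (drho z) (drho z)^J.
Proof.
move=> z1; have sC := sd_neq0 z1.
have XJ (x : R) : (x%:C ^+ 2)^J = x%:C ^+ 2 :> C by rewrite -rmorphXn conjc_real.
have dJ : (drho z)^J = (pos (cu z) ^+ 2)%:C * ((- (3 / k))%:C * (z * ((sd z)^-1)%:C ^+ 2)).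
  by rewrite /drho !conjRM conjMl conjcK XJ.
apply: wd_eq (wd_posX 1 (wd_cu z1)) _ _; rewrite ?dJ /drho (fmorphV (real_complex R) (sd z)) exprVn.
  by move: (k^-1) (pos (cu z)) (z^J) (_ ^- 2) => *; ring.
by move: (k^-1) (pos (cu z)) (_ ^- 2) => *; ring.
Qed.

Lemma lipr_cu r : r < 1 -> lipr r (fun z => (cu z)%:C).
Proof.
move=> r1; have h := liprD (lipr_cst r 1) (liprN (liprM (lipr_cst r k^-1%:C) (lipr_sdV r1))).
by apply: lipr_ext h => z _; rewrite /cu rmorphB rmorphM rmorph1.
Qed.

Lemma lipr_rho r : r < 1 -> lipr r (fun z => (rho z)%:C).
Proof. by move=> r1; apply: lipr_posX; exact: lipr_cu. Qed.

Lemma lipr_drho r : r < 1 -> lipr r drho.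
Proof.
move=> r1; apply: liprM; first by apply: lipr_posX; exact: lipr_cu.
apply: liprM; first exact: lipr_cst.
by apply: liprM; [apply/liprJ/lipr_id|apply: liprX; exact: lipr_sdV].
Qed.

Lemma cu_out z : nm z < 1 -> k * sd z <= 1 -> pos (cu z) = 0.
Proof.
move=> z1 ks; apply: pos0; rewrite subr_le0 -invfM -[leLHS]invr1 lef_pV2 ?posrE ?mulr_gt0 ?sd_gt0//.
Qed.

(** In the energy identity only the mixed derivative [ddrho] appears; the second z-derivative has
    merely to exist and to vanish where the cutoff does. *)
Lemma wd_drho z : nm z < 1 -> exists2 a, wd drho z a (ddrho z) & (k * sd z <= 1 -> a = 0).
Proof.
move=> z1; have sC := sd_neq0 z1.
have h2 := wd_posX 0 (wd_cu z1); have hs := wd_sdV z1.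
have h := wdM h2 (wdZ (- (3 / k))%:C (wdM (wdJ (wd_id z)) (wdM hs hs))).
eexists.
  apply: wd_eq (wd_ext _ h) _ _; first by move=> w; rewrite /drho expr2.
    reflexivity.
  rewrite /ddrho rmorph1 expr1 !expr2; ring.
by move=> ks; rewrite (cu_out z1 ks) !expr0n /= !(mulr0, mul0r, addr0).
Qed.

Lemma cut_out z : nm z < 1 -> k * sd z <= 1 -> [/\ rho z = 0, drho z = 0 & ddrho z = 0].
Proof.
by move=> z1 ks; rewrite /rho /drho /ddrho (cu_out z1 ks) !expr0n /= mulr0 !mul0r addr0.
Qed.

Lemma cu_bd z : nm z < 1 -> 0 <= pos (cu z) <= 1.
Proof.
move=> z1; rewrite pos_ge0 /pos ge_max ler01 andbT lerBlDr lerDl mulr_ge0 ?invr_ge0 ?ltW// sd_gt0//.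
Qed.

Lemma rho_bd z : nm z < 1 -> 0 <= rho z <= 1 /\ 1 - rho z <= 3 * (k * sd z)^-1.
Proof.
move=> z1; have /andP[c0 c1] := cu_bd z1; split.
  by apply/andP; split; [exact: exprn_ge0|exact: exprn_ile1].
have ks0 : 0 < k * sd z by rewrite mulr_gt0// sd_gt0.
have h : 1 - (k * sd z)^-1 <= pos (cu z) by rewrite /pos le_max invfM lexx.
have i0 : 0 < (k * sd z)^-1 by rewrite invr_gt0.
rewrite /rho; move: (pos _) (_^-1) c0 c1 h i0 => x y x0 x1 xy y0.
have : (1 - x) * (1 + x + x ^+ 2) <= y * 3.
  apply: ler_pM; rewrite ?subr_ge0 ?addr_ge0 ?sqr_ge0//; first by lra.
  by have : x ^+ 2 <= 1 by [rewrite exprn_ile1]; lra.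
rewrite (_ : (1 - x) * _ = 1 - x ^+ 3); last by ring.
lra.
Qed.

Lemma drho_bd z : nm z < 1 -> nm (drho z) * sd z <= 3 * (k * sd z)^-1 /\ nm (drho z) * sd z <= 3.
Proof.
move=> z1; have s0 := sd_gt0 z1; have /andP[c0 c1] := cu_bd z1.
have ks0 : 0 < k * sd z by rewrite mulr_gt0.
have h : nm (drho z) * sd z <= 3 * (k * sd z)^-1.
  rewrite /drho nmM nmM nmM nmX nmJ !nm_real normrX normrN !ger0_norm ?invr_ge0 ?divr_ge0 ?(ltW s0) ?(ltW k0)//.
  rewrite [leLHS](_ : _ = pos (cu z) ^+ 2 * nm z * (3 * (k * sd z)^-1)); last by field; rewrite !gt_eqF.
  rewrite ler_piMl ?mulr_ge0 ?invr_ge0 ?(ltW ks0)// mulr_ile1 ?sqr_ge0 ?nm_ge0 ?exprn_ile1//; exact: ltW.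
split=> //; have [ks|ks] := leP (k * sd z) 1.
  by have [_ -> _] := cut_out z1 ks; rewrite nm0 mul0r.
apply: (le_trans h); rewrite -[leRHS]mulr1 ler_pM2l// invf_le1//; exact: ltW.
Qed.

(** 15 = 6 + 9: the derivative falls on the square of [pos (cu z)], or on the explicit factor behind
    it. *)
Lemma ddrho_bd z : nm z < 1 -> nm (ddrho z) * sd z ^+ 2 <= 15 * (k * sd z)^-1 /\ nm (ddrho z) * sd z ^+ 2 <= 15.
Proof.
move=> z1; have s0 := sd_gt0 z1; have /andP[c0 c1] := cu_bd z1.
have ks0 : 0 < k * sd z by rewrite mulr_gt0.
have [ks|ks] := leP (k * sd z) 1.
  by have [_ _ ->] := cut_out z1 ks; rewrite nm0 mul0r mulr_ge0// invr_ge0 ltW.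
suff h : nm (ddrho z) * sd z ^+ 2 <= 15 * (k * sd z)^-1.
  split=> //; apply: (le_trans h); rewrite -[leRHS]mulr1 ler_pM2l// invf_le1//; exact: ltW.
have n0 := nm_ge0 z; have n1 := ltW z1; have s1 := sd_le1 z.
have a1 : nm ((2 * pos (cu z))%:C * (- k^-1%:C * (z / (sd z)%:C ^+ 2)) * ((- (3 / k))%:C * (z^J * ((sd z)^-1)%:C ^+ 2)))
   = 6 * pos (cu z) * nm z ^+ 2 * ((k * sd z)^-1 * (k * sd z)^-1) * sd z ^- 2.
  rewrite !(nmM, nmX, nmN, nmV, nm_real, nmJ) normrN !ger0_norm ?invr_ge0 ?divr_ge0 ?mulr_ge0 ?(ltW s0)//.
  by field; rewrite !gt_eqF.
have a2 : nm ((pos (cu z) ^+ 2)%:C * ((- (3 / k))%:C * (((sd z)^-1)%:C ^+ 2 + z^J * (2 * ((sd z)^-1)%:C * (z / (sd z)%:C ^+ 2)))))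
   <= (3 * sd z + 6) * (k * sd z)^-1 * sd z ^- 2.
  rewrite nmM nm_real ger0_norm ?sqr_ge0// nmM nm_real normrN ger0_norm ?divr_ge0//.
  have := nmD (((sd z)^-1)%:C ^+ 2) (z^J * (2 * ((sd z)^-1)%:C * (z / (sd z)%:C ^+ 2))).
  rewrite !(nmM, nmX, nmN, nmV, nm_real, nmJ) nm_nat !ger0_norm ?invr_ge0 ?(ltW s0)// => h.
  have h2 : (sd z)^-1 ^+ 2 + nm z * (2 * (sd z)^-1 * (nm z / sd z ^+ 2)) <= (sd z + 2) * (sd z)^-1 * sd z ^- 2.
    have -> : (sd z + 2) * (sd z)^-1 * sd z ^- 2 = (sd z)^-1 ^+ 2 + 2 * (sd z)^-1 * (1 / sd z ^+ 2).
      by field; rewrite gt_eqF.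
    rewrite lerD2l mulrCA; apply: ler_wpM2l; first by rewrite mulr_ge0// invr_ge0 ltW.
    rewrite mulrA; apply: ler_wpM2r; first by rewrite invr_ge0 exprn_ge0// ltW.
    by rewrite -expr2 exprn_ile1.
  have h3 := le_trans h h2.
  apply: (@le_trans _ _ (1 * (3 / k * ((sd z + 2) * (sd z)^-1 * sd z ^- 2)))).
    apply: ler_pM; rewrite ?sqr_ge0 ?exprn_ile1//.
      by apply: mulr_ge0; [exact: divr_ge0|exact: nm_ge0].
    by apply: ler_wpM2l => //; exact: divr_ge0.
  by rewrite mul1r le_eqVlt; apply/orP; left; apply/eqP; field; rewrite !gt_eqF.
have : nm (ddrho z) <= 6 * pos (cu z) * nm z ^+ 2 * ((k * sd z)^-1 * (k * sd z)^-1) * sd z ^- 2 + (3 * sd z + 6) * (k * sd z)^-1 * sd z ^- 2.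
  by apply: (le_trans (nmD _ _)); rewrite a1; exact: lerD.
move/(ler_wpM2r (exprn_ge0 2 (ltW s0))); rewrite mulrDl -!mulrA !mulVf ?gt_eqF ?exprn_gt0//.
rewrite !mulr1 => /le_trans; apply.
have j1 : (k * sd z)^-1 <= 1 by rewrite invf_le1// ltW.
have j0 : 0 <= (k * sd z)^-1 by rewrite invr_ge0 ltW.
move: (_^-1) j0 j1 => j j0 j1.
have e1 : 6 * (pos (cu z) * (nm z ^+ 2 * (j * j))) <= 6 * j.
  rewrite ler_pM2l// -[leRHS]mul1r; apply: ler_pM => //.
    by rewrite mulr_ge0 ?sqr_ge0// mulr_ge0.
  rewrite -[leRHS]mul1r; apply: ler_pM; rewrite ?sqr_ge0 ?mulr_ge0 ?exprn_ile1//.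
  by rewrite ler_piMl.
have e2 : (3 * sd z + 6) * j <= 9 * j by apply: ler_wpM2r => //; lra.
by move: e1; rewrite expr2 -!mulrA => e1; apply: (le_trans (lerD e1 e2)); lra.
Qed.

(** For |z| >= 1 - 1 / (2 k) one has k (1 - |z|^2) <= 1, so functions carrying the cutoff are test
    functions with compact support in the disc. *)
Lemma cut_int (F a b : C -> C) : (forall r, r < 1 -> lipr r F) -> (forall z, nm z < 1 -> wd F z (a z) (b z)) ->
  (forall z, nm z < 1 -> k * sd z <= 1 -> [/\ F z = 0, a z = 0 & b z = 0]) ->
  [/\ cintb (zext a), cintb (zext b), cint (zext a) = 0 & cint (zext b) = 0].
Proof.
move=> lF wF F0; pose r := 1 - k^-1 / 2; pose r' := (1 + r) / 2.
have i0 : 0 < k^-1 by rewrite invr_gt0.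
have i1 : k^-1 <= 1 by rewrite invf_le1.
have r1 : r < 1 by rewrite /r ltrBlDr ltrDl divr_gt0.
have r0 : 0 <= r by rewrite subr_ge0 ler_pdivrMr// (le_trans i1)// mul1r ler1n.
have rr : r < r' by rewrite /r'; lra.
have r'1 : r' < 1 by rewrite /r'; lra.
apply: (@cint_test _ r r' (zext F)); split=> //.
- by apply: lipr_ext (lF _ r'1) => z zr; rewrite zextE// (le_lt_trans zr).
- move=> z zr; have z1 := lt_trans zr r'1; rewrite !zextE//.
  by apply: wd_disc (wF z z1) => // w w1; rewrite zextE.
move=> z rz; have [z1|z1] := leP 1 (nm z); first by rewrite !zext0.
rewrite !zextE//; apply: F0 => //.
rewrite -(@ler_pM2l _ k^-1)// mulKf ?gt_eqF// mulr1 /sd lerBlDr.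
have : r ^+ 2 <= nm z ^+ 2 by rewrite ler_pXn2r ?nnegrE ?nm_ge0.
rewrite (_ : r ^+ 2 = 1 - k^-1 + (k^-1 / 2) ^+ 2); last by rewrite /r; field.
by have := sqr_ge0 (k^-1 / 2); move: ((k^-1 / 2) ^+ 2) (k^-1) (nm z ^+ 2) => A B D; lra.
Qed.

End level.

(** * The damped modes and their square integrability *)

Section mode.
Variables (p q : C).
Hypotheses (p1 : nm p = 1) (q1 : nm q = 1) (pq : p != q).
Variables (t e : R).
Hypotheses (e0 : 0 < e) (e2 : e <= 2^-1).
Local Notation Phi := (Phi p q).
Local Notation dPhi := (dPhi p q).

(** The factor Phi' makes |mode|^2 dA the pull-back of the area integral of |e^(itw) eta(w)|^2 over
    the strip. *)
Definition mode : C -> C := zext (fun z => cexp ('i * (t%:C * Phi z)) * (eta e (Phi z) * dPhi z)).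

Lemma hol_cexp_Phi (c : C) : hol (fun z => cexp (c * Phi z)).
Proof.
have H := @hol_comp R (fun z => c * Phi z) (@cexp R); apply: H.
  by apply: holM; [exact: hol_cst|exact: hol_Phi].
by move=> z _; exists (cexp (c * Phi z)); exact: wd_cexp.
Qed.

Lemma hol_eta_Phi : hol (fun z => eta e (Phi z)).
Proof.
apply: (@hol_comp _ Phi (eta e)); first exact: hol_Phi.
by move=> z z1; have [_ _ [d Hd _]] := eta_spec e0 e2 (Phi_strip p q z); exists d.
Qed.

Lemma hol_mode : hol mode.
Proof.
apply: hol_zext; apply: holM; last by apply: holM; [exact: hol_eta_Phi|exact: hol_dPhi].
by apply: hol_disc (hol_cexp_Phi ('i * t%:C)) => z _; rewrite mulrA.
Qed.

Lemma nm_cexp_iPhi z : nm (cexp ('i * (t%:C * Phi z))) = expR (- (t * complex.Im (Phi z))).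
Proof.
by rewrite nm_cexp; congr expR; rewrite !(cReM, cImM) /= !(mul0r, mul1r, sub0r, addr0).
Qed.

(* An integrable majorant of a function growing like |z - p|^{-a} + |z - q|^{-a}, a < 2,
   as a sum over boxes shrinking to the two points. *)
Fixpoint boxsum (x : R) (n : nat) (z : C) : R :=
  if n is m.+1 then boxsum x m z + (4 * x) ^+ m * (boxi p (2 / 2 ^+ m) z + boxi q (2 / 2 ^+ m) z) else 0.

(** The m-th term integrates to 2 * 4 (2 / 2^m)^2 (4 x)^m = 32 x^m, so the integrals form a
    geometric series. *)
Lemma boxsum_int (x : R) n : 0 <= x -> rintb (boxsum x n) /\ (1 - x) * rint (boxsum x n) = 32 * (1 - x ^+ n).
Proof.
move=> x0; elim: n => [|n [ih1 ih2]].
  split; first exact: rintb0.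
  by rewrite (@rint_ext _ _ (fun=> 0))// rint0 mulr0 expr0 subrr mulr0.
have b0 : 0 <= 2 / 2 ^+ n :> R by rewrite divr_ge0// exprn_ge0.
have i1 := rintbD (rintb_boxi p (2 / 2 ^+ n)) (rintb_boxi q (2 / 2 ^+ n)).
have i2 := rintbZ ((4 * x) ^+ n) i1.
split; first exact: (rintbD ih1 i2).
rewrite [X in rint X](_ : _ = fun z => boxsum x n z + (4 * x) ^+ n * (boxi p (2 / 2 ^+ n) z + boxi q (2 / 2 ^+ n) z))//.
rewrite (rintD ih1 i2) (rintZ _ i1) (rintD (rintb_boxi _ _) (rintb_boxi _ _)) !rint_boxi//.
rewrite mulrDr ih2 (exprS x n) exprMn.
have -> : 4 ^+ n = (2 ^+ n) ^+ 2 :> R by rewrite -exprM mulnC exprM expr2 -natrM.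
have : 2 ^+ n != 0 :> R by rewrite expf_neq0.
by move: (2 ^+ n) (x ^+ n) => a b a0; field.
Qed.

Lemma boxsum_ge (x : R) n m z : 0 <= x -> (m < n)%N ->
  (4 * x) ^+ m * (boxi p (2 / 2 ^+ m) z + boxi q (2 / 2 ^+ m) z) <= boxsum x n z.
Proof.
move=> x0; have t0 k : 0 <= (4 * x) ^+ k * (boxi p (2 / 2 ^+ k) z + boxi q (2 / 2 ^+ k) z).
  by rewrite mulr_ge0 ?addr_ge0 ?boxi_ge0// exprn_ge0// mulr_ge0.
have b0 k : 0 <= boxsum x k z by elim: k => //= k ih; exact: addr_ge0.
elim: n => // n ih; rewrite ltnS leq_eqVlt => /orP[/eqP ->|mn] /=; first by rewrite lerDr.
by apply: (le_trans (ih mn)); rewrite lerDl.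
Qed.

(** m is the least integer with 2^-m < r. Then D <= 2 * 2^m and E <= (2 c0 / 2^m)^e, so (E D)^2
    grows at most like (4 x)^m with x = 2^(-2e) < 1: the damping just beats the double pole. *)
Lemma shell (X r c0 D E : R) : 0 < r -> r <= 2 -> 0 <= E -> 0 <= D -> E <= expR (e * X) -> 0 < c0 -> expR X <= c0 * r -> D <= 2 / r ->
  exists m, r <= 2 / 2 ^+ m /\ (E * D) ^+ 2 <= 4 * expR (2 * e * ln (2 * c0)) * (4 * expR (- (2 * e * ln 2))) ^+ m.
Proof.
move=> r0 r2 E0 D0 EX c00 Xr Dr.
have pow n : 0 < 2 ^+ n :> R by rewrite exprn_gt0.
have ex : exists m, (2 ^+ m)^-1 < r.
  exists (Num.bound r^-1); have := archi_boundP (ltW (eqbRL (invr_gt0 r) r0)) => h.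
  rewrite -[ltRHS]invrK ltf_pV2 ?posrE ?invr_gt0//; apply: (lt_le_trans h).
  by rewrite -natrX ler_nat ltnW// ltn_expl.
have [m mP mmin] := ex_minnP ex.
have rm : r <= 2 / 2 ^+ m.
  case: m mP mmin => [_ _|m mP mmin]; first by rewrite expr0 divr1.
  rewrite exprS invfM mulrA mulfV// mul1r leNgt; apply/negP => /mmin; by rewrite ltnn.
exists m; split=> //.
have D4 : D ^+ 2 <= 4 * 4 ^+ m.
  have -> : 4 * 4 ^+ m = (2 * 2 ^+ m) ^+ 2 :> R by rewrite exprMn -exprM (mulnC m) exprM -!natrX.
  rewrite ler_pXn2r ?nnegrE ?mulr_ge0 ?(ltW (pow _))//; apply: (le_trans Dr).
  rewrite ler_pdivrMr// -mulrA -{1}(mulr1 2) ler_pM2l// -ler_pdivrMl// mulr1; exact: ltW.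
have Xb : X <= ln (2 * c0) - m%:R * ln 2.
  rewrite -ler_expR expRD lnK ?posrE ?mulr_gt0// expRN expRM_natl lnK ?posrE//.
  apply: (le_trans Xr); rewrite (mulrC 2) -mulrA ler_pM2l//.
have E2 : E ^+ 2 <= expR (2 * e * ln (2 * c0)) * expR (- (2 * e * ln 2)) ^+ m.
  apply: (@le_trans _ _ (expR (e * X) ^+ 2)); first by rewrite ler_pXn2r ?nnegrE ?expR_ge0.
  rewrite -!expRM_natl -expRD ler_expR.
  have := ler_wpM2l (ltW e0) Xb; move: (e * X) => eX h.
  rewrite (_ : 2 * e * ln (2 * c0) + _ = 2%:R * (e * (ln (2 * c0) - m%:R * ln 2))); last by ring.
  by rewrite ler_pM2l.
rewrite !exprMn mulrC; apply: (le_trans (ler_pM (sqr_ge0 _) (sqr_ge0 _) D4 E2)).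
by rewrite le_eqVlt; apply/orP; left; apply/eqP; ring.
Qed.

Lemma cexp_iPhi_bd z : expR (- (t * complex.Im (Phi z))) <= expR (2 * `|t|) /\ expR (t * complex.Im (Phi z)) <= expR (2 * `|t|).
Proof.
have h : `|t * complex.Im (Phi z)| <= 2 * `|t|.
  rewrite normrM mulrC ler_wpM2r// (le_trans (ltW (Phi_strip p q z)))// ltW//; exact: pihalf_lt2.
rewrite !ler_expR; move: h; rewrite ler_norml => /andP[h1 h2]; split; lra.
Qed.

(** One of the poles is at distance at least |p - q| / 2. With respect to the other pole c, |Phi'|
    <= 2 / |z - c|, while e^(Re Phi) or its inverse is bounded by a multiple of |z - c|, so that
    [eta] decays like |z - c|^e. *)
Lemma mode_shell z : nm z < 1 -> exists m, exists c, (c = p \/ c = q) /\ nm (z - c) <= 2 / 2 ^+ m /\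
  nm (mode z) ^+ 2 <= expR (2 * `|t|) ^+ 2 * (4 * expR (2 * e * ln (2 * (2 + 2 / nm (p - q) ^+ 2)))) * (4 * expR (- (2 * e * ln 2))) ^+ m.
Proof.
move=> z1; set d := nm (p - q); have d0 : 0 < d by exact: pq0.
have zp := zp0 p1 z1; have zq := zq0 q1 z1.
have [et _ _] := eta_spec e0 e2 (Phi_strip p q z).
have mE : nm (mode z) ^+ 2 = expR (- (t * complex.Im (Phi z))) ^+ 2 * (nm (eta e (Phi z)) * nm (dPhi z)) ^+ 2.
  by rewrite /mode zextE// nmM nm_cexp_iPhi nmM exprMn.
have [cb _] := cexp_iPhi_bd z.
have tri : d <= nm (z - p) + nm (z - q).
  by rewrite /d (_ : p - q = (z - q) - (z - p)); [apply: le_trans (nmB _ _) _; rewrite addrC|ring].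
have dE : nm (dPhi z) = d / (nm (z - q) * nm (z - p)) by rewrite /dPhi nmM nmV nmM.
have xE := exp_Re_Phi p1 q1 pq z1; rewrite -/d in xE.
have c0 : 0 < 2 + 2 / d ^+ 2 by rewrite addr_gt0// divr_gt0// exprn_gt0.
have n2 c : nm c = 1 -> nm (z - c) <= 2 by move=> c1; apply: (le_trans (nmB _ _)); rewrite c1; lra.
have fin m (S : (nm (eta e (Phi z)) * nm (dPhi z)) ^+ 2 <=
    4 * expR (2 * e * ln (2 * (2 + 2 / d ^+ 2))) * (4 * expR (- (2 * e * ln 2))) ^+ m) :
    nm (mode z) ^+ 2 <= expR (2 * `|t|) ^+ 2 * (4 * expR (2 * e * ln (2 * (2 + 2 / d ^+ 2)))) * (4 * expR (- (2 * e * ln 2))) ^+ m.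
  rewrite mE -mulrA; apply: ler_pM => //; rewrite ?sqr_ge0//.
  by rewrite ler_pXn2r ?nnegrE ?expR_ge0.
have half a b : 0 < a -> 0 < b -> d / 2 <= a -> d / (a * b) <= 2 / b.
  move=> a0 b0 ha; rewrite ler_pdivrMr ?mulr_gt0// (_ : 2 / b * (a * b) = 2 * a); last by field; rewrite gt_eqF.
  by move: ha; rewrite ler_pdivrMr// mulrC.
have [h|h] := leP (d / 2) (nm (z - q)).
  have b1 : nm (eta e (Phi z)) <= expR (e * complex.Re (Phi z)).
    by apply: (le_trans et); rewrite ler_expR -mulrN ler_pM2l// lerNl ler_normr lexx orbT.
  have b2 : expR (complex.Re (Phi z)) <= (2 + 2 / d ^+ 2) * nm (z - p).
    rewrite xE ler_pdivrMr//; apply: (@le_trans _ _ (2 * nm (z - p) * (d / 2))).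
      by rewrite le_eqVlt; apply/orP; left; apply/eqP; field.
    apply: ler_pM => //; [exact: mulr_ge0|by rewrite divr_ge0// ltW|].
    by rewrite ler_pM2r// lerDl divr_ge0// exprn_ge0// ltW.
  have b3 : nm (dPhi z) <= 2 / nm (z - p) by rewrite dE; exact: half.
  have [m [m1 m2]] := shell zp (n2 _ p1) (nm_ge0 _) (nm_ge0 _) b1 c0 b2 b3.
  by exists m, p; split; [left|split => //; exact: fin].
have h' : d / 2 <= nm (z - p) by lra.
have b1 : nm (eta e (Phi z)) <= expR (e * - complex.Re (Phi z)).
  by apply: (le_trans et); rewrite ler_expR -mulrN ler_pM2l// lerN2 ler_norm.
have b2 : expR (- complex.Re (Phi z)) <= (2 + 2 / d ^+ 2) * nm (z - q).
  rewrite expRN xE invf_div ler_pdivrMr ?mulr_gt0//.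
  apply: (@le_trans _ _ (2 / d ^+ 2 * nm (z - q) * (d * (d / 2)))).
    by rewrite le_eqVlt; apply/orP; left; apply/eqP; field; rewrite gt_eqF.
  have dn := ltW d0; have q0 := ltW zq.
  have f0 : 0 <= 2 / d ^+ 2 by rewrite divr_ge0// exprn_ge0.
  apply: ler_pM; [exact: mulr_ge0|by rewrite mulr_ge0// divr_ge0| |].
    by apply: ler_wpM2r => //; rewrite lerDr.
  by apply: ler_wpM2l.
have b3 : nm (dPhi z) <= 2 / nm (z - q) by rewrite dE mulrC mulrC (mulrC (nm (z - q))); exact: half.
have [m [m1 m2]] := shell zq (n2 _ q1) (nm_ge0 _) (nm_ge0 _) b1 c0 b2 b3.
by exists m, q; split; [right|split => //; exact: fin].
Qed.

Lemma meas_minr (f g : C -> R) : meas f -> meas g -> meas (fun z => Num.min (f z) (g z)).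
Proof. by move=> mf mg; exact: measurable_minr. Qed.

Lemma mode_out z : 1 <= nm z -> mode z = 0.
Proof. exact: zext0. Qed.

Lemma mode_meas : cmeas mode.
Proof. by apply: hol_meas; [exact: hol_mode|exact: mode_out]. Qed.

(** Truncating |mode|^2 by multiples of [boxsum] gives integrable functions with bounded integrals;
    [mode_shell] makes the truncation inactive at each point from some n on, and Fatou concludes. *)
Lemma mode_l2 : rintb (fun z => nm (mode z) ^+ 2).
Proof.
pose x := expR (- (2 * e * ln 2)) : R.
pose c : R := expR (2 * `|t|) ^+ 2 * (4 * expR (2 * e * ln (2 * (2 + 2 / nm (p - q) ^+ 2)))).
have x0 : 0 <= x by exact: expR_ge0.
have x1 : x < 1.
  have l2 : 0 < ln 2 :> R by apply: ln_gt0; rewrite ltr1n.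
  by rewrite /x -[ltRHS]expR0 ltr_expR oppr_lt0; apply: mulr_gt0 => //; exact: mulr_gt0.
have c0 : 0 <= c by rewrite mulr_ge0 ?sqr_ge0// mulr_ge0// expR_ge0.
pose gn n z := Num.min (nm (mode z) ^+ 2) (c * boxsum x n z).
have bi n := boxsum_int n x0.
have b0 n z : 0 <= boxsum x n z.
  by elim: n => //= n ih; rewrite addr_ge0// mulr_ge0 ?addr_ge0 ?boxi_ge0// exprn_ge0// mulr_ge0.
have g0 n z : 0 <= gn n z by rewrite le_min sqr_ge0 mulr_ge0.
have gi n : rintb (gn n).
  apply: (rintb_le _ _ (rintbZ c (bi n).1)).
    apply: meas_minr; first by apply: measX; apply: meas_nm; exact: mode_meas.
    exact: rintb_meas (rintbZ c (bi n).1).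
  by move=> z; rewrite ger0_norm// ge_min lexx orbT.
have [||//] := @rint_fatou R gn (fun z => nm (mode z) ^+ 2) (c * (32 / (1 - x))) gi g0.
  move=> z; have [z1|z1] := leP 1 (nm z).
    have -> : (fun n => gn n z) = fun=> nm (mode z) ^+ 2; last exact: cvg_cst.
    by apply/funext => n; rewrite /gn (mode_out z1) nm0 expr0n /= min_l// mulr_ge0.
  have [m [c' [c'E [zc mz]]]] := mode_shell z1.
  apply: cvg_near_cst; exists m.+1 => // n /= mn; rewrite /gn min_l//.
  apply: (le_trans mz); rewrite -/c -/x; apply: (le_trans _ (ler_wpM2l c0 (boxsum_ge z x0 mn))).
  rewrite -[leLHS]mulr1 -mulrA; apply: ler_wpM2l => //; apply: ler_wpM2l; first by rewrite exprn_ge0// mulr_ge0.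
  by case: c'E zc => -> zc; rewrite (boxi_nm zc) ?lerDl ?lerDr boxi_ge0.
move=> n; have [bi1 bi2] := bi n.
apply: (le_trans (rint_le (gi n) (rintbZ c bi1) _)).
  by move=> z; rewrite ge_min lexx orbT.
rewrite (rintZ _ bi1); apply: ler_wpM2l => //.
rewrite ler_pdivlMr ?subr_gt0// mulrC bi2 -[leRHS]mulr1 ler_pM2l// lerBlDr lerDl exprn_ge0//.
Qed.

End mode.
End cutoff.

(** * Approximate eigenfunctions and the energy estimate *)

Section modes.
Context (R : realType).
Local Notation C := R[i].
Local Notation nm := (@Normc.normc R).
Local Notation hp := (@pi R / 2).
Variables (p q : C).
Hypotheses (p1 : nm p = 1) (q1 : nm q = 1) (pq : p != q).
Variable (t : R).
Local Notation Phi := (Phi p q).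
Local Notation dPhi := (dPhi p q).

(** The strip coordinate Im Phi, set to 0 off the disc so that it is measurable on the whole
    plane. *)
Definition yy (z : C) : R := complex.Im (zext Phi z).

Lemma meas_yy : meas yy.
Proof.
have [_ h] // := hol_meas (hol_zext (hol_Phi p1 q1 pq)) (fun z => @zext0 _ _ z).
Qed.

Lemma yyE z : nm z < 1 -> yy z = complex.Im (Phi z).
Proof. by move=> z1; rewrite /yy zextE. Qed.

Lemma yy_strip z : nm z < 1 -> `|yy z| <= hp.
Proof. by move=> z1; rewrite yyE// ltW// Phi_strip. Qed.

Lemma yy_in3 z : nm z < 1 -> - 3 < yy z < 3.
Proof. by move=> z1; apply: in3; exact: yy_strip. Qed.

Lemma cos_yy z : nm z < 1 -> cos (yy z) = sd z / 2 * nm (dPhi z).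
Proof. by move=> z1; rewrite yyE// cos_Phi. Qed.

Lemma rd_der (f f' : R -> R) x : der f f' -> - 3 < x < 3 -> rd f x (f' x).
Proof. by move=> h x3; apply: is_derive_rd; exact: h. Qed.

Lemma wd_yy z : nm z < 1 -> wd (fun z => (yy z)%:C) z (dPhi z / (2 * 'i)) (- (dPhi z)^J / (2 * 'i)).
Proof.
move=> z1; have h : wd (zext Phi) z (dPhi z) 0.
  by apply: wd_disc (wd_Phi p1 q1 pq z1) => // w w1; rewrite zextE.
by apply: wd_eq (wd_Im h) _ _; rewrite ?conjc0 ?subr0 ?sub0r.
Qed.

Lemma lipr_yy r : r < 1 -> lipr r (fun z => (yy z)%:C).
Proof.
move=> r1; apply: lipr_Im; apply: hol_lipr r1; apply: hol_zext; exact: hol_Phi.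
Qed.

Lemma der_lip (f f' : R -> R) (W : R) : der f f' -> (forall y, `|y| <= hp -> `|f' y| <= W) ->
  forall x y, `|x| <= hp -> `|y| <= hp -> `|f x - f y| <= W * `|x - y|.
Proof.
move=> df fW; suff H x y : `|x| <= hp -> `|y| <= hp -> x <= y -> `|f x - f y| <= W * `|x - y|.
  move=> x y xh yh; have [xy|/ltW yx] := leP x y; first exact: H.
  by rewrite distrC (distrC x); exact: H.
move=> xh yh xy; have /andP[x3 _] := in3 xh; have /andP[_ y3] := in3 yh.
have dW c : der (fun x : R => c * x) (fun=> c).
  by apply: der_eq (derZ c (@der_id R)) _ => u; rewrite mulr1.
have B u : x <= u <= y -> - W <= f' u <= W.
  move=> /andP[xu uy]; rewrite -ler_norml; apply: fW.
  move: xh yh; rewrite !ler_norml => /andP[h1 _] /andP[_ h2].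
  by rewrite (le_trans h1 xu) (le_trans uy h2).
have l1 := diff_le x3 xy y3 df (dW W) (fun u hu => (andP (B u hu)).2).
have l2 := diff_le x3 xy y3 (dW (- W)) df (fun u hu => (andP (B u hu)).1).
by rewrite distrC (distrC x) (ger0_norm (_ : 0 <= y - x)) ?subr_ge0// ler_norml; apply/andP; split; lra.
Qed.

Lemma lipr_fyy (f f' : R -> R) (W : R) r : der f f' -> (forall y, `|y| <= hp -> `|f' y| <= W) -> r < 1 ->
  lipr r (fun z => (f (yy z))%:C).
Proof.
move=> df fW r1; apply: (lipr_comp (K := W) (lipr_yy r1)) => z w zr wr.
by apply: (der_lip df fW); apply: yy_strip; exact: le_lt_trans r1.
Qed.

(** Division by the undamped mode e^(it Phi); the result is holomorphic, and its conjugate is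
    annihilated by the z-derivative. *)
Definition untwist (f : C -> C) (z : C) : C := cexp (- ('i * t%:C) * Phi z) * f z.

Lemma hol_untwist f : hol f -> hol (untwist f).
Proof. by move=> hf; apply: holM => //; exact: hol_cexp_Phi. Qed.

Lemma nm_untwist f z : nm z < 1 -> nm (untwist f z) = expR (t * yy z) * nm (f z).
Proof.
move=> z1; rewrite nmM nm_cexp yyE//; congr (expR _ * _).
by rewrite !(cReM, cImM, cReN, cImN) /= !(mul0r, mul1r, sub0r, addr0, subr0, mulr0, oppr0, mulNr, opprK, add0r).
Qed.

Lemma expty z : nm z < 1 -> expR (t * yy z) <= expR (2 * `|t|) /\ expR (- (t * yy z)) <= expR (2 * `|t|).
Proof. by move=> z1; rewrite yyE//; have [] := cexp_iPhi_bd p q t z. Qed.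

Lemma wyE z : wexp t (yy z) = expR (- (t * yy z)) ^+ 2.
Proof. by rewrite /wexp -expRM_natl; congr expR; ring. Qed.

Let W4 : R := expR (4 * `|t|).
Let W4E : W4 = expR (2 * `|t|) ^+ 2.
Proof. by rewrite /W4 -expRM_natl; congr expR; ring. Qed.

Lemma lipr_meas (F : C -> C) : (forall r, r < 1 -> lipr r F) -> cmeas (zext F).
Proof.
move=> lF; apply: (cmeas_open (@disc_open_nm R)) => [z /= /negP|z /= z1 e e0].
  by rewrite -leNgt; exact: zext0.
pose r := (1 + nm z) / 2; have r1 : r < 1 by rewrite /r; lra.
have zr : nm z < r by rewrite /r; lra.
have [L L0 HL] := lipr_ge0 (lF r r1).
have LL : 0 < L + 1 by rewrite ltr_wpDl.
exists (Num.min (r - nm z) (e / (L + 1))); first by rewrite lt_min subr_gt0 zr divr_gt0.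
move=> w; rewrite lt_min => /andP[w1 w2].
have wr : nm w <= r by rewrite (_ : w = (w - z) + z); [apply: (le_trans (nmD _ _)); lra|ring].
rewrite !zextE//; last exact: le_lt_trans r1.
apply: (le_lt_trans (HL _ _ wr (ltW zr))).
move: w2; rewrite ltr_pdivlMr// => w2; apply: le_lt_trans w2.
by rewrite mulrC; apply: ler_wpM2l => //; rewrite lerDl.
Qed.

Lemma le_inv_ccvg (u : nat -> C) l (c s : R) : 0 < s -> (forall n, nm (u n - l) <= c * (n.+1%:R * s)^-1) -> ccvg u l.
Proof.
move=> s0 H; apply: (ccvg_le H).
rewrite -[X in _ --> X](mulr0 (c * s^-1)).
have -> : (fun n : nat => c * (n.+1%:R * s)^-1) = fun n => c * s^-1 * n.+1%:R^-1.
  by apply/funext => n; rewrite invfM mulrA mulrAC.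
by apply: cvgMr; exact: (@cvg_harmonic R).
Qed.

(** * The damped modes as approximate eigenfunctions *)

Section R3.
Variables (e : R) (h : R -> R) (m C0 : R) (A : R -> R).
Hypotheses (e0 : 0 < e) (e2 : e <= 2^-1) (ch : continuous h) (h01 : forall y, 0 <= h y <= 1) (m01 : 0 <= m <= 1).
Hypotheses (dA : der A (fun y => (h y - m) * wexp t y)) (C00 : 0 <= C0) (AC : forall y, `|y| <= hp -> `|A y| <= C0 * cos y).
Variable (g : C -> C).
Hypotheses (hg : hol g) (g0 : forall z, 1 <= nm z -> g z = 0) (ig : rintb (fun z => nm (g z) ^+ 2)).
Local Notation md := (mode p q t e).

Lemma A'_bd y : `|y| <= hp -> `|(h y - m) * wexp t y| <= W4.
Proof.
move=> yh; rewrite normrM (gtr0_norm (wexp_gt0 t y)) -[leRHS]mul1r.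
apply: ler_pM => //; [exact: ltW (wexp_gt0 _ _)| |exact: wexp_bd].
by have /andP[? ?] := h01 y; have /andP[? ?] := m01; rewrite ler_norml; apply/andP; split; lra.
Qed.

Lemma prod_bd z : nm z < 1 -> nm (eta e (Phi z)) * nm (untwist g z) * nm (dPhi z) <= W4 * (nm (md z) * nm (g z)).
Proof.
move=> z1; rewrite nm_untwist// /mode zextE// nmM nm_cexp_iPhi nmM -yyE//.
have e3 : expR (t * yy z) = expR (- (t * yy z)) * expR (t * yy z) ^+ 2.
  by rewrite expr2 mulrA -expRD addNr expR0 mul1r.
have [b1 _] := expty z1.
have b2 : expR (t * yy z) ^+ 2 <= W4 by rewrite W4E ler_pXn2r ?nnegrE ?expR_ge0.
rewrite e3; move: (expR (- (t * yy z))) (expR_ge0 (- (t * yy z))) => X X0.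
have := ler_wpM2r (_ : 0 <= X * nm (eta e (Phi z)) * nm (dPhi z) * nm (g z)) b2.
move=> H; rewrite [leLHS](_ : _ = expR (t * yy z) ^+ 2 * (X * nm (eta e (Phi z)) * nm (dPhi z) * nm (g z))); last by ring.
rewrite [leRHS](_ : _ = W4 * (X * nm (eta e (Phi z)) * nm (dPhi z) * nm (g z))); last by ring.
by apply: H; do !apply: mulr_ge0.
Qed.

Lemma cintb_mg (k : C -> R) : meas k -> (forall z, 0 <= k z <= 1) -> cintb (fun z => (k z)%:C * (md z * (g z)^J)).
Proof.
move=> mk k01; apply: cintb_l2 => //; [exact: mode_meas|exact: hol_meas|exact: mode_l2].
Qed.

Lemma rintb_mg : rintb (fun z => nm (md z) * nm (g z)).
Proof.
have := cintb_nm (cintb_mg (meas_cst 1) (@one01 R)); apply: rintb_ext => z.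
by rewrite rmorph1 mul1r nmM nmJ.
Qed.

(* With A' = (h - m) e^{-2ty} and A = 0 at both ends, integrate the z-derivative of
   rho A(y) eta(Phi) conj(e^{-it Phi} g) and let rho tend to 1: since g is holomorphic,
   only the term with eta', of size e, remains. *)
Lemma quasi_mode :
  nm (cint (fun z => (h (yy z))%:C * (md z * (g z)^J)) - m%:C * cint (fun z => md z * (g z)^J)) <=
  2 * C0 * e * W4 * rint (fun z => nm (md z) * nm (g z)).
Proof.
have mh : meas (fun z => h (yy z)) by apply: continuous_meas => //; exact: meas_yy.
have i1 := cintb_mg mh (fun z => h01 (yy z)).
have i2 : cintb (fun z => md z * (g z)^J).
  by apply: cintb_ext (cintb_mg (meas_cst 1) (@one01 R)) => z; rewrite rmorph1 mul1r.
have /choice[d Hd] : forall z, exists d, nm z < 1 -> wd (eta e) (Phi z) d 0 /\ nm d <= e * nm (eta e (Phi z)).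
  by move=> z; have [_ _ [d Hd1 Hd2]] := eta_spec e0 e2 (Phi_strip p q z); exists d.
have hE := hol_untwist hg.
have [E' hE' wE'] := hol_deriv hE.
have i2n : 2 * 'i != 0 :> C by rewrite mulf_neq0 ?pnatr_eq0// -nm_eq0 nm_i oner_eq0.
(* The z-derivative falls on the cutoff ([X]), on A ([G1], the quantity to be estimated) or on eta
   ([G2]). *)
pose G2 z := (A (yy z))%:C * (d z * dPhi z * (untwist g z)^J).
pose G1 z := (2 * 'i)^-1 * ((h (yy z))%:C * (md z * (g z)^J) - m%:C * (md z * (g z)^J)).
pose X n z := drho n z * ((A (yy z))%:C * (eta e (Phi z) * (untwist g z)^J)).
pose a n z := X n z + (rho n z)%:C * (G1 z + G2 z).
have wA z : nm z < 1 -> wd (fun z => (A (yy z))%:C) z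
    (((h (yy z) - m) * wexp t (yy z))%:C * (dPhi z / (2 * 'i))) (((h (yy z) - m) * wexp t (yy z))%:C * (- (dPhi z)^J / (2 * 'i))).
  by move=> z1; apply: wd_real (wd_yy z1) _; apply: (rd_der dA); exact: yy_in3.
have weta z : nm z < 1 -> wd (fun z => eta e (Phi z)) z (d z * dPhi z) 0.
  move=> z1; have [H _] := Hd z z1; apply: wd_eq (wd_comp (wd_Phi p1 q1 pq z1) H) _ _.
    by rewrite mul0r addr0.
  by rewrite mulr0 mul0r addr0.
have G1E z : nm z < 1 -> G1 z = ((h (yy z) - m) * wexp t (yy z))%:C * (dPhi z / (2 * 'i)) * (eta e (Phi z) * (untwist g z)^J).
  move=> z1; rewrite /G1 /untwist /mode zextE// conjMl.
  (* e^(it Phi) is its squared modulus e^(-2ty) divided by its conjugate: the mode becomes the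
     weight times the factor that conj([untwist g]) contains. *)
  have k1 : cexp ('i * (t%:C * Phi z)) = (wexp t (yy z))%:C * (cexp (- ('i * t%:C) * Phi z))^J.
    rewrite mulNr cexpN -mulrA.
    have n0 := cexp_neq0 ('i * (t%:C * Phi z)).
    have nJ : (cexp ('i * (t%:C * Phi z)))^J != 0 by rewrite -nm_eq0 nmJ nm_eq0.
    rewrite wyE yyE// -(nm_cexp_iPhi p q t z) -mulJE.
    have -> : ((cexp ('i * (t%:C * Phi z)))^-1)^J = ((cexp ('i * (t%:C * Phi z)))^J)^-1 by exact: fmorphV.
    by rewrite mulfK.
  have -> : ((h (yy z) - m) * wexp t (yy z))%:C = ((h (yy z))%:C - m%:C) * (wexp t (yy z))%:C :> C by rewrite rmorphM rmorphB.
  rewrite k1; move: (cexp _)^J (g z)^J (h _)%:C m%:C (wexp _ _)%:C (eta _ _) (dPhi z) ((2 * 'i)^-1) => *; ring.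
have step n : cintb (zext (a n)) /\ cint (zext (a n)) = 0.
  pose F z := (rho n z)%:C * ((A (yy z))%:C * (eta e (Phi z) * (untwist g z)^J)).
  have [] // := @cut_int R n F (a n) (fun z => (drho n z)^J * ((A (yy z))%:C * (eta e (Phi z) * (untwist g z)^J)) +
     (rho n z)%:C * (((h (yy z) - m) * wexp t (yy z))%:C * (- (dPhi z)^J / (2 * 'i)) * (eta e (Phi z) * (untwist g z)^J) +
       (A (yy z))%:C * (0 * (untwist g z)^J + eta e (Phi z) * (E' z)^J))).
  - move=> r r1; apply: liprM; first exact: lipr_rho.
    apply: liprM; first exact: (lipr_fyy dA A'_bd).
    apply: liprM; first by apply: hol_lipr r1; exact: hol_eta_Phi.
    by apply/liprJ; exact: hol_lipr r1.
  - move=> z z1; apply: wd_eq (wdM (wd_rho n z1) (wdM (wA z z1) (wdM (weta z z1) (wdJ (wE' z z1))))) _ _.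
      rewrite /a /X /G2 G1E// conjc0 mulr0 addr0; move: (eta _ _) => *; ring.
    by [].
  - by move=> z z1 ks; have [r0 dr0 _] := cut_out z1 ks; rewrite /F /a /X r0 dr0 conjc0 !mul0r !addr0.
have W0 : 0 <= W4 by exact: expR_ge0.
pose B : R := 3 * C0 / 2 * W4 + 1 + C0 * e * W4.
have B0 : 0 <= B.
  by rewrite /B !addr_ge0// ?mulr_ge0// ltW.
(* Since |A| <= C0 cos y = C0 (1 - |z|^2) |Phi'| / 2, the zero of A turns [drho] into [drho] times 1
   - |z|^2, which is bounded and tends to 0. *)
have X_bd n z : nm z < 1 -> nm (X n z) <= (nm (drho n z) * sd z) * (C0 / 2 * W4 * (nm (md z) * nm (g z))).
  move=> z1; rewrite /X nmM nmM nm_real nmM nmJ.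
  have := AC (yy_strip z1); rewrite cos_yy// => k1.
  have s0 := ltW (sd_gt0 z1).
  apply: (@le_trans _ _ (nm (drho n z) * (C0 * (sd z / 2 * nm (dPhi z)) * (nm (eta e (Phi z)) * nm (untwist g z))))).
    apply: ler_wpM2l => //; apply: ler_wpM2r => //; exact: mulr_ge0.
  rewrite [leLHS](_ : _ = nm (drho n z) * sd z * (C0 / 2 * (nm (eta e (Phi z)) * nm (untwist g z) * nm (dPhi z)))); last by ring.
  rewrite [leRHS](_ : _ = nm (drho n z) * sd z * (C0 / 2 * (W4 * (nm (md z) * nm (g z))))); last by ring.
  apply: ler_wpM2l; first exact: mulr_ge0.
  by apply: ler_wpM2l; [exact: divr_ge0|exact: prod_bd].
have G2_bd z : nm z < 1 -> nm (G2 z) <= C0 * e * W4 * (nm (md z) * nm (g z)).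
  move=> z1; rewrite /G2 nmM nm_real nmM nmM nmJ; have [_ hd] := Hd z z1.
  have k1 : `|A (yy z)| <= C0.
    by apply: (le_trans (AC (yy_strip z1))); rewrite -[leRHS]mulr1; apply: ler_wpM2l => //; exact: cos_le1.
  apply: (@le_trans _ _ (C0 * (e * (nm (eta e (Phi z)) * nm (untwist g z) * nm (dPhi z))))).
    apply: ler_pM => //; first by rewrite !mulr_ge0.
    rewrite [leRHS](_ : _ = (e * nm (eta e (Phi z))) * nm (dPhi z) * nm (untwist g z)); last by ring.
    by apply: ler_wpM2r => //; apply: ler_wpM2r.
  rewrite -!mulrA; apply: ler_wpM2l => //; rewrite ler_pM2l//.
  by have := prod_bd z1; rewrite -!mulrA.
have G1_bd z : nm (G1 z) <= nm (md z) * nm (g z).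
  rewrite /G1 -mulrBl -rmorphB nmM nmV nmM nm_nat nm_i mulr1 nmM nm_real nmM nmJ.
  have k : `|h (yy z) - m| <= 1.
    by have /andP[? ?] := h01 (yy z); have /andP[? ?] := m01; rewrite ler_norml; apply/andP; split; lra.
  rewrite mulrA -[leRHS]mul1r; apply: ler_wpM2r; first exact: mulr_ge0.
  by rewrite ler_pdivrMl//; lra.
have GG z : nm z < 1 -> nm (G1 z + G2 z) <= (1 + C0 * e * W4) * (nm (md z) * nm (g z)).
  move=> z1; apply: (le_trans (nmD _ _)); rewrite mulrDl mul1r; apply: lerD; [exact: G1_bd|exact: G2_bd].
have mg0 z : 0 <= nm (md z) * nm (g z) by exact: mulr_ge0.
have [iG cG] : cintb (zext (fun z => G1 z + G2 z)) /\ ccvg (fun n => cint (zext (a n))) (cint (zext (fun z => G1 z + G2 z))).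
  apply: (@cint_dct R (fun n => zext (a n)) _ (fun z => B * (nm (md z) * nm (g z)))).
  - by move=> n; apply: cintb_meas; exact: (step n).1.
  - move=> z; have [z1|z1] := leP 1 (nm z).
      have -> : (fun n => zext (a n) z) = fun=> 0 by apply/funext => n; rewrite zext0.
      by rewrite zext0//; exact: ccvg_cst.
    apply: (@le_inv_ccvg _ _ (3 * B * (nm (md z) * nm (g z))) (sd z)); first exact: sd_gt0.
    move=> n; rewrite !zextE// /a.
    rewrite (_ : _ - _ = X n z - (1 - rho n z)%:C * (G1 z + G2 z)); last by rewrite rmorphB rmorph1; ring.
    apply: (le_trans (nmB _ _)); rewrite nmM nm_real.
    have [/andP[r0 r1] r2] := rho_bd n z1; have [d1 _] := drho_bd n z1.
    rewrite (ger0_norm (_ : 0 <= 1 - rho n z)) ?subr_ge0//.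
    have j0 : 0 <= (n.+1%:R * sd z)^-1 by rewrite invr_ge0 mulr_ge0// ltW// sd_gt0.
    have t1 : nm (X n z) <= 3 * (n.+1%:R * sd z)^-1 * (C0 / 2 * W4 * (nm (md z) * nm (g z))).
      apply: (le_trans (X_bd n z z1)); apply: ler_wpM2r => //.
      by do !apply: mulr_ge0 => //.
    have t2 : (1 - rho n z) * nm (G1 z + G2 z) <= 3 * (n.+1%:R * sd z)^-1 * ((1 + C0 * e * W4) * (nm (md z) * nm (g z))).
      by apply: ler_pM; rewrite ?subr_ge0 ?nm_ge0//; exact: GG.
    apply: (le_trans (lerD t1 t2)).
    rewrite -mulrDr -mulrDl [leRHS](_ : _ = 3 * (n.+1%:R * sd z)^-1 * (B * (nm (md z) * nm (g z)))); last by ring.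
    apply: ler_wpM2l; first by rewrite mulr_ge0.
    apply: ler_wpM2r => //; rewrite /B; have : 0 <= C0 * W4 by exact: mulr_ge0.
    by move=> H; rewrite -subr_ge0 (_ : _ - _ = C0 * W4)//; field.
  - move=> n z; have [z1|z1] := leP 1 (nm z); first by rewrite zext0// nm0 mulr_ge0.
    rewrite zextE// /a; apply: (le_trans (nmD _ _)); rewrite nmM nm_real.
    have [/andP[r0 r1] r2] := rho_bd n z1; have [_ d1] := drho_bd n z1.
    rewrite (ger0_norm r0).
    have t1 : nm (X n z) <= 3 * (C0 / 2 * W4 * (nm (md z) * nm (g z))).
      apply: (le_trans (X_bd n z z1)); apply: ler_wpM2r => //.
      by do !apply: mulr_ge0 => //.
    have t2 : rho n z * nm (G1 z + G2 z) <= 1 * ((1 + C0 * e * W4) * (nm (md z) * nm (g z))).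
      by apply: ler_pM; rewrite ?nm_ge0//; exact: GG.
    apply: (le_trans (lerD t1 t2)); rewrite mul1r /B.
    rewrite le_eqVlt; apply/orP; left; apply/eqP; ring.
  - exact: rintbZ rintb_mg.
have G0 : cint (zext (fun z => G1 z + G2 z)) = 0.
  apply: ccvg_uniq cG _; have -> : (fun n => cint (zext (a n))) = fun=> 0 by apply/funext => n; exact: (step n).2.
  exact: ccvg_cst.
have md0 z : 1 <= nm z -> md z = 0 by exact: mode_out.
have iG1 : cintb G1 by apply: cintbZ; apply: cintbB => //; exact: cintbZ.
have G1z : zext G1 =1 G1.
  move=> z; have [z1|z1] := leP 1 (nm z); last by rewrite zextE.
  by rewrite zext0// /G1 md0// mul0r !mulr0 subr0 mulr0.
have zD z : zext (fun z => G1 z + G2 z) z = G1 z + zext G2 z.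
  by rewrite -G1z /zext; case: ifP => // _; rewrite addr0.
have iG2 : cintb (zext G2).
  apply: cintb_ext (cintbB iG iG1) => z; rewrite zD; ring.
have c1 : cint G1 = - cint (zext G2).
  by apply/eqP; rewrite -addr_eq0 -(cintD iG1 iG2) -G0; apply/eqP/cint_ext => z; rewrite zD.
have c2 : cint G1 = (2 * 'i)^-1 * (cint (fun z => (h (yy z))%:C * (md z * (g z)^J)) - m%:C * cint (fun z => md z * (g z)^J)).
  by rewrite /G1 (cintZ _ (cintbB i1 (cintbZ m%:C i2))) (cintB i1 (cintbZ m%:C i2)) (cintZ _ i2).
have -> : cint (fun z => (h (yy z))%:C * (md z * (g z)^J)) - m%:C * cint (fun z => md z * (g z)^J) = - (2 * 'i) * cint (zext G2).
  by apply: (mulfI (x := (2 * 'i)^-1)); rewrite ?invr_eq0// -c2 c1 mulNr mulrN mulKf.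
rewrite nmM nmN nmM nm_nat nm_i mulr1.
have k2 : nm (cint (zext G2)) <= C0 * e * W4 * rint (fun z => nm (md z) * nm (g z)).
  apply: (le_trans (le_nm_cint iG2)); rewrite -(rintZ _ rintb_mg).
  apply: rint_le; [exact: cintb_nm|exact: rintbZ rintb_mg|] => z.
  have [z1|z1] := leP 1 (nm z); last by rewrite zextE//; exact: G2_bd.
  by rewrite zext0// nm0; do !apply: mulr_ge0 => //; exact: ltW.
by rewrite -!mulrA ler_pM2l// !mulrA.
Qed.

End R3.

(** * The energy estimate *)

Section R4.
Variables (h : R -> R) (M C0 : R) (A K : R -> R).
Hypotheses (ch : continuous h) (h01 : forall y, 0 <= h y <= 1) (M01 : 0 <= M <= 1).
Hypotheses (dK : der K A) (dA : der A (fun y => (M - h y) * wexp t y)) (C00 : 0 <= C0).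
Hypotheses (K0 : forall y, `|y| <= hp -> 0 <= K y) (KC : forall y, `|y| <= hp -> K y <= C0 * cos y ^+ 2)
  (AC : forall y, `|y| <= hp -> `|A y| <= C0 * cos y).
Variable (f : C -> C).
Hypotheses (hf : hol f) (f0 : forall z, 1 <= nm z -> f z = 0) (if2 : rintb (fun z => nm (f z) ^+ 2)).

Lemma pot'_bdd y : `|y| <= hp -> `|(M - h y) * wexp t y| <= W4.
Proof.
move=> yh; rewrite normrM (gtr0_norm (wexp_gt0 t y)) -[leRHS]mul1r.
apply: ler_pM => //; [exact: ltW (wexp_gt0 _ _)| |exact: wexp_bd].
by have /andP[? ?] := h01 y; have /andP[? ?] := M01; rewrite ler_norml; apply/andP; split; lra.
Qed.

Lemma A_bd0 y : `|y| <= hp -> `|A y| <= C0.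
Proof.
by move=> yh; apply: (le_trans (AC yh)); rewrite -[leRHS]mulr1; apply: ler_wpM2l => //; exact: cos_le1.
Qed.

(* For g = f e^{-it Phi} / Phi' and k = rho K(y), integrating by parts twice gives
   int (d dbar k) |g|^2 = int k |g'|^2 >= 0; as rho tends to 1 the left side tends to
   a positive multiple of int (M - h(y)) |f|^2. *)
Lemma energy : rint (fun z => h (yy z) * nm (f z) ^+ 2) <= M * rint (fun z => nm (f z) ^+ 2).
Proof.
have mh : meas (fun z => h (yy z)) by apply: continuous_meas => //; exact: meas_yy.
(* The factor 1 / Phi' is chosen so that |g|^2 |Phi'|^2 e^(-2ty) = |f|^2: differentiating K(y) twice
   produces |Phi'|^2. *)
pose g z := (dPhi z)^-1 * untwist f z.
have hg : hol g.
  by apply: holM; [apply: holV; [exact: hol_dPhi|move=> z; exact: dPhi_neq0]|exact: hol_untwist].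
have [g' hg' wg'] := hol_deriv hg.
have [g'' _ wg''] := hol_deriv hg'.
have [dP' _ wdP] := hol_deriv (hol_dPhi p1 q1).
pose I2 : C := (2 * 'i)^-1.
have I2E : I2 = - ('i / 2) by exact: invi2.
have I22 : I2 * I2 = - 4^-1.
  by rewrite I2E mulrNN mulrACA i2 -invfM -natrM mulN1r.
have wK z : nm z < 1 -> wd (fun z => (K (yy z))%:C) z ((A (yy z))%:C * (dPhi z * I2)) ((A (yy z))%:C * (- (dPhi z)^J * I2)).
  by move=> z1; apply: wd_real (wd_yy z1) _; apply: (rd_der dK); exact: yy_in3.
have wA z : nm z < 1 -> wd (fun z => (A (yy z))%:C) z
    (((M - h (yy z)) * wexp t (yy z))%:C * (dPhi z * I2)) (((M - h (yy z)) * wexp t (yy z))%:C * (- (dPhi z)^J * I2)).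
  by move=> z1; apply: wd_real (wd_yy z1) _; apply: (rd_der dA); exact: yy_in3.
(* [k1] and [k12] are the z-derivative and the mixed derivative of k = rho K(y). *)
pose k1 n z := drho n z * (K (yy z))%:C + (rho n z)%:C * ((A (yy z))%:C * (dPhi z * I2)).
pose k12 n z := ddrho n z * (K (yy z))%:C + drho n z * ((A (yy z))%:C * (- (dPhi z)^J * I2)) +
  ((drho n z)^J * ((A (yy z))%:C * (dPhi z * I2)) + (rho n z)%:C * (((M - h (yy z)) * wexp t (yy z))%:C * (- (dPhi z)^J * I2) * (dPhi z * I2))).
pose Om n z := k12 n z * (g z * (g z)^J).
pose Th n z := (rho n z)%:C * (K (yy z))%:C * (g' z * (g' z)^J).
have lK r : r < 1 -> lipr r (fun z => (K (yy z))%:C) by exact: (lipr_fyy dK A_bd0).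
have lA r : r < 1 -> lipr r (fun z => (A (yy z))%:C) by exact: (lipr_fyy dA pot'_bdd).
have lk1 n r : r < 1 -> lipr r (k1 n).
  move=> r1; apply: liprD; first by apply: liprM; [exact: lipr_drho|exact: lK].
  apply: liprM; first exact: lipr_rho.
  apply: liprM; first exact: lA.
  apply: liprM; last exact: lipr_cst.
  by apply: hol_lipr r1; exact: hol_dPhi.
have lg r : r < 1 -> lipr r g by exact: hol_lipr.
have lg' r : r < 1 -> lipr r g' by exact: hol_lipr.
have kout n z : nm z < 1 -> n.+1%:R * sd z <= 1 -> k1 n z = 0 /\ k12 n z = 0.
  move=> z1 ks; have [r0 d0 dd0] := cut_out z1 ks.
  by rewrite /k1 /k12 r0 d0 dd0 conjc0 !mul0r !addr0.
have step n : [/\ cintb (zext (fun z => Om n z - Th n z)), cint (zext (fun z => Om n z - Th n z)) = 0,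
   cmeas (zext (Om n)) & cmeas (zext (Th n))].
  have mT : cmeas (zext (Th n)).
    apply: lipr_meas => r r1; apply: liprM; first by apply: liprM; [exact: lipr_rho|exact: lK].
    by apply: liprM; [exact: lg'|apply/liprJ/lg'].
  have /choice[c Hc] : forall z, exists c, nm z < 1 -> wd (k1 n) z c (k12 n z) /\ (n.+1%:R * sd z <= 1 -> c = 0).
    move=> z; have [z1|z1] := ltP (nm z) 1; last by exists 0.
    have [a Ha Ha0] := wd_drho n z1.
    have w1 := wdM Ha (wK z z1).
    have w2 := wdM (wd_rho n z1) (wdM (wA z z1) (wdM (wdP z z1) (wd_cst I2 z))).
    eexists => _; split.
      apply: wd_eq (wdD w1 w2) _ _; first reflexivity.
      by rewrite /k12 !(mul0r, mulr0, addr0).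
    by move=> ks; have [r0 d0 _] := cut_out z1 ks; rewrite Ha0// r0 d0 !(mul0r, addr0).
  (* First integration by parts: the conj(z)-derivative of k1 |g|^2 integrates to 0. *)
  have lF r : r < 1 -> lipr r (fun z => k1 n z * (g z * (g z)^J)).
    move=> r1; have lgr := lg r r1.
    exact: (liprM (lk1 n r r1) (liprM lgr (liprJ lgr))).
  have wF z : nm z < 1 -> wd (fun z => k1 n z * (g z * (g z)^J)) z
      (c z * (g z * (g z)^J) + k1 n z * (g' z * (g z)^J + g z * 0^J))
      (k12 n z * (g z * (g z)^J) + k1 n z * (0 * (g z)^J + g z * (g' z)^J)).
    by move=> z1; exact: wdM (Hc z z1).1 (wdM (wg' z z1) (wdJ (wg' z z1))).
  have [|i1 i2' e1 e2] := cut_int (n := n) lF wF.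
    move=> z z1 ks; have [r0 d0] := kout n z z1 ks.
    by rewrite r0 d0 (Hc z z1).2// !mul0r !addr0.
  (* Second one: the z-derivative of k g conj(g') integrates to 0. In the difference the terms with
     k1 g conj(g') cancel. *)
  have [j1 j2 e3 e4] := @cut_int R n (fun z => (rho n z)%:C * ((K (yy z))%:C * (g z * (g' z)^J)))
    (fun z => drho n z * ((K (yy z))%:C * (g z * (g' z)^J)) + (rho n z)%:C * ((A (yy z))%:C * (dPhi z * I2) * (g z * (g' z)^J) +
        (K (yy z))%:C * (g' z * (g' z)^J + g z * 0^J)))
    (fun z => (drho n z)^J * ((K (yy z))%:C * (g z * (g' z)^J)) + (rho n z)%:C * ((A (yy z))%:C * (- (dPhi z)^J * I2) * (g z * (g' z)^J) +
        (K (yy z))%:C * (0 * (g' z)^J + g z * (g'' z)^J)))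
    ltac:(by move=> r r1; apply: liprM; [exact: lipr_rho|apply: liprM; [exact: lK|apply: liprM; [exact: lg|apply/liprJ/lg']]])
    ltac:(by move=> z z1; exact: wdM (wd_rho n z1) (wdM (wK z z1) (wdM (wg' z z1) (wdJ (wg'' z z1)))))
    ltac:(by move=> z z1 ks; have [r0 d0 _] := cut_out z1 ks; rewrite r0 d0 conjc0 !mul0r !addr0).
  have zE z : zext (fun z => k12 n z * (g z * (g z)^J) + k1 n z * (0 * (g z)^J + g z * (g' z)^J)) z -
      zext (fun z => drho n z * ((K (yy z))%:C * (g z * (g' z)^J)) + (rho n z)%:C * ((A (yy z))%:C * (dPhi z * I2) * (g z * (g' z)^J) +
        (K (yy z))%:C * (g' z * (g' z)^J + g z * 0^J))) z = zext (fun z => Om n z - Th n z) z.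
    rewrite /zext; case: ifP => _; last by rewrite subrr.
    by rewrite conjc0 /Om /Th /k1; ring.
  have iOT : cintb (zext (fun z => Om n z - Th n z)) by apply: cintb_ext zE (cintbB i2' j1).
  split; [exact: iOT| | |exact: mT].
    by rewrite -(cint_ext zE) (cintB i2' j1) e2 e3 subrr.
  apply: cmeas_ext (cmeasD (cintb_meas iOT) mT) => z.
  by rewrite /zext; case: ifP => _; rewrite ?addr0// subrK.
have W0 : 0 <= W4 by exact: expR_ge0.
have fE z : nm z < 1 -> nm (dPhi z) ^+ 2 * nm (g z) ^+ 2 = expR (t * yy z) ^+ 2 * nm (f z) ^+ 2.
  move=> z1; have -> : nm (g z) = (nm (dPhi z))^-1 * nm (untwist f z) by rewrite -nmV -nmM.
  by rewrite nm_untwist// -!exprMn mulVKf// gt_eqF// nm_gt0 dPhi_neq0.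
have fW z : nm z < 1 -> nm (dPhi z) ^+ 2 * nm (g z) ^+ 2 <= W4 * nm (f z) ^+ 2.
  move=> z1; rewrite fE//; apply: ler_wpM2r; first exact: sqr_ge0.
  by have [b1 _] := expty z1; rewrite W4E ler_pXn2r ?nnegrE ?expR_ge0.
(* The pointwise limit of [Om n]; the 1/4 is the square of the 1/2 in d Im Phi. [er] collects the
   terms in which a derivative falls on the cutoff. *)
pose L z : C := ((M - h (yy z)) / 4 * nm (f z) ^+ 2)%:C.
pose er n z := ddrho n z * (K (yy z))%:C + drho n z * ((A (yy z))%:C * (- (dPhi z)^J * I2)) + (drho n z)^J * ((A (yy z))%:C * (dPhi z * I2)).
have OmE n z : nm z < 1 -> Om n z = er n z * (nm (g z) ^+ 2)%:C + (rho n z)%:C * L z.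
  move=> z1; rewrite /Om mulJE.
  have -> : k12 n z = er n z + (rho n z)%:C * (((M - h (yy z)) * wexp t (yy z))%:C * ((nm (dPhi z) ^+ 2)%:C * 4^-1)).
    by rewrite /k12 /er -(mulJE (dPhi z)) -[4^-1]opprK -I22; ring.
  rewrite mulrDl; congr (_ + _); rewrite -mulrA; congr (_ * _).
  have -> : 4^-1 = (4^-1 : R)%:C :> C by rewrite natVC.
  rewrite -!rmorphM; congr (_%:C).
  rewrite [LHS](_ : _ = (M - h (yy z)) / 4 * (wexp t (yy z) * (nm (dPhi z) ^+ 2 * nm (g z) ^+ 2))); last by ring.
  congr (_ * _); rewrite fE// wyE mulrA -exprMn -expRD addNr expR0 expr1n mul1r //.
have nI2 : nm I2 = 2^-1 by rewrite nmV nmM nm_nat nm_i mulr1.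
(* The bounds K <= C0 cos^2 y and |A| <= C0 cos y supply (1 - |z|^2)^2 for [ddrho] and 1 - |z|^2 for
   [drho]. *)
have er_bd n z : nm z < 1 -> nm (er n z * (nm (g z) ^+ 2)%:C) <=
    (nm (ddrho n z) * sd z ^+ 2 * (C0 / 4) + nm (drho n z) * sd z * (C0 / 2)) * (W4 * nm (f z) ^+ 2).
  move=> z1; rewrite nmM nm_real ger0_norm ?sqr_ge0//.
  have s0 := ltW (sd_gt0 z1); have yh := yy_strip z1.
  have e1 : nm (er n z) <= (nm (ddrho n z) * sd z ^+ 2 * (C0 / 4) + nm (drho n z) * sd z * (C0 / 2)) * nm (dPhi z) ^+ 2.
    have kk := KC yh; have aa := AC yh; rewrite cos_yy// in kk aa.
    apply: (le_trans (nmD _ _)); apply: (le_trans (lerD (nmD _ _) (lexx _))).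
    have -> : nm (ddrho n z * (K (yy z))%:C) = nm (ddrho n z) * K (yy z).
      by rewrite (nmM (ddrho n z)) nm_real (ger0_norm (K0 yh)).
    have -> : nm (drho n z * ((A (yy z))%:C * (- (dPhi z)^J * I2))) = nm (drho n z) * (`|A (yy z)| * (nm (dPhi z) / 2)).
      by rewrite (nmM (drho n z)) (nmM (A (yy z))%:C) (nmM (- (dPhi z)^J)) nm_real nmN nmJ nI2.
    have -> : nm ((drho n z)^J * ((A (yy z))%:C * (dPhi z * I2))) = nm (drho n z) * (`|A (yy z)| * (nm (dPhi z) / 2)).
      by rewrite (nmM (drho n z)^J) (nmM (A (yy z))%:C) (nmM (dPhi z)) nm_real nmJ nI2.
    have t1 : nm (ddrho n z) * K (yy z) <= nm (ddrho n z) * sd z ^+ 2 * (C0 / 4) * nm (dPhi z) ^+ 2.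
      apply: (le_trans (ler_wpM2l (nm_ge0 _) kk)).
      by rewrite le_eqVlt; apply/orP; left; apply/eqP; field.
    have t2 : nm (drho n z) * (`|A (yy z)| * (nm (dPhi z) * 2^-1)) <= nm (drho n z) * sd z * (C0 / 4) * nm (dPhi z) ^+ 2.
      apply: (@le_trans _ _ (nm (drho n z) * (C0 * (sd z / 2 * nm (dPhi z)) * (nm (dPhi z) * 2^-1)))).
        by apply: ler_wpM2l => //; apply: ler_wpM2r => //; exact: mulr_ge0.
      by rewrite le_eqVlt; apply/orP; left; apply/eqP; field.
    have := lerD (lerD t1 t2) t2; move/le_trans; apply.
    by rewrite le_eqVlt; apply/orP; left; apply/eqP; field.
  apply: (le_trans (ler_wpM2r (sqr_ge0 _) e1)); rewrite -[leLHS]mulrA; apply: ler_wpM2l; last exact: fW.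
  by rewrite addr_ge0// !mulr_ge0// ?divr_ge0// exprn_ge0.
have hb y : `|M - h y| <= 1.
  by have /andP[? ?] := h01 y; have /andP[? ?] := M01; rewrite ler_norml; apply/andP; split; lra.
have L_bd z : nm (L z) <= nm (f z) ^+ 2.
  rewrite /L nm_real normrM (ger0_norm (sqr_ge0 _)) -[leRHS]mul1r; apply: ler_wpM2r; first exact: sqr_ge0.
  rewrite normrM (ger0_norm (_ : 0 <= 4^-1)) ?invr_ge0//; have := hb (yy z); lra.
have F0 z : 0 <= nm (f z) ^+ 2 by exact: sqr_ge0.
pose B : R := 6 * C0 * W4 + 3.
have B0 : 0 <= B by rewrite /B addr_ge0// !mulr_ge0.
have Om_bd n z : nm (zext (Om n) z) <= B * nm (f z) ^+ 2.
  have [z1|z1] := leP 1 (nm z); first by rewrite zext0// nm0 mulr_ge0.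
  rewrite zextE// OmE//; apply: (le_trans (nmD _ _)); rewrite [nm (_ * L z)]nmM nm_real.
  have [/andP[r0 r1] r2] := rho_bd n z1; have [_ d1] := drho_bd n z1; have [_ d2] := ddrho_bd n z1.
  rewrite (ger0_norm r0).
  have t2 : rho n z * nm (L z) <= 1 * nm (f z) ^+ 2 by apply: ler_pM; rewrite ?nm_ge0.
  apply: (le_trans (lerD (er_bd n z z1) t2)).
  have t3 : nm (ddrho n z) * sd z ^+ 2 * (C0 / 4) <= 15 * (C0 / 4) by apply: ler_wpM2r => //; exact: divr_ge0.
  have t4 : nm (drho n z) * sd z * (C0 / 2) <= 3 * (C0 / 2) by apply: ler_wpM2r => //; exact: divr_ge0.
  have t5 := ler_wpM2r (mulr_ge0 W0 (F0 z)) (lerD t3 t4).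
  apply: (le_trans (lerD t5 (lexx _))); rewrite /B.
  have jj : 0 <= C0 * W4 * nm (f z) ^+ 2 by do !apply: mulr_ge0 => //.
  rewrite -subr_ge0 (_ : _ - _ = 3 / 4 * (C0 * W4 * nm (f z) ^+ 2) + 2 * nm (f z) ^+ 2).
    by rewrite addr_ge0// mulr_ge0// divr_ge0.
  by field.
have [iL cL] : cintb (zext L) /\ ccvg (fun n => cint (zext (Om n))) (cint (zext L)).
  apply: (@cint_dct R (fun n => zext (Om n)) _ (fun z => B * nm (f z) ^+ 2)).
  - by move=> n; have [] := step n.
  - move=> z; have [z1|z1] := leP 1 (nm z).
      have -> : (fun n => zext (Om n) z) = fun=> 0 by apply/funext => n; rewrite zext0.
      by rewrite zext0//; exact: ccvg_cst.
    apply: (@le_inv_ccvg _ _ (B * nm (f z) ^+ 2) (sd z)); first exact: sd_gt0.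
    move=> n; rewrite !zextE// OmE//.
    rewrite (_ : _ - _ = er n z * (nm (g z) ^+ 2)%:C - (1 - rho n z)%:C * L z); last by rewrite rmorphB rmorph1; ring.
    apply: (le_trans (nmB _ _)); rewrite [nm (_ * L z)]nmM nm_real.
    have [/andP[r0 r1] r2] := rho_bd n z1; have [d1 _] := drho_bd n z1; have [d2 _] := ddrho_bd n z1.
    rewrite (ger0_norm (_ : 0 <= 1 - rho n z)) ?subr_ge0//.
    have j0 : 0 <= (n.+1%:R * sd z)^-1 by rewrite invr_ge0 mulr_ge0// ltW// sd_gt0.
    have t2 : (1 - rho n z) * nm (L z) <= 3 * (n.+1%:R * sd z)^-1 * nm (f z) ^+ 2.
      by apply: ler_pM; rewrite ?subr_ge0 ?nm_ge0.
    apply: (le_trans (lerD (er_bd n z z1) t2)).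
    move: (_^-1) j0 d1 d2 => j j0 d1 d2.
    have t3 : nm (ddrho n z) * sd z ^+ 2 * (C0 / 4) <= 15 * j * (C0 / 4) by apply: ler_wpM2r => //; exact: divr_ge0.
    have t4 : nm (drho n z) * sd z * (C0 / 2) <= 3 * j * (C0 / 2) by apply: ler_wpM2r => //; exact: divr_ge0.
    have t5 := ler_wpM2r (mulr_ge0 W0 (F0 z)) (lerD t3 t4).
    apply: (le_trans (lerD t5 (lexx _))); rewrite /B.
    have jj : 0 <= j * C0 * W4 * nm (f z) ^+ 2 by do !apply: mulr_ge0 => //.
    rewrite -subr_ge0 (_ : _ - _ = 3 / 4 * (j * C0 * W4 * nm (f z) ^+ 2)); first by rewrite mulr_ge0// divr_ge0.
    by field.
  - exact: Om_bd.
  - exact: rintbZ if2.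
(* By the two integrations by parts this is the integral of rho K |g'|^2. *)
have Om_ge0 n : 0 <= complex.Re (cint (zext (Om n))).
  have [iOT cOT mO mT] := step n.
  have iO : cintb (zext (Om n)).
    apply: (cintb_le mO (h := fun z => B * nm (f z) ^+ 2)); last exact: rintbZ.
    exact: Om_bd.
  have zE z : zext (Om n) z - zext (fun z => Om n z - Th n z) z = zext (Th n) z.
    by rewrite /zext; case: ifP => _; [ring|rewrite subrr].
  have -> : cint (zext (Om n)) = cint (zext (Th n)).
    by rewrite -(cint_ext zE) (cintB iO iOT) cOT subr0.
  apply: rint_ge0 => z; have [z1|z1] := leP 1 (nm z); first by rewrite zext0.
  rewrite zextE// /Th mulJE -!rmorphM /=; have [/andP[r0 _] _] := rho_bd n z1.
  by apply: mulr_ge0; [apply: mulr_ge0 => //; apply/K0/yy_strip|exact: sqr_ge0].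
have L_ge0 : 0 <= complex.Re (cint (zext L)).
  apply/ler_addgt0Pr => e e0; have /ccvgP/(_ e e0) [N _ HN] := cL.
  have := HN N (leqnn N) => h1; have h2 := le_trans (Re_le _) h1; have := Om_ge0 N.
  move: h2; rewrite cReD cReN ler_norml; move: (complex.Re _) (complex.Re _) => x y /andP[h2 h3]; move: h2; lra.
have LE z : complex.Re (zext L z) = 4^-1 * (M * nm (f z) ^+ 2 + - (h (yy z) * nm (f z) ^+ 2)).
  have [z1|z1] := leP 1 (nm z); last by rewrite zextE// /L /=; ring.
  by rewrite zext0// f0// nm0 expr0n /= !mulr0 subrr mulr0.
have ihf : rintb (fun z => h (yy z) * nm (f z) ^+ 2).
  apply: rintb_le if2; first by apply: measM => //; apply: measX; apply: meas_nm; exact: hol_meas.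
  move=> z; have /andP[h0 h1] := h01 (yy z); rewrite ger0_norm ?mulr_ge0//.
  by rewrite -[leRHS]mul1r; exact: ler_wpM2r.
move: L_ge0; rewrite /cint /= (rint_ext LE) (rintZ _ (rintbD (rintbZ M if2) (rintbN ihf))).
rewrite (rintD (rintbZ M if2) (rintbN ihf)) (rintZ _ if2) (rintN ihf).
by rewrite pmulr_rge0 ?invr_gt0// subr_ge0.
Qed.

End R4.
End modes.

(** * The spectrum of a slab *)

Section slab.
Context (R : realType).
Local Notation C := R[i].
Local Notation nm := (@Normc.normc R).
Local Notation hp := (@pi R / 2).
Local Notation H := (bergman (disc_open R)).
Local Notation ip := (@bergman_ip R _ (disc_open R)).

Lemma sqrD_le (A B D E : R) : 0 <= A -> A <= B + D -> B ^+ 2 <= E -> D ^+ 2 <= E -> A ^+ 2 <= 4 * E.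
Proof.
move=> A0 AB BE DE; have : A ^+ 2 <= (B + D) ^+ 2 by rewrite ler_pXn2r ?nnegrE// (le_trans A0).
have := sqr_ge0 (B - D); rewrite (_ : (B + D) ^+ 2 = 2 * B ^+ 2 + 2 * D ^+ 2 - (B - D) ^+ 2); [lra|ring].
Qed.

Section abstract.
Variables (V : lmodType C) (ipV b : V -> V -> C).
Hypothesis hV : form ipV.

(** An approximate eigenvector for a nearby y serves for x; adding two errors before squaring costs
    a factor 4, hence the shares e / 4. *)
Lemma approx_closed (x : R) :
  (forall d, 0 < d -> exists2 y, `|x - y| <= d & approx ipV b y) -> approx ipV b x.
Proof.
move=> H e e0; have e4 : 0 < Num.sqrt (e / 4) by rewrite sqrtr_gt0 divr_gt0.
have [y xy Hy] := H _ e4; have [F F0 HF] := Hy (e / 4) (divr_gt0 e0 (ltr0n _ 4)).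
exists F => // g; have := HF g; have := form_CS hV g F.
have g0 := q_ge0 hV g.
have xy2 : (x - y) ^+ 2 <= e / 4.
  have e40 : 0 <= e / 4 by rewrite divr_ge0// ltW.
  by rewrite -(sqr_sqrtr e40) -(real_normK (num_real (x - y))) ler_pXn2r ?nnegrE ?sqrtr_ge0.
have -> : b g F - x%:C * ipV g F = (b g F - y%:C * ipV g F) - (x - y)%:C * ipV g F by rewrite rmorphB /=; ring.
move=> h1 h2; have := nmB (b g F - y%:C * ipV g F) ((x - y)%:C * ipV g F).
rewrite nmM nm_real => h3.
have n1 := nm_ge0 (b g F - y%:C * ipV g F); have n2 := nm_ge0 (ipV g F).
have n3 := nm_ge0 (b g F - y%:C * ipV g F - (x - y)%:C * ipV g F).
have h4 : (`|x - y| * nm (ipV g F)) ^+ 2 <= e / 4 * qf ipV F * qf ipV g.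
  rewrite exprMn real_normK ?num_real// -mulrA; apply: ler_pM; rewrite ?sqr_ge0//.
  by rewrite mulrC.
rewrite (_ : e * _ * _ = 4 * (e / 4 * qf ipV F * qf ipV g)); last by field.
exact: (sqrD_le n3 h3 h2 h4).
Qed.

End abstract.

Lemma coercive_max (f : R -> R) (B : R) : continuous f -> 0 <= B ->
  (forall t, B <= `|t| -> f t <= f 0) -> exists t0, forall t, f t <= f t0.
Proof.
move=> cf B0 fB; have BB : - B <= B by lra.
have [|t0 t0B tm] := EVT_max BB (f := f); first exact: continuous_subspaceT.
exists t0 => t; have z0 : f 0 <= f t0 by apply: tm; rewrite in_itv /= oppr_le0 B0.
have [tB|tB] := leP B `|t|; first exact: le_trans (fB _ tB) z0.
by apply: tm; rewrite in_itv /= -ler_norml ltW.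
Qed.

Lemma rint_CS (u v : H) : 0 < qf ip u ->
  rint (fun z => nm (u z) * nm (v z)) ^+ 2 <= qf ip u * qf ip v.
Proof.
move=> a0; have iu := bergman_l2 u; have iv := bergman_l2 v.
have iuv : rintb (fun z => nm (u z) * nm (v z)).
  have := cintb_nm (cintb_bform (meas_cst 1) (@one01 R) u v); apply: rintb_ext => z.
  by rewrite rmorph1 mul1r nmM nmJ.
rewrite !qf_ip in a0 *; set c := rint _; set a := rint _; set b := rint _.
pose x := - c / a.
have : 0 <= rint (fun z => (x * nm (u z) + nm (v z)) ^+ 2) by apply: rint_ge0 => z; exact: sqr_ge0.
rewrite (_ : rint _ = x ^+ 2 * a + (2 * x * c + b)); last first.
  have i1 := rintbZ (x ^+ 2) iu; have i2 := rintbZ (2 * x) iuv.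
  rewrite -(rintZ _ iu) -(rintZ _ iuv) -(rintD i2 iv) -(rintD i1 (rintbD i2 iv)).
  by apply: rint_ext => z; ring.
rewrite (_ : _ + _ = b - c ^+ 2 / a); last by rewrite /x; field; rewrite gt_eqF.
by rewrite subr_ge0 ler_pdivrMr// mulrC.
Qed.

Lemma yy_lt (p q z : C) : nm z < 1 -> - hp < yy p q z < hp.
Proof. by move=> z1; rewrite yyE// -ltr_norml Phi_strip. Qed.

(** * The mean of a slab as a function of t *)

Section weights.
Variables (al be : R).
Hypotheses (alh : - hp <= al) (ab : al < be) (beh : be <= hp).

Let c1 : continuous (fun _ : R => 1 : R). Proof. by move=> y; exact: cst_continuous. Qed.
Let b01 (y : R) : 0 <= (1 : R) <= 1. Proof. by rewrite ler01 lexx. Qed.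

Lemma wslab_cont : continuous (wslab al be).
Proof. by apply: wmean_cont => //; exact: ltW. Qed.

Lemma wslab_gt0 t : 0 < wslab al be t.
Proof.
have h : 0 < wslab al be 0.
  rewrite /wslab /wmean divr_gt0 ?wmass_gt0// pint_w1.
  have [h3 h4] := hp3 R; have a3 := lt_le_trans h3 alh; have b3 := le_lt_trans beh h4.
  have w0 : wexp 0 = fun=> 1 :> R by apply/funext => y; rewrite /wexp mulr0 mul0r oppr0 expR0.
  by rewrite w0 (pint_cst a3 (ltW ab) b3) mul1r subr_gt0.
have := wmean_mul c1 b01 alh (ltW ab) beh t 0 => /(lt_le_trans h).
by rewrite pmulr_rgt0// expR_gt0.
Qed.

Lemma wslab_small_pinfty : - hp < al -> forall e, 0 < e -> exists T, forall t, T <= t -> wslab al be t <= e.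
Proof. by move=> al' e e0; apply: wmean_small => //; exact: ltW. Qed.

Lemma wslab_small_ninfty : be < hp -> forall e, 0 < e -> exists T, forall t, t <= - T -> wslab al be t <= e.
Proof.
move=> be' e e0.
have k1 : - hp <= - be by rewrite lerN2.
have k2 : - be <= - al by rewrite lerN2 ltW.
have k3 : - al <= hp by rewrite lerNl.
have k4 : - hp < - be by rewrite ltrN2.
have [T HT] := wmean_small c1 b01 k1 k2 k3 k4 e0.
exists T => t tT; rewrite /wslab wmean_reflect// ?(ltW ab)//; apply: HT; by rewrite lerNr.
Qed.

End weights.

Lemma wslab_small (al be e : R) : - hp < al -> al < be -> be < hp -> 0 < e ->
  exists2 B, 0 <= B & forall t, B <= `|t| -> wslab al be t <= e.
Proof.
move=> alh ab beh e0; have [T1 H1] := wslab_small_pinfty (ltW alh) ab (ltW beh) alh e0.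
have [T2 H2] := wslab_small_ninfty (ltW alh) ab (ltW beh) beh e0.
exists (Num.max 0 (Num.max T1 T2)) => [|t]; first by rewrite le_max lexx.
rewrite !ge_max => /and3P[_]; case: (ger0P t) => _ t1 t2; first exact: H1.
by apply: H2; rewrite lerNr.
Qed.

Lemma wslab_cat (a b c t : R) : wslab a b t + wslab b c t = wslab a c t.
Proof. by rewrite /wslab /wmean -mulrDl pint_cat. Qed.

Lemma wslab_full t : wslab (- hp) hp t = 1.
Proof. by rewrite /wslab /wmean pint_w1 divff// gt_eqF// wmass_gt0. Qed.

Variables (p q : C).
Hypotheses (p1 : nm p = 1) (q1 : nm q = 1) (pq : p != q).
Variables (al be : R).
Hypotheses (alh : - hp <= al) (ab : al < be) (beh : be <= hp).
Local Notation yy := (yy p q).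

(** Ramp widths: at most half the slab, so that the two ramps do not overlap, and tending to 0. *)
Let dl n : R := (be - al) / 2 / n.+1%:R.

Let dl_gt0 n : 0 < dl n.
Proof. by rewrite divr_gt0// divr_gt0// subr_gt0. Qed.

Let dl_le n : al + dl n <= be - dl n.
Proof.
have : dl n <= (be - al) / 2.
  by rewrite ler_pdivrMr// ler_peMr ?ler1n// divr_ge0// subr_ge0 ltW.
lra.
Qed.

Lemma trap_near y : \forall n \near \oo, trap al be (dl n) y = if al < y < be then 1 else 0.
Proof.
case: ifPn => [/andP[ay yb]|]; last first.
  rewrite negb_and -!leNgt => yab; near=> n; exact: trap_out.
have e0 : 0 < Num.min (y - al) (be - y) by rewrite lt_min !subr_gt0 ay.
have ba : 0 < (be - al) / 2 by rewrite divr_gt0// subr_gt0.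
have : \forall n \near \oo, n.+1%:R^-1 < Num.min (y - al) (be - y) / ((be - al) / 2).
  exact: (near_infty_natSinv_lt (PosNum (divr_gt0 e0 ba))).
apply: filterS => n; rewrite ltr_pdivlMr// mulrC -/(dl n) lt_min => /andP[h1 h2].
by apply: trap_one => //; lra.
Unshelve. all: by end_near. Qed.

Variable (U : set C).
Hypotheses (oU : open U) (UE : forall z, U z <-> nm z < 1 /\ al < yy z < be).

Lemma chi_slab z : nm z < 1 -> chi U z = if al < yy z < be then 1 else 0.
Proof.
move=> z1; rewrite /chi; case: asboolP => [/UE [_ ->]//|nU].
by case: ifP => // h; case: nU; apply/UE.
Qed.

Lemma meas_trap n : meas (fun z => trap al be (dl n) (yy z)).
Proof. apply: continuous_meas; [exact: trap_cont|exact: meas_yy]. Qed.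

Lemma trap_ccvg (u v : H) :
  ccvg (fun n => bform (fun z => trap al be (dl n) (yy z)) u v) (bform (chi U) u v).
Proof.
apply: (@cint_dct R _ _ (fun z => nm (u z) * nm (v z)) _ _ _ _).2.
- by move=> n; apply/cintb_meas/cintb_bform; [exact: meas_trap|move=> z; exact: trap01].
- move=> z; have [z1|z1] := leP 1 (nm z).
    have -> : u z = 0 by exact: bergman_out.
    rewrite mul0r mulr0; have -> : (fun n => (trap al be (dl n) (yy z))%:C * 0) = fun=> 0 :> C by apply/funext => n; rewrite mulr0.
    exact: ccvg_cst.
  apply/ccvgP => e e0; apply: filterS (trap_near (yy z)) => n ->.
  by rewrite chi_slab// subrr nm0 ltW.
- move=> n z; have /andP[t0 t1] := trap01 al be (dl n) (yy z).
  by rewrite nmM nm_real ger0_norm// nmM nmJ ler_piMl// mulr_ge0.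
- have := cintb_nm (cintb_bform (meas_cst 1) (@one01 R) u v); apply: rintb_ext => z.
  by rewrite rmorph1 mul1r nmM nmJ.
Qed.

Lemma mode_neq0 t e : 0 < e -> e <= 2^-1 -> mode p q t e 0 != 0.
Proof.
move=> e0 e2; have z1 : nm (0 : C) < 1 by rewrite nm0.
rewrite /mode zextE// mulf_neq0 ?cexp_neq0// mulf_neq0 ?dPhi_neq0//.
by have [] := eta_spec e0 e2 (Phi_strip p q 0).
Qed.

Lemma trap_wmean01 n t : 0 <= wmean (trap al be (dl n)) (- hp) hp t <= 1.
Proof.
have h0 := @hp0 R; apply/andP; split.
  by apply: wmean_ge0 => // [|y]; [exact: trap_cont|exact: trap01].
by apply: wmean_le1 => // [|y]; [exact: trap_cont|exact: trap01].
Qed.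

(** [quasi_mode] is applied to the trapezoids with the same mode for all n. Its constant 3 W4 does
    not depend on the ramp width, so the bound passes to the limit. *)
Lemma wslab_approx t : approx ip (bform (chi U)) (wslab al be t).
Proof.
move=> e e0; pose W4 : R := expR (4 * `|t|); have W0 : 0 < W4 by exact: expR_gt0.
(* The constant of [quasi_mode] for C0 = 3 * W4; the damping x is then taken with (c x)^2 <= e. *)
pose c := 2 * (3 * W4) * W4.
have c0 : 0 < c by rewrite !mulr_gt0.
pose x := Num.min 2^-1 (Num.sqrt e / c).
have se0 : 0 < Num.sqrt e by rewrite sqrtr_gt0.
have x0 : 0 < x by rewrite lt_min divr_gt0// invr_gt0 ltr0n.
have x2 : x <= 2^-1 by rewrite ge_min lexx.
have cx0 : 0 <= c * x by exact: ltW (mulr_gt0 c0 x0).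
have cx : (c * x) ^+ 2 <= e.
  rewrite -(sqr_sqrtr (ltW e0)) ler_pXn2r ?nnegrE ?cx0 ?(ltW se0)//.
  by rewrite mulrC -ler_pdivlMr// ge_min lexx orbT.
have [F FE] := bergman_mk (hol_mode p1 q1 pq t x0 x2) (@mode_out R p q t x) (mode_l2 p1 q1 pq t x0 x2).
have F0 : 0 < qf ip F.
  rewrite lt_neqAle (q_ge0 (ip_form R)) andbT eq_sym; apply/eqP => /bergman_def F0.
  by have := mode_neq0 t x0 x2; rewrite -FE F0 eqxx.
exists F => // g.
have bnd n : nm (bform (fun z => trap al be (dl n) (yy z)) F g - (wmean (trap al be (dl n)) (- hp) hp t)%:C * bform (fun=> 1) F g)
    <= c * x * rint (fun z => nm (F z) * nm (g z)).
  pose h := trap al be (dl n); pose m := wmean h (- hp) hp t.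
  have ch : continuous h by exact: trap_cont.
  have h01 y : 0 <= h y <= 1 by exact: trap01.
  have m01 : 0 <= m <= 1 by exact: trap_wmean01.
  have dA : der (fun y => -1 * pot1 h m t y) (fun y => (h y - m) * wexp t y).
    by apply: der_eq (derZ (-1) (der_pot1 m t ch)) _ => y; rewrite /pot'; ring.
  have AC y : `|y| <= hp -> `|-1 * pot1 h m t y| <= 3 * W4 * cos y.
    move=> yh; rewrite mulN1r normrN; apply: (le_trans (pot1_bd ch h01 m01 erefl yh)).
    by rewrite [3 * W4]mulrC -mulrA; apply: ler_wpM2l; [exact: ltW|exact: hp_cos].
  have := quasi_mode p1 q1 pq x0 x2 ch h01 m01 dA (ltW (mulr_gt0 (ltr0n _ 3) W0)) AC
    (bergman_hol g) (fun z => @bergman_out R g z) (bergman_l2 g).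
  rewrite -FE -/W4 (_ : 2 * (3 * W4) * x * W4 = c * x); last by rewrite /c; ring.
  congr (nm (_ - _ * _) <= _); apply: cint_ext => z; by rewrite rmorph1 mul1r.
have lim : ccvg (fun n => bform (fun z => trap al be (dl n) (yy z)) F g - (wmean (trap al be (dl n)) (- hp) hp t)%:C * bform (fun=> 1) F g)
   (bform (chi U) F g - (wslab al be t)%:C * bform (fun=> 1) F g).
  apply: ccvgB; first exact: trap_ccvg.
  apply: (@le_inv_ccvg _ _ _ ((be - al) * W4 * nm (bform (fun=> 1) F g)) (wmass t)); first exact: wmass_gt0.
  move=> n; rewrite -mulrBl nmM -rmorphB nm_real.
  have [k1 k2] := wmean_trap t alh (dl_le n) beh (dl_gt0 n).
  rewrite mulrAC; apply: ler_wpM2r => //; rewrite distrC ger0_norm ?subr_ge0// lerBlDl.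
  apply: (le_trans k2); rewrite lerD2l le_eqVlt; apply/orP; left; apply/eqP.
  by rewrite /dl -/W4; field; rewrite gt_eqF ?wmass_gt0//= pnatr_eq0.
have fU : form (bform (chi U)).
  by apply: bform_form; [exact: meas_chi|exact: chi01].
have b1 : nm (bform (chi U) g F - (wslab al be t)%:C * ip g F) <= c * x * rint (fun z => nm (F z) * nm (g z)).
  rewrite (formJ fU F g) (formJ (ip_form R) F g) bergman_ipE.
  rewrite (_ : _ - _ = (bform (chi U) F g - (wslab al be t)%:C * bform (fun=> 1) F g)^J); last first.
    by rewrite -conjRM; exact/esym/rmorphB.
  rewrite nmJ.
  by apply: ccvg_le_lim lim _; near=> n; exact: bnd.
have r0 : 0 <= rint (fun z => nm (F z) * nm (g z)) by apply: rint_ge0 => z; exact: mulr_ge0.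
apply: (@le_trans _ _ ((c * x * rint (fun z => nm (F z) * nm (g z))) ^+ 2)).
  by rewrite ler_pXn2r ?nnegrE ?mulr_ge0// ltW.
rewrite exprMn -mulrA; apply: ler_pM; rewrite ?sqr_ge0//; exact: rint_CS.
Unshelve. all: by end_near. Qed.

Lemma wslab_attained t1 t2 x : wslab al be t1 <= x -> x <= wslab al be t2 -> exists t, wslab al be t = x.
Proof.
move=> x1 x2; have cw a b : {within `[a, b], continuous (wslab al be)}.
  exact/continuous_subspaceT/(wslab_cont alh ab beh).
have mm (a b : R) : a <= x -> x <= b -> Num.min a b <= x <= Num.max a b.
  by move=> ax xb; rewrite ge_min le_max ax xb orbT.
have [t12|t21] := leP t1 t2.
  by have [t _ tx] := IVT t12 (cw _ _) (mm _ _ x1 x2); exists t.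
have := mm _ _ x1 x2; rewrite minC maxC => H.
by have [t _ tx] := IVT (ltW t21) (cw _ _) H; exists t.
Qed.

Let fU : form (bform (chi U)).
Proof. by apply: bform_form; [exact: meas_chi|exact: chi01]. Qed.

Hypothesis UD : U `<=` disc R.

(** The form bounds confine the spectrum to [0, M]. Conversely the means take every intermediate
    value by continuity, and [approx_closed] adds the end points. *)
Lemma spectrum_slab (M : R) : 0 <= M -> (forall v, qf (bform (chi U)) v <= M * qf ip v) ->
  (forall d, 0 < d -> exists t, wslab al be t <= d) -> (forall d, 0 < d -> exists t, M - d <= wslab al be t) ->
  spectrum ip (bergman_T oU UD) = [set x%:C | x in `[0, M]%classic] /\ op_norm ip (bergman_T oU UD) = M.
Proof.
move=> M0 bM lo hi; have TE := bergman_TE oU UD.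
have ap x : 0 <= x <= M -> approx ip (bform (chi U)) x.
  move=> /andP[x0 xM]; apply: (approx_closed (ip_form R)) => d d0.
  have [t1 t1d] := lo d d0; have [t2 t2d] := hi d d0.
  have [h1|h1] := leP (wslab al be t1) x; have [h2|h2] := leP x (wslab al be t2).
  - have [t <-] := wslab_attained h1 h2; exists (wslab al be t); [by rewrite subrr normr0 ltW|exact: wslab_approx].
  - exists (wslab al be t2); last exact: wslab_approx.
    by rewrite ger0_norm; move: (wslab al be t2) t2d h2 => *; lra.
  - exists (wslab al be t1); last exact: wslab_approx.
    by rewrite ler0_norm; move: (wslab al be t1) t1d h1 => *; lra.
  - exists (wslab al be t1); last exact: wslab_approx.
    by rewrite ler0_norm; move: (wslab al be t1) t1d h1 => *; lra.
split; last first.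
  by apply: (op_norm_approx (bergman_hilbert R) fU bM TE M0); apply: ap; rewrite M0 lexx.
apply/seteqP; split=> [c|c [x]].
  move=> /(spectrum_sub (bergman_hilbert R) fU bM TE)[x xM ->]; exists x.
    by rewrite /= in_itv.
  by [].
rewrite /= in_itv /= => xM <-; apply: (approx_spectrum (bergman_hilbert R) TE); exact: ap.
Qed.

(** Each trapezoid has its own maximizing t0, but its maximal mean is at most the slab mean at t0,
    hence at most M; letting n grow gives the bound for U. *)
Lemma slab_energy (M : R) : - hp < al -> be < hp -> (forall t, wslab al be t <= M) -> forall v, qf (bform (chi U)) v <= M * qf ip v.
Proof.
move=> alh' beh' bM v.
have key n : qf (bform (fun z => trap al be (dl n) (yy z))) v <= M * qf ip v.
  pose h := trap al be (dl n); pose f := wmean h (- hp) hp.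
  have ch : continuous h by exact: trap_cont.
  have h01 y : 0 <= h y <= 1 by exact: trap01.
  have cf : continuous f by apply: wmean_cont => //; exact: hp0.
  have fm t : f t <= wslab al be t by have [] := wmean_trap t alh (dl_le n) beh (dl_gt0 n).
  (* The mean is dominated by that of the slab, which tends to 0 both ways, so a positive value at 0
     forces a maximum. If the value at 0 is 0, [wmean_mul] makes the mean vanish identically. *)
  have [t0 tmax] : exists t0, forall t, f t <= f t0.
    have f0 t : 0 <= f t by have /andP[] := trap_wmean01 n t.
    have [fz|fz] := eqVneq (f 0) 0.
      exists 0 => t; have := wmean_mul ch h01 (lexx _) (@hp0 R) (lexx _) 0 t.
      by rewrite -/f fz mulr0.
    have [|B B0 HB] := wslab_small alh' ab beh' (_ : 0 < f 0); first by rewrite lt_neqAle eq_sym fz f0.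
    by apply: coercive_max cf B0 _ => t /HB; apply: le_trans; exact: fm.
  have M01 : 0 <= f t0 <= 1 by exact: trap_wmean01.
  have W0 : 0 <= expR (4 * `|t0|) by exact: expR_ge0.
  (* 9 = 3^2, from squaring [hp_cos] for the double zero; it also covers the 3 of the simple
     zero. *)
  pose C0 := 9 * expR (4 * `|t0|).
  have C00 : 0 <= C0 by exact: mulr_ge0.
  have K0 y : `|y| <= hp -> 0 <= pot h (f t0) t0 y.
    have /andP[m0 m1] := M01; have d0 := dl_gt0 n; have dd := dl_le n.
    have dM : dl n * f t0 <= dl n by rewrite ler_piMr// ltW.
    have dM0 : 0 <= dl n * f t0 by rewrite mulr_ge0// ltW.
    apply: (pot_ge0 ch h01 M01 erefl tmax (a := al + dl n * f t0) (b := be - dl n * f t0)).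
    - by apply: (le_trans alh); rewrite lerDl.
    - by move: dM dd; move: (dl n * f t0) (dl n) => *; lra.
    - by apply: le_trans beh; rewrite lerBlDr lerDl.
    - by move=> x xa; apply: trap_le => //; rewrite xa.
    - by move=> x xa; apply: trap_le => //; rewrite xa orbT.
    - by move=> x /andP[xa xb]; apply: trap_ge.
  have KC y : `|y| <= hp -> pot h (f t0) t0 y <= C0 * cos y ^+ 2.
    move=> yh; apply: (le_trans (ler_norm _)); apply: (le_trans (pot_bd ch h01 M01 erefl tmax yh)).
    rewrite [C0]mulrC -mulrA; apply: ler_wpM2l => //.
    rewrite (_ : 9 * cos y ^+ 2 = (3 * cos y) ^+ 2); last by ring.
    have c1 := hp_cos yh; rewrite ler_pXn2r ?nnegrE//; first by rewrite subr_ge0.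
    by apply: le_trans c1; rewrite subr_ge0.
  have AC y : `|y| <= hp -> `|pot1 h (f t0) t0 y| <= C0 * cos y.
    move=> yh; apply: (le_trans (pot1_bd ch h01 M01 erefl yh)).
    rewrite [C0]mulrC -mulrA; apply: ler_wpM2l => //; have c1 := hp_cos yh.
    have : 0 <= cos y by rewrite -(@pmulr_rge0 _ 3)//; apply: le_trans c1; rewrite subr_ge0.
    by move: c1; move: (cos y) => c; lra.
  have := energy p1 q1 pq ch h01 M01 (der_pot (f t0) t0 ch) (der_pot1 (f t0) t0 ch) C00 K0 KC AC
    (bergman_hol v) (fun z => @bergman_out R v z) (bergman_l2 v).
  rewrite qf_bform qf_ip => /le_trans; apply; apply: ler_wpM2r; first by apply: rint_ge0 => z; exact: sqr_ge0.
  by apply: (le_trans (fm t0)); exact: bM.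
have := trap_ccvg v v => /ccvgP H; apply/ler_addgt0Pr => e e0.
have [N _ /(_ N (leqnn N)) HN] := H e e0; have := le_trans (Re_le _) HN; have := key N.
rewrite cReD cReN ler_norml => k1 /andP[k2 k3].
rewrite /qf in k1 *; lra.
Qed.

Lemma spectrum_lune : - hp < al -> be < hp -> let normT := op_norm ip (bergman_T oU UD) in
  [/\ spectrum ip (bergman_T oU UD) = [set x%:C | x in `[0, normT]%classic], 0 < normT & normT < 1].
Proof.
move=> alh' beh' /=.
have [B B0 HB] := wslab_small alh' ab beh' (wslab_gt0 alh ab beh 0).
have [t0 tmax] := coercive_max (wslab_cont alh ab beh) B0 HB.
have M0 := wslab_gt0 alh ab beh t0.
have [||-> ->] := spectrum_slab (ltW M0) (slab_energy alh' beh' tmax).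
- move=> d d0; have [B' B0' HB'] := wslab_small alh' ab beh' d0.
  by exists B'; apply: HB'; rewrite ger0_norm.
- by move=> d d0; exists t0; rewrite lerBlDr lerDl ltW.
split=> //.
(* The slab and its two complementary slabs have total mean 1, and the outer two are nonempty. *)
have := wslab_full t0; rewrite -(wslab_cat _ al) -(wslab_cat al be hp).
have := wslab_gt0 (lexx _) alh' (le_trans (ltW ab) beh) t0.
have := wslab_gt0 (le_trans alh (ltW ab)) beh' (lexx _) t0.
by move: (wslab _ _ _) (wslab _ _ _) (wslab _ _ _) => *; lra.
Qed.

(** A crescent reaches one end of the strip and its complement the other. So the mean tends to 0 in
    one direction of t, and that of the complement in the other; the bound by 1 is trivial. *)
Lemma spectrum_crescent : (- hp < al /\ be = hp) \/ (al = - hp /\ be < hp) ->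
  spectrum ip (bergman_T oU UD) = [set x%:C | x in `[0, 1]%classic].
Proof.
move=> H; have [] // := @spectrum_slab 1 ler01.
- move=> v; rewrite mul1r; apply: bform_le; [exact: meas_chi|exact: chi01].
- move=> d d0; case: H => -[h1 h2].
    by have [T HT] := wslab_small_pinfty alh ab beh h1 d0; exists T; exact: HT.
  by have [T HT] := wslab_small_ninfty alh ab beh h2 d0; exists (- T); exact: HT.
move=> d d0; case: H => -[h1 h2].
  have alh2 : al <= hp by rewrite (le_trans (ltW ab)).
  have alh3 : al < hp by rewrite -h2.
  have [T HT] := wslab_small_ninfty (lexx _) h1 alh2 alh3 d0; exists (- T).
  have := HT (- T) (lexx _); have := wslab_full (- T); rewrite -(wslab_cat _ al) h2.
  by move: (wslab _ _ _) (wslab _ _ _) => *; lra.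
have beh2 : - hp <= be by rewrite -h1 ltW.
have beh3 : - hp < be by rewrite -h1.
have [T HT] := wslab_small_pinfty beh2 h2 (lexx _) beh3 d0; exists T.
have := HT T (lexx _); have := wslab_full T; rewrite -(wslab_cat _ be) h1.
by move: (wslab _ _ _) (wslab _ _ _) => *; lra.
Qed.

End slab.

(** * Hypercycles in strip coordinates *)

Section geometry.
Context (R : realType).
Local Notation C := R[i].
Local Notation nm := (@Normc.normc R).
Local Notation hp := (@pi R / 2).

Lemma wd_continuous (f : C -> C) (z a b : C) : wd f z a b -> {for z, continuous f}.
Proof.
move=> /wd_cont h; have FF := nbhs_filter z; apply/cvgrPdist_lt => e e0.
have [e0' eE] : 0 < complex.Re e /\ e = (complex.Re e)%:C.
  move: e e0 => [x y]; rewrite ltcE /= => /andP[/eqP -> x0]; by split.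
have [d d0 hd] := h _ e0'; exists d%:C; first by rewrite /= ltcR.
move=> w; rewrite /ball /= => zw; rewrite eE distrC normCE ltcR; apply: hd.
by rewrite nm_distC -ltcR -normCE.
Qed.

Lemma Re_segment (a b : C) (s : R) : complex.Re (a + s%:C * b) = complex.Re a + s * complex.Re b.
Proof. by case: a b => [? ?] [? ?] /=; ring. Qed.

Lemma Im_segment (a b : C) (s : R) : complex.Im (a + s%:C * b) = complex.Im a + s * complex.Im b.
Proof. by case: a b => [? ?] [? ?] /=; ring. Qed.

Lemma segment_continuous (a b : C) : continuous (fun s : R => a + s%:C * b).
Proof.
have -> : (fun s : R => a + s%:C * b) = @plane R \o (fun s => (complex.Re a + s * complex.Re b, complex.Im a + s * complex.Im b)).
  by apply/funext => s /=; apply: complexPeq; rewrite ?Re_segment ?Im_segment.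
move=> s; apply: continuous_comp; last exact: plane_continuous.
have h (x y : R) : (fun s => x + s * y) @ s --> x + s * y.
  by apply: cvgD; [exact: cvg_cst|apply: cvgMl; exact: cvg_id].
have := cvg_pair (h (complex.Re a) (complex.Re b)) (h (complex.Im a) (complex.Im b)); exact.
Qed.

Lemma conjBl (x y : C) : (x - y)^J = x^J - y^J. Proof. exact: rmorphB. Qed.
Lemma conjVl (x : C) : (x^-1)^J = (x^J)^-1. Proof. exact: fmorphV. Qed.

Lemma cIm_conj (z w : C) : complex.Im (z * w^J) = complex.Im z * complex.Re w - complex.Re z * complex.Im w.
Proof. by case: z w => [a b] [c d] /=; ring. Qed.

Lemma Im_zeta_alg (p q z : C) : nm p = 1 -> nm q = 1 ->
  complex.Im ((q - p) * p^J * (z - p) * (z - q)^J) =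
  complex.Im (q * p^J) * (1 + nm z ^+ 2) - 2 * complex.Im (z * (p - q)^J).
Proof.
move=> p1 q1; have hp := nm_sqr p; have hq := nm_sqr q; rewrite p1 expr1n in hp; rewrite q1 expr1n in hq.
rewrite !nm_sqr; move: hp hq; move: p q z {p1 q1} => [a b] [c d] [x y] /= hp hq.
have hp' : a ^+ 2 = 1 - b ^+ 2 by rewrite hp addrK.
have hq' : c ^+ 2 = 1 - d ^+ 2 by rewrite hq addrK.
by ring: hp' hq'.
Qed.

Section coord.
Variables (p q : C).
Hypotheses (p1 : nm p = 1) (q1 : nm q = 1) (pq : p != q).
Local Notation zeta := (zeta p q).
Local Notation yy := (yy p q).

Lemma Im_zeta z : nm z < 1 -> complex.Im (zeta z) =
  (complex.Im (q * p^J) * (1 + nm z ^+ 2) - 2 * complex.Im (z * (p - q)^J)) / nm (z - q) ^+ 2.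
Proof.
move=> z1; have zq := zq0 q1 z1.
have zq' : z - q != 0 by rewrite -nm_gt0.
have -> : zeta z = (nm (z - q) ^- 2)%:C * ((q - p) * p^J * (z - p) * (z - q)^J).
  have -> : (nm (z - q) ^- 2)%:C = ((z - q) * (z - q)^J)^-1 :> C by rewrite mulJE fmorphV.
  have : (z - q)^J != 0 by rewrite -nm_eq0 nmJ nm_eq0.
  rewrite /zeta; move: ((z - q)^J) => v v0; field; by rewrite v0 zq'.
by rewrite -(Im_zeta_alg z p1 q1); move: (_ * (z - q)^J) => X; rewrite cImM /=; ring.
Qed.

Definition unzeta (w : C) : C := (w * q - (q - p) * p^J * p) / (w - (q - p) * p^J).

Let k : C := (q - p) * p^J.

Let Re_k : complex.Re k = - (nm (p - q) ^+ 2 / 2).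
Proof.
have hp := nm_sqr p; have hq := nm_sqr q; rewrite p1 expr1n in hp; rewrite q1 expr1n in hq.
rewrite /k nm_sqr; move: hp hq; case: p q => [a b] [c d] /= hp hq.
have hp' : a ^+ 2 = 1 - b ^+ 2 by rewrite hp addrK.
have hq' : c ^+ 2 = 1 - d ^+ 2 by rewrite hq addrK.
by field: hp' hq'.
Qed.

Lemma unzeta_den w : 0 < complex.Re w -> w - (q - p) * p^J != 0.
Proof.
move=> w0; apply/eqP => /(congr1 (@complex.Re R)); rewrite cReD cReN Re_k /= opprK => /eqP.
by rewrite gt_eqF// addr_gt0// divr_gt0// exprn_gt0// pq0.
Qed.

Lemma unzeta_disc w : 0 < complex.Re w -> nm (unzeta w) < 1.
Proof.
move=> w0; have d0 := unzeta_den w0; have n0 : 0 < nm (w - k) by rewrite nm_gt0.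
rewrite /unzeta nmM nmV -/k ltr_pdivrMr// mul1r -(@ltr_pXn2r _ 2) ?nnegrE ?nm_ge0//.
have pq2 : 0 < nm (p - q) ^+ 2 by rewrite exprn_gt0// pq0.
rewrite -subr_gt0 (_ : _ - _ = 2 * complex.Re w * nm (p - q) ^+ 2); first by rewrite mulr_gt0// mulr_gt0.
have hp := nm_sqr p; have hq := nm_sqr q; rewrite p1 expr1n in hp; rewrite q1 expr1n in hq.
rewrite /k !nm_sqr; move: hp hq; move: p q w {w0 d0 n0 pq2} => [a b] [c d] [x y] /= hp hq.
have hp' : a ^+ 2 = 1 - b ^+ 2 by rewrite hp addrK.
have hq' : c ^+ 2 = 1 - d ^+ 2 by rewrite hq addrK.
by ring: hp' hq'.
Qed.

Lemma zetaK z : nm z < 1 -> unzeta (zeta z) = z.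
Proof.
move=> z1; have zq := disc_neq z1 q1; have qp : q - p != 0 by rewrite subr_eq0 eq_sym.
have pJ : p^J != 0 by rewrite -nm_eq0 nmJ p1 oner_eq0.
have k0 : k != 0 by rewrite mulf_neq0.
rewrite /unzeta -[zeta z]/(k * (z - p) / (z - q)) -/k.
have -> : k * (z - p) / (z - q) * q - k * p = z * (k * (q - p) / (z - q)) by field.
have -> : k * (z - p) / (z - q) - k = k * (q - p) / (z - q) by field.
by rewrite mulfK// mulf_neq0 ?invr_eq0// mulf_neq0.
Qed.

Lemma unzetaK w : 0 < complex.Re w -> zeta (unzeta w) = w.
Proof.
move=> w0; have d0 := unzeta_den w0; have qp : q - p != 0 by rewrite subr_eq0 eq_sym.
have pJ : p^J != 0 by rewrite -nm_eq0 nmJ p1 oner_eq0.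
have k0 : k != 0 by rewrite mulf_neq0.
rewrite -[zeta _]/(k * (unzeta w - p) / (unzeta w - q)) /unzeta -/k.
have -> : (w * q - k * p) / (w - k) - p = w * (q - p) / (w - k) by field.
have -> : (w * q - k * p) / (w - k) - q = k * (q - p) / (w - k) by field.
by field; rewrite d0 qp.
Qed.

(** Moebius invariance of the pseudo-hyperbolic distance, which in the right half-plane is |w - w'|
    / |w + conj(w')|. *)
Lemma hdist_zeta z w : nm z < 1 -> nm w < 1 ->
  nm ((z - w) / (1 - z * w^J)) = nm (zeta z - zeta w) / nm (zeta z + (zeta w)^J).
Proof.
move=> z1 w1; have zq := disc_neq z1 q1; have wq := disc_neq w1 q1.
have pn : p != 0 by rewrite -nm_eq0 p1 oner_eq0.
have qn : q != 0 by rewrite -nm_eq0 q1 oner_eq0.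
have pJ : p^J = p^-1 by apply: (mulfI pn); rewrite mulJE p1 expr1n mulfV.
have qJ : q^J = q^-1 by apply: (mulfI qn); rewrite mulJE q1 expr1n mulfV.
have wqJ : q * w^J - 1 != 0.
  have -> : q * w^J - 1 = q * (w - q)^J by rewrite conjBl qJ mulrBr mulfV.
  by rewrite mulf_neq0// -nm_eq0 nmJ nm_eq0.
have nwq : nm (q * w^J - 1) = nm (w - q).
  have -> : q * w^J - 1 = q * (w - q)^J by rewrite conjBl qJ mulrBr mulfV.
  by rewrite nmM q1 mul1r nmJ.
have -> : zeta z - zeta w = (q - p) * p^-1 * (p - q) * (z - w) / ((z - q) * (w - q)).
  by rewrite /zeta pJ; field; rewrite ?pn ?zq ?wq.
have -> : (zeta w)^J = (q^-1 - p^-1) * p * (w^J - p^-1) / (w^J - q^-1).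
  by rewrite /zeta !conjMl conjcK conjVl !conjBl pJ qJ.
have -> : zeta z + (q^-1 - p^-1) * p * (w^J - p^-1) / (w^J - q^-1) =
    (q - p) * p^-1 * (q - p) * (z * w^J - 1) / ((z - q) * (q * w^J - 1)).
  rewrite /zeta pJ; move: (w^J) wqJ {nwq} => v v0; field; rewrite ?pn ?qn ?zq ?v0 //.
rewrite !nmM !nmV !nmM nwq -[nm (1 - _)]nmN opprB [nm (p - q)]nm_distC.
have a1 : nm (z - q) != 0 by rewrite gt_eqF// zq0.
have a2 : nm (w - q) != 0 by rewrite gt_eqF// zq0.
have a3 : nm (q - p) != 0 by rewrite nm_distC gt_eqF// pq0.
have a4 : nm p != 0 by rewrite p1 oner_eq0.
have a5 : nm (z * w^J - 1) != 0.
  rewrite nm_eq0 subr_eq0; apply: contraTneq z1 => e1.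
  have := congr1 nm e1; rewrite nmM nmJ nm1 => e2; rewrite -leNgt -e2 ler_piMr//; exact: ltW.
by field; rewrite a1 a2 a3 a4 a5.
Qed.

(** tan (arg (zeta z) / 2), the signed pseudo-hyperbolic distance to the axis. *)
Definition tau (z : C) : R := complex.Im (zeta z) / (nm (zeta z) + complex.Re (zeta z)).

(* The hyperbolic distance between points at pseudo-hyperbolic distance [x]. *)
Definition gd_inv (x : R) : R := ln ((1 + x) / (1 - x)).

Lemma gd_inv_mono (x y : R) : -1 < x -> x <= y -> y < 1 -> gd_inv x <= gd_inv y.
Proof.
move=> x1 xy y1; have x1' : x < 1 by exact: le_lt_trans y1.
have hx : 0 < 1 - x by rewrite subr_gt0.
have hy : 0 < 1 - y by rewrite subr_gt0.
have hx' : 0 < 1 + x by move: x1; lra.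
have hy' : 0 < 1 + y by move: x1 xy; lra.
rewrite ler_ln ?posrE ?divr_gt0// ler_pdivrMr// mulrAC ler_pdivlMr//; move: xy; nra.
Qed.

Lemma tau_abs z : nm z < 1 -> `|tau z| = nm (zeta z - (nm (zeta z))%:C) / nm (zeta z + (nm (zeta z))%:C) /\ `|tau z| < 1.
Proof.
move=> z1; have x0 := Re_zeta_gt0 p1 q1 pq z1; have n0 : 0 < nm (zeta z) by apply: lt_le_trans x0 _; exact: le_trans (ler_norm _) (Re_le _).
have e1 := nm_sqr (zeta z); rewrite /tau; move: (nm (zeta z)) n0 e1 => r r0 e1.
have rx : 0 < r + complex.Re (zeta z) by exact: addr_gt0.
have iE : complex.Im (zeta z) ^+ 2 = (r - complex.Re (zeta z)) * (r + complex.Re (zeta z)) by rewrite -subr_sqr e1 addrAC subrr add0r.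
have nB := nm_sqr (zeta z - r%:C); have nD := nm_sqr (zeta z + r%:C).
rewrite !(cReD, cImD, cReN, cImN) /= oppr0 !addr0 in nB nD.
move: (complex.Re _) (complex.Im _) x0 rx iE e1 nB nD (nm_ge0 (zeta z - r%:C)) (nm_ge0 (zeta z + r%:C)) => x y x0 rx iE e1.
move: (nm _) (nm _) => D B nB nD B0 D0.
have D1 : 0 < D by rewrite lt_neqAle D0 andbT eq_sym -sqrf_eq0 nD gt_eqF// ltr_wpDr ?sqr_ge0// exprn_gt0// addrC.
rewrite normrM normfV (gtr0_norm rx); split.
  apply/eqP; rewrite -(@eqrXn2 _ 2) ?divr_ge0 ?(ltW rx)//; apply/eqP.
  rewrite !expr_div_n real_normK ?num_real// nB nD.
  have -> : (x - r) ^+ 2 + y ^+ 2 = 2 * r * (r - x).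
    by rewrite iE; ring.
  have -> : (x + r) ^+ 2 + y ^+ 2 = 2 * r * (r + x).
    by rewrite iE; ring.
  by rewrite iE; field; rewrite !gt_eqF.
rewrite ltr_pdivrMr// mul1r -(@ltr_pXn2r _ 2) ?nnegrE ?(ltW rx)// real_normK ?num_real// iE expr2.
by rewrite ltr_pM2r// ltrD2l; lra.
Qed.

(** The point of the positive axis closest to w is |w|. *)
Lemma apollonius (w : C) (om : R) : 0 < complex.Re w -> 0 < om ->
  nm (w - (nm w)%:C) / nm (w + (nm w)%:C) <= nm (w - om%:C) / nm (w + om%:C) /\ nm (w - om%:C) / nm (w + om%:C) < 1.
Proof.
move=> x0 om0; have r0 : 0 < nm w by apply: lt_le_trans x0 _; exact: le_trans (ler_norm _) (Re_le _).
have e1 := nm_sqr w; have n1 := nm_sqr (w - (nm w)%:C); have n2 := nm_sqr (w + (nm w)%:C).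
have n3 := nm_sqr (w - om%:C); have n4 := nm_sqr (w + om%:C).
have p1' := nm_ge0 (w - (nm w)%:C); have p2 := nm_ge0 (w + (nm w)%:C).
have p3 := nm_ge0 (w - om%:C); have p4 := nm_ge0 (w + om%:C).
rewrite !(cReD, cImD, cReN, cImN) /= oppr0 !addr0 in n1 n2 n3 n4.
move: (nm (w - (nm w)%:C)) (nm (w + (nm w)%:C)) (nm (w - om%:C)) (nm (w + om%:C)) n1 n2 n3 n4 p1' p2 p3 p4 => a b a' b'.
move: (nm w) (complex.Re w) (complex.Im w) r0 x0 e1 => r x y r0 x0 e1 n1 n2 n3 n4 a0 b0 a0' b0'.
have pos_of (u v : R) : 0 <= v -> 0 < u -> v ^+ 2 = (x + u) ^+ 2 + y ^+ 2 -> 0 < v.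
  move=> v0 u0 vE; rewrite lt_neqAle v0 andbT eq_sym -sqrf_eq0 vE gt_eqF//.
  by rewrite ltr_wpDr ?sqr_ge0// exprn_gt0// addr_gt0.
have b1 := pos_of _ _ b0 r0 n2; have b1' := pos_of _ _ b0' om0 n4.
split.
  rewrite ler_pdivrMr// mulrAC ler_pdivlMr// -(@ler_pXn2r _ 2) ?nnegrE ?mulr_ge0//.
  rewrite !exprMn n1 n2 n3 n4 -subr_ge0.
  (* With denominators cleared, the gap is 4 |w| Re w (|w| - om)^2. *)
  rewrite (_ : _ - _ = 4 * r * x * (r - om) ^+ 2 + 2 * x * (r ^+ 2 - (x ^+ 2 + y ^+ 2)) * 0 ); last first.
    have y2 : y ^+ 2 = r ^+ 2 - x ^+ 2 by rewrite e1 addrC addKr.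
    by ring: y2.
  by rewrite mulr0 addr0 mulr_ge0 ?sqr_ge0// !mulr_ge0 ?(ltW r0) ?(ltW x0).
rewrite ltr_pdivrMr// mul1r -(@ltr_pXn2r _ 2) ?nnegrE// n3 n4 ltrD2r -subr_gt0.
by rewrite (_ : _ - _ = 4 * x * om); [rewrite !mulr_gt0|ring].
Qed.

Variable (G : set C).
Hypothesis (GE : forall z, G z <-> nm z < 1 /\ complex.Im (zeta z) = 0).

(** The infimum is attained at the point of the axis whose image is |zeta z|, by [apollonius] and
    monotonicity of [gd_inv]. *)
Lemma hdist_setE z : nm z < 1 -> hdist_set G z = gd_inv `|tau z|.
Proof.
move=> z1; have x0 := Re_zeta_gt0 p1 q1 pq z1.
have n0 : 0 < nm (zeta z) by apply: lt_le_trans x0 _; exact: le_trans (ler_norm _) (Re_le _).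
have [tE t1] := tau_abs z1.
have hG w : G w -> [/\ nm w < 1, 0 < complex.Re (zeta w) & zeta w = (complex.Re (zeta w))%:C].
  move=> /GE[w1 wi]; split=> //; first exact: Re_zeta_gt0.
  by apply: complexPeq.
have hE w : G w -> hdist z w = gd_inv (nm (zeta z - zeta w) / nm (zeta z + zeta w)).
  move=> /hG[w1 _ wE]; have zJ : (zeta w)^J = zeta w by rewrite wE conjc_real.
  by rewrite /hdist hdist_zeta// zJ.
apply/eqP; rewrite eq_le; apply/andP; split.
  pose w := unzeta (nm (zeta z))%:C.
  have wr : 0 < complex.Re ((nm (zeta z))%:C : C) by [].
  have Gw : G w by apply/GE; rewrite unzetaK//; split; [exact: unzeta_disc|].
  have -> : gd_inv `|tau z| = hdist z w by rewrite hE// unzetaK// tE.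
  apply: ge_inf; last by exists w.
  exists 0 => _ [v Gv <-]; rewrite hE//; have [v1 v0 ->] := hG v Gv.
  have [_ a1] := apollonius x0 v0.
  have -> : 0 = gd_inv 0 by rewrite /gd_inv addr0 subr0 divr1 ln1.
  apply: gd_inv_mono => //.
  by rewrite divr_ge0.
apply: lb_le_inf.
  exists (hdist z (unzeta 1)); exists (unzeta 1) => //.
  have o0 : 0 < complex.Re (1 : C) by exact: ltr01.
  by apply/GE; rewrite unzetaK//; split; first exact: unzeta_disc.
move=> _ [v Gv <-]; rewrite hE//; have [v1 v0 ->] := hG v Gv.
have [a0 a1] := apollonius x0 v0.
apply: gd_inv_mono => //; last by rewrite tE.
by apply: lt_le_trans (normr_ge0 _); rewrite ltrN10.
Qed.

Definition signed_dist (z : C) : R := gd_inv (tau z).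

Lemma gd_invN (x : R) : -1 < x -> x < 1 -> gd_inv (- x) = - gd_inv x.
Proof.
move=> x1 x2; have h1 : 0 < 1 + x by move: x1; lra.
have h2 : 0 < 1 - x by rewrite subr_gt0.
by rewrite /gd_inv opprK -lnV ?posrE ?divr_gt0// invf_div.
Qed.

Lemma gd_inv0 : gd_inv 0 = 0. Proof. by rewrite /gd_inv addr0 subr0 divr1 ln1. Qed.

Lemma hdist_set_abs z : nm z < 1 -> hdist_set G z = `|signed_dist z|.
Proof.
move=> z1; rewrite hdist_setE// /signed_dist; have [_ t1] := tau_abs z1.
have := t1; rewrite ltr_norml => /andP[t2 t3].
have k0 x : 0 <= x -> x < 1 -> 0 <= gd_inv x.
  by move=> y0 y1; rewrite -gd_inv0; apply: gd_inv_mono => //; rewrite ltrN10.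
have [t0|t0] := leP 0 (tau z); first by rewrite !ger0_norm// k0.
have n0 : 0 <= - tau z by rewrite oppr_ge0 ltW.
by rewrite ltr0_norm// gd_invN// -normrN -gd_invN// ger0_norm// k0// ltrNl.
Qed.

(* The gudermannian: the argument in the strip of the hypercycle at signed
   distance [a]. *)
Definition gd (a : R) : R := 2 * atan ((expR a - 1) / (expR a + 1)).

Lemma gd_lt : {mono gd : a b / a < b}.
Proof.
apply: leW_mono; apply: le_mono => a b ab; rewrite /gd ltr_pM2l//; apply: lt_atan.
have ea := expR_gt0 a; have eb := expR_gt0 b; have : expR a < expR b by rewrite ltr_expR.
move: (expR a) (expR b) ea eb => x y x0 y0 xy.
by rewrite ltr_pdivrMr ?addr_gt0// mulrAC ltr_pdivlMr ?addr_gt0//; nra.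
Qed.

Lemma gd_bd a : - hp < gd a < hp.
Proof.
have ea := expR_gt0 a; rewrite /gd.
have h : `|(expR a - 1) / (expR a + 1)| < 1.
  have d0 : 0 < expR a + 1 by rewrite addr_gt0.
  rewrite normrM normfV (gtr0_norm d0) ltr_pdivrMr// mul1r ltr_norml.
  by apply/andP; split; move: ea; lra.
move: h; rewrite ltr_norml => /andP[h1 h2].
have := lt_atan h1; have := lt_atan h2; rewrite atanN atan1.
by move: (atan _) => x; lra.
Qed.

(** [tau] is tan (y / 2), and the distance is 2 artanh of [tau]; so y = 2 atan (tanh (distance /
    2)), and equidistant curves are horizontal lines. *)
Lemma yy_gd z : nm z < 1 -> yy z = gd (signed_dist z).
Proof.
move=> z1; have [_] := tau_abs z1; rewrite ltr_norml => /andP[t1 t2].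
have h1 : 0 < 1 + tau z by move: t1; lra.
have h2 : 0 < 1 - tau z by rewrite subr_gt0.
rewrite /gd /signed_dist /gd_inv lnK ?posrE ?divr_gt0//.
have -> : ((1 + tau z) / (1 - tau z) - 1) / ((1 + tau z) / (1 - tau z) + 1) = tau z.
  by field; rewrite !gt_eqF//=; move: h1 h2; lra.
have x0 := Re_zeta_gt0 p1 q1 pq z1.
have n0 : 0 < nm (zeta z) by apply: lt_le_trans x0 _; exact: le_trans (ler_norm _) (Re_le _).
have /andP[y1 y2] := yy_lt p q z1.
have cy : cos (yy z) = complex.Re (zeta z) / nm (zeta z).
  by rewrite yyE// -[complex.Im _]/(atan _) cos_atan_div.
have cy0 : cos (yy z) != 0 by rewrite cy gt_eqF// divr_gt0.
have sy : sin (yy z) = complex.Im (zeta z) / nm (zeta z).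
  have : tan (yy z) = complex.Im (zeta z) / complex.Re (zeta z) by rewrite yyE// -[complex.Im (Phi _ _ _)]/(atan _) atanK.
  rewrite /tan cy => /(congr1 (fun u => u * (complex.Re (zeta z) / nm (zeta z)))).
  rewrite divfK ?mulf_neq0 ?invr_eq0 ?gt_eqF// => ->; field; by rewrite !gt_eqF.
pose th := yy z / 2; have thE : yy z = th *+ 2 by rewrite /th -mulr_natr divfK.
have cth : 0 < cos th by apply: cos_gt0_pihalf; rewrite /th; apply/andP; split; lra.
have tauE : tau z = tan th.
  have r1 : tau z = sin (yy z) / (1 + cos (yy z)).
    by rewrite sy cy /tau; field; rewrite !gt_eqF// addr_gt0.
  rewrite r1 thE sin_mulr2n cos_mulr2n /tan; move: (cos th) (sin th) cth => c s c0.
  by field; rewrite gt_eqF//= (_ : _ + _ = 2 * c ^+ 2) ?mulf_neq0 ?expf_neq0 ?gt_eqF//; ring.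
rewrite tauE tanK ?thE; first by rewrite -mulr_natl.
by rewrite in_itv /=; apply/andP; split; rewrite /th; lra.
Qed.

Lemma signed_dist_lt z a : nm z < 1 -> (signed_dist z < a) = (yy z < gd a).
Proof. by move=> z1; rewrite yy_gd// gd_lt. Qed.

Lemma signed_dist_gt z a : nm z < 1 -> (a < signed_dist z) = (gd a < yy z).
Proof. by move=> z1; rewrite yy_gd// gd_lt. Qed.

Definition slab (al be : R) : set C := [set z | nm z < 1 /\ al < yy z < be].

(** In the half-plane a slab is a sector, which is convex: along a segment Im / Re stays between its
    values at the two ends. *)
Lemma slab_segment al be (z0 z : C) (s : R) : slab al be z0 -> slab al be z -> 0 <= s <= 1 ->
  slab al be (unzeta (zeta z0 + s%:C * (zeta z - zeta z0))) /\ 0 < complex.Re (zeta z0 + s%:C * (zeta z - zeta z0)).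
Proof.
move=> [z01 /andP[z02 z03]] [z1 /andP[z2 z3]] /andP[s0 s1].
have x0 := Re_zeta_gt0 p1 q1 pq z01; have x1 := Re_zeta_gt0 p1 q1 pq z1.
set w := _ + _.
have wR : complex.Re w = complex.Re (zeta z0) + s * (complex.Re (zeta z) - complex.Re (zeta z0)).
  by rewrite /w Re_segment cReD cReN.
have wI : complex.Im w = complex.Im (zeta z0) + s * (complex.Im (zeta z) - complex.Im (zeta z0)).
  by rewrite /w Im_segment cImD cImN.
have w0 : 0 < complex.Re w.
  rewrite wR (_ : _ + _ = (1 - s) * complex.Re (zeta z0) + s * complex.Re (zeta z)); last by ring.
  have [s2|s2] := ltP s 1.
    by rewrite ltr_wpDr ?mulr_ge0 ?(ltW x1)// mulr_gt0// subr_gt0.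
  by have -> : s = 1 by [apply/eqP; rewrite eq_le s1]; rewrite subrr mul0r add0r mul1r.
split=> //; split; first exact: unzeta_disc.
have yyE' u : nm u < 1 -> yy u = atan (complex.Im (zeta u) / complex.Re (zeta u)).
  by move=> u1; rewrite yyE.
rewrite yyE' ?unzeta_disc// unzetaK//.
rewrite !yyE'// in z02 z03 z2 z3.
move: (complex.Re (zeta z0)) (complex.Im (zeta z0)) (complex.Re (zeta z)) (complex.Im (zeta z)) x0 x1 z02 z03 z2 z3 wR wI => a b c d a0 c0 z02 z03 z2 z3 wR wI.
have me (m : R) : m <= b / a -> m <= d / c -> m <= complex.Im w / complex.Re w.
  rewrite !ler_pdivlMr// => m1 m2.
  rewrite wI wR -subr_ge0 (_ : _ - _ = (1 - s) * (b - m * a) + s * (d - m * c)); last by ring.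
  by rewrite addr_ge0// mulr_ge0// subr_ge0.
have mf (m : R) : b / a <= m -> d / c <= m -> complex.Im w / complex.Re w <= m.
  rewrite !ler_pdivrMr// => m1 m2.
  rewrite wI wR -subr_ge0 (_ : _ - _ = (1 - s) * (m * a - b) + s * (m * c - d)); last by ring.
  by rewrite addr_ge0// mulr_ge0// subr_ge0.
apply/andP; split.
  have [h|h] := leP (b / a) (d / c).
    by apply: (lt_le_trans z02); apply: le_atan; exact: me.
  by apply: (lt_le_trans z2); apply: le_atan; apply: me => //; exact: ltW.
have [h|h] := leP (b / a) (d / c).
  by apply: (le_lt_trans _ z3); apply: le_atan; exact: mf.
by apply: (le_lt_trans _ z03); apply: le_atan; apply: mf => //; exact: ltW.
Qed.

Lemma unzeta_continuous w : 0 < complex.Re w -> {for w, continuous unzeta}.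
Proof.
move=> /unzeta_den w0.
have h1 := wdB (wdM (wd_id w) (wd_cst q w)) (wd_cst (k * p) w).
have h2 := @wdV _ (fun w => w - k) _ _ _ w0 (wdB (wd_id w) (wd_cst k w)).
exact: wd_continuous (wdM h1 h2).
Qed.

(** The slab is a union of images of segments issuing from one point. *)
Lemma slab_connected al be : connected (slab al be).
Proof.
have [[z0 S0]|nS] := pselect (exists z, slab al be z); last first.
  by rewrite (_ : slab al be = set0); [exact: connected0|apply/seteqP; split=> // z Sz; case: nS; exists z].
pose g z s := unzeta (zeta z0 + s%:C * (zeta z - zeta z0)).
have -> : slab al be = \bigcup_(z in slab al be) (g z @` `[0, 1]%classic).
  apply/seteqP; split=> z.
    move=> Sz; exists z => //; exists 1; first by rewrite /= in_itv /= ler01 lexx.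
    by rewrite /g rmorph1 mul1r addrC subrK zetaK//; case: Sz.
  by move=> [v Sv [s]]; rewrite /= in_itv /= => s01 <-; have [] := slab_segment S0 Sv s01.
apply: bigcup_connected.
  exists z0 => v Sv; exists 0; first by rewrite /= in_itv /= lexx ler01.
  by rewrite /g rmorph0 mul0r addr0 zetaK//; case: S0.
move=> v Sv; apply: connected_continuous_connected; first exact: segment_connected.
apply: continuous_in_subspaceT => s; rewrite inE /= in_itv /= => s01.
have [_ w0] := slab_segment S0 Sv s01.
apply: (@continuous_comp _ _ _ (fun s : R => zeta z0 + s%:C * (zeta v - zeta z0)) unzeta).
  exact: segment_continuous.
exact: unzeta_continuous.
Qed.

Lemma gd0 : gd 0 = 0.
Proof. by rewrite /gd expR0 subrr mul0r atan0 mulr0. Qed.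

Lemma gd_inj : injective gd.
Proof.
move=> a b ab; have := gd_lt a b; have := gd_lt b a; rewrite ab !ltxx => h1 h2.
by apply/eqP; rewrite eq_le !leNgt -h1 -h2.
Qed.

(** * Signed distances and the regions they bound *)

Section signed.
Variable (d : C -> R).
Hypothesis (hd : signed_hdist G d).

Let d_cont z : nm z < 1 -> {for z, continuous d}.
Proof.
case: hd => + _ _ _; rewrite continuous_open_subspace; last exact: disc_open.
by move=> h z1; apply: h; rewrite inE discE.
Qed.

Lemma side_connected (A : set C) (a : R) : connected A -> (forall z, A z -> nm z < 1) ->
  (forall z, A z -> d z <> a) -> (forall z, A z -> a < d z) \/ (forall z, A z -> d z < a).
Proof.
move=> cA A1 Aa; have : connected (d @` A).
  apply: connected_continuous_connected => //; apply: continuous_in_subspaceT => z; rewrite inE => Az.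
  exact/d_cont/A1.
move=> /connected_intervalP iA.
have [[w [Aw wa]]|H] := pselect (exists w, A w /\ d w < a); [right|left] => z Az.
  rewrite ltNge; apply/negP => az.
  have [v Av va] : (d @` A) a by apply: (iA (d w) (d z)); [by exists w|by exists z|by rewrite (ltW wa) az].
  exact: (Aa v Av va).
rewrite lt_neqAle eq_sym; apply/andP; split; first by apply/eqP; exact: Aa.
by rewrite leNgt; apply/negP => za; apply: H; exists z.
Qed.

(** d vanishes only on the axis, so it has a constant sign on each connected side. It takes both
    signs, so the two sides have opposite ones, and |d| is known. *)
Lemma signed_hdistE : (forall z, nm z < 1 -> d z = signed_dist z) \/ (forall z, nm z < 1 -> d z = - signed_dist z).
Proof.
have dabs z : nm z < 1 -> `|d z| = `|signed_dist z|.
  by case: hd => _ h _ _ z1; rewrite h ?discE// hdist_set_abs.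
have nz z : nm z < 1 -> yy z != 0 -> d z <> 0.
  move=> z1 yz dz; have := dabs z z1; rewrite dz normr0 => /esym/eqP; rewrite normr_eq0 => /eqP s0.
  by move: yz; rewrite yy_gd// s0 gd0 eqxx.
have hp1 : 0 < hp by rewrite divr_gt0// pi_gt0.
have HP : (forall z, slab 0 hp z -> 0 < d z) \/ (forall z, slab 0 hp z -> d z < 0).
  apply: side_connected; [exact: slab_connected|by move=> z []|].
  by move=> z [z1 /andP[y0 _]]; apply: nz => //; rewrite gt_eqF.
have HN : (forall z, slab (- hp) 0 z -> 0 < d z) \/ (forall z, slab (- hp) 0 z -> d z < 0).
  apply: side_connected; [exact: slab_connected|by move=> z []|].
  by move=> z [z1 /andP[_ y0]]; apply: nz => //; rewrite lt_eqF.
have Pin z : nm z < 1 -> 0 < yy z -> slab 0 hp z.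
  by move=> z1 y0; split=> //; have /andP[_ ->] := yy_lt p q z1; rewrite y0.
have Nin z : nm z < 1 -> yy z < 0 -> slab (- hp) 0 z.
  by move=> z1 y0; split=> //; have /andP[-> _] := yy_lt p q z1; rewrite y0.
have sP z : nm z < 1 -> 0 < yy z -> 0 < signed_dist z by move=> z1 y0; rewrite signed_dist_gt// gd0.
have sN z : nm z < 1 -> yy z < 0 -> signed_dist z < 0 by move=> z1 y0; rewrite signed_dist_lt// gd0.
have sO z : nm z < 1 -> yy z = 0 -> signed_dist z = 0 by move=> z1 y0; apply: gd_inj; rewrite gd0 -yy_gd.
have dO z : nm z < 1 -> yy z = 0 -> d z = 0.
  by move=> z1 /(sO z z1) s0; apply/eqP; rewrite -normr_eq0 dabs// s0 normr0.
case: hd => _ _ [v + dv] [v' + dv']; rewrite !discE => v1 v1'.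
case: HP => HP; case: HN => HN.
- have [yv|yv|yv] := ltgtP (yy v) 0.
  + by have := lt_trans dv (HN v (Nin v v1 yv)); rewrite ltxx.
  + by have := lt_trans dv (HP v (Pin v v1 yv)); rewrite ltxx.
  + by move: dv; rewrite dO// ltxx.
- left=> z z1; have := dabs z z1; have [yz|yz|yz] := ltgtP (yy z) 0.
  + by rewrite !ltr0_norm ?sN ?HN//; [move/oppr_inj|exact: Nin].
  + by rewrite !gtr0_norm ?sP ?HP//; exact: Pin.
  + by rewrite dO// sO.
- right=> z z1; have := dabs z z1; have [yz|yz|yz] := ltgtP (yy z) 0.
  + by rewrite gtr0_norm ?ltr0_norm ?sN ?HN//; exact: Nin.
  + by rewrite ltr0_norm ?gtr0_norm ?sP ?HP//; [move<-; rewrite opprK|exact: Pin].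
  + by rewrite dO// sO// oppr0.
have [yv|yv|yv] := ltgtP (yy v') 0.
- by have := lt_trans dv' (HN v' (Nin v' v1' yv)); rewrite ltxx.
- by have := lt_trans dv' (HP v' (Pin v' v1' yv)); rewrite ltxx.
- by move: dv'; rewrite dO// ltxx.
Qed.

Lemma lune_slab (a b : R) : a < b -> exists al be, [/\ - hp < al, al < be, be < hp &
  forall z, (disc R z /\ a < d z < b) <-> (nm z < 1 /\ al < yy z < be)].
Proof.
move=> ab; case: signed_hdistE => dE.
  exists (gd a), (gd b); rewrite gd_lt ab; have /andP[-> _] := gd_bd a; have /andP[_ ->] := gd_bd b; split=> // z.
  by rewrite discE; split=> -[z1 H]; split=> //; move: H; rewrite dE// signed_dist_gt// signed_dist_lt.
exists (gd (- b)), (gd (- a)); rewrite gd_lt ltrN2 ab; have /andP[-> _] := gd_bd (- b); have /andP[_ ->] := gd_bd (- a); split=> // z.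
by rewrite discE; split=> -[z1 H]; split=> //; move: H; rewrite dE// ltrNr ltrNl signed_dist_gt// signed_dist_lt// andbC.
Qed.

(** U avoids the hypercycle and is connected, so it lies on one side of it; inside the disc U has no
    other boundary, so it fills that side. *)
Lemma crescent_slab (a : R) (B U : set C) : ideal_arc G B -> open U -> connected U -> U `<=` disc R ->
  frontier U = closure (hypercycle d a) `|` B ->
  exists al be, [/\ - hp <= al, al < be, be <= hp, (- hp < al /\ be = hp) \/ (al = - hp /\ be < hp) &
   forall z, U z <-> (nm z < 1 /\ al < yy z < be)].
Proof.
move=> arc oU cU UD fU.
have U1 z : U z -> nm z < 1 by move=> /UD; rewrite discE.
have B1 z : B z -> 1 <= nm z.
  by case: arc => v _ -> /connected_component_sub [/= + _]; rewrite normCE => -[->].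
(* The arc B lies on the unit circle, so a boundary point of U in the disc belongs to the closure of
   the hypercycle, on which d = a by continuity. *)
have out z : nm z < 1 -> closure U z -> ~ U z -> d z = a.
  move=> z1 cz nz; have : frontier U z by split=> //; rewrite (interior_id _).1.
  rewrite fU => -[cl|/B1]; last by rewrite leNgt z1.
  apply: contrapT => da.
  have /cl[w [[_ wa] /= wn]] : nbhs z [set w | d w <> a].
    have e0 : 0 < `|d z - a| by rewrite normr_gt0 subr_eq0; exact/eqP.
    have /cvgrPdist_lt/(_ _ e0) := d_cont z1; apply: filterS => w dw wa.
    by move: dw; rewrite wa ltxx.
  exact: wn.
(* U is open, hence disjoint from its frontier, which contains the hypercycle. *)
have Ua z : U z -> d z <> a.
  move=> Uz da; have : (closure (hypercycle d a) `|` B) z.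
    by left; apply: subset_closure; split=> //; exact: UD.
  by rewrite -fU => -[_]; rewrite (interior_id _).1.
(* The frontier contains the nonempty arc, so U is not empty. *)
have [z0 Uz0] : exists z, U z.
  case: arc => v Bv BE; have : frontier U v by rewrite fU; right; rewrite BE; exact: connected_component_refl.
  by move=> [cv _]; have [z [Uz _]] := cv setT filterT; exists z.
(* U is open and closed in the slab, which is connected. *)
have full al be : (forall z, U z -> slab al be z) -> (forall z, slab al be z -> d z <> a) -> forall z, U z <-> slab al be z.
  move=> sub da z; split; first exact: sub.
  suff <- : U `&` slab al be = slab al be by case.
  rewrite setIC; apply: slab_connected.
  - by exists z0; split=> //; exact: sub.
  - by exists U.
  - exists (closure U); first exact: closed_closure.
    apply/seteqP; split=> w [Sw Uw]; split=> //; first exact: subset_closure.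
    by apply: contrapT => nU; apply: (da w Sw); apply: out => //; case: Sw.
have right c : (forall z, U z -> c < signed_dist z) -> (forall z, nm z < 1 -> d z = a -> signed_dist z = c) ->
  exists al be, [/\ - hp <= al, al < be, be <= hp, (- hp < al /\ be = hp) \/ (al = - hp /\ be < hp) &
   forall z, U z <-> (nm z < 1 /\ al < yy z < be)].
  move=> cs sc; have /andP[c1 c2] := gd_bd c; exists (gd c), hp; split=> //; [exact: ltW|by left|].
  apply: full => z.
    by move=> Uz; have z1 := U1 z Uz; split=> //; rewrite -signed_dist_gt// cs//; have /andP[] := yy_lt p q z1.
  by move=> [z1 /andP[]]; rewrite -signed_dist_gt// => + _ da; rewrite sc// ltxx.
have left_ c : (forall z, U z -> signed_dist z < c) -> (forall z, nm z < 1 -> d z = a -> signed_dist z = c) ->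
  exists al be, [/\ - hp <= al, al < be, be <= hp, (- hp < al /\ be = hp) \/ (al = - hp /\ be < hp) &
   forall z, U z <-> (nm z < 1 /\ al < yy z < be)].
  move=> cs sc; have /andP[c1 c2] := gd_bd c; exists (- hp), (gd c); split=> //; [exact: ltW|by right|].
  apply: full => z.
    by move=> Uz; have z1 := U1 z Uz; split=> //; rewrite -signed_dist_lt// cs// andbT; have /andP[] := yy_lt p q z1.
  by move=> [z1 /andP[_]]; rewrite -signed_dist_lt// => + da; rewrite sc// ltxx.
case: signed_hdistE => dE; case: (side_connected cU U1 Ua) => H.
- by apply: (right a) => z; [move=> Uz; rewrite -dE ?H ?U1|move=> z1; rewrite dE].
- by apply: (left_ a) => z; [move=> Uz; rewrite -dE ?H ?U1|move=> z1; rewrite dE].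
- by apply: (left_ (- a)) => z; [move=> Uz; rewrite ltrNr -dE ?H ?U1|move=> z1 <-; rewrite dE// opprK].
- by apply: (right (- a)) => z; [move=> Uz; rewrite ltrNl -dE ?H ?U1|move=> z1 <-; rewrite dE// opprK].
Qed.

End signed.
End coord.

Lemma unit_alg (m x y r : R) : 0 < m -> x ^+ 2 = m - y ^+ 2 -> r ^+ 2 = m - 1 ->
  ((x - r * y) / m) ^+ 2 + ((y + r * x) / m) ^+ 2 = 1.
Proof.
move=> m0 xE rE; rewrite (_ : _ + _ = (1 + r ^+ 2) * (x ^+ 2 + y ^+ 2) / m ^+ 2); last by field; rewrite gt_eqF.
by rewrite xE rE; field; rewrite gt_eqF.
Qed.

(** A diameter along u ends at -u and u; an orthogonal arc ends where its circle meets the unit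
    circle. In both cases Im zeta is, up to a nonvanishing factor, the equation of G. *)
Lemma geodesic_ends (G : set C) : geodesic G -> exists p q, [/\ nm p = 1, nm q = 1, p != q &
  forall z, G z <-> nm z < 1 /\ complex.Im (zeta p q z) = 0].
Proof.
case=> [[u u1 ->]|[c [r [r0 cr ->]]]].
  have n1 : nm u = 1 by move: u1; rewrite normCE => -[].
  have un : - u != u by rewrite eq_sym -subr_eq0 opprK -mulr2n -mulr_natr mulf_neq0 ?pnatr_eq0// -nm_eq0 n1 oner_eq0.
  exists (- u), u; split=> //; first by rewrite nmN.
  move=> z; rewrite /= discE; split=> -[z1 H]; split=> //; move: H; rewrite Im_zeta ?nmN//.
    move=> H; have H' : complex.Im (z * u^J) = 0 := H.
    have -> : complex.Im (u * (- u)^J) = 0 by move: u {u1 n1 un H H'} => [a b] /=; ring.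
    have -> : complex.Im (z * (- u - u)^J) = -2 * complex.Im (z * u^J).
      by move: u z {u1 n1 un H H' z1} => [a b] [x y] /=; ring.
    by rewrite H' !(mul0r, mulr0, subrr).
  have -> : complex.Im (u * (- u)^J) = 0 by move: u {u1 n1 un} => [a b] /=; ring.
  have -> : complex.Im (z * (- u - u)^J) = -2 * complex.Im (z * u^J).
    by move: u z {u1 n1 un z1} => [a b] [x y] /=; ring.
  have nz : (nm (z - u) ^+ 2)^-1 != 0 by rewrite invr_eq0 expf_neq0// gt_eqF// zq0.
  move/eqP; rewrite mulf_eq0 (negbTE nz) orbF mul0r sub0r oppr_eq0 !mulf_eq0 oppr_eq0 !pnatr_eq0 /=.
  by move/eqP.
have c2 : nm c ^+ 2 = 1 + r ^+ 2.
  by move: cr; rewrite normCE -!rmorphXn -[1]/(1%:C) -rmorphD => -[].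
pose m := 1 + r ^+ 2; have m0 : 0 < m by rewrite ltr_pwDl// sqr_ge0.
(* p and q are c (1 + i r) / |c|^2 and c (1 - i r) / |c|^2, the points of contact of the tangents
   from c to the unit circle. *)
pose p : C := ((complex.Re c - r * complex.Im c) / m) +i* ((complex.Im c + r * complex.Re c) / m).
pose q : C := ((complex.Re c + r * complex.Im c) / m) +i* ((complex.Im c - r * complex.Re c) / m).
have cE : complex.Re c ^+ 2 = m - complex.Im c ^+ 2 by rewrite /m -c2 nm_sqr addrK.
have rE2 : r ^+ 2 = m - 1 by rewrite /m addrAC subrr add0r.
have nm1 (x : C) : nm x ^+ 2 = 1 -> nm x = 1.
  by move=> h; apply/eqP; rewrite -(@eqrXn2 _ 2) ?nm_ge0// h expr1n.
have p1 : nm p = 1.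
  by apply: nm1; rewrite nm_sqr /=; exact: unit_alg cE rE2.
have q1 : nm q = 1.
  apply: nm1; rewrite nm_sqr /= -[RHS](unit_alg (r := - r) m0 cE); last by rewrite sqrrN.
  by rewrite !mulNr opprK.
have iqp : complex.Im (q * p^J) = - (2 * r / m).
  rewrite cIm_conj /=; move: (complex.Re c) (complex.Im c) cE => x y xE.
  by rewrite (_ : - (2 * r / m) = - (2 * r * (x ^+ 2 + y ^+ 2)) / m ^+ 2); [field|rewrite xE; field]; rewrite gt_eqF.
have pq : p != q.
  by apply: contraNneq (_ : complex.Im (q * p^J) != 0) => [->|]; [rewrite mulJE|rewrite iqp oppr_eq0 !mulf_neq0 ?gt_eqF// invr_gt0].
exists p, q; split=> // z; rewrite /= discE.
(* The numerator is a multiple of |z - c|^2 - r^2, by |c|^2 = 1 + r^2. *)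
have key : nm z < 1 -> complex.Im (zeta p q z) = - (2 * r / m) * (nm (z - c) ^+ 2 - r ^+ 2) / nm (z - q) ^+ 2.
  move=> z1; rewrite Im_zeta// iqp; congr (_ / _).
  rewrite !nm_sqr cIm_conj !(cReD, cImD, cReN, cImN) /=.
  have c2' : r ^+ 2 = complex.Re c ^+ 2 + complex.Im c ^+ 2 - 1 by rewrite -nm_sqr c2 addrAC subrr add0r.
  by rewrite c2'; field; rewrite gt_eqF.
have rE z' : `|z' - c| = r%:C <-> nm (z' - c) = r.
  by rewrite normCE; split=> [[]|->].
split=> -[z1 H]; split=> //.
  by rewrite key//; move/rE: H => ->; rewrite subrr mulr0 mul0r.
apply/rE/eqP; rewrite -(@eqrXn2 _ 2) ?nm_ge0 ?ltW//; move: H; rewrite key// => /eqP.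
have nz : (nm (z - q) ^+ 2)^-1 != 0 by rewrite invr_eq0 expf_neq0// gt_eqF// zq0.
by rewrite mulf_eq0 (negbTE nz) orbF mulf_eq0 oppr_eq0 !mulf_eq0 invr_eq0 (gt_eqF m0) (gt_eqF r0) pnatr_eq0 /= subr_eq0.
Qed.

End geometry.

Theorem theorem4 (R : realType) :
  (forall (U : set R[i]) (oU : open U) (UD : U `<=` disc R),
     hypercyclic_crescent U ->
     spectrum (@bergman_ip R _ (disc_open R)) (bergman_T oU UD)
       = [set x%:C | x in `[0, 1]%classic]) /\
  (forall (U : set R[i]) (oU : open U) (UD : U `<=` disc R),
     hypercyclic_lune U ->
     let normT := op_norm (@bergman_ip R _ (disc_open R)) (bergman_T oU UD) in
     [/\ spectrum (@bergman_ip R _ (disc_open R)) (bergman_T oU UD)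
           = [set x%:C | x in `[0, normT]%classic],
         0 < normT & normT < 1]).
Proof.
split=> U oU UD.
  move=> [G [d [a [B [gG hd arc [_ cU _ fU]]]]]].
  have [p [q [p1 q1 pq GE]]] := geodesic_ends gG.
  have [al [be [alh ab beh ends UE]]] := crescent_slab p1 q1 pq GE hd arc oU cU UD fU.
  exact: (spectrum_crescent p1 q1 pq alh ab beh oU UE UD ends).
move=> [G [d [a [b [gG hd ab UE]]]]].
have [p [q [p1 q1 pq GE]]] := geodesic_ends gG.
have [al [be [alh albe beh SE]]] := lune_slab p1 q1 pq GE hd ab.
have UE' z : U z <-> Normc.normc z < 1 /\ al < yy p q z < be by rewrite UE; exact: SE.
exact: (spectrum_lune p1 q1 pq (ltW alh) albe (ltW beh) oU UE' UD alh beh).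
Qed.
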